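(* Let $X$ be a compact weighted $2$-complex which satisfies the $2$-cell reduction hypothesis, and let $Y_1$ be the (subdivided) based bouquet of $r$ circles, with its map $Y_1\to X$, corresponding to a set of $r$ generators (closed based paths in $X^{(1)}$) of a subgroup of $\pi_1X$. Let $|Y_1|$ denote the number of $1$-cells in $Y_1$. There exist constants $C_1$ and $C_2$ depending only on $X$ such that the perimeter reduction algorithm started at $Y_1\to X$ terminates in fewer than $C_1|Y_1|$ steps, and the time it takes to complete each step is bounded by $C_2|Y_1|$. In particular, the algorithm to calculate a finite presentation for the subgroup with these $r$ generators is $O(|Y_1|^2)$.
   Context: Complexes and maps. All complexes are combinatorial $2$-complexes and all maps are combinatorial (each open cell maps homeomorphically onto an open cell; attaching maps are combinatorial after subdivision). A $2$-cell of $X$ is regarded as a map $R\to X$, $R$ a polygon, with $\partial R\to X$ the attaching map, assumed to be an immersion (locally injective). Spaces whose fundamental group is taken are connected. A path is a map from a subdivided interval or a single $0$-cell. A $1$-immersion is a map locally injective on the $1$-skeleton of its domain. Sides and perimeter. A side of $X$ is a pair $(R,r)$ with $R$ a $2$-cell of $X$ and $r$ a $1$-cell of $\partial R$; it is present at the $1$-cell that is the image of $r$. For a map $\phi:Y\to X$ and a $1$-cell $y$ of $Y$, a side $(R,r)$ present at $\phi(y)$ is present at $y$ if there is a map $\rho:R\to Y$ with $\rho(r)=y$ and $\phi\circ\rho$ equal to $R\to X$; otherwise it is missing at $y$. A weighted $2$-complex is a $2$-complex $X$ with a nonnegative integer weight $\mathbf{Wt}((R,r))$ on each side such that $\sum_{(R,r)\text{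 present at }x}\mathbf{Wt}((R,r))$ is finite for each $1$-cell $x$ and $\mathbf{Wt}(R)=\sum_r\mathbf{Wt}((R,r))>0$ for each $2$-cell $R$. The perimeter of $\phi:Y\to X$ is $\mathbf{P}(Y)=\sum_{y\in\mathrm{Edges}(Y)}\sum_{(R,r)\text{ missing at }y}\mathbf{Wt}((R,r))$. Packets. The exponent of $R\to X$ is the largest $n$ such that $\partial R\to X$ can be expressed as $W^n$ with $W$ a closed path in $X$. The packet $\widetilde R$ is $\partial R$ with $n$ copies of $R$ attached, the $j$-th via rotation of $\partial R$ by $j|W|$ edges ($0\le j<n$), with induced map $\widetilde R\to X$ extending $R\to X$. A map $\phi:Y\to X$ is packed if whenever $R\to X$ lifts to $R\to Y$, $\widetilde R\to X$ lifts to a map $\widetilde R\to Y$ extending it. $2$-cell perimeter reductions. For a packed map $Y\to X$ and a $2$-cell $R\to X$, a $2$-cell attachment site is a pair of paths $R\leftarrow Q\to Y$ with $Q$ a subpath of $\partial R$, the two compositions $Q\to X$ (through $R$ and through $Y$) equal, and such that there is no lift $R\to\widetilde R\to Y$ of $R\to\widetilde R\to X$ whose composition with $Q\to R$ equals $Q\to Y$. It is a $2$-cell perimeter reduction if $\mathbf{P}(\widetilde R)<\mathbf{P}(Q)$. It is maximal if $Q$ is not a proper subpath of a $Q'$ with compatible maps $R\leftarrow Q'\to Y$ (with $Q'\to R$ a subpath of $\partial R$) of the same kind. $X$ satisfies the $2$-cell reduction hypothesis if every packed $1$-immersion $Y\to X$ which is not $\pi_1$-injective admits a $2$-cell perimeter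 reduction $R\leftarrow Q\to Y$ for some $2$-cell $R\to X$. The algorithm. Starting from $Y_1\to X$, produce $Y_i\to X$ inductively. If $Y_i\to X$ is not a $1$-immersion, form $Y_{i+1}$ by a fold: choose a length-$2$ path in $Y_i$ with distinct $1$-cells projecting to a backtrack $ee^{-1}$ in $X$, and identify its endpoints and its two $1$-cells. If $Y_i\to X$ is a $1$-immersion which admits a $2$-cell perimeter reduction, choose a maximal one $R\leftarrow Q\to Y_i$ and let $Y_{i+1}=Y_i\cup_Q\widetilde R$, formed by identifying the image of each $1$-cell of $Q$ in $\widetilde R$ with its image in $Y_i$. Each such fold or attachment is one step. The algorithm stops at $Y_t\to X$ when neither operation is possible; then $Y_t\to X$ is $\pi_1$-injective with image the given subgroup, and a finite presentation is read off from $Y_t$. *)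

(* Defs.v *)
From mathcomp Require Import all_boot.
From Stdlib Require Import Relations.

Set Implicit Arguments.
Unset Strict Implicit.
Unset Printing Implicit Defensive.

Structure graph := Graph {
  vert : Type;
  cell1 : Type;
  src : cell1 -> vert;
  tgt : cell1 -> vert }.

(* [(e, true)] is the 1-cell [e] traversed from [tgt e] to [src e]. *)
Definition oedge (G : graph) : Type := (cell1 G * bool)%type.

Section Paths.
Variable G : graph.

Definition oinv (o : oedge G) : oedge G := (o.1, ~~ o.2).
Definition osrc (o : oedge G) : vert G := if o.2 then tgt o.1 else src o.1.
Definition otgt (o : oedge G) : vert G := osrc (oinv o).

Fixpoint is_path (u : vert G) (p : seq (oedge G)) (v : vert G) : Prop :=
  if p is o :: p' then osrc o = u /\ is_path (otgt o) p' v else u = v.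

Definition inv_path (p : seq (oedge G)) : seq (oedge G) := rev (map oinv p).

Definition closed_path (p : seq (oedge G)) : Prop :=
  p <> [::] /\ exists u, is_path u p u.

(* Local injectivity of the circle labelled by the closed path [p]; using all
   the rotations takes care of the passage from the last edge to the first. *)
Definition immersed_loop (p : seq (oedge G)) : Prop :=
  forall k o1 o2 q, rot k p = [:: o1, o2 & q] -> o2 <> oinv o1.

Definition connected : Prop := forall u v, exists p, is_path u p v.

End Paths.

(* A 2-cell is a polygon [R] whose boundary circle is read from a chosen
   vertex in a chosen direction; [bd R] is the attaching path so read.  The
   1-cells of the polygon are the positions [i < size (bd R)]. *)
Structure complex := Complex {
  skel :> graph;
  cell2 : Type;
  bd : cell2 -> seq (oedge skel);
  bd_closed : forall R, closed_path (bd R);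
  bd_immersed : forall R, immersed_loop (bd R) }.

(* Compact means having finitely many cells. *)
Structure fcomplex := FComplex {
  fvert : finType;
  fcell1 : finType;
  fcell2 : finType;
  fsrc : fcell1 -> fvert;
  ftgt : fcell1 -> fvert;
  fbd : fcell2 -> seq (oedge (Graph fsrc ftgt));
  fbd_closed : forall R, closed_path (fbd R);
  fbd_immersed : forall R, immersed_loop (fbd R) }.

Coercion complex_of (X : fcomplex) : complex :=
  Complex (@fbd_closed X) (@fbd_immersed X).

Definition turn (G : graph) (k : nat) (b : bool) (p : seq (oedge G)) :=
  rot k (if b then inv_path p else p).

Definition omap_of (G H : graph) (f : cell1 G -> oedge H) (o : oedge G) :
  oedge H := if o.2 then oinv (f o.1) else f o.1.

(* A 2-cell [S] is sent to a 2-cell [mf S] through an isomorphism of polygons,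
   that is, a rotation [mrot S] possibly combined with a reflection
   [mflip S]. *)
Structure cmap (Y X : complex) := CMap {
  mv : vert Y -> vert X;
  me : cell1 Y -> oedge X;
  mf : cell2 Y -> cell2 X;
  mrot : cell2 Y -> nat;
  mflip : cell2 Y -> bool;
  me_src : forall e, osrc (me e) = mv (src e);
  me_tgt : forall e, otgt (me e) = mv (tgt e);
  mf_bd : forall S,
    map (omap_of me) (turn (mrot S) (mflip S) (bd S)) = bd (mf S) }.

Section Maps.
Variables (Y X : complex) (phi : cmap Y X).

Definition mo : oedge Y -> oedge X := omap_of (me phi).

(* A 2-cell [S] of [Y] with [mf phi S = R] is the same thing as a lift
   [R -> Y] of [R -> X] (compose with the inverse of the isomorphism of
   polygons); [lift_bd S] is the restriction of this lift to the boundary,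
   position [i] being the image of position [i] of the boundary of [R]. *)
Definition lift_bd (S : cell2 Y) : seq (oedge Y) :=
  turn (mrot phi S) (mflip phi S) (bd S).

Definition immersion1 : Prop :=
  forall o1 o2, osrc o1 = osrc o2 -> mo o1 = mo o2 -> o1 = o2.

End Maps.

(* Maps [Y -> Y'] commuting with given maps of [Y] and [Y'] to [X]. *)
Structure over_map (X Y Y' : complex) (phi : cmap Y X) (phi' : cmap Y' X) :=
  OverMap {
  pv : vert Y -> vert Y';
  po : oedge Y -> oedge Y';
  pf : cell2 Y -> cell2 Y';
  po_inv : forall o, po (oinv o) = oinv (po o);
  po_src : forall o, osrc (po o) = pv (osrc o);
  pv_over : forall v, mv phi' (pv v) = mv phi v;
  po_over : forall o, mo phi' (po o) = mo phi o;
  pf_over : forall S, mf phi' (pf S) = mf phi S;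
  pf_bd : forall S, lift_bd phi' (pf S) = map po (lift_bd phi S) }.

Section Homotopy.
Variable Y : complex.

Inductive homotopic (u v : vert Y) : seq (oedge Y) -> seq (oedge Y) -> Prop :=
| hom_refl p : is_path u p v -> homotopic u v p p
| hom_sym p q : homotopic u v p q -> homotopic u v q p
| hom_trans p q r :
    homotopic u v p q -> homotopic u v q r -> homotopic u v p r
| hom_backtrack p o q :
    is_path u (p ++ [:: o, oinv o & q]) v ->
    homotopic u v (p ++ [:: o, oinv o & q]) (p ++ q)
| hom_cell2 p S q :
    is_path u (p ++ bd S ++ q) v ->
    homotopic u v (p ++ bd S ++ q) (p ++ q).

End Homotopy.

Definition pi1_injective (Y X : complex) (phi : cmap Y X) : Prop :=
  forall u p, is_path u p u ->
    homotopic (mv phi u) (mv phi u) (map (mo phi) p) [::] ->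
    homotopic u u p [::].

Structure wcomplex := WComplex {
  wbase :> fcomplex;
  wt : forall R : fcell2 wbase, 'I_(size (bd (c := wbase) R)) -> nat;
  wt_gt0 : forall R, 0 < \sum_(i < size (bd (c := wbase) R)) wt i }.

Section Perimeter.
Variable X : wcomplex.

(* The total weight of the sides [(R, i)] that are present at the 1-cell [x]
   and satisfy [P]. *)
Definition sides_weight (x : fcell1 X) (P : fcell2 X -> nat -> bool) : nat :=
  \sum_(R : fcell2 X)
    \sum_(i < size (bd (c := X) R)
           | ((tnth (in_tuple (bd (c := X) R)) i).1 == x) && P R i) wt i.

Definition side_present (Y : fcomplex) (phi : cmap Y X) (y : fcell1 Y)
    (R : fcell2 X) (i : nat) : bool :=
  [exists S : fcell2 Y, ((mf phi S : fcell2 X) == R) &&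
     (omap fst (onth (lift_bd phi S) i) == Some y :> option (fcell1 Y))].

Definition perimeter (Y : fcomplex) (phi : cmap Y X) : nat :=
  \sum_(y : fcell1 Y)
    sides_weight (me phi y).1 (fun R i => ~~ side_present phi y R i).

(* The perimeter of a path [Q -> X]: the interval [Q] has no 2-cell, so all
   sides are missing. *)
Definition path_perimeter (q : seq (oedge X)) : nat :=
  \sum_(o <- q) sides_weight o.1 (fun _ _ => true).

End Perimeter.

(* The path [take (size s %/ n) s] is automatically closed when [s] is a
   closed path. *)
Definition exponent (T : eqType) (s : seq T) : nat :=
  \max_(n < (size s).+1 | s == flatten (nseq n (take (size s %/ n) s))) n.

Lemma exponentP (T : eqType) (s : seq T) : s <> [::] ->
  s = flatten (nseq (exponent s) (take (size s %/ exponent s) s)).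
Proof.
move=> /eqP s0; pose P (n : 'I_(size s).+1) :=
  s == flatten (nseq n (take (size s %/ n) s)).
have h1 : 1 < (size s).+1 by rewrite ltnS lt0n size_eq0.
have P1 : P (Ordinal h1) by rewrite /P /= divn1 take_size cats0.
rewrite /exponent (bigmax_eq_arg (Ordinal h1)) //.
by case: arg_maxnP => //= i /eqP.
Qed.

Lemma rot_exponent (T : eqType) (s : seq T) j : s <> [::] ->
  j <= exponent s -> rot (j * (size s %/ exponent s)) s = s.
Proof.
move=> s0; set n := exponent s; set k := size s %/ n => jn.
have Es : s = flatten (nseq n (take k s)) by exact: exponentP.
have flC m (w : seq T) : flatten (nseq m w) ++ w = w ++ flatten (nseq m w).
  by elim: m => [|m IH] /=; rewrite ?cats0 // -catA IH.
have szk : size (take k s) = k by rewrite size_take_min (minn_idPl (leq_div _ _)).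
rewrite Es -(subnKC jn) nseqD flatten_cat.
have -> : j * k = size (flatten (nseq j (take k s))).
  rewrite size_flatten /shape map_nseq szk.
  by elim: {+}j => //= m <-; rewrite mulSn.
rewrite rot_size_cat -!flatten_cat -!nseqD.
by rewrite addnC.
Qed.

Section Circle.
Variable L : nat.
Definition circle_graph : graph := Graph (id : 'I_L -> 'I_L) (@ordS L).
Definition circle : seq (oedge circle_graph) :=
  [seq (k, false) | k <- enum 'I_L].
End Circle.

Lemma size_circle L : size (circle L) = L.
Proof. by rewrite size_map size_enum_ord. Qed.

Section PathFacts.
Variable G : graph.
Implicit Types (p q : seq (oedge G)) (u v w : vert G).

Lemma is_path_cat p q u v w :
  is_path u p v -> is_path v q w -> is_path u (p ++ q) w.
Proof. by elim: p u => [u ->//|o p IH u [h1 h2] h3]; split=> //; exact: IH. Qed.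

Lemma is_path_catP p q u w :
  is_path u (p ++ q) w -> exists2 v, is_path u p v & is_path v q w.
Proof.
elim: p u => [u h|o p IH u [h1 /IH [v h2 h3]]]; first by exists u.
by exists v.
Qed.

Lemma closed_path_rot k p : closed_path p -> closed_path (rot k p).
Proof.
move=> [p0 [u]]; rewrite -{1}(cat_take_drop k p) => /is_path_catP[v h1 h2].
split; last by exists v; apply: is_path_cat h2 h1.
by move=> h; apply: p0; apply: (@rot_inj k); rewrite h.
Qed.

Lemma immersed_loop_rot k p : immersed_loop p -> immersed_loop (rot k p).
Proof. by move=> hp k' o1 o2 q; rewrite rot_rot_add => /hp. Qed.

Lemma is_path_nth o (f : nat -> vert G) p :
  (forall i, i < size p ->
     osrc (nth o p i) = f i /\ otgt (nth o p i) = f i.+1) ->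
  is_path (f 0) p (f (size p)).
Proof.
elim: p f => //= o' p IH f h; have [h1 h2] := h 0 isT; split=> //.
by rewrite h2; apply: (IH (f \o S)) => i; exact: (h i.+1).
Qed.

Lemma path_nth o p u w : is_path u p w ->
  forall i, i < size p -> otgt (nth o p i) =
    if i.+1 == size p then w else osrc (nth o p i.+1).
Proof.
elim: p u => //= o' p IH u [_ h] [_ /=|i hi]; last exact: IH h _ hi.
by case: p h {IH} => //= o'' p [].
Qed.

Lemma path_nth0 o p u w : is_path u p w -> 0 < size p -> osrc (nth o p 0) = u.
Proof. by case: p => //= ? ? []. Qed.

Lemma closed_path_next p (cp : closed_path p) (i : 'I_(size p)) :
  otgt (tnth (in_tuple p) i) = osrc (tnth (in_tuple p) (ordS i)).
Proof.
case: cp => p0 [u hp]; have o := tnth (in_tuple p) i.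
have sp : 0 < size p by case: (p) p0.
rewrite !(tnth_nth o) /= (path_nth o hp) //; case: eqP => [->|/eqP h].
  by rewrite modnn (path_nth0 _ hp).
by rewrite modn_small // ltn_neqAle h /=.
Qed.

End PathFacts.

Lemma circle_nth L o i (iL : i < L) :
  nth o (circle L) i = (Ordinal iL, false) :> oedge (circle_graph L).
Proof.
rewrite (nth_map (Ordinal iL)) ?size_enum_ord //.
by congr (_, _); apply: val_inj; rewrite /= nth_enum_ord.
Qed.

Lemma circle_closed L : 0 < L -> closed_path (circle L).
Proof.
case: L => // L _; split; first by move/(congr1 size); rewrite size_circle.
pose f i : vert (circle_graph L.+1) := inord (i %% L.+1) : 'I_L.+1.
pose o : oedge (circle_graph L.+1) := (ord0, false).
exists (f 0); have {2}-> : f 0 = f (size (circle L.+1)).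
  by rewrite size_circle /f modnn mod0n.
apply: (is_path_nth (o := o)) => i; rewrite size_circle => iL.
rewrite (circle_nth _ iL) /osrc /otgt /osrc /f /=; split; apply: val_inj => /=.
  by rewrite inordK ?ltn_pmod // modn_small.
by rewrite inordK ?ltn_pmod.
Qed.

Lemma circle_immersed L : immersed_loop (circle L).
Proof.
move=> k o1 o2 q h.
have: all (fun o => ~~ o.2) (rot k (circle L)).
  rewrite /rot all_cat andbC -all_cat cat_take_drop /circle.
  by elim: (enum _).
by rewrite h /= => /and3P[/negPf h1 h2 _] e; move: h2; rewrite e /= h1.
Qed.

Section Packet.
Variables (X : fcomplex) (R : cell2 X).

(* Oriented 1-cells of [X], with decidable equality. *)
Let s : seq (fcell1 X * bool) := bd R.
Let L := size (bd R).

Definition cell2_exponent : nat := exponent s.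
Definition root_length : nat := L %/ cell2_exponent.

Lemma packet_subproof (j : 'I_cell2_exponent) :
  closed_path (rot (j * root_length) (circle L)).
Proof.
apply/closed_path_rot/circle_closed; rewrite /L; case: (bd_closed R) => h _.
by case: (bd R) h.
Qed.

(* The packet: the boundary circle of [R] with [n] copies of [R] attached, [n]
   the exponent, the [j]-th one rotated by [j] times the length of the root. *)
Definition packet : fcomplex :=
  @FComplex 'I_L 'I_L 'I_cell2_exponent id (@ordS L)
    (fun j => rot (j * root_length) (circle L))
    packet_subproof
    (fun j => immersed_loop_rot (k := j * root_length) (@circle_immersed L)).

Let pe (i : 'I_L) : oedge X := tnth (in_tuple (bd R)) i.

Lemma packet_map_src (e : cell1 packet) : osrc (pe e) = osrc (pe (src e)).
Proof. by []. Qed.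

Lemma packet_map_tgt (e : cell1 packet) : otgt (pe e) = osrc (pe (tgt e)).
Proof. exact: closed_path_next (bd_closed R) e. Qed.

Lemma packet_map_bd (j : cell2 packet) :
  map (omap_of (G := packet) pe) (turn 0 false (bd j)) = bd R.
Proof.
rewrite /turn rot0 /= map_rot.
have -> : map (omap_of (G := packet) pe) (circle L) = bd R.
  rewrite -map_comp -[RHS](map_tnth_enum (in_tuple (bd R))).
  by apply: eq_map.
apply: (@rot_exponent _ s); first by case: (bd_closed R).
exact: ltnW.
Qed.

Definition packet_map : cmap packet X :=
  @CMap packet X (fun i => osrc (pe i)) pe (fun=> R) (fun=> 0) (fun=> false)
    packet_map_src packet_map_tgt packet_map_bd.

(* The subpath of length [l] of the boundary of [R] starting at vertex [i]; it
   goes at most once around. *)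
Definition arc (i : 'I_L) (l : nat) : seq (oedge packet) :=
  take l (rot i (circle L)).

End Packet.

(* A map [phi : Y -> X] is packed if every lift [R -> Y] extends to a lift of
   the packet; the copy of [R] extending the given lift is the 0-th one. *)
Definition packed (X : fcomplex) (Y : complex) (phi : cmap Y X) : Prop :=
  forall S : cell2 Y,
    exists psi : over_map (packet_map (mf phi S)) phi,
      forall j : 'I_(cell2_exponent (mf phi S)), j = 0 :> nat -> pf psi j = S.

Section Reductions.
Variables (X : wcomplex) (Y : complex) (phi : cmap Y X).

(* The pair of paths [R <- Q -> Y] in which [Q -> R] is the subpath of the
   boundary of [R] with initial vertex [i] and the length of [q], and [Q -> Y]
   is the path [q] with initial vertex [v].  Comparing the lengths of both
   members of the last but one condition gives [size q <= size (bd R)]. *)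
Definition attachment_site (R : cell2 X) (i : 'I_(size (bd R)))
    (v : vert Y) (q : seq (oedge Y)) : Prop :=
  [/\ exists w, is_path v q w,
      mv phi v = mv (packet_map R) i,
      map (mo phi) q = map (mo (packet_map R)) (arc i (size q))
    & ~ exists psi : over_map (packet_map R) phi,
          pv psi i = v /\ map (po psi) (arc i (size q)) = q].

Definition perimeter_reduction (R : cell2 X) (i : 'I_(size (bd R)))
    (v : vert Y) (q : seq (oedge Y)) : Prop :=
  attachment_site i v q /\
  perimeter (packet_map R) < path_perimeter (map (mo phi) q).

Definition maximal_reduction (R : cell2 X) (i : 'I_(size (bd R)))
    (v : vert Y) (q : seq (oedge Y)) : Prop :=
  perimeter_reduction i v q /\
  forall (i' : 'I_(size (bd R))) (v' : vert Y) (p1 p2 : seq (oedge Y)),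
    perimeter_reduction i' v' (p1 ++ q ++ p2) ->
    is_path v' p1 v ->
    i = (i' + size p1) %% size (bd R) :> nat ->
    p1 = [::] /\ p2 = [::].

Definition admits_reduction : Prop :=
  exists (R : cell2 X) (i : 'I_(size (bd R))) v q, perimeter_reduction i v q.

End Reductions.

Definition reduction_hypothesis (X : wcomplex) : Prop :=
  forall (Y : complex) (phi : cmap Y X),
    connected Y -> packed phi -> immersion1 phi -> ~ pi1_injective phi ->
    admits_reduction phi.

(* [f] is, up to a bijection, the projection onto the quotient by the
   equivalence relation generated by [rel]. *)
Definition is_quotient (T T' : Type) (rel : T -> T -> Prop) (f : T -> T') :=
  (forall y, exists x, f x = y) /\
  (forall x x', f x = f x' <-> clos_refl_sym_trans T rel x x').

Definition sum_fun (A B C : Type) (f : A -> C) (g : B -> C) (x : A + B) : C :=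
  match x with inl a => f a | inr b => g b end.

(* Identification of the endpoints and of the 1-cells of a path [a b]. *)
Inductive fold_vert (G : graph) (a b : oedge G) : vert G -> vert G -> Prop :=
| FoldVert : fold_vert a b (osrc a) (otgt b).

Inductive fold_edge (G : graph) (a b : oedge G) : oedge G -> oedge G -> Prop :=
| FoldEdge : fold_edge a b (oinv a) b
| FoldEdgeInv : fold_edge a b a (oinv b).

(* Identification of the path [q] starting at [v] in [G] with the path [r]
   starting at [w] in [H]. *)
Inductive glue_vert (G H : graph) (v : vert G) (q : seq (oedge G))
    (w : vert H) (r : seq (oedge H)) :
    vert G + vert H -> vert G + vert H -> Prop :=
| GlueStart : glue_vert v q w r (inl v) (inr w)
| GlueVert k a b : onth q k = Some a -> onth r k = Some b ->
    glue_vert v q w r (inl (otgt a)) (inr (otgt b)).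

Inductive glue_edge (G H : graph) (q : seq (oedge G)) (r : seq (oedge H)) :
    oedge G + oedge H -> oedge G + oedge H -> Prop :=
| GlueEdge k a b : onth q k = Some a -> onth r k = Some b ->
    glue_edge q r (inl a) (inr b)
| GlueEdgeInv k a b : onth q k = Some a -> onth r k = Some b ->
    glue_edge q r (inl (oinv a)) (inr (oinv b)).

Definition no_rel (T : Type) (x y : T) : Prop := False.

Structure complex_over (X : complex) := Over {
  dom : fcomplex;
  str :> cmap dom X }.

Section Algorithm.
Variable X : wcomplex.
Implicit Types Y : complex_over X.

Definition is_fold Y Y' : Prop :=
  exists (a b : oedge (dom Y)) (p : over_map Y Y'),
    [/\ otgt a = osrc b,
        a.1 <> b.1
      & mo Y b = oinv (mo Y a)] /\
    [/\ is_quotient (fold_vert a b) (pv p),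
        is_quotient (fold_edge a b) (po p)
      & is_quotient (@no_rel (cell2 (dom Y))) (pf p)].

(* [Y'] is [Y] with the packet of [R] attached along [Q]. *)
Definition is_attachment Y Y' : Prop :=
  immersion1 Y /\
  exists (R : cell2 X) (i : 'I_(size (bd R))) v q,
    maximal_reduction Y i v q /\
    exists (f : over_map Y Y') (g : over_map (packet_map R) Y'),
      [/\ is_quotient (glue_vert (H := packet R) v q i (arc i (size q)))
            (sum_fun (pv f) (pv g)),
          is_quotient (glue_edge q (arc i (size q))) (sum_fun (po f) (po g))
        & is_quotient (@no_rel _) (sum_fun (pf f) (pf g))].

Definition alg_step Y Y' : Prop := is_fold Y Y' \/ is_attachment Y Y'.

Definition stops_at Y : Prop := immersion1 Y /\ ~ admits_reduction Y.

Fixpoint run (n : nat) Y Y' : Prop :=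
  if n is n'.+1 then exists Y'', run n' Y Y'' /\ alg_step Y'' Y' else Y = Y'.

Definition reachable Y Y' : Prop := exists n, run n Y Y'.

End Algorithm.

Structure loop (X : complex) (x0 : vert X) := Loop {
  lpath :> seq (oedge X);
  lpath_closed : is_path x0 lpath x0;
  lpath_neq0 : lpath <> [::] }.

Section Bouquet.
Variables (X : complex) (x0 : vert X) (r : nat) (gen : 'I_r -> loop x0).

(* The [k]-th 1-cell of the [i]-th circle, and the vertices other than the base
   vertex [None]: the [k]-th interior vertex of the [i]-th circle is the
   terminal vertex of its [k]-th 1-cell. *)
Definition bq_cell1 : finType := {i : 'I_r & 'I_(size (gen i))}.
Definition bq_inner : finType := {i : 'I_r & 'I_(size (gen i)).-1}.
Definition bq_vert : finType := option bq_inner.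

Definition bq_at (i : 'I_r) (k : nat) : bq_vert :=
  omap (@Tagged _ i (fun i => 'I_(size (gen i)).-1)) (insub k).

Definition bq_src (e : bq_cell1) : bq_vert :=
  if tagged e is Ordinal k.+1 _ then bq_at (tag e) k else None.
Definition bq_tgt (e : bq_cell1) : bq_vert := bq_at (tag e) (tagged e).

Definition bq_cx : fcomplex :=
  @FComplex bq_vert bq_cell1 void bq_src bq_tgt
    (fun R => match R with end)
    (fun R => match R with end) (fun R => match R with end).

Definition bq_me (e : cell1 bq_cx) : oedge X :=
  tnth (in_tuple (gen (tag e))) (tagged e).

Definition bq_mv (v : vert bq_cx) : vert X :=
  if v is Some w then
    otgt (tnth (in_tuple (gen (tag w))) (widen_ord (leq_pred _) (tagged w)))
  else x0.

Lemma bq_me_tgt (e : cell1 bq_cx) : otgt (bq_me e) = bq_mv (tgt e).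
Proof.
case: e => i k; rewrite /= /bq_tgt /bq_at /bq_me /=.
have o := tnth (in_tuple (gen i)) k.
have hp := lpath_closed (gen i).
case: insubP => /= [k' _ ek|]; rewrite !(tnth_nth o) /= ?ek //.
rewrite (path_nth o hp) //; case: eqP => // h; rewrite -leqNgt => h'.
by case: h; apply/eqP; rewrite eqn_leq ltn_ord -[X in X <= _](ltn_predK (ltn_ord k)).
Qed.

Lemma bq_me_src (e : cell1 bq_cx) : osrc (bq_me e) = bq_mv (src e).
Proof.
case: e => i [[|k] hk]; have o := tnth (in_tuple (gen i)) (Ordinal hk);
  have hp := lpath_closed (gen i); rewrite /= /bq_me (tnth_nth o) /=.
  exact: path_nth0 hp hk.
have hk' : k < size (gen i) by exact: ltnW.
have := bq_me_tgt (Tagged (fun i => 'I_(size (gen i))) (Ordinal hk')).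
rewrite /= /bq_me /bq_tgt /= (tnth_nth o) /= (path_nth o hp) //.
by rewrite ltn_eqF // => ->.
Qed.

Definition bouquet : complex_over X :=
  @Over X bq_cx
    (@CMap bq_cx X bq_mv bq_me (fun R => match R with end) (fun=> 0)
       (fun=> false) bq_me_src bq_me_tgt (fun R => match R with end)).

End Bouquet.

Definition word (k : nat) : Type := seq ('I_k * bool).

(* Equality in the group presented by [rels]; [(i, true)] is the inverse of the
   [i]-th generator. *)
Inductive pres_eq (k : nat) (rels : seq (word k)) : word k -> word k -> Prop :=
| pres_refl w : pres_eq rels w w
| pres_sym w w' : pres_eq rels w w' -> pres_eq rels w' w
| pres_trans w w' w'' :
    pres_eq rels w w' -> pres_eq rels w' w'' -> pres_eq rels w w''
| pres_cancel w a w' : pres_eq rels (w ++ [:: a, (a.1, ~~ a.2) & w']) (w ++ w')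
| pres_rel w u w' : u \in rels -> pres_eq rels (w ++ u ++ w') (w ++ w').

Section Presentation.
Variables (X : complex) (x0 : vert X).

Definition eval_word (k : nat) (g : 'I_k -> seq (oedge X)) (w : word k) :
  seq (oedge X) :=
  flatten [seq if a.2 then inv_path (g a.1) else g a.1 | a <- w].

(* [k] and [rels] present the subgroup of the fundamental group at [x0]
   generated by [gen]: some homomorphism from the free group of rank [k] has
   this subgroup as its image and the normal closure of [rels] as its
   kernel. *)
Definition presents_subgroup (r : nat) (gen : 'I_r -> loop x0)
    (k : nat) (rels : seq (word k)) : Prop :=
  exists g : 'I_k -> seq (oedge X),
    [/\ forall i, is_path x0 (g i) x0,
        forall i, exists w, homotopic x0 x0 (g i) (eval_word gen w),
        forall j, exists w, homotopic x0 x0 (gen j) (eval_word g w)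
      & forall w, homotopic x0 x0 (eval_word g w) [::] <-> pres_eq rels w [::]].

End Presentation.

(* The model of computation is a unit-cost random access machine: a program
   addresses finitely many variables and finitely many unbounded arrays of
   natural numbers, and its only arithmetic operations are addition and
   truncated subtraction. *)
Structure state := State {
  var : nat -> nat;
  arr : nat -> nat -> nat }.

Definition upd (T : Type) (f : nat -> T) (i : nat) (v : T) : nat -> T :=
  fun j => if j == i then v else f j.

Definition set_var (s : state) (x n : nat) : state :=
  State (upd (var s) x n) (arr s).
Definition set_arr (s : state) (a i n : nat) : state :=
  State (var s) (upd (arr s) a (upd (arr s a) i n)).

Inductive cmd :=
| Skip
| Const (x n : nat)
| Add (x y z : nat)
| Sub (x y z : nat)
| Read (x a y : nat)
| Write (a x y : nat)
| Seq (c1 c2 : cmd)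
| If (x : nat) (c1 c2 : cmd)
| While (x : nat) (c : cmd).

(* [exec c s t s']: started in [s], the program [c] halts in [s'] after [t]
   operations. *)
Inductive exec : cmd -> state -> nat -> state -> Prop :=
| ExSkip s : exec Skip s 1 s
| ExConst s x n : exec (Const x n) s 1 (set_var s x n)
| ExAdd s x y z : exec (Add x y z) s 1 (set_var s x (var s y + var s z))
| ExSub s x y z : exec (Sub x y z) s 1 (set_var s x (var s y - var s z))
| ExRead s x a y : exec (Read x a y) s 1 (set_var s x (arr s a (var s y)))
| ExWrite s a x y :
    exec (Write a x y) s 1 (set_arr s a (var s x) (var s y))
| ExSeq s s' s'' t t' c1 c2 :
    exec c1 s t s' -> exec c2 s' t' s'' -> exec (Seq c1 c2) s (t + t') s''
| ExIfTrue s s' t x c1 c2 :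
    var s x != 0 -> exec c1 s t s' -> exec (If x c1 c2) s t.+1 s'
| ExIfFalse s s' t x c1 c2 :
    var s x = 0 -> exec c2 s t s' -> exec (If x c1 c2) s t.+1 s'
| ExWhileStop s x c : var s x = 0 -> exec (While x c) s 1 s
| ExWhile s s' s'' t t' x c :
    var s x != 0 -> exec c s t s' -> exec (While x c) s' t' s'' ->
    exec (While x c) s (t + t').+1 s''.

Definition letter (n : nat) (b : bool) : nat := n.*2 + b.

(* The number of words in variable 0, their lengths in array 0 and their
   letters, one word after the other, in array 1. *)
Definition holds_words (s : state) (ws : seq (seq nat)) : Prop :=
  [/\ var s 0 = size ws,
      forall i, i < size ws -> arr s 0 i = size (nth [::] ws i)
    & forall j, j < size (flatten ws) -> arr s 1 j = nth 0 (flatten ws) j].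

Definition numbering (T : finType) (f : T -> nat) : Prop :=
  injective f /\ forall x, f x < #|T|.

Section Encoding.
Variable X : fcomplex.

Definition letter_of (o : oedge X) : nat :=
  letter (enum_rank (o.1 : fcell1 X)) o.2.

Definition holds_generators (x0 : vert X) (r : nat) (gen : 'I_r -> loop x0)
    (s : state) : Prop :=
  holds_words s [seq [seq letter_of o | o <- lpath (gen i)] | i <- enum 'I_r].

(* The cells of [Y] are numbered.  Variables 0, 1, 2 hold the numbers of cells
   of each dimension, arrays 0, 1, 2 the endpoints and the image of each 1-cell,
   array 3 the image [R] of each 2-cell, and array [4 + i] the 1-cell at
   position [i] of the corresponding lift of the boundary of [R]. *)
Definition holds_complex (Y : complex_over X) (s : state) : Prop :=
  [/\ var s 0 = #|fvert (dom Y)|,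
      var s 1 = #|fcell1 (dom Y)|,
      var s 2 = #|fcell2 (dom Y)|
    & exists (nv : fvert (dom Y) -> nat) (ne : fcell1 (dom Y) -> nat)
             (nf : fcell2 (dom Y) -> nat),
        [/\ numbering nv, numbering ne, numbering nf,
            forall e, [/\ arr s 0 (ne e) = nv (fsrc e),
                          arr s 1 (ne e) = nv (ftgt e)
                        & arr s 2 (ne e) = letter_of (me Y e)]
          & forall S, arr s 3 (nf S) = enum_rank (mf Y S : fcell2 X) /\
              forall i o, onth (lift_bd Y S) i = Some o ->
                arr s (4 + i) (nf S) = letter (ne o.1) o.2]].

End Encoding.

(* The number of generators in variable 1, and the relators. *)
Definition holds_presentation (k : nat) (rels : seq (word k)) (s : state) :
  Prop :=
  var s 1 = k /\
  holds_words s
    [seq [seq letter a.1 a.2 | a : 'I_k * bool <- w] | w : word k <- rels].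

(* Variable 3 tells whether a step has been performed. *)
Definition go : nat := 3.

Section Implementation.
Variables (X : wcomplex) (x0 : vert X) (r : nat) (gen : 'I_r -> loop x0).

Definition starts (T : nat) (init : cmd) : Prop :=
  forall s, holds_generators gen s ->
    exists t s', [/\ exec init s t s', t <= T & holds_complex (bouquet gen) s'].

(* On any representation of any complex met by the algorithm, [step] performs
   one step, or detects that there is none left, in time at most [T]. *)
Definition performs_steps (T : nat) (step : cmd) : Prop :=
  forall (Y : complex_over X) s,
    reachable (bouquet gen) Y -> holds_complex Y s ->
    exists t s', [/\ exec step s t s', t <= T
      & if var s' go == 0 then stops_at Y /\ holds_complex Y s'
        else exists Y', alg_step Y Y' /\ holds_complex Y' s'].

Definition computes_presentation (T : nat) (prog : cmd) : Prop :=
  forall s, holds_generators gen s ->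
    exists t s', [/\ exec prog s t s', t <= T
      & exists k (rels : seq (word k)),
          holds_presentation rels s' /\ presents_subgroup gen rels].

End Implementation.

Definition reduction_algorithm (init step read : cmd) : cmd :=
  Seq init (Seq (Seq step (While go step)) read).

(* Main.v *)
From mathcomp Require Import all_boot zify.
From Stdlib Require Import Relations Classical.
Require Import Defs.

(** The perimeter counts, with weights, the sides of the 2-cells of [X] that a
complex [Y] over [X] is still missing along its 1-cells. A fold identifies
1-cells and does not raise the perimeter. Attaching a packet along a maximal
reduction strictly lowers it: the sides which the packet brings to the 1-cells
of the attaching path were missing there and are pairwise distinct, because [Y]
is packed and immersed and because the path, being maximal, cannot run into
itself periodically; their total weight exceeds what the rest of the packet is
missing ([attachment_perimeter]). An attachment adds at most as many 1-cells as
the longest boundary of a 2-cell has. Hence the perimeter, multiplied by one more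
than this length and increased by the number of 1-cells, drops at every step
([step_potential]). It is at most a multiple of the number of 1-cells of the
bouquet, which gives the bound on the number of steps ([run_potential],
[bouquet_potential]) and bounds the size of every complex that is met
([reachable_bounds]).

Programs are written in a small language with expressions and loops whose bounds
are fixed on entry. Such a program always halts, its effect is a function
([sem]), it runs on the random access machine within an explicit cost
([compile_ok]), and the cost is polynomial in the bounds of its loops, of degree
the nesting of the loops ([cost_bound]). The step program has loops of nesting
one over the cells of [Y]. It tabulates the oriented 1-cells and stores each of
them in a slot determined by its origin and its label; two 1-cells in one slot
are a fold ([find_foldP]). Otherwise [Y] is immersed, a path is determined by its
initial vertex and its labels, and reductions are searched for by following
the labels of every arc of every boundary that is heavy enough to pay off, from
every vertex ([walkP]). Such a path is a reduction unless the packet already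
lifts along it, which only depends on its first 1-cell ([reduction_good]). The
longest arcs are tried first, so that a reduction found is maximal
([try_sitesP]). The new complex is a quotient of [Y], or of the disjoint union of
[Y] and the packet, on cells numbered afresh ([folded_coded], [attached_coded]).

When no step is possible, the complex is pi_1-injective by the reduction
hypothesis. Steps change neither connectedness nor the subgroup carried by the
loops at the base point ([run_loops_lift]), so the fundamental group of the last
complex is the subgroup. It is generated by all 1-cells, subject to the 1-cells
of a spanning tree and the boundaries of the 2-cells ([presentation]); a
spanning tree is found in quadratic time by relabelling components
([spanningP]). *)

Set Implicit Arguments.
Unset Strict Implicit.
Unset Printing Implicit Defensive.

(** * Paths and homotopy *)

Section GraphPaths.
Variable G : graph.
Implicit Types (o : oedge G) (p q : seq (oedge G)) (u v w : vert G).

Lemma oinvK : involutive (@oinv G).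
Proof. by case=> e b; rewrite /oinv /= negbK. Qed.

Lemma oinv_neq o : oinv o <> o.
Proof. by case: o => e []; case. Qed.

Lemma otgt_inv o : otgt (oinv o) = osrc o.
Proof. by rewrite /otgt oinvK. Qed.

Lemma same_cell1 o1 o2 : o1.1 = o2.1 -> o2 = o1 \/ o2 = oinv o1.
Proof.
by case: o1 o2 => e b [e' b'] /= ->; case: b b' => [] []; [left|right|right|left].
Qed.

Lemma is_path_cat_inv p q u w : is_path u (p ++ q) w <->
  exists2 v, is_path u p v & is_path v q w.
Proof.
split; first exact: is_path_catP.
by case=> v hp hq; apply: is_path_cat hp hq.
Qed.

Lemma is_path_det2 p u v v' : is_path u p v -> is_path u p v' -> v = v'.
Proof. by elim: p u => [u <- <-//|o p IH u /= [_ h] [_ h']]; exact: IH h h'. Qed.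

Lemma is_path_det p u v u' v' : is_path u p v -> is_path u' p v' ->
  p <> [::] -> u = u' /\ v = v'.
Proof.
by case: p => // o p [<- h] [<- h'] _; split=> //; exact: is_path_det2 h h'.
Qed.

Lemma is_path_rcons p o u v :
  is_path u (rcons p o) v <-> is_path u p (osrc o) /\ otgt o = v.
Proof.
rewrite -cats1 is_path_cat_inv; split=> [[x h [/= -> <-]]//|[h <-]].
by exists (osrc o).
Qed.

Lemma inv_path_cat p q : inv_path (p ++ q) = inv_path q ++ inv_path p.
Proof. by rewrite /inv_path map_cat rev_cat. Qed.

Lemma inv_path_cons o p : inv_path (o :: p) = rcons (inv_path p) (oinv o).
Proof. by rewrite /inv_path /= rev_cons. Qed.

Lemma inv_pathK : involutive (@inv_path G).
Proof.
by move=> p; rewrite /inv_path map_rev revK mapK //; apply: oinvK.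
Qed.

Lemma is_path_inv p u v : is_path u p v -> is_path v (inv_path p) u.
Proof.
elim: p u => [u ->//|o p IH u [hu /IH h]].
by rewrite inv_path_cons is_path_rcons otgt_inv.
Qed.

Lemma map_inv_path (H : graph) (f : oedge G -> oedge H) p :
  (forall o, f (oinv o) = oinv (f o)) -> map f (inv_path p) = inv_path (map f p).
Proof.
by move=> h; rewrite /inv_path map_rev -!map_comp; congr rev; apply: eq_map => o /=.
Qed.

(** Reversal commutes with rotation only up to a change of the starting point. *)
Lemma turn_inv k b p : exists k', inv_path (turn k b p) = turn k' (~~ b) p.
Proof.
suff h q j : exists k', inv_path (rot j q) = rot k' (inv_path q).
  have [k' ->] := h (if b then inv_path p else p) k.
  by exists k'; rewrite /turn; case: b => //=; rewrite inv_pathK.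
exists (size (inv_path (drop j q))).
by rewrite -[X in rot _ (inv_path X)](cat_take_drop j q) !inv_path_cat rot_size_cat.
Qed.

End GraphPaths.

Section HomotopyFacts.
Variable Y : complex.
Implicit Types (o : oedge Y) (p q : seq (oedge Y)) (u v w : vert Y).

Lemma homotopic_paths u v p q : homotopic u v p q ->
  is_path u p v /\ is_path u q v.
Proof.
elim=> {p q} [p|p q _ []|p q r _ [h _] _ []|p o q h|p S q h] //; split=> //.
  have [x hp [/= h1 [_ hq]]] := is_path_catP h.
  by apply: is_path_cat hp _; rewrite -h1 -(otgt_inv o).
have [x hp /is_path_catP[y hS hq]] := is_path_catP h.
have [S0 [z hz]] := bd_closed S; have [ex ey] := is_path_det hS hz S0.
by apply: is_path_cat hp _; rewrite ex -ey.
Qed.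

Lemma hom_catl u v w p q q' : is_path u p v -> homotopic v w q q' ->
  homotopic u w (p ++ q) (p ++ q').
Proof.
move=> hp; elim=> {q q'} [q h|q q' _|q q' q'' _ h1 _|q o r h|q S r h].
- by apply: hom_refl; apply: is_path_cat hp h.
- exact: hom_sym.
- exact: hom_trans.
- have := @hom_backtrack _ u w (p ++ q) o r; rewrite -!catA; apply.
  exact: is_path_cat hp h.
- have := @hom_cell2 _ u w (p ++ q) S r; rewrite -!catA; apply.
  exact: is_path_cat hp h.
Qed.

Lemma hom_catr u v w p p' q : homotopic u v p p' -> is_path v q w ->
  homotopic u w (p ++ q) (p' ++ q).
Proof.
move=> hp hq; elim: hp => {p p'} [p h|p p' _|p p' p'' _ h1 _|p o r h|p S r h].
- by apply: hom_refl; apply: is_path_cat h hq.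
- exact: hom_sym.
- exact: hom_trans.
- have := @hom_backtrack _ u w p o (r ++ q); rewrite -!catA; apply.
  by have := is_path_cat h hq; rewrite -catA.
- have := @hom_cell2 _ u w p S (r ++ q); rewrite -!catA; apply.
  by have := is_path_cat h hq; rewrite -!catA.
Qed.

Lemma hom_cat u v w p p' q q' : homotopic u v p p' -> homotopic v w q q' ->
  homotopic u w (p ++ q) (p' ++ q').
Proof.
move=> hp hq; have [_ h] := homotopic_paths hp; have [h' _] := homotopic_paths hq.
by apply: hom_trans (hom_catr hp h') (hom_catl h hq).
Qed.

Lemma hom_invr u v p : is_path u p v -> homotopic u u (p ++ inv_path p) [::].
Proof.
elim: p u => [u _|o p IH u [hu h]]; first exact: hom_refl.
rewrite inv_path_cons -cats1 cat_cons catA -cat1s.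
have ho : is_path u [:: o] (otgt o) by [].
have ho' : is_path (otgt o) [:: oinv o] u by split=> //=; rewrite otgt_inv.
apply: hom_trans (hom_catl ho (hom_catr (IH _ h) ho')) _.
by apply: (@hom_backtrack _ u u [::] o [::]); split=> //; split=> //=; rewrite otgt_inv.
Qed.

Lemma hom_invl u v p : is_path u p v -> homotopic v v (inv_path p ++ p) [::].
Proof. by move=> /is_path_inv /hom_invr; rewrite inv_pathK. Qed.

Lemma hom_inv u v p q : homotopic u v p q ->
  homotopic v u (inv_path p) (inv_path q).
Proof.
move=> h; have [hp hq] := homotopic_paths h.
have ip := is_path_inv hp; have iq := is_path_inv hq.
have := hom_catl ip (hom_invr hq); rewrite cats0 => h1.
apply: hom_trans (hom_sym h1) _; rewrite catA.
apply: hom_trans (hom_catr (hom_catl ip (hom_sym h)) iq) _.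
exact: (hom_catr (hom_invl hp) iq).
Qed.

Lemma hom_cancell u v w p q q' : is_path u p v -> is_path v q w ->
  is_path v q' w -> homotopic u w (p ++ q) (p ++ q') -> homotopic v w q q'.
Proof.
move=> hp hq hq' h.
have e r : is_path v r w -> homotopic v w (inv_path p ++ p ++ r) r.
  by move=> hr; rewrite catA; apply: hom_catr (hom_invl hp) hr.
apply: hom_trans (hom_sym (e _ hq)) (hom_trans _ (e _ hq')).
exact: hom_catl (is_path_inv hp) h.
Qed.

(** The loop and its rotation are conjugate by a path between their base points. *)
Lemma hom_rot u v k p : is_path u p u -> is_path v (rot k p) v ->
  homotopic v v (rot k p) [::] -> homotopic u u p [::].
Proof.
have [-> h _ _|p0] : p = [::] \/ p <> [::] by case: (p); [left|right].
  exact: hom_refl.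
rewrite -[X in is_path u X u](cat_take_drop k p) => /is_path_catP[x h1 h2].
rewrite -[X in homotopic u u X](cat_take_drop k p) => hv h.
have hvx : v = x.
  have h3 := is_path_cat h2 h1; have [] // := is_path_det hv h3.
  by move=> e; apply: p0; apply: (@rot_inj k); rewrite e.
subst x; rewrite /rot in h; have h3 := hom_catl h1 (hom_catr h (is_path_inv h1)).
apply: hom_trans (hom_trans h3 (hom_invr h1)).
rewrite -!catA; apply: (hom_catl h1).
have := hom_catl h2 (hom_invr h1); rewrite cats0; exact: hom_sym.
Qed.

Lemma hom_bd u S : is_path u (bd S) u -> homotopic u u (bd S) [::].
Proof. by move=> h; have := @hom_cell2 _ u u [::] S [::]; rewrite !cats0; apply. Qed.

Lemma hom_turn u k b p S : is_path u p u -> turn k b p = bd S ->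
  homotopic u u p [::].
Proof.
move=> hp e; have [_ [x hx]] := bd_closed S.
have := hom_bd hx; move: hx; rewrite -{}e /turn; case: b => hx h; last first.
  exact: hom_rot hp hx h.
have := hom_inv (hom_rot (is_path_inv hp) hx h).
by rewrite inv_pathK.
Qed.

End HomotopyFacts.

Section MapFacts.
Variables (Y X : complex) (phi : cmap Y X).
Implicit Types (o : oedge Y) (p q : seq (oedge Y)) (u v w : vert Y).

Lemma mo_inv o : mo phi (oinv o) = oinv (mo phi o).
Proof. by case: o => e []; rewrite /mo /omap_of //= oinvK. Qed.

Lemma osrc_mo o : osrc (mo phi o) = mv phi (osrc o).
Proof.
case: o => e []; rewrite /mo /omap_of /=; last exact: (me_src phi e).
exact: (me_tgt phi e).
Qed.

Lemma otgt_mo o : otgt (mo phi o) = mv phi (otgt o).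
Proof. by rewrite /otgt -mo_inv osrc_mo. Qed.

Lemma mo_inj_cell1 o1 o2 : o1.1 = o2.1 -> mo phi o1 = mo phi o2 -> o1 = o2.
Proof. by move=> /same_cell1[//|->]; rewrite mo_inv => /esym/oinv_neq. Qed.

Lemma mo_cell1 o : (mo phi o).1 = (me phi o.1).1.
Proof. by case: o => e []. Qed.

Lemma is_path_mo p u v : is_path u p v ->
  is_path (mv phi u) (map (mo phi) p) (mv phi v).
Proof.
elim: p u => [u ->//|o p IH u [<- /IH h]] /=.
by rewrite osrc_mo otgt_mo.
Qed.

Lemma map_mo_inv p : map (mo phi) (inv_path p) = inv_path (map (mo phi) p).
Proof. by apply: map_inv_path => o; apply: mo_inv. Qed.

Lemma lift_bd_over S : map (mo phi) (lift_bd phi S) = bd (mf phi S).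
Proof. exact: mf_bd. Qed.

Lemma size_lift_bd S : size (lift_bd phi S) = size (bd (mf phi S)).
Proof. by rewrite -lift_bd_over size_map. Qed.

Lemma closed_lift_bd S : closed_path (lift_bd phi S).
Proof.
rewrite /lift_bd /turn; apply: closed_path_rot; case: (mflip _ _); last exact: bd_closed.
have [S0 [u hu]] := bd_closed S; split; last by exists u; apply: is_path_inv.
by move=> /(congr1 (@inv_path _)); rewrite inv_pathK.
Qed.

(** A 2-cell is mapped through a rotation and possibly a reflection of its
boundary, which [hom_turn] absorbs. *)
Lemma hom_mo u v p q : homotopic u v p q ->
  homotopic (mv phi u) (mv phi v) (map (mo phi) p) (map (mo phi) q).
Proof.
elim=> {p q} [p h|p q _|p q r _ h1 _|p o q h|p S q h].
- by apply: hom_refl; apply: is_path_mo.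
- exact: hom_sym.
- exact: hom_trans.
- move/is_path_mo: h; rewrite !map_cat /= mo_inv; exact: hom_backtrack.
have [x hp /is_path_catP[y hS hq]] := is_path_catP h.
have [S0 [z hz]] := bd_closed S; have [ex ey] := is_path_det hS hz S0.
subst x y; rewrite !map_cat; apply: hom_catl (is_path_mo hp) _.
apply: (@hom_catr _ _ _ _ _ [::] _ _ (is_path_mo hq)).
apply: (@hom_turn _ _ (mrot phi S) (mflip phi S) _ (mf phi S)).
  exact: is_path_mo.
rewrite -mf_bd /turn map_rot; case: ifP => // _; by rewrite map_mo_inv.
Qed.

(** The next 1-cell of a path is determined by its origin and its label. *)
Lemma immersion_path_inj : immersion1 phi -> forall p q u v w,
  is_path u p v -> is_path u q w -> map (mo phi) p = map (mo phi) q -> p = q.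
Proof.
move=> im; elim=> [[]//|o p IH] [|o' q] // u v w [hu hp] [hu' hq] /= [ho h].
have eo : o = o' by apply: im; rewrite ?hu.
by subst o'; congr (_ :: _); apply: IH hp hq h.
Qed.

End MapFacts.

Section OverMaps.
Variable X : complex.

Section One.
Variables (Y Y' : complex) (phi : cmap Y X) (phi' : cmap Y' X).
Variable f : over_map phi phi'.

Lemma po_tgt o : otgt (po f o) = pv f (otgt o).
Proof. by rewrite /otgt -po_inv po_src. Qed.

Lemma is_path_po p u v : is_path u p v -> is_path (pv f u) (map (po f) p) (pv f v).
Proof.
elim: p u => [u ->//|o p IH u [<- /IH h]] /=.
by rewrite po_src po_tgt.
Qed.

Lemma map_mo_po p : map (mo phi') (map (po f) p) = map (mo phi) p.
Proof. by rewrite -map_comp; apply: eq_map => o /=; rewrite po_over. Qed.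

End One.

Program Definition over_id (Y : complex) (phi : cmap Y X) : over_map phi phi :=
  @OverMap X Y Y phi phi id id id _ _ _ _ _ _.
Next Obligation. by rewrite map_id. Qed.

Program Definition over_comp (Y1 Y2 Y3 : complex) (f1 : cmap Y1 X)
    (f2 : cmap Y2 X) (f3 : cmap Y3 X) (g : over_map f2 f3) (f : over_map f1 f2) :
    over_map f1 f3 :=
  @OverMap X Y1 Y3 f1 f3 (pv g \o pv f) (po g \o po f) (pf g \o pf f) _ _ _ _ _ _.
Next Obligation. by rewrite !po_inv. Qed.
Next Obligation. by rewrite !po_src. Qed.
Next Obligation. by rewrite !pv_over. Qed.
Next Obligation. by rewrite !po_over. Qed.
Next Obligation. by rewrite !pf_over. Qed.
Next Obligation. by rewrite !pf_bd -map_comp. Qed.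

End OverMaps.

(** * Packets *)

Section PacketFacts.
Variables (X : fcomplex) (R : cell2 X).
Notation L := (size (bd R)).
Notation n := (cell2_exponent R).
Notation rl := (root_length R).

Lemma bd_size_gt0 : 0 < L.
Proof. by case: (bd_closed R) => h _; case: (bd R) h. Qed.

Lemma exponent_mul_root : n * rl = L.
Proof.
have h : (bd R : seq (fcell1 X * bool)) <> [::] by case: (bd_closed R).
have := congr1 size (exponentP h); rewrite size_flatten /shape map_nseq size_take_min.
rewrite (minn_idPl (leq_div _ _)) sumn_nseq mulnC => e.
by rewrite /root_length /cell2_exponent.
Qed.

Lemma cell2_exponent_gt0 : 0 < n.
Proof. by have := bd_size_gt0; rewrite -exponent_mul_root muln_gt0 => /andP[]. Qed.

Lemma root_length_gt0 : 0 < rl.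
Proof. by have := bd_size_gt0; rewrite -exponent_mul_root muln_gt0 => /andP[]. Qed.

(** Positions on the boundary circle are counted modulo its length. *)
Definition cyc (k : nat) : 'I_L := Ordinal (ltn_pmod k bd_size_gt0).
Definition bd_at (k : nat) : oedge X := tnth (in_tuple (bd R)) (cyc k).
Definition circ (k : nat) : oedge (packet R) := (cyc k, false).

Lemma cyc_ord (i : 'I_L) : cyc i = i.
Proof. by apply: val_inj; rewrite /= modn_small. Qed.

Lemma cyc_modP k k' : cyc k = cyc k' <-> k = k' %[mod L].
Proof. by split=> [/(congr1 val)//|h]; apply: val_inj. Qed.

Lemma nth_bd o k : k < L -> nth o (bd R) k = bd_at k.
Proof. by move=> h; rewrite /bd_at (tnth_nth o) /= modn_small. Qed.

Lemma bd_at_mod k : bd_at (k %% L) = bd_at k.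
Proof. by congr tnth; apply/cyc_modP; rewrite modn_mod. Qed.

Lemma bd_at_root k : bd_at (k + rl) = bd_at k.
Proof.
have h0 : (bd R : seq (fcell1 X * bool)) <> [::] by case: (bd_closed R).
have o : fcell1 X * bool := bd_at 0.
have := @rot_exponent _ _ 1 h0 cell2_exponent_gt0; rewrite mul1n => e.
have E j : bd_at j = nth o (bd R) (j %% L).
  by rewrite -bd_at_mod nth_bd // ltn_pmod ?bd_size_gt0.
rewrite !E -[X in _ = nth o X _]e.
rewrite -/(cell2_exponent R) -/(root_length R); set m := k %% L.
have hm : m < L by rewrite ltn_pmod ?bd_size_gt0.
have hr : rl <= L by apply: leq_div.
rewrite -modnDml -/m nth_cat size_drop nth_drop.
case: ltnP => h; first by rewrite addnC modn_small // -ltn_subRL.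
have h' : L <= m + rl by rewrite addnC -leq_subLR.
have h2 : m + rl - L < rl by rewrite ltn_subLR // ltn_add2r.
rewrite subnBA // nth_take //; congr nth.
rewrite -{1}(subnK h') modnDr modn_small //; exact: leq_trans hr.
Qed.

Lemma bd_at_rootM k j : bd_at (k + j * rl) = bd_at k.
Proof. by elim: j => [|j IH]; rewrite ?addn0 // mulSnr addnA bd_at_root. Qed.

Lemma bd_at_mod_root k : bd_at (k %% rl) = bd_at k.
Proof. by rewrite [in RHS](divn_eq k rl) addnC bd_at_rootM. Qed.

Lemma size_arc (i : 'I_L) l : l <= L -> size (arc i l) = l.
Proof. by move=> h; rewrite size_take_min size_rot size_circle (minn_idPl h). Qed.

Lemma arcE (i : 'I_L) l : l <= L -> arc i l = [seq circ (i + m) | m <- iota 0 l].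
Proof.
move=> h; apply: (@eq_from_nth _ (circ 0)) => [|k]; first by rewrite size_map size_iota size_arc.
rewrite size_arc // => hk; rewrite (nth_map 0) ?size_iota // nth_iota // add0n.
have hkL := leq_trans hk h.
rewrite /arc nth_take // /rot nth_cat size_drop size_circle nth_drop.
have iL := ltn_ord i; case: ltnP => hi.
  have hik : i + k < L by rewrite -ltn_subRL.
  by rewrite (circle_nth _ hik); congr (_, _); apply: val_inj; rewrite /= modn_small.
rewrite nth_take; last by rewrite ltn_subLR // subnK // ltnW.
have h1 : L <= i + k by rewrite -leq_subLR.
have h2 : k - (L - i) < L by rewrite (leq_ltn_trans _ hkL) // leq_subr.
rewrite (circle_nth _ h2); congr (_, _); apply: val_inj.
have e : k - (L - i) = i + k - L by rewrite subnBA 1?addnC // ltnW.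
by rewrite /= e -[in RHS](subnK h1) modnDr modn_small -?e.
Qed.

Lemma osrc_circ k : osrc (circ k) = cyc k :> 'I_L.
Proof. by []. Qed.

Lemma otgt_circ k : otgt (circ k) = cyc k.+1 :> 'I_L.
Proof. by apply: val_inj; rewrite /= -[in RHS]addn1 -modnDml addn1. Qed.

Lemma mo_circ k : mo (packet_map R) (circ k) = bd_at k.
Proof. by []. Qed.

Lemma mv_cyc k : mv (packet_map R) (cyc k) = osrc (bd_at k).
Proof. by []. Qed.

Lemma map_mo_arc (i : 'I_L) l : l <= L ->
  map (mo (packet_map R)) (arc i l) = [seq bd_at (i + m) | m <- iota 0 l].
Proof. by move=> h; rewrite arcE // -map_comp. Qed.

Lemma circle_iota : circle L = [seq circ m | m <- iota 0 L].
Proof.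
have := @arcE (cyc 0) L (leqnn _); rewrite /arc /= mod0n rot0 take_oversize //.
by rewrite size_circle.
Qed.

Lemma rot_circle k : rot (k %% L) (circle L) = [seq circ (k + m) | m <- iota 0 L].
Proof.
have := @arcE (cyc k) L (leqnn _); rewrite /arc /= take_oversize ?size_rot ?size_circle // => ->.
by apply: eq_map => m; rewrite /circ; congr (_, _); apply/cyc_modP; rewrite modnDml.
Qed.

Lemma packet_lift_bd (j : 'I_n) :
  lift_bd (packet_map R) j = [seq circ (j * rl + m) | m <- iota 0 L].
Proof.
rewrite /lift_bd /turn /= rot0 -rot_circle modn_small //.
by rewrite -[X in _ < X]exponent_mul_root ltn_mul2r root_length_gt0 /=.
Qed.

Lemma bd_iota : bd R = [seq bd_at m | m <- iota 0 L].
Proof.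
have o := bd_at 0.
apply: (@eq_from_nth _ o) => [|k hk]; first by rewrite size_map size_iota.
by rewrite (nth_map 0) ?size_iota // nth_iota // nth_bd.
Qed.

Lemma otgt_bd_at k : otgt (bd_at k) = osrc (bd_at k.+1).
Proof.
by rewrite -mo_circ otgt_mo otgt_circ mv_cyc.
Qed.

Lemma oedge_packet (o : oedge (packet R)) :
  exists k, k < L /\ (o = circ k \/ o = oinv (circ k)).
Proof.
case: o => k b; exists (k : 'I_L); split; first exact: ltn_ord.
by have e := cyc_ord k; case: b; [right|left]; rewrite /circ /oinv /= e.
Qed.

(** Rotating the boundary circle by [j] roots preserves the labels and permutes the
copies of the 2-cell: these are the deck transformations of the packet. *)
Section Rotation.
Variable j : 'I_n.

Definition deck_v (c : vert (packet R)) : vert (packet R) := cyc ((c : 'I_L) + j * rl).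
Definition deck_f (c : cell2 (packet R)) : cell2 (packet R) :=
  Ordinal (ltn_pmod ((c : 'I_n) + j) cell2_exponent_gt0).

Lemma deck_label c : tnth (in_tuple (bd R)) (deck_v c) = tnth (in_tuple (bd R)) c.
Proof. by rewrite -[in RHS](cyc_ord c); exact: bd_at_rootM. Qed.

Program Definition deck : over_map (packet_map R) (packet_map R) :=
  @OverMap X _ _ (packet_map R) (packet_map R) deck_v
    (fun o => (deck_v o.1, o.2)) deck_f _ _ _ _ _ _.
Next Obligation.
case: o => c [] //; rewrite /osrc /=; apply: val_inj => /=.
by rewrite -addn1 modnDml addn1 modnDml.
Qed.
Next Obligation.
by move: (deck_label v) => /= ->.
Qed.
Next Obligation.
by case: o => c b; rewrite /mo /omap_of /= deck_label.
Qed.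
Next Obligation.
rewrite !packet_lift_bd -map_comp; apply: eq_map => m /=.
rewrite /circ; congr (_, _); apply/val_inj => /=.
rewrite modnDml addnAC -mulnDl; apply/eqP; rewrite eqn_modDr.
by rewrite -[X in _ == _ %[mod X]]exponent_mul_root muln_modl // modn_mod.
Qed.

End Rotation.

End PacketFacts.

(** * Sides and attachment sites *)

Section SidesWeight.
Variable X : wcomplex.
Implicit Types (x : fcell1 X) (P Q : fcell2 X -> nat -> bool).

Lemma sides_weightE x P : sides_weight x P =
  \sum_(R : fcell2 X) \sum_(i < size (bd (c := X) R))
    ((tnth (in_tuple (bd (c := X) R)) i).1 == x) * P R i * wt i.
Proof.
apply: eq_bigr => R _; rewrite [LHS]big_mkcond /=; apply: eq_bigr => i _.
by case: (_ == x); case: (P R i); rewrite ?mul1n.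
Qed.

(** The family [P], indexed by the elements of [D], and [P0] are pairwise
disjoint, and each side is counted only once in [Q]. *)
Lemma sides_weight_family (I : finType) (D : pred I) x P0 (P : I -> fcell2 X -> nat -> bool) Q :
  (forall R i, P0 R i -> Q R i) ->
  (forall k R i, D k -> P k R i -> Q R i) ->
  (forall k R i, D k -> P k R i -> ~~ P0 R i) ->
  (forall k k' R i, D k -> D k' -> P k R i -> P k' R i -> k = k') ->
  sides_weight x P0 + \sum_(k | D k) sides_weight x (P k) <= sides_weight x Q.
Proof.
move=> h0 hP hd hdd; under eq_bigr => k _ do rewrite sides_weightE.
rewrite !sides_weightE exchange_big -big_split /=; apply: leq_sum => R _.
rewrite exchange_big -big_split /=; apply: leq_sum => i _.
case: (_ == x); rewrite ?mul0n ?mul1n //=; last by rewrite big1 // => k; rewrite mul0n.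
under eq_bigr => k _ do rewrite mul1n.
rewrite -big_distrl -mulnDl leq_mul2r; apply/orP; right.
case: (pickP [pred k | D k && P k R i]) => [k /= /andP[Dk Pk]|h]; last first.
  rewrite big1 => [|k Dk]; last by have := h k; rewrite /= Dk /= => ->.
  by have := @h0 R i; case: (P0 R i) => //; case: (Q R i) => // ->.
rewrite (negPf (hd _ _ _ Dk Pk)) (hP _ _ _ Dk Pk) (bigD1 k) //= Pk big1 // => k' /andP[Dk' ne].
by case E: (P k' R i) => //; rewrite (hdd _ _ _ _ Dk' Dk E Pk) eqxx in ne.
Qed.

Lemma sides_weight_mono x P Q : (forall R i, P R i -> Q R i) ->
  sides_weight x P <= sides_weight x Q.
Proof.
move=> h; have := @sides_weight_family void xpred0 x P (fun _ _ _ => false) Q h.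
by rewrite big_pred0 // addn0; apply.
Qed.

Lemma sides_weight_compl x P :
  sides_weight x (fun R i => ~~ P R i) + sides_weight x P = sides_weight x (fun _ _ => true).
Proof.
rewrite !sides_weightE -big_split; apply: eq_bigr => R _ /=.
rewrite -big_split; apply: eq_bigr => i _ /=.
by case: (P R i); rewrite !muln0 ?muln1 ?mul0n ?addn0.
Qed.

Lemma sides_weight_one x P (R : fcell2 X) (p : 'I_(size (bd (c := X) R))) :
  (tnth (in_tuple (bd (c := X) R)) p).1 = x -> P R p -> wt p <= sides_weight x P.
Proof.
move=> e h; rewrite sides_weightE (bigD1 R) //= (bigD1 p) //= e eqxx h !mul1n.
by rewrite -addnA leq_addr.
Qed.

End SidesWeight.

Section Presence.
Variable X : wcomplex.

Lemma side_presentP (Y : fcomplex) (phi : cmap Y X) y R p :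
  side_present phi y R p <->
  exists (S : fcell2 Y) (o : oedge Y),
    [/\ mf phi S = R, onth (lift_bd phi S) p = Some o & o.1 = y].
Proof.
split.
  case/existsP=> S /andP[/eqP hS]; case E: (onth _ _) => [o|] //= /eqP[ho].
  by exists S, o.
case=> S [o [hS ho hy]]; apply/existsP; exists S.
by rewrite hS eqxx ho /= hy.
Qed.

Lemma onth_nth (T : Type) (x0 : T) (s : seq T) k : k < size s -> onth s k = Some (nth x0 s k).
Proof. by elim: s k => // x s IH [|k] //= /IH. Qed.

Lemma onth_Some (T : Type) (x0 : T) (s : seq T) k x : onth s k = Some x ->
  k < size s /\ nth x0 s k = x.
Proof. by elim: s k => [[]//|y s IH [|k]] /= => [[->]|/IH]. Qed.

Lemma side_present_po (Y Y' : fcomplex) (phi : cmap Y X) (phi' : cmap Y' X)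
    (f : over_map phi phi') y R p :
  side_present phi y R p -> side_present phi' (po f (y, false)).1 R p.
Proof.
case/side_presentP=> S [o [hS ho hy]]; apply/side_presentP; exists (pf f S), (po f o).
rewrite pf_over pf_bd; split=> //.
  by rewrite onth_map ho.
case: o hy {ho} => e b /= ->; case: b => //.
by have := po_inv f (y : cell1 Y, false); rewrite /oinv /= => ->.
Qed.

Lemma side_present_packet (R : cell2 X) (k : nat) R' p :
  side_present (packet_map R) (cyc R k) R' p ->
  [/\ R' = R, p < size (bd R) & p = k %[mod root_length R]].
Proof.
case/side_presentP=> S [o [/= <- ho hk]].
rewrite packet_lift_bd in ho; have [] := onth_Some o ho.
rewrite size_map size_iota => hp; rewrite (nth_map 0) ?size_iota // nth_iota // add0n => e.
split=> //; move: hk; rewrite -e /circ /= => /(congr1 val) /= h.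
apply/eqP; rewrite -(modnMDl S p); apply/eqP.
have d : root_length R %| size (bd R) by rewrite -exponent_mul_root dvdn_mull.
by rewrite -[LHS](modn_dvdm _ d) h modn_dvdm.
Qed.

Lemma side_present_packet_self (R : cell2 X) (p : 'I_(size (bd R))) :
  side_present (packet_map R) p R p.
Proof.
apply/side_presentP; exists (Ordinal (cell2_exponent_gt0 R)), (circ R p).
split=> //; last exact: cyc_ord.
rewrite packet_lift_bd (onth_nth (circ R 0)) ?size_map ?size_iota //.
by rewrite (nth_map 0) ?size_iota // nth_iota.
Qed.

End Presence.

Section Reduction.
Variables (X : wcomplex) (Y : complex) (phi : cmap Y X).
Hypotheses (pk : packed phi) (im : immersion1 phi).

Lemma immersion_path_inj_r p q u v w : is_path u p w -> is_path v q w ->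
  map (mo phi) p = map (mo phi) q -> p = q /\ u = v.
Proof.
move=> hp hq e.
have ee : p = q.
  apply: (can_inj (@inv_pathK Y)).
  apply: (immersion_path_inj im (is_path_inv hp) (is_path_inv hq)).
  by rewrite !map_mo_inv e.
subst q; split=> //.
by apply: is_path_det2 (is_path_inv hp) (is_path_inv hq).
Qed.

Lemma packed_at R S : mf phi S = R -> exists psi : over_map (packet_map R) phi,
  lift_bd phi S = [seq po psi (circ R m) | m <- iota 0 (size (bd R))].
Proof.
move=> <-; have [psi h] := pk S; exists psi.
have := pf_bd psi (Ordinal (cell2_exponent_gt0 (mf phi S))).
by rewrite h // packet_lift_bd -map_comp /= => ->.
Qed.

(** Up to a deck transformation, a lift of a 2-cell spreads to a lift of its
packet carrying any prescribed congruent position to the same 1-cell. *)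
Lemma packed_lift (R : cell2 X) S p k o : mf phi S = R -> onth (lift_bd phi S) p = Some o ->
  p = k %[mod root_length R] ->
  exists psi : over_map (packet_map R) phi, po psi (circ R k) = o.
Proof.
move=> hS hp hk; have [psi e] := packed_at hS.
move: hp; rewrite e => /(onth_Some o)[]; rewrite size_map size_iota => hpL.
rewrite (nth_map 0) ?size_iota // nth_iota // add0n => ho.
have L0 := bd_size_gt0 R; set rl := root_length R in hk; set n := cell2_exponent R.
have nrl : n * rl = size (bd R) by exact: exponent_mul_root.
have kL : k <= k * size (bd R) by rewrite leq_pmulr.
(* Modulo the length of the boundary, [k * size (bd R) - k] is [- k]. *)
set a := p + (k * size (bd R) - k).
have da : rl %| a.
  rewrite /dvdn -(mod0n rl); apply/eqP/eqP; rewrite -(eqn_modDr k) /a -addnA subnK // add0n.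
  by rewrite -nrl mulnA addnC modnMDl hk.
have hj : (a %/ rl) %% n < n by rewrite ltn_mod cell2_exponent_gt0.
exists (over_comp psi (deck (Ordinal hj))); rewrite -ho /=; congr (po psi _).
rewrite /circ; congr (_, _); apply: val_inj; rewrite /= modnDml.
rewrite -/rl muln_modl divnK // nrl modnDmr /a addnCA subnKC //.
by rewrite addnC modnMDl.
Qed.

Section Site.
Variables (R : cell2 X) (i : 'I_(size (bd R))) (v : vert Y) (q : seq (oedge Y)).
Hypothesis site : attachment_site phi i v q.

Lemma site_size : size q <= size (bd R).
Proof.
case: site => _ _ /(congr1 size); rewrite !size_map size_take_min size_rot size_circle.
by move=> -> _; exact: geq_minr.
Qed.

Lemma site_labels : map (mo phi) q = [seq bd_at R (i + m) | m <- iota 0 (size q)].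
Proof. by case: site => _ _ -> _; rewrite map_mo_arc // site_size. Qed.

Lemma site_label o m : m < size q -> mo phi (nth o q m) = bd_at R (i + m).
Proof.
move=> h; rewrite -(nth_map _ (mo phi o)) // site_labels (nth_map 0) ?size_iota //.
by rewrite nth_iota.
Qed.

Lemma is_path_arc l : l <= size (bd R) ->
  is_path (i : vert (packet R)) (arc i l) (cyc R (i + l)).
Proof.
elim: l => [|l IH] h; first by rewrite arcE //= addn0 cyc_ord.
rewrite arcE // -addn1 iotaD add0n map_cat cats1 is_path_rcons otgt_circ addn1 addnS.
by split=> //; rewrite -arcE ?(ltnW h) //; apply: IH (ltnW h).
Qed.

(** In an immersed complex a lift of the packet is determined by one vertex. *)
Lemma site_no_lift (psi : over_map (packet_map R) phi) : pv psi i <> v.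
Proof.
move=> e; have sz := site_size; case: site => [[w hw] _ lab]; case; exists psi; split=> //.
have h := is_path_po psi (is_path_arc sz); rewrite e in h.
by apply: (immersion_path_inj im h hw); rewrite map_mo_po lab.
Qed.

(** Read backwards from the common 1-cell, the lift of the arc and the path have
the same labels, so that the lift starts at [v] as well. *)
Lemma site_no_lift_edge (psi : over_map (packet_map R) phi) o m : m < size q ->
  po psi (circ R (i + m)) <> nth o q m.
Proof.
move=> hm e; have sz := site_size; case: site => [[w hw] _ _ _].
have hm' : m.+1 <= size (bd R) by apply: leq_trans sz.
have h1 := is_path_po psi (is_path_arc hm').
have [x hx _] : exists2 x, is_path v (take m.+1 q) x & is_path x (drop m.+1 q) w.
  by apply: is_path_catP; rewrite cat_take_drop.
have ex : x = pv psi (cyc R (i + m.+1)).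
  move: hx; rewrite (take_nth o) // is_path_rcons => -[_ <-].
  by rewrite -e po_tgt otgt_circ addnS.
rewrite {}ex in hx; have [] := immersion_path_inj_r h1 hx.
  rewrite map_mo_po map_mo_arc // map_take site_labels -map_take take_iota.
  by rewrite (minn_idPl hm).
by move=> _ /site_no_lift.
Qed.

End Site.
End Reduction.

(** A side that is already present in [Y] at a 1-cell of the attaching path is
not added there by the packet, since otherwise the packet would lift along the path. *)
Lemma site_sides_disjoint (X : wcomplex) (Y : fcomplex) (phi : cmap Y X)
    (R : cell2 X) (i : 'I_(size (bd R))) v q o m R' p :
  packed phi -> immersion1 phi -> attachment_site phi i v q -> m < size q ->
  side_present phi (nth o q m).1 R' p ->
  side_present (packet_map R) (cyc R (i + m)) R' p -> False.
Proof.
move=> pk im site hm /side_presentP[S [o1 [hS ho1 e]]] /side_present_packet[eR hp hk].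
rewrite {}eR in hS; have eo : o1 = nth o q m.
  apply: (mo_inj_cell1 (phi := phi) e); rewrite (site_label site) //.
  have [_ <-] := onth_Some o ho1.
  rewrite -(nth_map _ (mo phi o)); last by have [] := onth_Some o ho1.
  rewrite lift_bd_over hS nth_bd //.
  by rewrite -bd_at_mod_root hk bd_at_mod_root.
subst o1; have [psi e'] := packed_lift pk hS ho1 hk.
exact: (site_no_lift_edge im site hm e').
Qed.

(** * An attachment lowers the perimeter *)

Section AttachmentPerimeter.
Variables (X : wcomplex) (Y : fcomplex) (phi : cmap Y X).
Hypotheses (pk : packed phi) (im : immersion1 phi).
Variables (R : cell2 X) (i : 'I_(size (bd R))) (v : vert Y) (q : seq (oedge Y)).
Hypothesis mx : maximal_reduction phi i v q.
Notation L := (size (bd R)).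
Notation l := (size q).

Let site : attachment_site phi i v q.
Proof. by case: mx => -[]. Qed.

(** If a maximal attaching path that does not go all around met the same side
twice, its lift would be periodic and could be prolonged by one more period. *)
Lemma maximal_sides_disjoint o m1 m2 R' p : l < L -> m1 < m2 -> m2 < l ->
  (nth o q m1).1 = (nth o q m2).1 ->
  side_present (packet_map R) (cyc R (i + m1)) R' p ->
  side_present (packet_map R) (cyc R (i + m2)) R' p -> False.
Proof.
move=> lL h12 h2 e /side_present_packet[_ _ e1] /side_present_packet[_ _ e2].
have h1 := ltn_trans h12 h2.
have eq12 : nth o q m1 = nth o q m2.
  apply: (mo_inj_cell1 (phi := phi) e); rewrite !(site_label site) //.
  by rewrite -bd_at_mod_root -e1 e2 bd_at_mod_root.
have ed k : bd_at R (i + m1 + k) = bd_at R (i + m2 + k).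
  by rewrite -bd_at_mod_root -modnDml -e1 e2 modnDml bd_at_mod_root.
case: (site) => -[w hw] hv lab nolift.
have step k : m2 + k < l -> nth o q (m1 + k) = nth o q (m2 + k).
  elim: k => [|k IH] hk; first by rewrite !addn0.
  have hk' : m2 + k < l by rewrite (leq_trans _ hk) // addnS ltnW.
  have hk1 : m1 + k.+1 < l by rewrite (leq_ltn_trans _ hk) // leq_add2r ltnW.
  have hk1' : m1 + k < l by rewrite (leq_trans _ hk1) // addnS ltnW.
  apply: im.
    have := path_nth o hw hk'; have := path_nth o hw hk1'.
    rewrite -!addnS IH // !ltn_eqF // => -> //.
  by rewrite !(site_label site) // !addnA ed.
(* The 1-cell one period before the end of [q], which also fits after [q]. *)
set x := nth o q (m1 + (l - m2)).
have hx1 : m1 + (l - m2) < l by rewrite -[X in _ < X](subnKC (ltnW h2)) ltn_add2r.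
have ox : osrc x = w.
  have lp : 0 < l by exact: leq_ltn_trans h2.
  have h3 : m2 + (l - m2).-1 = l.-1.
    by rewrite -[in RHS](subnKC (ltnW h2)) -[in RHS](prednK (n := l - m2)) ?subn_gt0 // addnS.
  have := step (l - m2).-1; rewrite h3 prednK // => /(_ (leqnn _)) e3.
  have := path_nth o hw (i := l.-1); rewrite prednK // eqxx => /(_ (leqnn _)) <-.
  rewrite -e3 (path_nth o hw); last first.
    by rewrite (leq_ltn_trans _ hx1) // leq_add2l leq_pred.
  by rewrite -addnS prednK ?subn_gt0 // ltn_eqF.
have pr : perimeter_reduction phi i v ([::] ++ q ++ [:: x]).
  rewrite /= cats1; split; last first.
    have [[_ hp] _] := mx; apply: leq_trans hp _.
    by rewrite map_rcons -cats1 /path_perimeter big_cat leq_addr.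
  split=> //.
  - by exists (otgt x); rewrite is_path_rcons ox.
  - rewrite size_rcons map_mo_arc // -addn1 iotaD map_cat map_rcons (site_labels site) cats1.
    congr rcons; rewrite /x (site_label site) // add0n addnA ed -addnA.
    by rewrite subnKC // ltnW.
  case=> psi [hpsi _]; exact: (site_no_lift im site hpsi).
have [_ max] := mx.
have [] : [::] = [::] :> seq (oedge Y) /\ [:: x] = [::]; last by [].
by apply: (max i v) pr _ _ => //=; rewrite addn0 modn_small.
Qed.

Variables (Y' : fcomplex) (phi' : cmap Y' X).
Variables (f : over_map phi phi') (g : over_map (packet_map R) phi').
Hypothesis cover : forall o' : oedge Y', exists x, sum_fun (po f) (po g) x = o'.
Hypothesis glue : forall o m, m < l -> po f (nth o q m) = po g (circ R (i + m)).

Let missC (m : nat) := sides_weight (bd_at R m).1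
  (fun R' p => ~~ side_present (packet_map R) (cyc R m) R' p).
Let presC (m : nat) := sides_weight (bd_at R m).1
  (fun R' p => side_present (packet_map R) (cyc R m) R' p).

Let over (y : fcell1 Y) (m : nat) : bool := onth (map fst q) m == Some y.
(** The weight of the sides missing at [y] that the packet does not bring there. *)
Let left (y : fcell1 Y) := sides_weight (me phi y).1 (fun R' p =>
  ~~ side_present phi y R' p &&
  [forall m : 'I_l, over y m ==> ~~ side_present (packet_map R) (cyc R (i + m)) R' p]).

Lemma po_fst (Z Z' : fcomplex) (z : cmap Z X) (z' : cmap Z' X) (h : over_map z z') o :
  (po h o).1 = (po h (o.1, false)).1.
Proof. by case: o => e [] //; have := po_inv h (e, false); rewrite /oinv /= => ->. Qed.

Lemma me_po (Z Z' : fcomplex) (z : cmap Z X) (z' : cmap Z' X) (h : over_map z z') e :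
  (me z' (po h (e, false)).1).1 = (me z e).1.
Proof. by rewrite -mo_cell1 po_over mo_cell1. Qed.

(** Every 1-cell of [Y'] is the image of one of [Y], or of one of the packet off
the attaching path; what is missing at it is missing at this preimage and at all
1-cells that are glued to it. *)
Lemma perimeter_attachment_le :
  perimeter phi' <= \sum_(y : fcell1 Y) left y + \sum_(m < L | l <= m) missC (i + m).
Proof.
pose hit (y' : fcell1 Y') (x : fcell1 Y + 'I_L) : bool :=
  match x with
  | inl y => (po f (y, false)).1 == y'
  | inr m => (l <= m) && ((po g (circ R (i + m))).1 == y')
  end.
have hit_inj y1 y2 x : hit y1 x -> hit y2 x -> y1 = y2.
  case: x => [y|m] /=; first by move=> /eqP <- /eqP.
  by move=> /andP[_ /eqP <-] /andP[_ /eqP].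
have hits y' : exists x, hit y' x.
  have [[o|o] ho] := cover ((y', false) : oedge Y').
    by exists (inl o.1); rewrite /= -po_fst; apply/eqP; move: ho => /= ->.
  have [k [kL hk]] := oedge_packet o.
  have hk' : (po g (circ R k)).1 = y'.
    by case: hk ho => -> /=; rewrite ?po_inv /= => ho; have := congr1 fst ho.
  pose m := (k + (L - i)) %% L.
  have em : cyc R (i + m) = cyc R k.
    apply: val_inj; rewrite /= /m modnDmr addnCA subnKC ?modnDr //; exact: ltnW.
  have hm : m < L by rewrite ltn_mod bd_size_gt0.
  rewrite /circ -em in hk'; case: (ltnP m l) => hml; last first.
    by exists (inr (Ordinal hm)); rewrite /= hml; apply/eqP.
  have o0 : oedge Y by case: (q) hml.
  exists (inl (nth o0 q m).1); rewrite /= -po_fst glue //; exact/eqP.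
pose h y' := xchoose (hits y').
have h_inj : injective h.
  move=> y1 y2 e; apply: (hit_inj _ _ (h y1)); first exact: (xchooseP (hits y1)).
  by rewrite e; apply: (xchooseP (hits y2)).
pose M (x : fcell1 Y + 'I_L) := match x with
  | inl y => left y | inr m => if l <= m then missC (i + m) else 0 end.
apply: (@leq_trans (\sum_(y' : fcell1 Y') M (h y'))).
  apply: leq_sum => y' _; have := xchooseP (hits y'); rewrite -/(h y').
  case: (h y') => [y|m] /= => [/eqP e|/andP[-> /eqP e]]; rewrite -e.
    rewrite me_po; apply: sides_weight_mono => R' p nP; apply/andP; split.
      by apply: contra nP; apply: side_present_po.
    apply/forallP=> m; apply/implyP=> /eqP hm; apply: contra nP => hp.
    have o0 : oedge Y := (y, false).
    have -> : (po f (y, false)).1 = (po g (circ R (i + m))).1.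
      rewrite -(glue o0) // [RHS]po_fst.
      by move: hm; rewrite onth_map (onth_nth o0) //= => -[->].
    exact: side_present_po hp.
  rewrite -[circ _ _]/((cyc R (i + m) : cell1 (packet R), false)) me_po.
  by apply: sides_weight_mono => R' p; apply: contra; apply: side_present_po.
rewrite -(big_imset M (in2W h_inj)) /=.
apply: (@leq_trans (\sum_x M x)).
  by rewrite [X in _ <= X](bigID [pred x in [set h x | x in predT]]) /= leq_addr.
rewrite big_sumType /= [X in _ <= _ + X]big_mkcond //.
Qed.

Let missC_mod k k' : cyc R k = cyc R k' -> missC k = missC k'.
Proof. by rewrite /missC /bd_at => ->. Qed.

Lemma perimeter_packet : perimeter (packet_map R) = \sum_(m < L) missC (i + m).
Proof.
have -> : perimeter (packet_map R) = \sum_(c < L) missC c.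
  by apply: eq_bigr => c _; rewrite /missC /bd_at cyc_ord.
rewrite (reindex_inj (h := fun m : 'I_L => cyc R (i + m))).
  by apply: eq_bigr => m _; apply: missC_mod; apply/cyc_modP; rewrite /= modn_mod.
move=> m m' /cyc_modP/eqP; rewrite eqn_modDl => /eqP; rewrite !modn_small // => h.
exact: val_inj.
Qed.

Lemma path_perimeter_site : path_perimeter (map (mo phi) q) =
  \sum_(m < l) (missC (i + m) + presC (i + m)).
Proof.
rewrite (site_labels site) /path_perimeter big_map -{1}(subn0 l) -/(index_iota 0 l) big_mkord.
by apply: eq_bigr => m _; rewrite /missC /presC sides_weight_compl.
Qed.

Let site_label1 o m : m < l -> (me phi (nth o q m).1).1 = (bd_at R (i + m)).1.
Proof. by move=> h; rewrite -(site_label site o h) mo_cell1. Qed.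

(** If the attaching path does not go all around, the weights of the sides that
the packet brings to its 1-cells add up without repetition, and the inequality of
the reduction says that they exceed what is missing at the rest of the packet. If
it goes all around, no 1-cell is added, and a side of [R] of positive weight is
no longer missing. *)
Lemma attachment_perimeter : perimeter phi' < perimeter phi.
Proof.
apply: (leq_ltn_trans perimeter_attachment_le).
have le1 y R' p : (~~ side_present phi y R' p && [forall m : 'I_l,
    over y m ==> ~~ side_present (packet_map R) (cyc R (i + m)) R' p]) ->
    ~~ side_present phi y R' p by case/andP.
have overP y m o : m < l -> over y m -> (nth o q m).1 = y.
  by move=> hm /eqP; rewrite onth_map (onth_nth o) //= => -[].
have [lL|Ll] := ltnP l L.
  have key : \sum_y left y + \sum_(m < l) presC (i + m) <= perimeter phi.
    have -> : \sum_(m < l) presC (i + m) =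
        \sum_(y : fcell1 Y) \sum_(m < l | over y m) sides_weight (me phi y).1
          (fun R' p => side_present (packet_map R) (cyc R (i + m)) R' p).
      rewrite [RHS](exchange_big_dep xpredT) //=; apply: eq_bigr => m _.
      have o : oedge Y by case: (q) m => [[]//|].
      rewrite (big_pred1 (nth o q m).1) => [|y].
        by rewrite /presC site_label1.
      by rewrite /over onth_map (onth_nth o) //= eq_sym.
    rewrite -big_split; apply: leq_sum => y _ /=.
    apply: sides_weight_family => [R' p|m R' p hm hp|m R' p hm hp|m m' R' p hm hm' hp hp'].
    - exact: le1.
    - have o : oedge Y by case: (q) m {hm hp} => [[]//|].
      rewrite -(overP _ _ o _ hm) //; apply/negP => h.
      exact: (site_sides_disjoint pk im site _ h hp).
    - by rewrite negb_and negbK; apply/orP; right; apply/forallPn; exists m; rewrite hm hp.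
    have o : oedge Y by case: (q) m {hm hp} => [[]//|].
    have e : (nth o q m).1 = (nth o q m').1 by rewrite !(overP y).
    apply/val_inj/eqP; case: (ltngtP m m') => // h.
      by case: (maximal_sides_disjoint lL h _ e hp hp').
    by case: (maximal_sides_disjoint lL h _ (esym e) hp' hp).
  have [[_ red] _] := mx; rewrite perimeter_packet path_perimeter_site big_split /= in red.
  have e : \sum_(m < L) missC (i + m) =
      \sum_(m < l) missC (i + m) + \sum_(m < L | l <= m) missC (i + m).
    rewrite (bigID (fun m : 'I_L => m < l)) /=; congr (_ + _).
      by rewrite (big_ord_narrow (ltnW lL)).
    by apply: eq_bigl => m; rewrite -leqNgt.
  rewrite e ltn_add2l in red.
  by apply: leq_trans key; rewrite -addnS leq_add2l.
rewrite [X in _ + X]big_pred0 ?addn0 => [|m]; last first.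
  by apply/negbTE; rewrite -ltnNge (leq_trans _ Ll).
have [p wp] : exists p : 'I_L, 0 < wt p.
  apply/existsP; apply: contraT => /existsPn h; have := @wt_gt0 X R.
  by rewrite big1 // => p _; apply/eqP; rewrite -leqn0 leqNgt h.
pose m := (p + (L - i)) %% L.
have hm : m < l by apply: leq_trans Ll; rewrite ltn_mod bd_size_gt0.
have em : cyc R (i + m) = p.
  rewrite -[RHS]cyc_ord; apply: val_inj; rewrite /= /m modnDmr addnCA subnKC ?modnDr //.
  exact: ltnW.
have o : oedge Y by case: (q) hm.
pose y := (nth o q m).1.
have pp : side_present (packet_map R) (cyc R (i + m)) R p.
  by rewrite em; exact: side_present_packet_self.
rewrite /perimeter [X in X < _](bigD1 y) //= [X in _ < X](bigD1 y) //= -addSn.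
apply: leq_add; last first.
  by apply: leq_sum => y' _; apply: sides_weight_mono => R' p'; apply: le1.
pose P1 (R' : fcell2 X) (p' : nat) := (R' == R) && (p' == p).
have w1 : 0 < sides_weight (me phi y).1 P1.
  apply: leq_trans wp _; apply: sides_weight_one; last by rewrite /P1 !eqxx.
  by rewrite /y site_label1 // /bd_at em.
apply: (@leq_trans (left y + \sum_(k : 'I_1) sides_weight (me phi y).1 P1)).
  by rewrite big_ord1 -addn1 leq_add2l.
have nP : ~~ side_present phi y R p.
  by apply/negP => h; apply: (site_sides_disjoint pk im site hm h pp).
apply: sides_weight_family => [R' p'|_ R' p' _|_ R' p' _|k k' *].
- exact: le1.
- by case/andP=> /eqP-> /eqP->.
- case/andP=> /eqP-> /eqP->; rewrite negb_and negbK; apply/orP; right.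
  apply/forallPn; exists (Ordinal hm); rewrite /= pp implybF negbK.
  by rewrite /over onth_map (onth_nth o).
by rewrite !ord1.
Qed.

End AttachmentPerimeter.

(** * Termination *)

Lemma leq_card_surj (A B : finType) (f : A -> B) :
  (forall y, exists x, f x = y) -> #|B| <= #|A|.
Proof.
move=> h; have h' y : exists x, f x == y by have [x <-] := h y; exists x.
apply: (leq_card (fun y => xchoose (h' y))) => y1 y2 e.
by rewrite -(eqP (xchooseP (h' y1))) e (eqP (xchooseP (h' y2))).
Qed.

Section Packedness.
Variable X : fcomplex.

Lemma packed_image (Y Y' : complex) (phi : cmap Y X) (phi' : cmap Y' X)
    (f : over_map phi phi') S :
  (exists psi : over_map (packet_map (mf phi S)) phi,
    forall j : 'I_(cell2_exponent (mf phi S)), j = 0 :> nat -> pf psi j = S) ->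
  exists psi : over_map (packet_map (mf phi' (pf f S))) phi',
    forall j : 'I_(cell2_exponent (mf phi' (pf f S))),
      j = 0 :> nat -> pf psi j = pf f S.
Proof.
rewrite pf_over => -[psi h]; exists (over_comp f psi) => j /h /= ->.
by [].
Qed.

(** The copy number [S] is the image of the one number 0 by the deck transformation [S]. *)
Lemma packed_packet (R : cell2 X) : packed (packet_map R).
Proof.
move=> S; exists (deck S) => j j0; apply: val_inj => /=.
by rewrite j0 add0n modn_small.
Qed.

End Packedness.

Section Potential.
Variable X : wcomplex.
Implicit Types Y : complex_over X.

Definition max_bd : nat := \max_(R : fcell2 X) size (bd (c := X) R).

Lemma leq_max_bd (R : cell2 X) : size (bd R) <= max_bd.
Proof. by rewrite /max_bd; apply: (leq_bigmax (R : fcell2 X)). Qed.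

(** A fold lowers the number of 1-cells without raising the perimeter; an
attachment may add [max_bd] 1-cells, which one unit of perimeter pays for. *)
Definition potential Y : nat :=
  max_bd.+1 * perimeter Y + #|fcell1 (dom Y)|.

Lemma fold_potential Y Y' : is_fold Y Y' -> potential Y' < potential Y.
Proof.
case=> a [b [p [[hab nab mab] [_ [surj qo] _]]]].
have s1 (e' : fcell1 (dom Y')) : exists e : fcell1 (dom Y), (po p (e, false)).1 == e'.
  by have [o ho] := surj ((e', false) : oedge (dom Y')); exists o.1; rewrite -po_fst ho.
pose g e' := xchoose (s1 e').
have gK e' : (po p (g e', false)).1 = e' by apply/eqP/(xchooseP (s1 e')).
have g_inj : injective g by move=> x y e; rewrite -(gK x) e gK.
have eab : po p (oinv a) = po p b by apply/qo/rst_step; left.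
have lt : #|fcell1 (dom Y')| < #|fcell1 (dom Y)|.
  rewrite ltn_neqAle (leq_card _ g_inj) andbT; apply/eqP => e.
  have ss : forall y, exists x, g x = y.
    move=> y; have /codomP[x ->] := inj_card_onto g_inj (eq_leq (esym e)) y.
    by exists x.
  have [x hx] := ss a.1; have [y hy] := ss b.1; apply: nab.
  rewrite -hx -hy; congr g; rewrite -(gK x) -(gK y) hx hy -!po_fst -eab po_inv.
  by [].
rewrite /potential -addnS leq_add // leq_mul2l /perimeter /=.
apply: (@leq_trans (\sum_(y' : fcell1 (dom Y'))
    sides_weight (me Y (g y')).1 (fun R i => ~~ side_present Y (g y') R i))).
  apply: leq_sum => y' _; rewrite -{1 2}(gK y') me_po.
  apply: sides_weight_mono => R i; apply: contra => h.
  by exact: (side_present_po p h).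
rewrite -(big_imset (fun y => sides_weight (me Y y).1 (fun R i => ~~ side_present Y y R i)) (in2W g_inj)) /=.
by rewrite [X in _ <= X](bigID [pred x in [set g x | x in predT]]) /= leq_addr.
Qed.

Section Attach.
Variables (Y Y' : complex_over X) (R : cell2 X) (i : 'I_(size (bd R))).
Variables (v : vert (dom Y)) (q : seq (oedge (dom Y))).
Variables (f : over_map Y Y') (g : over_map (packet_map R) Y').
Hypothesis qo : is_quotient (glue_edge q (arc i (size q))) (sum_fun (po f) (po g)).

Lemma onth_arc l k : k < l -> l <= size (bd R) -> onth (arc i l) k = Some (circ R (i + k)).
Proof.
move=> kl h; rewrite (onth_nth (circ R 0)) ?size_arc // arcE //.
by rewrite (nth_map 0) ?size_iota // nth_iota.
Qed.

Lemma glue_po o m : size q <= size (bd R) -> m < size q ->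
  po f (nth o q m) = po g (circ R (i + m)).
Proof.
move=> hl h; case: qo => _ hq; apply: (proj2 (hq (inl _) (inr _))); apply: rst_step.
by apply: (GlueEdge (k := m)); rewrite ?(onth_nth o) ?onth_arc.
Qed.
End Attach.

Lemma attachment_potential Y Y' : packed Y -> is_attachment Y Y' -> potential Y' < potential Y.
Proof.
move=> pk [im [R [i [v [q [mx [f [g [qv qo _]]]]]]]]].
have hl : size q <= size (bd R) by case: (mx) => -[/site_size].
have hP : perimeter Y' < perimeter Y.
  apply: (attachment_perimeter pk im mx (f := f) (g := g)); first by case: qo.
  by move=> o m hm; apply: glue_po.
have hE : #|fcell1 (dom Y')| <= #|fcell1 (dom Y)| + size (bd R).
  have := @leq_card_surj (((fcell1 (dom Y) * bool) + ('I_(size (bd R)) * bool))%type)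
    (fcell1 (dom Y') * bool)%type _ (proj1 qo).
  by rewrite card_sum !card_prod card_bool card_ord -mulnDl leq_mul2r.
rewrite /potential -addnS; apply: (@leq_trans (max_bd.+1 * (perimeter Y').+1 + #|fcell1 (dom Y)|)); last first.
  by rewrite leq_add2r leq_mul2l hP orbT.
rewrite mulnS -[X in _ <= X]addnA [X in _ <= X]addnCA leq_add2l addSn ltnS.
by apply: (leq_trans hE); rewrite addnC leq_add2r leq_max_bd.
Qed.

Lemma fold_packed Y Y' : packed Y -> is_fold Y Y' -> packed Y'.
Proof.
move=> pk [a [b [p [_ [_ _ [sf _]]]]]] S'; have [S <-] := sf S'.
exact: packed_image (pk S).
Qed.

Lemma attachment_packed Y Y' : packed Y -> is_attachment Y Y' -> packed Y'.
Proof.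
move=> pk [_ [R [i [v [q [_ [f [g [_ _ [sf _]]]]]]]]]] S'.
have [[S <-|S <-]] := sf S' => /=; first exact: packed_image (pk S).
exact: packed_image (packed_packet S).
Qed.

Lemma step_packed Y Y' : packed Y -> alg_step Y Y' -> packed Y'.
Proof. by move=> pk []; [apply: fold_packed|apply: attachment_packed]. Qed.

Lemma step_potential Y Y' : packed Y -> alg_step Y Y' -> potential Y' < potential Y.
Proof. by move=> pk []; [apply: fold_potential|apply: attachment_potential]. Qed.

Lemma run_potential n Y Y' : packed Y -> run n Y Y' ->
  packed Y' /\ n + potential Y' <= potential Y.
Proof.
move=> pk; elim: n Y' => [Y' <- //|n IH Y' [Y2 [/IH[pk2 h] st]]].
split; first exact: step_packed st.
apply: leq_trans h; rewrite addSnnS leq_add2l; exact: step_potential.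
Qed.

(** The exponent of a 2-cell, which is the number of 2-cells of its packet, is at
most the length of its boundary. *)
Lemma step_cells Y Y' : alg_step Y Y' ->
  #|fvert (dom Y')| <= #|fvert (dom Y)| + max_bd /\
  #|fcell2 (dom Y')| <= #|fcell2 (dom Y)| + max_bd.
Proof.
case=> [[a [b [p [_ [[sv _] _ [sf _]]]]]]|[_ [R [i [v [q [_ [f [g [[sv _] _ [sf _]]]]]]]]]]].
  by split; apply: leq_trans (leq_addr _ _); [apply: leq_card_surj sv|apply: leq_card_surj sf].
split.
  have := leq_card_surj (A := (fvert (dom Y) + 'I_(size (bd R)))%type) sv.
  rewrite card_sum card_ord => /leq_trans; apply; rewrite leq_add2l; exact: leq_max_bd.
have := leq_card_surj (A := (fcell2 (dom Y) + 'I_(cell2_exponent R))%type) sf.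
rewrite card_sum card_ord => /leq_trans; apply; rewrite leq_add2l.
apply: leq_trans (leq_max_bd R); rewrite -exponent_mul_root leq_pmulr //.
exact: root_length_gt0.
Qed.

Lemma run_cells n Y Y' : run n Y Y' ->
  #|fvert (dom Y')| <= #|fvert (dom Y)| + n * max_bd /\
  #|fcell2 (dom Y')| <= #|fcell2 (dom Y)| + n * max_bd.
Proof.
elim: n Y' => [Y' <-|n IH Y' [Y2 [/IH[h1 h2] /step_cells[h3 h4]]]].
  by rewrite mul0n !addn0.
by rewrite mulSnr !addnA; split; [apply: leq_trans h3 _|apply: leq_trans h4 _]; rewrite leq_add2r.
Qed.

End Potential.

(** * Subgroups carried by the complexes of a run *)

(** A common setting for folds and attachments: [Y'] is covered by vertices
[Tv] and oriented 1-cells [To]; every vertex [x] has an anchor in [Y] and a path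
[c x] of [X] joining the image of its anchor to its own image. *)
Section Anchors.
Variables (X Y Y' : complex) (phi : cmap Y X) (phi' : cmap Y' X).
Variables (Tv To : Type) (Fv : Tv -> vert Y') (Fo : To -> oedge Y').
Variables (anc : Tv -> vert Y) (c : Tv -> seq (oedge X)).
Hypothesis c_path : forall x, is_path (mv phi (anc x)) (c x) (mv phi' (Fv x)).

Definition carried (x y : Tv) (s : seq (oedge X)) : Prop :=
  exists2 p, is_path (anc x) p (anc y) &
    homotopic (mv phi (anc x)) (mv phi (anc y)) (map (mo phi) p)
      (c x ++ s ++ inv_path (c y)).

Lemma carried_refl x : carried x x [::].
Proof. by exists [::] => //=; apply: hom_sym; apply: hom_invr. Qed.

Lemma carried_inv x y s : carried x y s -> carried y x (inv_path s).
Proof.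
case=> p hp h; exists (inv_path p); first exact: is_path_inv.
by have := hom_inv h; rewrite map_mo_inv !inv_path_cat inv_pathK catA.
Qed.

Lemma carried_cat x y z s t : carried x y s -> carried y z t -> carried x z (s ++ t).
Proof.
case=> p hp h [p' hp' h']; exists (p ++ p'); first exact: is_path_cat hp hp'.
rewrite map_cat; apply: hom_trans (hom_cat h h') _.
have [_ e] := homotopic_paths h; have [_ e'] := homotopic_paths h'.
have [a ha /is_path_catP[b hb hb']] := is_path_catP e.
have [a' ha' hc'] := is_path_catP e'.
have ea := is_path_det2 ha (c_path x); have ea' := is_path_det2 ha' (c_path y).
have eb : b = mv phi' (Fv y).
  have := is_path_inv hb'; rewrite inv_pathK => h1; exact: is_path_det2 h1 (c_path y).
subst a a' b; rewrite -!catA; apply: (hom_catl ha); apply: (hom_catl hb).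
by rewrite catA; apply: (@hom_catr _ _ _ _ _ [::] _ (hom_invl (c_path y))).
Qed.

Lemma carried_clos (rel : Tv -> Tv -> Prop) :
  (forall x y, rel x y -> carried x y [::]) ->
  forall x y, clos_refl_sym_trans _ rel x y -> carried x y [::].
Proof.
move=> h x y; elim=> {x y} [x y /h//|x|x y _|x y z _ h1 _ h2].
- exact: carried_refl.
- by move/carried_inv.
- exact: (carried_cat h1 h2).
Qed.

Variables (so to : To -> Tv).
Hypothesis Fo_src : forall o, osrc (Fo o) = Fv (so o).
Hypothesis Fo_tgt : forall o, otgt (Fo o) = Fv (to o).
Hypothesis Fo_surj : forall o', exists o, Fo o = o'.
Hypothesis same : forall x y, Fv x = Fv y -> carried x y [::].
Hypothesis cell : forall o, carried (so o) (to o) [:: mo phi' (Fo o)].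

Lemma carried_path x y p' : is_path (Fv x) p' (Fv y) -> carried x y (map (mo phi') p').
Proof.
elim: p' x => [x /same//|o' p' IH x]; have [o <-] := Fo_surj o'.
rewrite /= Fo_src Fo_tgt => -[/esym/same h /IH h'].
have := carried_cat h (carried_cat (cell o) h'); exact.
Qed.
End Anchors.

(** Over such a map, [Y'] is connected if [Y] is, and both carry the same subgroup
of the fundamental group of [X]. *)
Definition loops_lift (X : complex) (Y Y' : complex) (phi : cmap Y X) (phi' : cmap Y' X)
    (f : over_map phi phi') : Prop :=
  (forall x', exists u p, is_path (pv f u) p x') /\
  (forall u w p', is_path (pv f u) p' (pv f w) ->
     exists2 p, is_path u p w &
       homotopic (mv phi u) (mv phi w) (map (mo phi) p) (map (mo phi') p')).

Section StepLifts.
Variable X : wcomplex.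
Implicit Types Y : complex_over X.

(** The endpoints that are identified are joined in [Y] by a path whose image is a
backtrack. *)
Lemma fold_loops_lift Y Y' : is_fold Y Y' -> exists f : over_map Y Y', loops_lift f.
Proof.
case=> a [b [f [[hab nab mab] [[sv qv] [so _] _]]]]; exists f; split.
  by move=> x'; have [u <-] := sv x'; exists u, [::].
move=> u w p' hp'.
have cp x : is_path (mv Y x) [::] (mv Y' (pv f x)) by rewrite pv_over.
have [|||x y h|o|p hp h] := @carried_path _ _ _ Y Y' _ _ (pv f) (po f) id (fun=> [::]) cp
  (@osrc _) (@otgt _) _ _ _ _ _ u w p' hp'.
- by move=> o; rewrite po_src.
- by move=> o; rewrite po_tgt.
- exact: so.
- apply: (carried_clos cp _ (proj1 (qv _ _) h)) => x1 y1 [].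
  exists [:: a; b] => //=.
  rewrite mab; apply: (@hom_backtrack _ _ _ [::] (mo Y a) [::]).
  rewrite -mab; have := @is_path_mo _ _ Y [:: a; b] (osrc a) (otgt b); by apply.
- exists [:: o] => //=; rewrite po_over; apply: hom_refl.
  have := @is_path_mo _ _ Y [:: o] (osrc o) (otgt o); by apply.
by exists p; rewrite // cats0 in h *.
Qed.

Section Attach.
Variables (Y Y' : complex_over X) (R : cell2 X) (i : 'I_(size (bd R))).
Variables (v : vert (dom Y)) (q : seq (oedge (dom Y))).
Hypothesis site : attachment_site Y i v q.
Variables (f : over_map Y Y') (g : over_map (packet_map R) Y').
Hypothesis qv : is_quotient (glue_vert (H := packet R) v q i (arc i (size q)))
  (sum_fun (pv f) (pv g)).
Hypothesis qo : is_quotient (glue_edge q (arc i (size q))) (sum_fun (po f) (po g)).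
Notation L := (size (bd R)).

Let A (d : nat) : seq (oedge X) := [seq bd_at R (i + m) | m <- iota 0 d].
Let dist (k : nat) : nat := (k + (L - i)) %% L.
Let x0 : vert X := mv Y v.

Let distK k : cyc R (i + dist k) = cyc R k.
Proof.
by apply/cyc_modP; rewrite modnDmr addnCA subnKC ?modnDr // ltnW.
Qed.

Let dist_add d : dist (i + d) = d %% L.
Proof. by rewrite /dist addnAC subnKC ?modnDl // ltnW. Qed.

Let dist_mod k : dist (k %% L) = dist k.
Proof. by rewrite /dist modnDml. Qed.

Let AS d : A d.+1 = rcons (A d) (bd_at R (i + d)).
Proof. by rewrite /A -addn1 iotaD map_cat cats1. Qed.

Let A_path d : is_path x0 (A d) (osrc (bd_at R (i + d))).
Proof.
elim: d => [|d IH]; first by rewrite /= addn0 /x0; case: site => _ -> _ _; rewrite /bd_at cyc_ord.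
by rewrite AS is_path_rcons addnS otgt_bd_at.
Qed.

(** Going around the 2-cell is trivial in [X], so that the anchor paths along the
arc do not depend on the number of turns. *)
Let A_full : homotopic x0 x0 (A L) [::].
Proof.
have hp := A_path L; have e : osrc (bd_at R (i + L)) = x0.
  by rewrite -bd_at_mod modnDr bd_at_mod -(addn0 i); have := A_path 0.
rewrite e in hp; apply: (@hom_turn _ _ (L - i) false _ R hp).
rewrite /turn; have -> : A L = rot i (bd R).
  rewrite /A -(map_mo_arc i (leqnn L)) /arc take_oversize ?size_rot ?size_circle //.
  rewrite map_rot; congr rot; rewrite circle_iota -map_comp [RHS]bd_iota; exact: eq_map.
have := rotK i (bd R); rewrite /rotr size_rot; exact.
Qed.

Let A_mod d : d <= L -> homotopic x0 (osrc (bd_at R (i + d))) (A d) (A (d %% L)).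
Proof.
rewrite leq_eqVlt => /orP[/eqP->|h]; last first.
  by rewrite modn_small //; apply: hom_refl.
rewrite modnn -bd_at_mod modnDr bd_at_mod; have := A_path 0; rewrite addn0 /= => <-.
exact: A_full.
Qed.

Let anc (x : vert (dom Y) + vert (packet R)) := if x is inl u then u else v.
Let c (x : vert (dom Y) + vert (packet R)) := if x is inr k then A (dist (k : 'I_L)) else [::].
Let Fv : vert (dom Y) + vert (packet R) -> vert (dom Y') := sum_fun (pv f) (pv g).
Let Fo : oedge (dom Y) + oedge (packet R) -> oedge (dom Y') := sum_fun (po f) (po g).
Let so (o : oedge (dom Y) + oedge (packet R)) : vert (dom Y) + vert (packet R) :=
  match o with inl o => inl (osrc o) | inr o => inr (osrc o) end.
Let to (o : oedge (dom Y) + oedge (packet R)) : vert (dom Y) + vert (packet R) :=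
  match o with inl o => inl (otgt o) | inr o => inr (otgt o) end.

Let c_path x : is_path (mv Y (anc x)) (c x) (mv Y' (Fv x)).
Proof.
case: x => [u|k] /=; first by rewrite pv_over.
rewrite pv_over -/x0 -[X in mv _ X](cyc_ord (k : 'I_L)) -distK mv_cyc; exact: A_path.
Qed.

Let carried_circ d : d < L ->
  carried Y anc c (inr (cyc R (i + d))) (inr (cyc R (i + d.+1))) [:: bd_at R (i + d)].
Proof.
move=> h; exists [::] => //=; rewrite !dist_mod !dist_add (modn_small h).
rewrite -cat1s catA cats1 -AS -/x0; apply: hom_sym.
have := A_mod h; rewrite -(addn1 d) addnA addn1 -otgt_bd_at => hA.
apply: hom_trans (hom_catr hA (is_path_inv _)) (hom_invr _).
  have [_] := homotopic_paths hA; rewrite addn1; exact.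
by have [_] := homotopic_paths hA; rewrite addn1; exact.
Qed.

(** A vertex of the packet is anchored at [v] by the arc leading to it from [i]. *)
Lemma attach_loops_lift : loops_lift f.
Proof.
have hl := site_size site; case: (site) => -[w hw] _ lab _.
have gl : Fv (inl v) = Fv (inr i) by apply/(proj2 qv)/rst_step; left.
split=> [x'|u1 u2 p' hp'].
  have [[u|k] <-] := proj1 qv x'; first by exists u, [::].
  exists v, (map (po g) (arc i (dist (k : 'I_L)))).
  have hd : dist (k : 'I_L) <= L by rewrite ltnW // ltn_mod bd_size_gt0.
  rewrite -[pv f v]/(Fv (inl v)) gl /=; have := is_path_po g (is_path_arc i hd).
  by rewrite distK cyc_ord.
have [|||x y h|o|p hp h] := @carried_path _ _ _ Y Y' _ _ Fv Fo anc c c_path so to _ _ _ _ _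
  (inl u1) (inl u2) p' hp'.
- by case=> o; [exact: (po_src f)|exact: (po_src g)].
- by case=> o; [exact: (po_tgt f)|exact: (po_tgt g)].
- exact: (proj1 qo).
- apply: (carried_clos c_path _ (proj1 ((proj2 qv) _ _) h)) => x1 y1 [|k a b ha hb].
    exists [::] => //=; rewrite /dist subnKC ?modnn ?(ltnW (ltn_ord i)) //=.
    exact: hom_refl.
  have [hk ea] := onth_Some a ha.
  have hkL := leq_trans hk hl.
  rewrite onth_arc // in hb; case: hb => <-.
  have pt : is_path v (take k.+1 q) (otgt a).
    move: hw; rewrite -{1}(cat_take_drop k.+1 q) => /is_path_catP[z hz _].
    rewrite (take_nth a) // ea in hz *; apply/is_path_rcons.
    by case/is_path_rcons: hz.
  exists (inv_path (take k.+1 q)); first exact: is_path_inv.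
  rewrite map_mo_inv otgt_circ /= dist_mod -addnS dist_add.
  have e : map (mo Y) (take k.+1 q) = A k.+1.
    by rewrite map_take (site_labels site) -map_take take_iota (minn_idPl hk).
  rewrite e; apply: hom_inv; have := @is_path_mo _ _ Y _ _ _ pt; rewrite e => h1.
  by have h2 := A_mod hkL; have [h3 _] := homotopic_paths h2; rewrite -/x0 (is_path_det2 h1 h3).
- case: o => o.
    exists [:: o] => //=; rewrite po_over; apply: hom_refl.
    have := @is_path_mo _ _ Y [:: o] (osrc o) (otgt o); by apply.
  have [k [kL ek]] := oedge_packet o.
  have hc : carried Y anc c (so (inr (circ R k))) (to (inr (circ R k)))
      [:: mo Y' (Fo (inr (circ R k)))].
    rewrite /= po_over osrc_circ otgt_circ mo_circ.
    have hd : dist k < L by rewrite ltn_mod bd_size_gt0.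
    have := carried_circ hd; rewrite distK.
    have -> : cyc R (i + (dist k).+1) = cyc R k.+1.
      by apply/cyc_modP; rewrite addnS -addn1 -modnDml; move/cyc_modP: (distK k) => ->; rewrite modnDml addn1.
    have -> : bd_at R (i + dist k) = bd_at R k by rewrite /bd_at distK.
    by [].
  case: ek => -> //; have := carried_inv hc.
  by rewrite /= otgt_inv po_inv mo_inv.
by exists p; rewrite // cats0 in h *.
Qed.

End Attach.

Lemma step_loops_lift Y Y' : alg_step Y Y' -> exists f : over_map Y Y', loops_lift f.
Proof.
case=> [/fold_loops_lift//|[_ [R [i [v [q [[[site _] _] [f [g [qv qo _]]]]]]]]]].
by exists f; apply: (attach_loops_lift site qv qo).
Qed.

Lemma loops_lift_comp (Y1 Y2 Y3 : complex_over X) (f : over_map Y1 Y2) (g : over_map Y2 Y3) :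
  loops_lift f -> loops_lift g -> loops_lift (over_comp g f).
Proof.
move=> [f1 f2] [g1 g2]; split=> [x'|u w p' hp'].
  have [u [p hp]] := g1 x'; have [u' [p' hp']] := f1 u.
  exists u', (map (po g) p' ++ p); exact: is_path_cat (is_path_po g hp') hp.
have [p hp h] := g2 _ _ _ hp'; have [p1 hp1 h1] := f2 _ _ _ hp.
by exists p1 => //; rewrite !pv_over in h; apply: hom_trans h1 h.
Qed.

Lemma run_loops_lift n Y Y' : run n Y Y' -> exists f : over_map Y Y', loops_lift f.
Proof.
elim: n Y' => [Y' <-|n IH Y' [Y2 [/IH[f hf] /step_loops_lift[g hg]]]].
  exists (over_id Y); split=> [x'|u w p' hp']; first by exists x', [::].
  by exists p' => //; apply: hom_refl; apply: is_path_mo.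
by exists (over_comp g f); apply: loops_lift_comp.
Qed.

End StepLifts.

(** * From the bouquet to the complexes of a run *)

Lemma connected_lift (X Y Y' : complex) (phi : cmap Y X) (phi' : cmap Y' X)
    (f : over_map phi phi') : connected Y -> loops_lift f -> connected Y'.
Proof.
move=> cY [h _] x y; have [u [p hp]] := h x; have [w [p' hp']] := h y.
have [p2 hp2] := cY u w; exists (inv_path p ++ map (po f) p2 ++ p').
exact: is_path_cat (is_path_inv hp) (is_path_cat (is_path_po f hp2) hp').
Qed.

Section EvalWord.
Variables (X : complex) (x0 : vert X) (k : nat) (g : 'I_k -> seq (oedge X)).
Hypothesis g_path : forall i, is_path x0 (g i) x0.

Definition inv_word (w : word k) : word k := rev [seq (a.1, ~~ a.2) | a <- w].

Lemma eval_word_cat w w' : eval_word g (w ++ w') = eval_word g w ++ eval_word g w'.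
Proof. by rewrite /eval_word map_cat flatten_cat. Qed.

Lemma eval_word1 a : eval_word g [:: a] = if a.2 then inv_path (g a.1) else g a.1.
Proof. by rewrite /eval_word /= cats0. Qed.

Lemma eval_word_path w : is_path x0 (eval_word g w) x0.
Proof.
elim: w => // a w IH; rewrite -cat1s eval_word_cat eval_word1.
by apply: is_path_cat IH; case: a.2; [apply: is_path_inv|].
Qed.

Lemma eval_inv_word w : eval_word g (inv_word w) = inv_path (eval_word g w).
Proof.
elim: w => // a w IH; rewrite -[in RHS]cat1s eval_word_cat inv_path_cat -IH.
rewrite /inv_word /= rev_cons -cats1 eval_word_cat !eval_word1 /=; congr (_ ++ _).
by case: a.2; rewrite /= ?inv_pathK.
Qed.

End EvalWord.

Section BouquetFacts.
Variables (X : complex) (x0 : vert X) (r : nat) (gen : 'I_r -> loop x0).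
Notation Y1 := (bouquet gen).

Definition bq_edge (i : 'I_r) (k : 'I_(size (gen i))) : oedge (dom Y1) :=
  (Tagged (fun i => 'I_(size (gen i))) k : cell1 (dom Y1), false).

Definition bq_path (i : 'I_r) (m : nat) : seq (oedge (dom Y1)) :=
  [seq bq_edge k | k <- take m (enum 'I_(size (gen i)))].

Definition bq_end (i : 'I_r) (m : nat) : vert (dom Y1) :=
  if m is k.+1 then bq_at gen i k else None.

Lemma is_path_bq_path i m : m <= size (gen i) ->
  is_path (None : vert (dom Y1)) (bq_path i m) (bq_end i m).
Proof.
elim: m => [|m IH] h; first by rewrite /bq_path take0.
rewrite /bq_path (take_nth (Ordinal h)) ?size_enum_ord // map_rcons.
have -> : nth (Ordinal h) (enum 'I_(size (gen i))) m = Ordinal h.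
  by apply: val_inj; rewrite /= nth_enum_ord.
apply/is_path_rcons; split; last by [].
have -> : osrc (bq_edge (Ordinal h)) = bq_end i m by case: (m) h.
exact: IH (ltnW h).
Qed.

Lemma map_mo_bq_path i m : map (mo Y1) (bq_path i m) = take m (gen i).
Proof.
rewrite /bq_path -map_comp map_take; congr take.
by rewrite -[RHS](map_tnth_enum (in_tuple (gen i))); apply: eq_map.
Qed.

Lemma bq_at_last i k : (size (gen i)).-1 <= k -> bq_at gen i k = None.
Proof. by rewrite /bq_at => h; rewrite insubF // ltnNge h. Qed.

Lemma gen_size_gt0 i : 0 < size (gen i).
Proof. by have := @lpath_neq0 _ _ (gen i); case: (lpath _). Qed.

Lemma bouquet_gen j : exists2 p, is_path (None : vert (dom Y1)) p None &
  map (mo Y1) p = gen j.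
Proof.
exists (bq_path j (size (gen j))); last by rewrite map_mo_bq_path take_size.
have := is_path_bq_path (leqnn (size (gen j))).
by case E: (size (gen j)) (gen_size_gt0 j) => [//|k] _; rewrite /= bq_at_last ?E.
Qed.

Definition bq_anchor (x : vert (dom Y1)) : seq (oedge X) :=
  if x is Some w then take (tagged w).+1 (gen (tag w)) else [::].

Lemma bq_anchor_end i m : m < size (gen i) -> bq_anchor (bq_end i m) = take m (gen i).
Proof.
case: m => [|m] h; first by rewrite take0.
rewrite /bq_end /bq_at; case: insubP => [k _ /= -> //|].
by rewrite -(ltn_predK (gen_size_gt0 i)) ltnS in h; rewrite h.
Qed.

Lemma vert_bouquet (x : vert (dom Y1)) : exists2 p, is_path (None : vert (dom Y1)) p x &
  map (mo Y1) p = bq_anchor x.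
Proof.
case: x => [[i k]|]; last by exists [::].
exists (bq_path i k.+1); last by rewrite map_mo_bq_path.
have := @is_path_bq_path i k.+1; rewrite /= /bq_at valK /=; apply.
exact: leq_trans (ltn_ord k) (leq_pred _).
Qed.

Lemma bouquet_connected : connected (dom Y1).
Proof.
move=> x y; have [p hp _] := vert_bouquet x; have [p' hp' _] := vert_bouquet y.
by exists (inv_path p ++ p'); apply: is_path_cat hp'; apply: is_path_inv.
Qed.

Let anchor_path x : is_path x0 (bq_anchor x) (mv Y1 x).
Proof. by have [p hp <-] := vert_bouquet x; apply: (is_path_mo Y1 hp). Qed.

Let eval_path (w : word r) : is_path x0 (eval_word gen w) x0.
Proof. by apply: eval_word_path => i; apply: lpath_closed. Qed.

(** Along a circle the anchor paths grow with the 1-cells, except at its last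
1-cell, where a generator is completed. *)
Lemma bouquet_edge_word (o : oedge (dom Y1)) : exists w : word r,
  homotopic x0 (mv Y1 (otgt o)) (bq_anchor (osrc o) ++ [:: mo Y1 o])
    (eval_word gen w ++ bq_anchor (otgt o)).
Proof.
have pos (e : cell1 (dom Y1)) : exists w : word r,
    homotopic x0 (mv Y1 (tgt e)) (bq_anchor (src e) ++ [:: me Y1 e])
      (eval_word gen w ++ bq_anchor (tgt e)).
  have hp : is_path x0 (bq_anchor (src e) ++ [:: me Y1 e]) (mv Y1 (tgt e)).
    apply: is_path_cat (anchor_path _) _; split; first exact: me_src.
    exact: (me_tgt Y1 e).
  suff [w e'] : exists w : word r, bq_anchor (src e) ++ [:: me Y1 e] =
      eval_word gen w ++ bq_anchor (tgt e).
    by exists w; rewrite -e'; apply: hom_refl.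
  case: e {hp} => i k; have hk := ltn_ord k.
  have -> : src (existT (fun i => 'I_(size (gen i))) i k : cell1 (dom Y1)) = bq_end i k.
    by case: k {hk} => -[|k] hk.
  have -> : tgt (existT (fun i => 'I_(size (gen i))) i k : cell1 (dom Y1)) = bq_end i k.+1.
    by [].
  rewrite bq_anchor_end // cats1.
  have o' := tnth (in_tuple (gen i)) k.
  have -> : rcons (take k (gen i))
      (me Y1 (existT (fun i => 'I_(size (gen i))) i k : cell1 (dom Y1))) = take k.+1 (gen i).
    by rewrite (take_nth o') //= /bq_me (tnth_nth o').
  have [h|h] := ltnP k.+1 (size (gen i)).
    by exists [::]; rewrite bq_anchor_end.
  exists [:: (i, false)]; rewrite eval_word1 /= take_oversize // bq_at_last ?cats0 //.
  by rewrite -ltnS prednK // gen_size_gt0.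
case: o => e [] /=; last exact: pos.
have [w h] := pos e; exists (inv_word w).
rewrite /osrc /otgt /osrc /= eval_inv_word.
have hw := eval_path w; have ht := anchor_path (tgt e).
have hs := anchor_path (src e).
have ho : is_path (mv Y1 (src e)) [:: me Y1 e] (mv Y1 (tgt e)).
  by split; [exact: me_src|exact: (me_tgt Y1 e)].
apply: (@hom_cancell _ _ _ _ _ _ _ hw).
- apply: is_path_cat ht _; have := is_path_inv ho; exact.
- exact: is_path_cat (is_path_inv hw) hs.
have e1 := hom_catr (hom_sym h) (is_path_inv ho).
rewrite -!catA in e1; apply: hom_trans e1 _.
have e2 := hom_catl hs (hom_invr ho); rewrite cats0 in e2.
apply: hom_trans e2 _; rewrite catA; apply: hom_sym.
exact: (@hom_catr _ _ _ _ _ [::] _ (hom_invr hw) hs).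
Qed.

Lemma bouquet_path_word x p y : is_path x p y -> exists w : word r,
  homotopic x0 (mv Y1 y) (bq_anchor x ++ map (mo Y1) p) (eval_word gen w ++ bq_anchor y).
Proof.
elim: p x => [x ->|o p IH x [<- hp]].
  by exists [::]; rewrite /= cats0; apply: hom_refl.
have [w h] := bouquet_edge_word o; have [w' h'] := IH _ hp.
exists (w ++ w'); rewrite eval_word_cat /= -cat1s catA.
apply: hom_trans (hom_catr h (is_path_mo Y1 hp)) _.
rewrite -!catA; exact: hom_catl (eval_path w) h'.
Qed.

Lemma bouquet_loop_word p : is_path (None : vert (dom Y1)) p None ->
  exists w : word r, homotopic x0 x0 (map (mo Y1) p) (eval_word gen w).
Proof. by move/bouquet_path_word=> [w]; rewrite /= cats0; exists w. Qed.

End BouquetFacts.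

Section Reachable.
Variables (X : wcomplex) (x0 : vert X) (r : nat) (gen : 'I_r -> loop x0).
Notation Y1 := (bouquet gen).
Notation n1 := #|fcell1 (dom Y1)|.

Lemma bouquet_packed : packed Y1.
Proof. by case. Qed.

Lemma reachable_packed Y : reachable Y1 Y -> packed Y.
Proof. by case=> n /(run_potential bouquet_packed)[]. Qed.

Lemma reachable_connected Y : reachable Y1 Y -> connected (dom Y).
Proof.
case=> n /run_loops_lift[f hf]; exact: connected_lift (bouquet_connected (gen := gen)) hf.
Qed.

(** Both inclusions hold for the bouquet and are transported along the run. *)
Lemma reachable_subgroup Y : reachable Y1 Y -> exists b : vert (dom Y),
  [/\ mv Y b = x0,
      forall p, is_path b p b -> exists w : word r,
        homotopic x0 x0 (map (mo Y) p) (eval_word gen w)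
    & forall j, exists2 p, is_path b p b & map (mo Y) p = gen j].
Proof.
case=> n /run_loops_lift[f [_ hf]]; exists (pv f None); rewrite pv_over; split=> // [p hp|j].
  have [p1 hp1 h1] := hf _ _ _ hp; have [w h2] := bouquet_loop_word hp1.
  by exists w; apply: hom_trans (hom_sym h1) h2.
have [p hp <-] := bouquet_gen gen j; exists (map (po f) p); last by rewrite map_mo_po.
exact: is_path_po hp.
Qed.

Definition max_weight : nat := \max_(x : fcell1 X) sides_weight x (fun _ _ => true).
Definition pot_const : nat := max_bd X * max_weight + max_weight + 1.

(** A 1-cell misses at most all sides at its image. *)
Lemma bouquet_potential : potential Y1 <= pot_const * n1.
Proof.
rewrite /potential mulnDl mul1n leq_add2r -mulSnr -mulnA leq_mul2l /=.
rewrite mulnC -sum_nat_const; apply: leq_sum => e _.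
apply: (@leq_trans (sides_weight (me Y1 e).1 (fun _ _ => true))).
  exact: sides_weight_mono.
by rewrite /max_weight; apply: (leq_bigmax ((me Y1 e).1 : fcell1 X)).
Qed.

Lemma bouquet_cells : #|fvert (dom Y1)| <= n1.+1 /\ #|fcell2 (dom Y1)| = 0.
Proof.
split; last by rewrite card_void.
rewrite card_option ltnS.
pose f (w : bq_inner gen) : bq_cell1 gen :=
  Tagged (fun i => 'I_(size (gen i))) (widen_ord (leq_pred _) (tagged w)).
apply: (@leq_card _ _ f) => -[i k] [i' k'] e.
have ei : i = i' := congr1 tag e; subst i'.
by have /eqP := e; rewrite eq_Tagged => /eqP /(congr1 val) /= /val_inj ->.
Qed.

Definition size_const : nat := pot_const * max_bd X + pot_const + 2.

(** The potential bounds the number of 1-cells and the length of the run; a step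
adds at most [max_bd X] vertices and 2-cells. *)
Lemma reachable_bounds Y : 0 < n1 -> reachable Y1 Y ->
  [/\ #|fvert (dom Y)| <= size_const * n1, #|fcell1 (dom Y)| <= size_const * n1
    & #|fcell2 (dom Y)| <= size_const * n1].
Proof.
move=> n0 [n hn]; have [_ hp] := run_potential bouquet_packed hn.
have [hv hf] := run_cells hn; have [hv1 hf1] := bouquet_cells.
have hp1 := leq_trans hp bouquet_potential.
have hn1 : n * max_bd X <= pot_const * max_bd X * n1.
  by rewrite mulnAC leq_mul2r (leq_trans (leq_addr _ _) hp1) orbT.
have -> : size_const * n1 = pot_const * max_bd X * n1 + pot_const * n1 + 2 * n1.
  by rewrite -!mulnDl.
move: hp1 hn1; set a := pot_const * n1; set b := pot_const * max_bd X * n1.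
move=> hp1 hn1; split.
- apply: leq_trans hv _; rewrite addnC -addnA leq_add //.
  by apply: leq_trans hv1 _; rewrite mul2n -addnn -addn1 addnA leq_add // leq_addl.
- apply: leq_trans (leq_addl (n + (max_bd X).+1 * perimeter Y) _) _; rewrite -addnA.
  by apply: leq_trans hp1 _; rewrite addnAC leq_addl.
by apply: leq_trans hf _; rewrite hf1 add0n -addnA (leq_trans hn1) // leq_addr.
Qed.

End Reachable.

(** * A presentation read off a complex *)

Section Forest.
Variable Y : complex.

Fixpoint runs_in (T : cell1 Y -> Prop) (p : seq (oedge Y)) : Prop :=
  if p is o :: p' then T o.1 /\ runs_in T p' else True.

Lemma runs_in_cat T p q : runs_in T p -> runs_in T q -> runs_in T (p ++ q).
Proof. by elim: p => //= o p IH [h /IH h'] /h'. Qed.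

Lemma runs_in_inv T p : runs_in T p -> runs_in T (inv_path p).
Proof.
elim: p => //= o p IH [h /IH h']; rewrite inv_path_cons -cats1.
exact: runs_in_cat.
Qed.

Lemma runs_in_sub (T T' : cell1 Y -> Prop) p :
  (forall e, T e -> T' e) -> runs_in T p -> runs_in T' p.
Proof. by move=> h; elim: p => //= o p IH [/h h' /IH]. Qed.

(** [T] is a forest whose components are the classes of [comp]: the paths [tau]
from the roots run in [T] and are compatible with its 1-cells up to homotopy. *)
Definition forest (C : Type) (comp : vert Y -> C) (T : cell1 Y -> Prop) : Prop :=
  exists (root : vert Y -> vert Y) (tau : vert Y -> seq (oedge Y)),
    [/\ forall x, is_path (root x) (tau x) x,
        forall x y, comp x = comp y -> root x = root y,
        forall x, runs_in T (tau x)
      & forall e, T e -> comp (src e) = comp (tgt e) /\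
          homotopic (root (tgt e)) (tgt e) (tau (tgt e)) (tau (src e) ++ [:: (e, false)])].

Lemma forest0 (C : Type) (comp : vert Y -> C) : injective comp -> forest comp (fun _ => False).
Proof. by move=> inj; exists id, (fun=> [::]). Qed.

Lemma forest_ext (C : Type) (comp comp' : vert Y -> C) (T T' : cell1 Y -> Prop) :
  comp =1 comp' -> (forall e, T e <-> T' e) -> forest comp T -> forest comp' T'.
Proof.
move=> hc hT [root [tau [h1 h2 h3 h4]]]; exists root, tau; split=> //.
- by move=> x y; rewrite -!hc; apply: h2.
- by move=> x; apply: runs_in_sub (h3 x) => e /hT.
- by move=> e /hT/h4; rewrite -!hc.
Qed.

(** The paths of the absorbed component are rerouted through the new 1-cell. *)
Lemma forest_add (C : eqType) (comp : vert Y -> C) (T : cell1 Y -> Prop) (e : cell1 Y) :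
  forest comp T -> comp (src e) != comp (tgt e) ->
  forest (fun x => if comp x == comp (tgt e) then comp (src e) else comp x)
    (fun e' => e' = e \/ T e').
Proof.
move=> [root [tau [hp hr hT hh]]] ne.
pose det := tau (src e) ++ [:: (e, false)] ++ inv_path (tau (tgt e)).
have hdet : is_path (root (src e)) det (root (tgt e)).
  apply: is_path_cat (hp _) _; split=> //; exact: is_path_inv.
exists (fun x => if comp x == comp (tgt e) then root (src e) else root x).
exists (fun x => if comp x == comp (tgt e) then det ++ tau x else tau x); split.
- move=> x; case: eqP => // cx; apply: is_path_cat hdet _; rewrite -(hr _ _ cx); exact: hp.
- move=> x y; case: eqP => cx; case: eqP => cy // h; last exact: hr.
    by apply: hr.
  by apply: hr.
- move=> x; have sub p : runs_in T p -> runs_in (fun e' => e' = e \/ T e') p.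
    by apply: runs_in_sub; right.
  case: eqP => cx; last exact: sub (hT x).
  apply: runs_in_cat (sub _ (hT x)); apply: runs_in_cat (sub _ (hT _)) _.
  by split; [left|apply: sub; apply: runs_in_inv (hT _)].
move=> e' [->|Te'].
  rewrite (negPf ne) eqxx; split=> //.
  rewrite /det -!catA; apply: (hom_catl (hp _)); rewrite catA.
  have h := hom_invl (hp (tgt e)).
  by have := @hom_catl _ (src e) (tgt e) (tgt e) [:: (e, false)] _ _ (conj erefl erefl) h.
have [ec h] := hh _ Te'; rewrite ec; case: eqP => // cx; split=> //.
have hd := hdet; rewrite -(hr _ _ cx) in hd.
by rewrite -catA; apply: hom_catl hd h.
Qed.

End Forest.

Section PresEq.
Variables (k : nat) (rels : seq (word k)).
Implicit Types w u : word k.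

Lemma pres_eq_ctx a c w w' : pres_eq rels w w' -> pres_eq rels (a ++ w ++ c) (a ++ w' ++ c).
Proof.
elim=> {w w'} [w|w w' _|w w' w'' _ h1 _|w x w'|w u w' hu].
- exact: pres_refl.
- exact: pres_sym.
- exact: pres_trans.
- have := pres_cancel rels (a ++ w) x (w' ++ c); rewrite -!catA; exact.
- have := pres_rel (a ++ w) (w' ++ c) hu; rewrite -!catA; exact.
Qed.

Lemma pres_eq_cat w w' u u' : pres_eq rels w w' -> pres_eq rels u u' ->
  pres_eq rels (w ++ u) (w' ++ u').
Proof.
move=> h h'; apply: pres_trans (pres_eq_ctx [::] u h) _.
by have := pres_eq_ctx w' [::] h'; rewrite !cats0.
Qed.

Lemma pres_eq_invr w : pres_eq rels (w ++ inv_word w) [::].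
Proof.
elim: w => [|a w IH]; first exact: pres_refl.
rewrite /inv_word /= rev_cons -/(inv_word w) -cats1.
apply: pres_trans (_ : pres_eq rels [:: a; (a.1, ~~ a.2)] _).
  by have := pres_eq_ctx [:: a] [:: (a.1, ~~ a.2)] IH; rewrite /= -catA.
exact: (pres_cancel rels [::] a [::]).
Qed.

Lemma inv_wordK : involutive (@inv_word k).
Proof.
move=> w; rewrite /inv_word map_rev revK -map_comp -[RHS]map_id.
by apply: eq_map => -[i b] /=; rewrite negbK.
Qed.

Lemma pres_eq_invl w : pres_eq rels (inv_word w ++ w) [::].
Proof. by have := pres_eq_invr (inv_word w); rewrite inv_wordK. Qed.

Lemma pres_eq_inv w : pres_eq rels w [::] -> pres_eq rels (inv_word w) [::].
Proof.
move=> h; apply: pres_trans (pres_eq_invl w).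
by have := pres_eq_cat (pres_refl rels (inv_word w)) h; rewrite cats0; apply: pres_sym.
Qed.

Lemma pres_eq_rot m w : pres_eq rels (rot m w) [::] -> pres_eq rels w [::].
Proof.
rewrite /rot -{3}(cat_take_drop m w); set a := take m w; set b := drop m w => h.
apply: pres_trans (pres_eq_invr a).
have := pres_eq_ctx a (inv_word a) h; rewrite /= -!catA => h1.
apply: pres_trans h1; rewrite catA; apply: pres_sym.
by have := pres_eq_cat (pres_refl rels (a ++ b)) (pres_eq_invr a); rewrite cats0 -!catA.
Qed.

End PresEq.

Lemma turnK (G : graph) k b (p : seq (oedge G)) : exists k' b', turn k' b' (turn k b p) = p.
Proof.
case: b; last first.
  by exists (size (rot k p) - k), false; apply: (rotK k p).
have [j h] := turn_inv k true p; exists (size (rot j p) - j), true.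
by rewrite /turn -/(turn k true p) h; apply: (rotK j p).
Qed.

Section Presentation.
Variables (X : complex) (Y : complex) (phi : cmap Y X) (x0 : vert X).
Hypothesis inj : pi1_injective phi.
Variables (r : nat) (gen : 'I_r -> loop x0) (b : vert Y).
Hypothesis phib : mv phi b = x0.
Hypothesis img : forall p, is_path b p b -> exists w : word r,
  homotopic x0 x0 (map (mo phi) p) (eval_word gen w).
Hypothesis genb : forall j, exists2 p, is_path b p b & map (mo phi) p = gen j.

Variables (root : vert Y) (tau : vert Y -> seq (oedge Y)) (T : cell1 Y -> Prop).
Hypothesis tau_path : forall x, is_path root (tau x) x.
Hypothesis tau_T : forall x, runs_in T (tau x).
Hypothesis tau_hom : forall e, T e ->
  homotopic root (tgt e) (tau (tgt e)) (tau (src e) ++ [:: (e, false)]).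

Variables (k : nat) (num : cell1 Y -> 'I_k) (cell_of : 'I_k -> cell1 Y).
Hypothesis numK : cancel num cell_of.
Hypothesis cell_ofK : cancel cell_of num.
Variable rels : seq (word k).

Definition read_path (p : seq (oedge Y)) : word k := [seq (num o.1, o.2) | o <- p].

Hypothesis rels_tree : forall e, T e -> [:: (num e, false)] \in rels.
Hypothesis rels_cell : forall S, read_path (lift_bd phi S) \in rels.
Hypothesis rels_only : forall u, u \in rels ->
  [\/ u = [::], exists2 e, T e & u = [:: (num e, false)]
    | exists S, u = read_path (lift_bd phi S)].

Let gamma (i : 'I_k) : seq (oedge Y) :=
  inv_path (tau b) ++ tau (src (cell_of i)) ++ [:: (cell_of i, false)] ++
  inv_path (tau (tgt (cell_of i))) ++ tau b.

Lemma gamma_path i : is_path b (gamma i) b.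
Proof.
apply: is_path_cat (is_path_inv (tau_path b)) _; apply: is_path_cat (tau_path _) _.
by split=> //; apply: is_path_cat (is_path_inv (tau_path _)) (tau_path b).
Qed.

Let gword w : is_path b (eval_word gamma w) b := eval_word_path gamma_path w.

Lemma read_inv p : read_path (inv_path p) = inv_word (read_path p).
Proof. by rewrite /read_path /inv_path /inv_word map_rev -!map_comp. Qed.

Lemma pres_edge e c : T e -> pres_eq rels [:: (num e, c)] [::].
Proof.
move=> Te; have h : pres_eq rels [:: (num e, false)] [::].
  exact: (pres_rel [::] [::] (rels_tree Te)).
by case: c => //; exact: (pres_eq_inv h).
Qed.

Lemma pres_tau x : pres_eq rels (read_path (tau x)) [::].
Proof.
have := tau_T x; elim: (tau x) => [_|[e c] s IH [h /IH]]; first exact: pres_refl.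
rewrite /= -cat1s; exact: (pres_eq_cat (u' := [::]) (pres_edge c h)).
Qed.

(** All letters but one come from the tree. *)
Lemma read_gamma i : pres_eq rels (read_path (gamma i)) [:: (i, false)].
Proof.
rewrite /read_path !map_cat -!/(read_path _) !read_inv.
have ti x : pres_eq rels (inv_word (read_path (tau x))) [::].
  by apply: pres_eq_inv; apply: pres_tau.
apply: (pres_eq_cat (w' := [::]) (ti b)); apply: (pres_eq_cat (w' := [::]) (pres_tau _)).
rewrite /= cell_ofK -cat1s -[X in pres_eq _ _ X]cats0; apply: (pres_eq_cat (pres_refl _ _)).
exact: (pres_eq_cat (w' := [::]) (ti _) (pres_tau _)).
Qed.

Lemma read_eval w : pres_eq rels (read_path (eval_word gamma w)) w.
Proof.
elim: w => [|a w IH]; first exact: pres_refl.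
rewrite -cat1s eval_word_cat /read_path map_cat -!/(read_path _).
apply: pres_eq_cat IH; rewrite eval_word1; case: a => i [] /=; last exact: read_gamma.
rewrite read_inv; apply: pres_trans (_ : pres_eq rels
   (inv_word (read_path (gamma i)) ++ [:: (i, false); (i, true)]) _).
  apply: pres_sym; have := pres_cancel rels (inv_word (read_path (gamma i))) (i, false) [::].
  by rewrite cats0.
rewrite -cat1s catA.
apply: (@pres_eq_cat _ _ _ [::] [:: (i, true)] _ _ (pres_refl _ _)).
apply: pres_trans (pres_eq_invl _ (read_path (gamma i))).
apply: (pres_eq_cat (pres_refl _ _)); exact: pres_sym (read_gamma i).
Qed.

(** A backtrack cancels freely, and the boundary of a 2-cell is a relator up to
rotation and inversion. *)
Lemma read_hom u v p q : homotopic u v p q -> pres_eq rels (read_path p) (read_path q).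
Proof.
elim=> {p q} [p _|p q _|p q s _ h1 _|p o q _|p S q _].
- exact: pres_refl.
- exact: pres_sym.
- exact: pres_trans.
- rewrite /read_path !map_cat /=; exact: pres_cancel.
rewrite /read_path !map_cat -!/(read_path _).
have h : pres_eq rels (read_path (bd S)) [::].
  have := pres_rel [::] [::] (rels_cell S); rewrite /= cats0 /lift_bd /turn.
  rewrite /read_path map_rot -/(read_path _) => /pres_eq_rot.
  by case: (mflip phi S) => //; rewrite read_inv => /pres_eq_inv; rewrite inv_wordK.
exact: (pres_eq_ctx _ _ h).
Qed.

Let around (x y : vert Y) (p : seq (oedge Y)) :=
  inv_path (tau b) ++ tau x ++ p ++ inv_path (tau y) ++ tau b.

(** The parts of consecutive generators that run in the tree cancel. *)
Lemma eval_read x y p : is_path x p y ->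
  homotopic b b (eval_word gamma (read_path p)) (around x y p).
Proof.
have hb := tau_path b; have hib := is_path_inv hb.
elim: p x => [x ->|o p IH x [<- hp]].
  rewrite /around /=; apply: hom_sym.
  have h1 := @hom_catr _ _ _ _ _ [::] _ (hom_invr (tau_path y)) hb.
  rewrite -catA in h1; exact: hom_trans (hom_catl hib h1) (hom_invl hb).
have ho : homotopic b b (eval_word gamma [:: (num o.1, o.2)]) (around (osrc o) (otgt o) [:: o]).
  rewrite eval_word1; case: o {hp} => e c /=; case: c => /=; last first.
    by rewrite /gamma numK; apply: hom_refl; have := gamma_path (num e); rewrite /gamma numK.
  have := gamma_path (num e); rewrite /gamma numK => /is_path_inv.
  rewrite !inv_path_cat !inv_pathK -!catA; exact: hom_refl.
rewrite -[read_path (o :: p)]/([:: (num o.1, o.2)] ++ read_path p) eval_word_cat.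
apply: hom_trans (hom_cat ho (IH _ hp)) _.
rewrite /around -!catA; apply: (hom_catl hib); apply: (hom_catl (tau_path _)).
apply: (@hom_catl _ (osrc o) (otgt o) b [:: o]); first by [].
have hr : is_path (otgt o) (p ++ inv_path (tau y) ++ tau b) b.
  exact: is_path_cat hp (is_path_cat (is_path_inv (tau_path y)) hb).
apply: hom_trans (_ : homotopic _ _ (inv_path (tau (otgt o)) ++ tau (otgt o) ++ p ++ inv_path (tau y) ++ tau b) _).
  apply: (hom_catl (is_path_inv (tau_path _))); rewrite catA.
  exact: (@hom_catr _ _ _ _ _ [::] _ (hom_invr hb) (is_path_cat (tau_path _) hr)).
rewrite catA; exact: (@hom_catr _ _ _ _ _ [::] _ (hom_invl (tau_path _)) hr).
Qed.

Lemma around_null x p : is_path x p x -> homotopic x x p [::] ->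
  homotopic b b (around x x p) [::].
Proof.
move=> hp h; have := eval_read (p := [::]) (erefl x); move/hom_sym; rewrite /= => h0.
apply: hom_trans h0; apply: (hom_catl (is_path_inv (tau_path b))).
apply: (hom_catl (tau_path _)); apply: (@hom_catr _ _ _ _ _ [::] _ h).
exact: is_path_cat (is_path_inv (tau_path _)) (tau_path b).
Qed.

Lemma rel_null u : u \in rels -> homotopic b b (eval_word gamma u) [::].
Proof.
case/rels_only=> [->|[e Te ->]|[S ->]]; first exact: hom_refl.
  have ho : is_path (src e) [:: (e, false)] (tgt e) by [].
  apply: hom_trans (eval_read ho) _; rewrite /around.
  apply: hom_trans (hom_invl (tau_path b)); apply: (hom_catl (is_path_inv (tau_path b))).
  rewrite catA.
  have hq := is_path_cat (is_path_inv (tau_path (tgt e))) (tau_path b).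
  apply: hom_trans (hom_catr (hom_sym (tau_hom Te)) hq) _.
  by rewrite catA; apply: (@hom_catr _ _ _ _ _ [::] _ (hom_invr (tau_path _)) (tau_path b)).
have [_ [z hz]] := closed_lift_bd phi S.
apply: hom_trans (eval_read hz) (around_null hz _).
have [k' [b' h]] := turnK (mrot phi S) (mflip phi S) (bd S).
exact: hom_turn hz h.
Qed.

Lemma eval_pres w w' : pres_eq rels w w' ->
  homotopic b b (eval_word gamma w) (eval_word gamma w').
Proof.
elim=> {w w'} [w|w w' _|w w' w'' _ h1 _|w a w'|w u w' hu].
- exact: hom_refl.
- exact: hom_sym.
- exact: hom_trans.
- rewrite !eval_word_cat; apply: (hom_catl (gword w)).
  have -> : eval_word gamma [:: a, (a.1, ~~ a.2) & w'] =
      (eval_word gamma [:: a] ++ inv_path (eval_word gamma [:: a])) ++ eval_word gamma w'.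
    by rewrite -eval_inv_word -!eval_word_cat.
  exact: (@hom_catr _ _ _ _ _ [::] _ (hom_invr (gword _)) (gword w')).
rewrite !eval_word_cat; apply: (hom_catl (gword w)).
exact: (@hom_catr _ _ _ _ _ [::] _ (rel_null hu) (gword w')).
Qed.

(** The generator of a 1-cell is the loop that goes to it and returns through the
tree. If the value of a word is trivial in [X], the loop of [Y] that it spells is
null-homotopic, as [Y] is pi_1-injective, and reading the letters off this loop
gives the word back modulo the relators. *)
Lemma presentation : presents_subgroup gen rels.
Proof.
exists (fun i => map (mo phi) (gamma i)).
have e w : eval_word (fun i => map (mo phi) (gamma i)) w = map (mo phi) (eval_word gamma w).
  elim: w => // a w IH; rewrite -cat1s !eval_word_cat map_cat -IH !eval_word1.
  by case: a.2; rewrite ?map_mo_inv.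
split=> [i|i|j|w].
- by rewrite -phib; apply: is_path_mo; apply: gamma_path.
- exact: img (gamma_path i).
- have [p hp <-] := genb j; exists (read_path p); rewrite e -phib; apply: hom_mo.
  apply: hom_sym; apply: hom_trans (eval_read hp) _.
  rewrite /around catA; apply: hom_trans (hom_catr (hom_invl (tau_path b)) _) _.
    exact: is_path_cat hp (is_path_cat (is_path_inv (tau_path b)) (tau_path b)).
  by have := hom_catl hp (hom_invl (tau_path b)); rewrite cats0.
rewrite e -phib; split=> h; last by have := hom_mo phi (eval_pres h).
have := read_hom (inj (gword w) h) => h'.
exact: pres_trans (pres_sym (read_eval w)) h'.
Qed.

End Presentation.

(** * Programs with expressions and bounded loops *)

Inductive expr :=
| EVar (x : nat)
| ECst (n : nat)
| EAdd (e1 e2 : expr)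
| ESub (e1 e2 : expr)
| ERd (a : nat) (e : expr).

Inductive prog :=
| PSkip
| PSet (x : nat) (e : expr)
| PWr (a : nat) (e1 e2 : expr)
| PSeq (p q : prog)
| PIf (e : expr) (p q : prog)
| PFor (i n : nat) (p : prog).

Fixpoint eval (e : expr) (s : state) : nat :=
  match e with
  | EVar x => var s x
  | ECst n => n
  | EAdd e1 e2 => eval e1 s + eval e2 s
  | ESub e1 e2 => eval e1 s - eval e2 s
  | ERd a e => arr s a (eval e s)
  end.

(** [PFor i n p] runs [p] with the variable [i] equal to 0, 1, ... below the
value that [n] has on entry. *)
Fixpoint sem (p : prog) (s : state) : state :=
  match p with
  | PSkip => s
  | PSet x e => set_var s x (eval e s)
  | PWr a e1 e2 => set_arr s a (eval e1 s) (eval e2 s)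
  | PSeq p q => sem q (sem p s)
  | PIf e p q => if eval e s != 0 then sem p s else sem q s
  | PFor i n p => foldl (fun s k => sem p (set_var s i k)) s (iota 0 (var s n))
  end.

Fixpoint esize (e : expr) : nat :=
  match e with
  | EVar _ => 2
  | ECst _ => 1
  | EAdd e1 e2 | ESub e1 e2 => esize e1 + esize e2 + 1
  | ERd _ e => esize e + 1
  end.

Fixpoint loop_cost (i : nat) (c : state -> nat) (f : state -> state) (ks : seq nat)
    (s : state) : nat :=
  if ks is k :: ks' then
    c (set_var s i k) + 6 + loop_cost i c f ks' (f (set_var s i k))
  else 0.

Fixpoint cost (p : prog) (s : state) : nat :=
  match p with
  | PSkip => 1
  | PSet _ e => esize e + 2
  | PWr _ e1 e2 => esize e1 + esize e2 + 1
  | PSeq p q => cost p s + cost q (sem p s)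
  | PIf e p q => esize e + 1 + (if eval e s != 0 then cost p s else cost q s)
  | PFor i n p => 4 + loop_cost i (cost p) (sem p) (iota 0 (var s n)) s
  end.

Fixpoint evars (d : nat) (e : expr) : bool :=
  match e with
  | EVar x => x < d
  | ECst _ => true
  | EAdd e1 e2 | ESub e1 e2 => evars d e1 && evars d e2
  | ERd _ e => evars d e
  end.

Fixpoint pvars (d : nat) (p : prog) : bool :=
  match p with
  | PSkip => true
  | PSet x e => (x < d) && evars d e
  | PWr _ e1 e2 => evars d e1 && evars d e2
  | PSeq p q => pvars d p && pvars d q
  | PIf e p q => [&& evars d e, pvars d p & pvars d q]
  | PFor i n p => [&& i < d, n < d & pvars d p]
  end.

Section Compile.
Variable M : nat.

(** Arrays 4 to 23 are scratch space of the programs, and array [24 + i] holds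
position [i] of the attaching maps; on the machine the scratch arrays come after
the [M] arrays of attaching maps. *)
Definition ren (a : nat) : nat :=
  if a < 4 then a else if a < 24 then a + M else if a < 24 + M then a - 20 else a.

Lemma ren_inj : injective ren.
Proof.
by move=> a b; rewrite /ren; do ![case: ifP => ?]; lia.
Qed.

Fixpoint cexpr (e : expr) (d : nat) : cmd :=
  match e with
  | EVar x => Seq (Const d.+1 0) (Add d x d.+1)
  | ECst n => Const d n
  | EAdd e1 e2 => Seq (Seq (cexpr e1 d) (cexpr e2 d.+1)) (Add d d d.+1)
  | ESub e1 e2 => Seq (Seq (cexpr e1 d) (cexpr e2 d.+1)) (Sub d d d.+1)
  | ERd a e => Seq (cexpr e d) (Read d (ren a) d)
  end.

Fixpoint compile (p : prog) (d : nat) : cmd :=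
  match p with
  | PSkip => Skip
  | PSet x e => Seq (cexpr e d) (Seq (Const d.+1 0) (Add x d d.+1))
  | PWr a e1 e2 => Seq (Seq (cexpr e1 d) (cexpr e2 d.+1)) (Write (ren a) d d.+1)
  | PSeq p q => Seq (compile p d) (compile q d)
  | PIf e p q => Seq (cexpr e d) (If d (compile p d) (compile q d))
  | PFor i n p =>
      Seq (Seq (Const d.+1 0) (Add d n d.+1))
        (While d
          (Seq (Seq (Const d.+2 0) (Add i d.+1 d.+2))
          (Seq (compile p d.+2)
          (Seq (Const d.+2 1) (Seq (Add d.+1 d.+1 d.+2) (Sub d d d.+2))))))
  end.

Definition agree (d : nat) (s s0 : state) : Prop :=
  (forall x, x < d -> var s x = var s0 x) /\ (forall a i, arr s (ren a) i = arr s0 a i).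

Lemma var_set s x n y : var (set_var s x n) y = if y == x then n else var s y.
Proof. by []. Qed.

Lemma agree_hidden d d' s s0 n : agree d s s0 -> d <= d' -> agree d (set_var s d' n) s0.
Proof.
by move=> [h1 h2] dd'; split=> // x xd; rewrite var_set ltn_eqF ?h1 // (leq_trans xd).
Qed.

Lemma cexpr_ok d0 e d s s0 : evars d0 e -> d0 <= d -> agree d0 s s0 ->
  exists t s', [/\ exec (cexpr e d) s t s', t <= esize e, agree d0 s' s0,
    forall x, x < d -> var s' x = var s x & var s' d = eval e s0].
Proof.
elim: e d s => [x|n|e1 IH1 e2 IH2|e1 IH1 e2 IH2|a e IH] d s /=.
- move=> xd dd ag; have xd' := leq_trans xd dd.
  exists 2, (set_var (set_var s d.+1 0) d (var s x)); split=> //.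
  + have := ExSeq (ExConst s d.+1 0) (ExAdd (set_var s d.+1 0) d x d.+1).
    by rewrite !var_set eqxx ltn_eqF ?addn0 // ltnS ltnW.
  + by do 2![apply: agree_hidden => //]; rewrite ltnW.
  + by move=> y yd; rewrite !var_set !ltn_eqF // ltnS ltnW.
  + by rewrite var_set eqxx; apply: (proj1 ag).
- move=> _ dd ag; exists 1, (set_var s d n); split=> //; first exact: ExConst.
  + exact: agree_hidden.
  + by move=> y yd; rewrite var_set ltn_eqF.
  + by rewrite var_set eqxx.
- case/andP=> v1 v2 dd ag; have [t1 [s1 [x1 c1 a1 k1 r1]]] := IH1 d s v1 dd ag.
  have [t2 [s2 [x2 c2 a2 k2 r2]]] := IH2 d.+1 s1 v2 (leqW dd) a1.
  exists (t1 + t2 + 1), (set_var s2 d (var s2 d + var s2 d.+1)); split.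
  + by apply: ExSeq; [apply: ExSeq x1 x2|apply: ExAdd].
  + by rewrite leq_add // leq_add.
  + exact: agree_hidden.
  + by move=> y yd; rewrite var_set ltn_eqF // k2 ?k1 // ltnS ltnW.
  + by rewrite var_set eqxx r2 k2 // r1.
- case/andP=> v1 v2 dd ag; have [t1 [s1 [x1 c1 a1 k1 r1]]] := IH1 d s v1 dd ag.
  have [t2 [s2 [x2 c2 a2 k2 r2]]] := IH2 d.+1 s1 v2 (leqW dd) a1.
  exists (t1 + t2 + 1), (set_var s2 d (var s2 d - var s2 d.+1)); split.
  + by apply: ExSeq; [apply: ExSeq x1 x2|apply: ExSub].
  + by rewrite leq_add // leq_add.
  + exact: agree_hidden.
  + by move=> y yd; rewrite var_set ltn_eqF // k2 ?k1 // ltnS ltnW.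
  + by rewrite var_set eqxx r2 k2 // r1.
move=> v dd ag; have [t1 [s1 [x1 c1 a1 k1 r1]]] := IH d s v dd ag.
exists (t1 + 1), (set_var s1 d (arr s1 (ren a) (var s1 d))); split.
- by apply: ExSeq x1 _; apply: ExRead.
- by rewrite leq_add.
- exact: agree_hidden.
- by move=> y yd; rewrite var_set ltn_eqF // k1.
- by rewrite var_set eqxx r1 (proj2 a1).
Qed.

Lemma agree_set d s s0 x n : agree d s s0 -> agree d (set_var s x n) (set_var s0 x n).
Proof. by move=> [h1 h2]; split=> // y yd; rewrite !var_set h1. Qed.

(** The counters of a loop and the intermediate values of an expression are kept in
variables from [d] on, which neither the program nor the enclosing loops use. *)
Lemma compile_ok d0 p d s s0 : pvars d0 p -> d0 <= d -> agree d0 s s0 ->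
  exists t s', [/\ exec (compile p d) s t s', t <= cost p s0, agree d0 s' (sem p s0)
    & forall x, d0 <= x -> x < d -> var s' x = var s x].
Proof.
elim: p d s s0 => [|x e|a e1 e2|p IHp q IHq|e p IHp q IHq|i n p IH] d s s0 /=.
- by move=> _ dd ag; exists 1, s; split=> //; apply: ExSkip.
- case/andP=> xd v dd ag; have [t1 [s1 [x1 c1 a1 k1 r1]]] := cexpr_ok v dd ag.
  exists (t1 + 2), (set_var (set_var s1 d.+1 0) x (eval e s0)); split.
  + apply: ExSeq x1 _.
    have := ExSeq (ExConst s1 d.+1 0) (ExAdd (set_var s1 d.+1 0) x d d.+1).
    by rewrite !var_set eqxx (ltn_eqF (ltnSn d)) addn0 r1.
  + by rewrite leq_add.
  + by apply: agree_set; apply: agree_hidden => //; rewrite ltnW.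
  + move=> y dy yd; rewrite !var_set gtn_eqF ?(leq_trans xd) // ltn_eqF ?k1 // ltnS ltnW //.
- case/andP=> v1 v2 dd ag; have [t1 [s1 [x1 c1 a1 k1 r1]]] := cexpr_ok v1 dd ag.
  have [t2 [s2 [x2 c2 a2 k2 r2]]] := cexpr_ok v2 (leqW dd) a1.
  exists (t1 + t2 + 1), (set_arr s2 (ren a) (var s2 d) (var s2 d.+1)); split.
  + by apply: ExSeq; [apply: ExSeq x1 x2|apply: ExWrite].
  + by rewrite leq_add // leq_add.
  + case: a2 => h1 h2; split=> // b j; rewrite /= /upd (inj_eq ren_inj) r2 k2 // r1.
    by case: (b == a); rewrite ?h2 //; case: (_ == _); rewrite ?h2.
  + by move=> y _ yd; rewrite /= k2 ?k1 // ltnS ltnW.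
- case/andP=> v1 v2 dd ag; have [t1 [s1 [x1 c1 a1 k1]]] := IHp d s s0 v1 dd ag.
  have [t2 [s2 [x2 c2 a2 k2]]] := IHq d s1 _ v2 dd a1.
  exists (t1 + t2), s2; split=> //; [exact: ExSeq x1 x2|exact: leq_add|].
  by move=> y dy yd; rewrite k2 ?k1.
- case/and3P=> v v1 v2 dd ag; have [t [s1 [x1 c1 a1 k1 r1]]] := cexpr_ok v dd ag.
  case: (eqVneq (eval e s0) 0) => h /=.
    have [t2 [s2 [x2 c2 a2 k2]]] := IHq d s1 s0 v2 dd a1.
    exists (t + t2.+1), s2; split=> //.
    + by apply: ExSeq x1 _; apply: ExIfFalse x2; rewrite r1.
    + by rewrite -addnA leq_add.
    + by move=> y dy yd; rewrite k2 ?k1.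
  have [t2 [s2 [x2 c2 a2 k2]]] := IHp d s1 s0 v1 dd a1.
  exists (t + t2.+1), s2; split=> //.
  + by apply: ExSeq x1 _; apply: ExIfTrue x2; rewrite r1.
  + by rewrite -addnA leq_add.
  + by move=> y dy yd; rewrite k2 ?k1.
case/and3P=> id nd v dd ag.
set body := Seq (Seq (Const d.+2 0) _) _.
set cl := loop_cost i (cost p) (sem p).
have dd2 : d0 <= d.+2 by rewrite 2?leqW.
have ind y : y < d -> (y == d = false) * (y == d.+1 = false) * (y == d.+2 = false).
  by move=> yd; rewrite !ltn_eqF // !ltnS ltnW // ltnW.
have loop : forall m k s s0, agree d0 s s0 -> var s d = m -> var s d.+1 = k ->
    exists t s', [/\ exec (While d body) s t s', t <= cl (iota k m) s0 + 1,
      agree d0 s' (foldl (fun s k => sem p (set_var s i k)) s0 (iota k m))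
      & forall x, d0 <= x -> x < d -> var s' x = var s x].
  elim=> [|m IHm] k {}s {}s0 {}ag hm hk.
    by exists 1, s; split=> //; apply: ExWhileStop.
  pose s1 := set_var (set_var s d.+2 0) i k.
  have x1 : exec (Seq (Const d.+2 0) (Add i d.+1 d.+2)) s (1 + 1) s1.
    have := ExSeq (ExConst s d.+2 0) (ExAdd (set_var s d.+2 0) i d.+1 d.+2).
    by rewrite !var_set eqxx (ltn_eqF (ltnSn d.+1)) addn0 hk.
  have a1 : agree d0 s1 (set_var s0 i k).
    by apply: agree_set; apply: agree_hidden.
  have [t2 [s2 [x2 c2 a2 k2]]] := IH d.+2 s1 _ v dd2 a1.
  have i_d := leq_trans id dd.
  have e1 : var s2 d = m.+1.
    by rewrite k2 // /s1 !var_set (gtn_eqF i_d) (ltn_eqF (leqW (ltnSn d))).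
  have e2 : var s2 d.+1 = k.
    by rewrite k2 // ?(leqW dd) // /s1 !var_set (gtn_eqF (leqW i_d)) (ltn_eqF (ltnSn _)).
  pose s3 := set_var s2 d.+2 1.
  pose s4 := set_var s3 d.+1 (var s3 d.+1 + var s3 d.+2).
  pose s5 := set_var s4 d (var s4 d - var s4 d.+2).
  have x5 : exec (Seq (Const d.+2 1) (Seq (Add d.+1 d.+1 d.+2) (Sub d d d.+2))) s2 (1 + (1 + 1)) s5.
    apply: ExSeq (ExConst _ _ _) _; apply: ExSeq (ExAdd _ _ _ _) _; exact: ExSub.
  have a5 : agree d0 s5 (sem p (set_var s0 i k)).
    rewrite /s5 /s4 /s3; apply: (agree_hidden _ _ dd); apply: (agree_hidden _ _ (leqW dd)).
    exact: agree_hidden.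
  have e5 : var s5 d = m.
    rewrite /s5 var_set eqxx /s4 !var_set (ltn_eqF (ltnSn d)) (gtn_eqF (ltnSn d.+1)).
    by rewrite eqxx (ltn_eqF (leqW (ltnSn d))) e1 subn1.
  have e5' : var s5 d.+1 = k.+1.
    rewrite /s5 var_set (gtn_eqF (ltnSn d)) /s4 !var_set eqxx.
    by rewrite eqxx (ltn_eqF (ltnSn _)) e2 addn1.
  have [t6 [s6 [x6 c6 a6 k6]]] := IHm k.+1 s5 _ a5 e5 e5'.
  exists ((1 + 1 + (t2 + (1 + (1 + 1))) + t6).+1), s6; split=> //.
  - apply: ExWhile x6; first by rewrite hm.
    exact: ExSeq x1 (ExSeq x2 x5).
  - have -> : cl (iota k m.+1) s0 = cost p (set_var s0 i k) + 6 +
        cl (iota k.+1 m) (sem p (set_var s0 i k)) by [].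
    lia.
  - move=> y dy yd; rewrite k6 // /s5 /s4 /s3 !var_set !(ind y yd) k2 //; last by rewrite 2?leqW.
    by rewrite /s1 !var_set !(ind y yd) gtn_eqF // (leq_trans id).
pose s1 := set_var (set_var s d.+1 0) d (var s n).
have x1 : exec (Seq (Const d.+1 0) (Add d n d.+1)) s (1 + 1) s1.
  have := ExSeq (ExConst s d.+1 0) (ExAdd (set_var s d.+1 0) d n d.+1).
  by rewrite !var_set eqxx ltn_eqF ?addn0 // ltnS ltnW // (leq_trans nd).
have a1 : agree d0 s1 s0.
  by rewrite /s1; apply: (agree_hidden _ _ dd); apply: (agree_hidden _ _ (leqW dd)).
have e1 : var s1 d = var s0 n by rewrite /s1 var_set eqxx (proj1 ag).
have e1' : var s1 d.+1 = 0 by rewrite /s1 !var_set gtn_eqF // eqxx.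
have [t [s' [x' c' a' k']]] := loop _ 0 s1 s0 a1 e1 e1'.
exists (1 + 1 + t), s'; split=> //; first exact: ExSeq x1 x'.
  lia.
by move=> y dy yd; rewrite k' // /s1 !var_set !(ind y yd).
Qed.

End Compile.

(** * Frames and running time *)

Fixpoint modv (x : nat) (p : prog) : bool :=
  match p with
  | PSkip | PWr _ _ _ => false
  | PSet y _ => x == y
  | PSeq p q | PIf _ p q => modv x p || modv x q
  | PFor i _ p => (x == i) || modv x p
  end.

Fixpoint moda (a : nat) (p : prog) : bool :=
  match p with
  | PSkip | PSet _ _ => false
  | PWr b _ _ => a == b
  | PSeq p q | PIf _ p q => moda a p || moda a q
  | PFor _ _ p => moda a p
  end.

Lemma sem_var x p s : ~~ modv x p -> var (sem p s) x = var s x.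
Proof.
elim: p s => //= [y e|p IHp q IHq|e p IHp q IHq|i n p IH] s.
- by move=> h; rewrite /upd (negPf h).
- by rewrite negb_or => /andP[h1 h2]; rewrite IHq ?IHp.
- by rewrite negb_or => /andP[h1 h2]; case: ifP => _; rewrite ?IHq ?IHp.
rewrite negb_or => /andP[h1 h2]; move: (iota _ _) => ks; elim: ks s => //= k ks IHk s.
by rewrite IHk IH //= /upd (negPf h1).
Qed.

Lemma sem_arr a p s : ~~ moda a p -> arr (sem p s) a = arr s a.
Proof.
elim: p s => //= [b e1 e2|p IHp q IHq|e p IHp q IHq|i n p IH] s.
- by move=> h; rewrite /upd (negPf h).
- by rewrite negb_or => /andP[h1 h2]; rewrite IHq ?IHp.
- by rewrite negb_or => /andP[h1 h2]; case: ifP => _; rewrite ?IHq ?IHp.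
by move=> h; move: (iota _ _) => ks; elim: ks s => //= k ks IHk s; rewrite IHk IH.
Qed.

Lemma for_inv (I : nat -> state -> Prop) i n p s :
  I 0 s ->
  (forall k s', k < var s n -> I k s' -> I k.+1 (sem p (set_var s' i k))) ->
  I (var s n) (sem (PFor i n p) s).
Proof.
move=> h0 hS /=; move: (var s n) hS => m hS.
elim: m hS => [//|m IH] hS.
rewrite -[m.+1]addn1 iotaD foldl_cat add0n addn1 /=; apply: (hS) => //.
by apply: IH => k s' hk; apply: hS; apply: leqW.
Qed.

(** The step may use that what the body does not modify is as before the loop. *)
Lemma for_frame (I : nat -> state -> Prop) i n p s :
  I 0 s ->
  (forall k s', k < var s n -> I k s' ->
     (forall x, ~~ modv x (PFor i n p) -> var s' x = var s x) ->
     (forall a, ~~ moda a p -> arr s' a = arr s a) ->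
     I k.+1 (sem p (set_var s' i k))) ->
  I (var s n) (sem (PFor i n p) s).
Proof.
move=> h0 hS.
pose J k s' := [/\ I k s', forall x, ~~ modv x (PFor i n p) -> var s' x = var s x
  & forall a, ~~ moda a p -> arr s' a = arr s a].
suff [] : J (var s n) (sem (PFor i n p) s) by [].
apply: for_inv => // k s' hk [h1 h2 h3]; split; first exact: hS.
  move=> x hx; rewrite sem_var; last by move: hx; rewrite /= negb_or => /andP[].
  have /andP[/negPf h _] : (x != i) && ~~ modv x p by rewrite -negb_or.
  by rewrite var_set h h2.
by move=> a ha; rewrite sem_arr //= h3.
Qed.

Fixpoint limits_in (L : seq nat) (p : prog) : bool :=
  match p with
  | PSkip | PSet _ _ | PWr _ _ _ => true
  | PSeq p q | PIf _ p q => limits_in L p && limits_in L q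
  | PFor _ n p => (n \in L) && limits_in L p
  end.

Fixpoint psize (p : prog) : nat :=
  match p with
  | PSkip => 1
  | PSet _ e => esize e + 2
  | PWr _ e1 e2 => esize e1 + esize e2 + 1
  | PSeq p q => psize p + psize q
  | PIf e p q => esize e + 1 + (psize p + psize q)
  | PFor _ _ p => psize p + 10
  end.

Fixpoint pdepth (p : prog) : nat :=
  match p with
  | PSkip | PSet _ _ | PWr _ _ _ => 0
  | PSeq p q | PIf _ p q => maxn (pdepth p) (pdepth q)
  | PFor _ _ p => (pdepth p).+1
  end.

Definition fixed_limits (L : seq nat) (p : prog) : bool :=
  limits_in L p && all (fun x => ~~ modv x p) L.

(** Each loop, at whatever level of nesting, makes at most [N] turns, as its bound
never changes. *)
Lemma cost_bound L N p s : fixed_limits L p -> (forall x, x \in L -> var s x <= N) ->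
  cost p s <= psize p * N.+1 ^ pdepth p.
Proof.
have pos d : 0 < N.+1 ^ d by rewrite expn_gt0.
have mono a d d' : d <= d' -> a * N.+1 ^ d <= a * N.+1 ^ d'.
  by move=> h; rewrite leq_mul2l leq_pexp2l ?orbT.
case/andP; elim: p s => [|x e|a e1 e2|p IHp q IHq|e p IHp q IHq|i n p IH] s /=;
  rewrite ?expn0 ?muln1 //.
- case/andP=> lp lq /allP hm hL.
  have mp x : x \in L -> ~~ modv x p by move/hm; rewrite negb_or => /andP[].
  have mq x : x \in L -> ~~ modv x q by move/hm; rewrite negb_or => /andP[].
  rewrite mulnDl; apply: leq_add.
    by apply: leq_trans (IHp s lp _ hL) _; [apply/allP|apply: mono; exact: leq_maxl].
  apply: leq_trans (IHq _ lq _ _) _; first exact/allP.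
    by move=> x xL; rewrite sem_var ?mp // hL.
  by apply: mono; exact: leq_maxr.
- case/andP=> lp lq /allP hm hL.
  have mp x : x \in L -> ~~ modv x p by move/hm; rewrite negb_or => /andP[].
  have mq x : x \in L -> ~~ modv x q by move/hm; rewrite negb_or => /andP[].
  rewrite mulnDl; apply: leq_add; first by rewrite leq_pmulr.
  case: ifP => _.
    apply: leq_trans (IHp s lp _ hL) _; first exact/allP.
    by apply: leq_trans (mono _ _ _ (leq_maxl _ (pdepth q))) _; rewrite leq_mul2r leq_addr orbT.
  apply: leq_trans (IHq s lq _ hL) _; first exact/allP.
  by apply: leq_trans (mono _ _ _ (leq_maxr (pdepth p) _)) _; rewrite leq_mul2r leq_addl orbT.
case/andP=> nL lp /allP hm hL.
have mp x : x \in L -> ~~ modv x p by move/hm; rewrite negb_or => /andP[].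
have mi x : x \in L -> x != i by move/hm; rewrite negb_or => /andP[].
set B := psize p * N.+1 ^ pdepth p.
have body s' : (forall x, x \in L -> var s' x <= N) -> cost p s' <= B.
  by move=> h; apply: IH => //; apply/allP.
have loop ks s' : (forall x, x \in L -> var s' x <= N) ->
    loop_cost i (cost p) (sem p) ks s' <= size ks * (B + 6).
  elim: ks s' => //= k ks IHk s' h.
  have h' x : x \in L -> var (set_var s' i k) x <= N.
    by move=> xL; rewrite var_set (negPf (mi _ xL)) h.
  rewrite mulSn; apply: leq_add; first by rewrite leq_add2r body.
  by apply: IHk => x xL; rewrite sem_var ?mp // h'.
apply: leq_trans (leq_add (leqnn 4) (loop _ _ hL)) _; rewrite size_iota.
apply: (@leq_trans (N.+1 * (B + 10))).
  apply: (@leq_trans (4 + N * (B + 6))); first by rewrite leq_add2l leq_mul2r hL ?orbT.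
  rewrite mulSn leq_add ?leq_mul2l ?leq_add2l ?orbT //.
  by apply: leq_trans (leq_addl _ _); [].
rewrite /B mulnDl mulnDr expnS mulnCA leq_add2l (mulnC 10).
by rewrite leq_mul2r leq_pmulr ?orbT.
Qed.

Definition pseq (ps : seq prog) : prog := foldr PSeq PSkip ps.

Definition ENeq (e1 e2 : expr) : expr := EAdd (ESub e1 e2) (ESub e2 e1).
Definition ELt (e1 e2 : expr) : expr := ESub e2 e1.
Definition EDbl (e : expr) : expr := EAdd e e.

Lemma eval_neq e1 e2 s : (eval (ENeq e1 e2) s != 0) = (eval e1 s != eval e2 s).
Proof. by rewrite /= addn_eq0 !subn_eq0 -eqn_leq. Qed.

Lemma eval_lt e1 e2 s : (eval (ELt e1 e2) s != 0) = (eval e1 s < eval e2 s).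
Proof. by rewrite /= subn_eq0 -ltnNge. Qed.

(** The machine has no multiplication; multiplying by a constant is iterated
addition. *)
Fixpoint EMulc (k : nat) (e : expr) : expr :=
  if k is k'.+1 then EAdd e (EMulc k' e) else ECst 0.

Lemma eval_mulc k e s : eval (EMulc k e) s = k * eval e s.
Proof. by elim: k => //= k ->; rewrite mulSn. Qed.

(** * Quotients and disjoint unions over a complex *)

(** The maps [pvq] and [poq] present a quotient of the graph [Z], in which a
1-cell may be reversed. A 2-cell of the quotient is attached along the lift of the
boundary of its image in [X], so that its map to [X] needs no rotation. *)
Section Quotient.
Variables (X : complex) (Z : fcomplex) (zeta : cmap Z X) (V E : finType).
Variables (pvq : fvert Z -> V) (poq : oedge Z -> E * bool).
Definition flip (o : E * bool) : E * bool := (o.1, ~~ o.2).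
Hypothesis pv_onto : forall v, exists x, pvq x == v.
Hypothesis po_onto : forall o, exists e : fcell1 Z * bool, poq e == o.
Hypothesis po_flip : forall o, poq (oinv o) = flip (poq o).
Hypothesis pv_mv : forall x y, pvq x = pvq y -> mv zeta x = mv zeta y.
Hypothesis po_mo : forall o o', poq o = poq o' -> mo zeta o = mo zeta o'.
Hypothesis po_src : forall o o', poq o = poq o' -> pvq (osrc o) = pvq (osrc o').

Let secv v : fvert Z := xchoose (pv_onto v).
Let seco e : oedge Z := xchoose (po_onto (e, false)).

Let secvK v : pvq (secv v) = v. Proof. exact/eqP/(xchooseP (pv_onto v)). Qed.
Let secoK e : poq (seco e) = (e, false). Proof. exact/eqP/(xchooseP (po_onto _)). Qed.

Definition q_src (e : E) : V := pvq (osrc (seco e)).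
Definition q_tgt (e : E) : V := pvq (otgt (seco e)).
Let QG := Graph q_src q_tgt.
Let po (o : oedge Z) : oedge QG := poq o.
Definition q_me (e : E) : oedge X := mo zeta (seco e).
Definition q_mv (v : V) : vert X := mv zeta (secv v).

Let po_tgt o o' : poq o = poq o' -> pvq (otgt o) = pvq (otgt o').
Proof. by move=> h; apply: po_src; rewrite !po_flip h. Qed.

Lemma q_edge o e : poq o = (e, false) ->
  [/\ q_src e = pvq (osrc o), q_tgt e = pvq (otgt o) & q_me e = mo zeta o].
Proof.
move=> h; have h' : poq (seco e) = poq o by rewrite secoK.
by split; [exact: po_src|exact: po_tgt|exact: po_mo].
Qed.

Lemma q_osrc o : osrc (po o) = pvq (osrc o).
Proof.
rewrite /osrc /po; case E1 : (poq o) => [e []] /=; last by have [-> _ _] := q_edge E1.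
have /q_edge[_ -> _] : poq (oinv o) = (e, false) by rewrite po_flip E1.
by rewrite otgt_inv.
Qed.

Lemma q_poinv o : po (oinv o) = oinv (po o).
Proof. exact: po_flip. Qed.

Lemma q_otgt o : otgt (po o) = pvq (otgt o).
Proof. by rewrite {1}/otgt -q_poinv q_osrc. Qed.

Lemma q_mo o : omap_of (G := QG) q_me (po o) = mo zeta o.
Proof.
rewrite /omap_of /po; case E1 : (poq o) => [e []] /=; last by have [_ _ ->] := q_edge E1.
have /q_edge[_ _ ->] : poq (oinv o) = (e, false) by rewrite po_flip E1.
by rewrite mo_inv oinvK.
Qed.

Lemma q_is_path (u : vert Z) p (v : vert Z) : is_path u p v ->
  is_path (pvq u : vert QG) (map po p) (pvq v : vert QG).
Proof.
elim: p u => [u ->//|o p IH u [<- /IH h]] /=.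
by rewrite q_osrc q_otgt.
Qed.

Definition q_bd (S : fcell2 Z) : seq (oedge QG) := map po (lift_bd zeta S).

Lemma q_bd_closed S : closed_path (q_bd S).
Proof.
have [S0 [u hu]] := closed_lift_bd zeta S; split.
  by rewrite /q_bd; case: (lift_bd zeta S) S0.
exists (pvq u : vert QG); exact: q_is_path.
Qed.

Lemma q_bd_over S : map (omap_of (G := QG) q_me) (q_bd S) = bd (mf zeta S).
Proof. by rewrite -lift_bd_over -map_comp; apply: eq_map => o; apply: q_mo. Qed.

Lemma q_bd_immersed S : immersed_loop (q_bd S).
Proof.
move=> k o1 o2 q h eo; have := congr1 (map (omap_of (G := QG) q_me)) h.
rewrite map_rot q_bd_over /= => /bd_immersed; apply; rewrite eo.
by case: o1 {h eo} => e [] //; rewrite /omap_of /= oinvK.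
Qed.

Definition q_cx : fcomplex := @FComplex V E (fcell2 Z) q_src q_tgt q_bd q_bd_closed q_bd_immersed.

Lemma q_me_src (e : cell1 q_cx) : osrc (q_me e) = q_mv (src e).
Proof. by rewrite /q_me osrc_mo; apply: pv_mv; rewrite secvK. Qed.

Lemma q_me_tgt (e : cell1 q_cx) : otgt (q_me e) = q_mv (tgt e).
Proof. by rewrite /q_me otgt_mo; apply: pv_mv; rewrite secvK. Qed.

Lemma q_mf_bd (S : cell2 q_cx) :
  map (omap_of (G := q_cx) q_me) (turn 0 false (bd S)) = bd (mf zeta S).
Proof. by rewrite /turn rot0 -q_bd_over. Qed.

Definition q_map : cmap q_cx X :=
  @CMap q_cx X q_mv q_me (mf zeta) (fun=> 0) (fun=> false) q_me_src q_me_tgt q_mf_bd.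

Definition quotient : complex_over X := @Over X q_cx q_map.

Lemma q_lift_bd (S : cell2 q_cx) : lift_bd quotient S = map po (lift_bd zeta S).
Proof. by rewrite /lift_bd /turn rot0. Qed.

Lemma q_pv_over (x : vert Z) : mv quotient (pvq x : vert q_cx) = mv zeta x.
Proof. by apply: pv_mv; rewrite secvK. Qed.

Definition q_proj : over_map zeta quotient :=
  @OverMap X Z q_cx zeta quotient pvq po id q_poinv q_osrc q_pv_over q_mo
    (fun=> erefl) q_lift_bd.

End Quotient.

Section Union.
Variables (X : complex) (Y P : fcomplex) (phi : cmap Y X) (pi : cmap P X).

Definition u_src (e : fcell1 Y + fcell1 P) : fvert Y + fvert P :=
  match e with inl e => inl (fsrc e) | inr e => inr (fsrc e) end.
Definition u_tgt (e : fcell1 Y + fcell1 P) : fvert Y + fvert P :=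
  match e with inl e => inl (ftgt e) | inr e => inr (ftgt e) end.
Let UG := Graph u_src u_tgt.

Definition ul (o : oedge Y) : oedge UG := (inl o.1, o.2).
Definition ur (o : oedge P) : oedge UG := (inr o.1, o.2).

Lemma ul_src o : osrc (ul o) = inl (osrc o). Proof. by case: o => e []. Qed.
Lemma ur_src o : osrc (ur o) = inr (osrc o). Proof. by case: o => e []. Qed.
Lemma ul_tgt o : otgt (ul o) = inl (otgt o). Proof. by case: o => e []. Qed.
Lemma ur_tgt o : otgt (ur o) = inr (otgt o). Proof. by case: o => e []. Qed.

Lemma ul_path (u v : vert Y) p : is_path u p v ->
  is_path (inl u : vert UG) (map ul p) (inl v : vert UG).
Proof.
elim: p u => [u ->//|o p IH u [<- /IH h]] /=.
by rewrite ul_src ul_tgt.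
Qed.

Lemma ur_path (u v : vert P) p : is_path u p v ->
  is_path (inr u : vert UG) (map ur p) (inr v : vert UG).
Proof.
elim: p u => [u ->//|o p IH u [<- /IH h]] /=.
by rewrite ur_src ur_tgt.
Qed.

Definition u_bd (S : fcell2 Y + fcell2 P) : seq (oedge UG) :=
  match S with
  | inl c => map ul (lift_bd phi c)
  | inr c => map ur (lift_bd pi c)
  end.

Lemma u_bd_closed S : closed_path (u_bd S).
Proof.
case: S => S /=.
  have [S0 [u hu]] := closed_lift_bd phi S; split; first by case: (lift_bd _ _) S0.
  by exists (inl u); apply: ul_path.
have [S0 [u hu]] := closed_lift_bd pi S; split; first by case: (lift_bd _ _) S0.
by exists (inr u); apply: ur_path.
Qed.

Definition u_me (e : fcell1 Y + fcell1 P) : oedge X :=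
  match e with inl e => me phi e | inr e => me pi e end.
Definition u_mv (v : fvert Y + fvert P) : vert X :=
  match v with inl v => mv phi v | inr v => mv pi v end.
Definition u_mf (S : fcell2 Y + fcell2 P) : cell2 X :=
  match S with inl c => mf phi c | inr c => mf pi c end.

Lemma u_bd_over S : map (omap_of (G := UG) u_me) (u_bd S) = bd (u_mf S).
Proof. by case: S => S /=; rewrite -lift_bd_over -map_comp; apply: eq_map => -[e []]. Qed.

Lemma u_bd_immersed S : immersed_loop (u_bd S).
Proof.
move=> k o1 o2 q h eo; have := congr1 (map (omap_of (G := UG) u_me)) h.
rewrite map_rot u_bd_over /= => /bd_immersed; apply; rewrite eo.
by case: o1 {h eo} => e [] //; rewrite /omap_of /= oinvK.
Qed.

Definition u_cx : fcomplex := @FComplex _ _ _ u_src u_tgt u_bd u_bd_closed u_bd_immersed.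

Lemma u_me_src (e : cell1 u_cx) : osrc (u_me e) = u_mv (src e).
Proof. by case: e => e; [exact: (me_src phi e)|exact: (me_src pi e)]. Qed.

Lemma u_me_tgt (e : cell1 u_cx) : otgt (u_me e) = u_mv (tgt e).
Proof. by case: e => e; [exact: (me_tgt phi e)|exact: (me_tgt pi e)]. Qed.

Lemma u_mf_bd (S : cell2 u_cx) :
  map (omap_of (G := u_cx) u_me) (turn 0 false (bd S)) = bd (u_mf S).
Proof. by rewrite /turn rot0 -u_bd_over. Qed.

Definition u_map : cmap u_cx X :=
  @CMap u_cx X u_mv u_me u_mf (fun=> 0) (fun=> false) u_me_src u_me_tgt u_mf_bd.

Lemma u_lift_bd (S : cell2 u_cx) : lift_bd u_map S = u_bd S.
Proof. by rewrite /lift_bd /turn rot0. Qed.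

Program Definition u_inl : over_map phi u_map :=
  @OverMap X Y u_cx phi u_map inl ul inl _ _ _ _ _ _.
Next Obligation. by rewrite ul_src. Qed.
Next Obligation. by rewrite /lift_bd /turn rot0. Qed.

Program Definition u_inr : over_map pi u_map :=
  @OverMap X P u_cx pi u_map inr ur inr _ _ _ _ _ _.
Next Obligation. by rewrite ur_src. Qed.
Next Obligation. by rewrite /lift_bd /turn rot0. Qed.

End Union.

(** * Complexes in memory *)

(** The memory of a step. The variables 0 to 3 and the arrays 0 to 3 are those of
the encoding, and array [BD i] holds position [i] of the attaching maps. Variables
10 to 14 bound loops over vertices, 1-cells, oriented 1-cells, 2-cells and the
1-cells of [X]; 34 and 35 are 10 and 11 with room for a packet. Variables 15 to 17
hold a foldable pair, 18 and 19 new numbers of 1-cells and vertices, 20 and 21 loop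
indices, 22 to 26 the data of an identification of two numbers, 27 and 28 the
success and the current 1-cell of a walk, 29 and 30 the success and the result of
a search, 31 and 32 the numbers of vertices and 1-cells of a growing complex.
Arrays 4 to 8 hold origin, end, label, reverse and 1-cell of each oriented 1-cell,
9 the inverses of the labels, 10 the slots, 11 the marks, 12 and 13 the 1-cells
and the vertices of a walk, 14 to 16 new numbers of vertices, 1-cells and letters. *)
Definition BD (i : nat) : nat := 24 + i.

Lemma BD_eq i j : (BD i == BD j) = (i == j). Proof. exact: eqn_add2l. Qed.
Lemma BD_neq i a : a < 24 -> (BD i == a) = false.
Proof. by move=> h; rewrite gtn_eqF // (leq_trans h) // leq_addr. Qed.
Lemma neq_BD i a : a < 24 -> (a == BD i) = false.
Proof. by move=> h; rewrite eq_sym BD_neq. Qed.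

Lemma letter_inj n m b c : letter n b = letter m c -> n = m /\ b = c.
Proof.
move=> h; have e : b = c.
  by have := congr1 odd h; rewrite /letter !oddD !odd_double /= !oddb.
by split=> //; subst c; apply: double_inj; apply: (@addIn b).
Qed.

Lemma letter_even n b k : (letter n b == k + k) = (n == k) && ~~ b.
Proof.
rewrite addnn -[k.*2]addn0 -[_ + 0]/(letter k false).
by apply/eqP/andP => [/letter_inj[-> ->]|[/eqP-> /negPf->]].
Qed.

Lemma letter_odd n b k : (letter n b == k + k + 1) = (n == k) && b.
Proof.
rewrite addnn -[_ + 1]/(letter k true).
by apply/eqP/andP => [/letter_inj[-> ->]|[/eqP-> ->]].
Qed.

Lemma letter_lt n b m : n < m -> letter n b < m + m.
Proof.
move=> h; rewrite addnn /letter (@leq_trans n.+1.*2) ?leq_double //.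
by rewrite doubleS; case: b; rewrite ?addn1 ?addn0.
Qed.

Lemma letterP x : exists n b, x = letter n b.
Proof. by exists x./2, (odd x); rewrite /letter addnC odd_double_half. Qed.

Lemma numbering_onto (T : finType) (f : T -> nat) k : numbering f -> k < #|T| ->
  exists x, f x = k.
Proof.
move=> [inj lt] hk; pose g x : 'I_#|T| := Ordinal (lt x).
have g_inj : injective g by move=> x y [] /inj.
have /codomP[x hx] : Ordinal hk \in codom g by apply: inj_card_onto; rewrite ?card_ord.
by exists x; have := congr1 val hx.
Qed.

Section Fill.

Lemma arr_set s a i n b j :
  arr (set_arr s a i n) b j = if (b == a) && (j == i) then n else arr s b j.
Proof. by rewrite /= /upd; case: eqVneq => [->|] //. Qed.

Definition fill (a n : nat) (e : expr) : prog := PFor 20 n (PWr a (EVar 20) e).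

Lemma fillP a n e s (g : nat -> nat) : 
  (forall k s', k < var s n -> var s' 20 = k ->
     (forall x, x != 20 -> var s' x = var s x) ->
     (forall b, b != a -> arr s' b = arr s b) -> 
     (forall j, k <= j -> arr s' a j = arr s a j) -> eval e s' = g k) ->
  (forall k, k < var s n -> arr (sem (fill a n e) s) a k = g k) /\
  (forall k, var s n <= k -> arr (sem (fill a n e) s) a k = arr s a k).
Proof.
move=> h; pose I m s' := (forall k, k < m -> arr s' a k = g k) /\
  (forall k, m <= k -> arr s' a k = arr s a k).
apply: (@for_frame I) => // m s' hm [IH1 IH2] fv fa; split=> k hk.
  have -> : arr (sem (PWr a (EVar 20) e) (set_var s' 20 m)) a k =
      if k == m then eval e (set_var s' 20 m) else arr s' a k by rewrite arr_set eqxx.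
  case: eqVneq => [ek|ne]; last by apply: IH1; rewrite ltn_neqAle ne -ltnS.
  subst k; apply: (h m) => // x x20.
  by rewrite var_set (negPf x20) fv //= orbF.
have -> : arr (sem (PWr a (EVar 20) e) (set_var s' 20 m)) a k =
    if k == m then eval e (set_var s' 20 m) else arr s' a k by rewrite arr_set eqxx.
by rewrite gtn_eqF // IH2 // ltnW.
Qed.

Definition fill2 (a n : nat) (e0 e1 : expr) : prog :=
  PFor 20 n (PSeq (PWr a (EDbl (EVar 20)) e0) (PWr a (EAdd (EDbl (EVar 20)) (ECst 1)) e1)).

Lemma fill2P a n e0 e1 s (g : nat -> bool -> nat) : 
  (forall k s', k < var s n -> var s' 20 = k ->
     (forall x, x != 20 -> var s' x = var s x) ->
     (forall b, b != a -> arr s' b = arr s b) -> eval e0 s' = g k false /\ eval e1 s' = g k true) ->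
  forall k b, k < var s n -> arr (sem (fill2 a n e0 e1) s) a (letter k b) = g k b.
Proof.
move=> h k b; move: k; apply: (@for_frame (fun m s' => forall k, k < m ->
  arr s' a (letter k b) = g k b)) => // m s' hm IH fv fa k hk.
set s1 := set_var s' 20 m; pose s2 := set_arr s1 a (m + m) (eval e0 s1).
have x1 : var s2 20 = m by [].
have -> : sem (PSeq (PWr a (EDbl (EVar 20)) e0)
   (PWr a (EAdd (EDbl (EVar 20)) (ECst 1)) e1)) s1 = set_arr s2 a (m + m + 1) (eval e1 s2) by [].
have fv1 x : x != 20 -> var s1 x = var s x.
  by move=> x20; rewrite var_set (negPf x20) fv //= orbF.
have fa1 c : c != a -> arr s1 c = arr s c.
  by move=> ca; apply: fa; rewrite /= orbb.
rewrite !arr_set eqxx /= letter_even letter_odd.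
case: eqVneq => [ek|ne] /=; last by apply: IH; rewrite ltn_neqAle ne -ltnS.
rewrite ek; case: b IH => _ /=.
  apply: (proj2 (h m s2 hm x1 fv1 _)) => c ca.
  by rewrite /s2 /= /upd (negPf ca) fa1.
by apply: (proj1 (h m s1 hm _ fv1 fa1)).
Qed.

Definition scatter (a n : nat) (c d e : expr) : prog :=
  PFor 20 n (PIf c (PWr a d e) PSkip).

Lemma scatterP a n c d e s (P : nat -> bool) (f g : nat -> nat) :
  (forall k s', k < var s n -> var s' 20 = k ->
     (forall x, x != 20 -> var s' x = var s x) ->
     (forall b, b != a -> arr s' b = arr s b) ->
     (eval c s' != 0) = P k /\ (P k -> eval d s' = f k /\ eval e s' = g k)) ->
  (forall j k, j < var s n -> k < var s n -> P j -> P k -> f j = f k -> j = k) ->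
  forall k, k < var s n -> P k -> arr (sem (scatter a n c d e) s) a (f k) = g k.
Proof.
move=> h inj; apply: (@for_frame (fun m s' => forall k, k < m -> P k -> arr s' a (f k) = g k)) => //
  m s' hm IH fv fa j hj Pj; set s1 := set_var s' 20 m.
have [x x20|b ba|hc hde] := h m s1 hm erefl.
- by rewrite var_set (negPf x20) fv //= orbF.
- by apply: fa; rewrite /= orbF.
rewrite -[sem _ s1]/(if eval c s1 != 0 then set_arr s1 a (eval d s1) (eval e s1) else s1) hc.
case: (eqVneq j m) => [ej|ne].
  by subst j; rewrite Pj; have [-> ->] := hde Pj; rewrite arr_set !eqxx.
have jm : j < m by rewrite ltn_neqAle ne -ltnS.
case: ifP => Pm; last exact: IH.
have [-> _] := hde Pm; rewrite arr_set eqxx /=; case: eqP => [e1|_]; last exact: IH.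
have jn := ltn_trans jm hm.
by rewrite (inj _ _ jn hm Pj Pm e1) ltnn in jm.
Qed.

End Fill.

Section Coding.
Variables (X : fcomplex) (Y : complex_over X).
Notation V := (fvert (dom Y)).
Notation E := (fcell1 (dom Y)).
Notation F := (fcell2 (dom Y)).
Variables (nv : V -> nat) (ne : E -> nat) (nf : F -> nat).

Definition nl (o : oedge (dom Y)) : nat := letter (ne o.1) o.2.

(** The layout of [holds_complex], with the attaching maps moved to the arrays [BD i]. *)
Definition coded (s : state) : Prop :=
  [/\ var s 0 = #|V|, var s 1 = #|E|, var s 2 = #|F|
    & [/\ numbering nv, numbering ne, numbering nf,
          forall e, [/\ arr s 0 (ne e) = nv (fsrc e), arr s 1 (ne e) = nv (ftgt e)
                      & arr s 2 (ne e) = letter_of (me Y e)]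
        & forall S, arr s 3 (nf S) = enum_rank (mf Y S : fcell2 X) /\
            forall i o, onth (lift_bd Y S) i = Some o -> arr s (BD i) (nf S) = nl o]].

Lemma coded_ext s s' :
  (forall x, x < 3 -> var s' x = var s x) ->
  (forall a, a < 4 -> arr s' a = arr s a) -> (forall i, arr s' (BD i) = arr s (BD i)) ->
  coded s -> coded s'.
Proof.
move=> hv ha hb [h1 h2 h3 [n1 n2 n3 he hf]]; split; rewrite ?hv //; split=> //.
  by move=> e; have [g1 g2 g3] := he e; rewrite !ha.
move=> S; have [g1 g2] := hf S; rewrite ha //; split=> // i o ho.
by rewrite hb; apply: g2.
Qed.

Hypothesis Nv : numbering nv.
Hypothesis Ne : numbering ne.
Hypothesis Nf : numbering nf.

Lemma nl_inj : injective nl.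
Proof. by move=> [e b] [e' b'] /letter_inj[/= /(proj1 Ne) -> ->]. Qed.

Lemma nl_lt o : nl o < #|E| + #|E|.
Proof. by apply: letter_lt; apply: (proj2 Ne). Qed.

Lemma nl_onto x : x < #|E| + #|E| -> exists o, nl o = x.
Proof.
have [n [b ->]] := letterP x; rewrite addnn => h.
have hn : n < #|E|.
  by rewrite -ltn_double (leq_ltn_trans _ h) // leq_addr.
by have [e <-] := numbering_onto Ne hn; exists (e, b).
Qed.

Definition tables (s : state) : Prop := forall o,
  [/\ arr s 4 (nl o) = nv (osrc o), arr s 5 (nl o) = nv (otgt o),
      arr s 6 (nl o) = letter_of (mo Y o), arr s 7 (nl o) = nl (oinv o)
    & arr s 8 (nl o) = ne o.1].

Definition set_limits (M : nat) : prog :=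
  pseq [:: PSet 10 (EVar 0); PSet 11 (EVar 1); PSet 12 (EAdd (EVar 1) (EVar 1));
           PSet 13 (EVar 2); PSet 14 (ECst #|fcell1 X|);
           PSet 34 (EAdd (EVar 0) (ECst M)); PSet 35 (EAdd (EVar 1) (ECst M))].

Definition limits (s : state) : Prop :=
  [/\ var s 10 = #|V|, var s 11 = #|E|, var s 12 = #|E| + #|E|, var s 13 = #|F|
    & var s 14 = #|fcell1 X| ].

(** Room for the cells that an attachment may add. *)
Definition room (M : nat) (s : state) : Prop :=
  var s 34 = #|V| + M /\ var s 35 = #|E| + M.

Lemma set_limitsP M s : coded s -> let s' := sem (set_limits M) s in
  limits s' /\ room M s'.
Proof. by case=> h0 h1 h2 _; rewrite /limits /room /= /upd /= h0 h1 h2. Qed.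

Let v1 := EVar 20.
Definition inverse_letters : prog :=
  fill2 9 14 (EAdd (EDbl v1) (ECst 1)) (EDbl v1).

Lemma inverse_lettersP s : limits s -> forall n b, n < #|fcell1 X| ->
  arr (sem inverse_letters s) 9 (letter n b) = letter n (~~ b).
Proof.
case=> _ _ _ _ h14 n b hn; rewrite -{}h14 in hn.
apply: (fill2P (g := fun n b => letter n (~~ b)) _ _ hn) => k s' hk h20 _ _.
by rewrite /= h20 addnn /letter addn0 addn1.
Qed.

Definition oriented_tables : prog :=
  pseq [:: fill2 4 11 (ERd 0 v1) (ERd 1 v1); fill2 5 11 (ERd 1 v1) (ERd 0 v1);
           fill2 6 11 (ERd 2 v1) (ERd 9 (ERd 2 v1));
           fill2 7 11 (EAdd (EDbl v1) (ECst 1)) (EDbl v1); fill2 8 11 v1 v1].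

Lemma oriented_tablesP s : coded s -> limits s ->
  (forall n b, n < #|fcell1 X| -> arr s 9 (letter n b) = letter n (~~ b)) ->
  tables (sem oriented_tables s).
Proof.
move=> [_ _ _ [_ _ _ he _]] [_ h11 _ _ _] inv.
set t1 := fill2 4 11 (ERd 0 v1) (ERd 1 v1); set t2 := fill2 5 11 (ERd 1 v1) (ERd 0 v1).
set t3 := fill2 6 11 (ERd 2 v1) (ERd 9 (ERd 2 v1)).
set t4 := fill2 7 11 (EAdd (EDbl v1) (ECst 1)) (EDbl v1); set t5 := fill2 8 11 v1 v1.
pose s1 := sem t1 s; pose s2 := sem t2 s1; pose s3 := sem t3 s2; pose s4 := sem t4 s3.
have -> : sem oriented_tables s = sem t5 s4 by [].
have L1 : var s1 11 = #|E| by rewrite [LHS]sem_var.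
have L2 : var s2 11 = #|E| by rewrite [LHS]sem_var.
have L3 : var s3 11 = #|E| by rewrite [LHS]sem_var.
have L4 : var s4 11 = #|E| by rewrite [LHS]sem_var.
have at1 a : a != 4 -> arr s1 a = arr s a by move=> h; apply: sem_arr; rewrite /= orbb.
have at2 a : a != 5 -> arr s2 a = arr s1 a by move=> h; apply: sem_arr; rewrite /= orbb.
have at3 a : a != 6 -> arr s3 a = arr s2 a by move=> h; apply: sem_arr; rewrite /= orbb.
have at4 a : a != 7 -> arr s4 a = arr s3 a by move=> h; apply: sem_arr; rewrite /= orbb.
have at5 a : a != 8 -> arr (sem t5 s4) a = arr s4 a by move=> h; apply: sem_arr; rewrite /= orbb.
move=> [e b]; have he0 := proj2 Ne e; have [g0 g1 g2] := he e.
rewrite /nl; split.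
- rewrite at5 // at4 // at3 // at2 // (fill2P (g := fun k b => arr s b k)) ?h11 //; last first.
    by move=> k s' _ h20 _ fa; rewrite /= h20 !fa.
  by case: b.
- rewrite at5 // at4 // at3 // (fill2P (g := fun k b => arr s (~~ b) k)) ?L1 //; last first.
    by move=> k s' _ h20 _ fa; rewrite /= h20 !fa // !at1.
  by case: b.
- pose g k (b : bool) := if b then arr s 9 (arr s 2 k) else arr s 2 k.
  rewrite at5 // at4 // (fill2P (g := g)) ?L2 //; last first.
    by move=> k s' _ h20 _ fa; rewrite /= h20 !fa // !at2 // !at1.
  rewrite /g; case: b; rewrite g2 // /letter_of inv //.
- rewrite at5 // (fill2P (g := fun k b => letter k (~~ b))) ?L3 //.
  by move=> k s' _ h20 _ fa; rewrite /= h20 addnn /letter addn0 addn1.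
by rewrite (fill2P (g := fun k b => k)) ?L4.
Qed.

Lemma letter_of_lt (o : oedge X) : letter_of o < #|fcell1 X| + #|fcell1 X|.
Proof. exact: letter_lt. Qed.

(** A place in one array for each pair of a vertex and a label. In an immersed
complex it holds at most one 1-cell; where there is none, it holds anything. *)
Let K := #|fcell1 X| + #|fcell1 X|.
Definition slot (v l : expr) : expr := EAdd l (EMulc K v).
Definition slotn (v l : nat) : nat := l + K * v.

Arguments slot : simpl never.

Lemma eval_slot v l s : eval (slot v l) s = slotn (eval v s) (eval l s).
Proof. by rewrite /slot /= eval_mulc. Qed.

Lemma slotn_inj v l v' l' : l < K -> l' < K -> slotn v l = slotn v' l' -> v = v' /\ l = l'.
Proof.
rewrite /slotn ![K * _]mulnC => hl hl' h.
have e := congr1 (modn^~ K) h; rewrite /= ![_ + _ * K]addnC !modnMDl !modn_small // in e.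
split=> //; subst l'; have K0 : 0 < K by apply: leq_ltn_trans hl.
by move/eqP: h; rewrite eqn_add2l eqn_pmul2r // => /eqP.
Qed.

Definition fill_slots : prog :=
  PFor 20 12 (PWr 10 (slot (ERd 4 v1) (ERd 6 v1)) v1).

Definition oslot (o : oedge (dom Y)) : nat := slotn (nv (osrc o)) (letter_of (mo Y o)).

Definition slots (s : state) : Prop := forall o, exists o',
  [/\ arr s 10 (oslot o) = nl o', osrc o' = osrc o & mo Y o' = mo Y o].

Lemma letter_of_inj : injective (@letter_of X).
Proof.
by move=> [e b] [e' b'] /letter_inj[/= /val_inj/enum_rank_inj -> ->].
Qed.

Lemma oslot_inj o o' : oslot o = oslot o' -> osrc o = osrc o' /\ mo Y o = mo Y o'.
Proof.
move=> h; have [] := slotn_inj _ _ h; rewrite ?letter_of_lt // => /(proj1 Nv) -> h'.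
by split=> //; apply: letter_of_inj.
Qed.

Lemma fill_slotsP s : tables s -> limits s -> slots (sem fill_slots s).
Proof.
move=> tb [_ _ h12 _ _].
pose I k s' := forall o, nl o < k -> exists o',
  [/\ arr s' 10 (oslot o) = nl o', osrc o' = osrc o & mo Y o' = mo Y o].
suff h : I (#|E| + #|E|) (sem fill_slots s) by move=> o; apply: h; apply: nl_lt.
rewrite -h12; apply: for_frame => // k s' hk IH fv fa o ho.
have [o1 ho1] : exists o, nl o = k by apply: nl_onto; rewrite -h12.
set s1 := set_var s' 20 k.
have -> : sem (PWr 10 (slot (ERd 4 v1) (ERd 6 v1)) v1) s1 =
  set_arr s1 10 (eval (slot (ERd 4 v1) (ERd 6 v1)) s1) k by [].
have f4 : arr s' 4 = arr s 4 by apply: fa.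
have f6 : arr s' 6 = arr s 6 by apply: fa.
have -> : eval (slot (ERd 4 v1) (ERd 6 v1)) s1 = oslot o1.
  by rewrite eval_slot /= /upd /= f4 f6 -ho1; have [-> _ -> _ _] := tb o1.
rewrite arr_set eqxx /= -ho1.
case: eqVneq => [/oslot_inj[h1 h2]|h]; first by exists o1.
apply: IH; rewrite ltn_neqAle -ltnS ho andbT; apply/negP => /eqP e.
by rewrite -ho1 in e; move/eqP: h; apply; rewrite (nl_inj e).
Qed.

(** Two 1-cells with the same slot overwrite each other, so one of them is not found
in its slot. *)
Definition find_fold_loop : prog :=
  PFor 20 12 (PIf (ENeq (ERd 10 (slot (ERd 4 v1) (ERd 6 v1))) v1)
    (PSeq (PSet 15 (ECst 1)) (PSeq (PSet 16 v1)
       (PSet 17 (ERd 10 (slot (ERd 4 v1) (ERd 6 v1)))))) PSkip).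
Definition find_fold : prog := PSeq (PSet 15 (ECst 0)) find_fold_loop.

Definition foldable (o1 o2 : oedge (dom Y)) : Prop :=
  [/\ o1 <> o2, osrc o1 = osrc o2 & mo Y o1 = mo Y o2].

Lemma find_foldP s : tables s -> slots s -> limits s ->
  let s' := sem find_fold s in
  if var s' 15 == 0 then
    immersion1 Y /\ (forall o, arr s 10 (oslot o) = nl o)
  else exists o1 o2, [/\ foldable o1 o2, var s' 16 = nl o1 & var s' 17 = nl o2].
Proof.
move=> tb slt [_ _ h12 _ _].
pose I k s' := if var s' 15 == 0 then forall o, nl o < k -> arr s 10 (oslot o) = nl o
  else exists o1 o2, [/\ foldable o1 o2, var s' 16 = nl o1 & var s' 17 = nl o2].
suff h : I (#|E| + #|E|) (sem find_fold s).
  move: h; rewrite /I /=; case: eqP => // _ h.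
  have h' o : arr s 10 (oslot o) = nl o by apply: h; apply: nl_lt.
  split=> // o1 o2 e1 e2; apply: nl_inj; rewrite -!h' /oslot e1 e2.
  by [].
rewrite -h12; pose s1 := set_var s 15 0.
have -> : var s 12 = var s1 12 by [].
have -> : sem find_fold s = sem find_fold_loop s1 by [].
apply: for_frame => [|k s' hk IH fv fa]; first by rewrite /I.
have [o1 ho1] : exists o, nl o = k by apply: nl_onto; rewrite -h12.
set sl := slot _ _; set c := ENeq _ _.
have es : eval sl (set_var s' 20 k) = oslot o1.
  have f4 : arr s' 4 = arr s 4 by apply: fa.
  have f6 : arr s' 6 = arr s 6 by apply: fa.
  by rewrite eval_slot /= /upd /= f4 f6 -ho1; have [-> _ -> _ _] := tb o1.
have ec : (eval c (set_var s' 20 k) != 0) = (arr s 10 (oslot o1) != nl o1).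
  have f10 : arr s' 10 = arr s 10 by apply: fa.
  rewrite /c eval_neq -[eval (ERd 10 sl) _]/(arr s' 10 (eval sl (set_var s' 20 k))).
  by rewrite es f10 ho1.
have -> : sem (PIf c (PSeq (PSet 15 (ECst 1)) (PSeq (PSet 16 v1) (PSet 17 (ERd 10 sl)))) PSkip)
    (set_var s' 20 k) = if arr s 10 (oslot o1) != nl o1 then set_var (set_var (set_var
      (set_var s' 20 k) 15 1) 16 k) 17 (arr s 10 (oslot o1)) else set_var s' 20 k.
  rewrite -ec -[sem (PIf _ _ _) _]/(if eval c (set_var s' 20 k) != 0 then
    sem (PSeq (PSet 15 (ECst 1)) (PSeq (PSet 16 v1) (PSet 17 (ERd 10 sl)))) (set_var s' 20 k)
    else set_var s' 20 k); case: ifP => // _.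
  set s2 := set_var (set_var (set_var s' 20 k) 15 1) 16 k.
  have es2 : eval (ERd 10 sl) s2 = arr s 10 (oslot o1).
    have f10 : arr s' 10 = arr s 10 by apply: fa.
    by rewrite -es -f10 -[eval (ERd 10 sl) s2]/(arr s' 10 (eval sl s2)) !eval_slot.
  by rewrite -es2.
case: eqP => h /=.
  move: IH; rewrite /I /= /upd /=; case: eqP => // _ IH o; rewrite ltnS leq_eqVlt.
  case/orP=> [/eqP e|]; last exact: IH.
  by rewrite -ho1 in e; rewrite (nl_inj e).
rewrite /I /= /upd /=; have [o2 [h2 e1 e2]] := slt o1.
by exists o1, o2; split=> //; split=> // e; apply: h; rewrite h2 -e.
Qed.

End Coding.

(** * Folding *)

(** The renumbering of a quotient by the single identification of [u] with [w],
which may be equal. *)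
Definition collapse (n n' u w : nat) (rho : nat -> nat) : Prop :=
  [/\ forall x, x < n -> rho x < n', forall y, y < n' -> exists2 x, x < n & rho x = y
    & forall x y, x < n -> y < n ->
        rho x = rho y <-> [\/ x = y, x = u /\ y = w | x = w /\ y = u]].

Lemma numbering_ord n : numbering (fun i : 'I_n => val i).
Proof. by split=> [|i]; [exact: val_inj|rewrite card_ord; exact: (ltn_ord i)]. Qed.

Definition sort_pair : prog :=
  PIf (ELt (EVar 22) (EVar 23))
    (PSeq (PSet 24 (EVar 22)) (PSet 25 (EVar 23)))
    (PSeq (PSet 24 (EVar 23)) (PSet 25 (EVar 22))).

(** The larger of the two numbers in variables 22 and 23 is freed and given to the
last number, so that the numbers in use remain an initial segment. *)
Definition merge (a lim n r : nat) : prog :=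
  PSeq (fill a lim (EVar 20))
    (PIf (ENeq (EVar 22) (EVar 23))
      (PSeq sort_pair
        (PSeq (PWr a (ESub (EVar n) (ECst 1)) (EVar 25))
          (PSeq (PWr a (EVar 25) (EVar 24)) (PSet r (ESub (EVar n) (ECst 1))))))
      (PSet r (EVar n))).

Lemma sort_pairP s : let s' := sem sort_pair s in
  var s' 24 = minn (var s 22) (var s 23) /\ var s' 25 = maxn (var s 22) (var s 23).
Proof.
rewrite /sort_pair.
have -> : sem (PIf (ELt (EVar 22) (EVar 23)) (PSeq (PSet 24 (EVar 22)) (PSet 25 (EVar 23)))
    (PSeq (PSet 24 (EVar 23)) (PSet 25 (EVar 22)))) s =
  if eval (ELt (EVar 22) (EVar 23)) s != 0 then
    sem (PSeq (PSet 24 (EVar 22)) (PSet 25 (EVar 23))) s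
  else sem (PSeq (PSet 24 (EVar 23)) (PSet 25 (EVar 22))) s by [].
by rewrite eval_lt /minn /maxn /=; case: ltnP => h; rewrite /= /upd.
Qed.

Lemma collapse_pair n u w (rho : nat -> nat) : u < w -> w < n ->
  (forall x, x < n -> rho x = if x == w then u else if x == n.-1 then w else x) ->
  collapse n n.-1 u w rho.
Proof.
move=> uw wn hr; have n0 : 0 < n by apply: leq_ltn_trans wn.
have lt x : x < n -> x != n.-1 -> x < n.-1.
  by move=> xn ne; rewrite ltn_neqAle ne -ltnS prednK.
have un : u < n.-1 by apply: leq_trans uw _; rewrite -ltnS prednK.
split=> [x xn|y yn|x y xn yn].
- rewrite hr //; case: eqVneq => [_ //|xw]; case: eqVneq => [e|ne]; last exact: lt.
  by apply: lt => //; rewrite -e eq_sym.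
- case: (eqVneq y w) => [ey|yw].
    rewrite ey in yn *; exists n.-1; rewrite ?ltn_predL // hr ?ltn_predL //.
    by rewrite gtn_eqF // eqxx.
  exists y; first by apply: leq_trans yn (leq_pred n).
  by rewrite hr ?(negPf yw) ?ltn_eqF //; apply: leq_trans yn (leq_pred n).
rewrite !hr //; split=> [|[->//|[-> ->]|[-> ->]]]; last 2 first.
- by rewrite eqxx ltn_eqF // ltn_eqF.
- by rewrite eqxx ltn_eqF // ltn_eqF.
case: (eqVneq x w) => [ex|nx]; case: (eqVneq y w) => [ey|ny].
- by move=> _; constructor 1; rewrite ex ey.
- case: eqVneq => [_ e|_ e]; first by rewrite e ltnn in uw.
  by constructor 3.
- case: eqVneq => [_ e|_ e]; first by rewrite e ltnn in uw.
  by constructor 2.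
case: eqVneq => [ex|nx']; case: eqVneq => [ey|ny'] e.
- by constructor 1; rewrite ex ey.
- by rewrite e eqxx in ny.
- by rewrite e eqxx in nx.
by constructor 1.
Qed.

Lemma collapse_sym n n' u w rho : collapse n n' u w rho -> collapse n n' w u rho.
Proof.
move=> [h1 h2 h3]; split=> // x y xn yn; rewrite h3 //.
by split=> -[?|?|?]; [constructor 1|constructor 3|constructor 2|constructor 1|constructor 3|constructor 2].
Qed.

Lemma mergeP a lim n r s :
  n \notin [:: 20; 22; 23; 24; 25; r] -> var s n <= var s lim ->
  var s 22 < var s n -> var s 23 < var s n ->
  let s' := sem (merge a lim n r) s in
  collapse (var s n) (var s' r) (var s 22) (var s 23) (arr s' a).
Proof.
rewrite !inE !negb_or => /and5P[n20 n22 n23 n24 /andP[n25 nr]] hl hu hw.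
have [hf' _] := @fillP a lim (EVar 20) s id (fun k s' _ h _ _ _ => h).
have hf k (hk : k < var s n) := hf' k (leq_trans hk hl).
pose s1 := sem (fill a lim (EVar 20)) s.
have v1 x : x != 20 -> var s1 x = var s x by move=> h; apply: sem_var; rewrite /= orbF.
pose body := PSeq sort_pair (PSeq (PWr a (ESub (EVar n) (ECst 1)) (EVar 25))
  (PSeq (PWr a (EVar 25) (EVar 24)) (PSet r (ESub (EVar n) (ECst 1))))).
have -> : sem (merge a lim n r) s = if eval (ENeq (EVar 22) (EVar 23)) s1 != 0
  then sem body s1 else set_var s1 r (var s1 n) by [].
rewrite eval_neq -[eval (EVar 22) s1]/(var s1 22) -[eval (EVar 23) s1]/(var s1 23) !v1 //.
case: ifPn => [ne|/negPn/eqP e]; last first.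
  rewrite /= /upd eqxx -/s1 e; split=> [x xn|y yn|x y xn yn]; rewrite ?hf //; first by exists y; rewrite ?hf.
  by split=> [->|[->//|[-> ->]|[-> ->]]] //; constructor 1.
have [e24 e25] := sort_pairP s1; set s2 := sem sort_pair s1 in e24 e25 *.
rewrite !v1 // in e24 e25.
have v2n : var s2 n = var s n.
  by rewrite /s2 sem_var ?v1 //= ?orbF !negb_or n24 n25.
have a2 : arr s2 = arr s1.
  by rewrite /s2 /sort_pair /=; case: ifP.
pose s3 := set_arr s2 a (var s2 n - 1) (var s2 25).
pose s4 := set_arr s3 a (var s2 25) (var s2 24).
have -> : sem body s1 = set_var s4 r (var s2 n - 1) by [].
set s5 := set_var s4 r (var s2 n - 1).
have er : var s5 r = (var s n).-1 by rewrite /s5 /= /upd eqxx v2n subn1.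
cbv zeta; rewrite er.
set u := minn _ _ in e24; set w := maxn _ _ in e25.
have uw : u < w by rewrite /u /w /minn /maxn; case: (ltnP (var s 22)) => // h; rewrite ltn_neqAle eq_sym ne h.
have wn : w < var s n by rewrite /w gtn_max hu hw.
have hc : collapse (var s n) (var s n).-1 u w (arr s5 a).
  apply: collapse_pair => // x xn.
  have -> : arr s5 a x = arr s4 a x by [].
  by rewrite !arr_set eqxx /= e25 e24 v2n subn1 a2 hf.
move: hc; rewrite /u /w /minn /maxn; case: (ltnP (var s 22)) => // _; exact: collapse_sym.
Qed.

Section Fold.
Variables (X : wcomplex) (Y : complex_over X).
Notation V := (fvert (dom Y)).
Notation E := (fcell1 (dom Y)).
Notation F := (fcell2 (dom Y)).
Variables (nv : V -> nat) (ne : E -> nat) (nf : F -> nat).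
Hypothesis Nv : numbering nv.
Hypothesis Ne : numbering ne.
Hypothesis Nf : numbering nf.
Variables (x y : oedge (dom Y)).
Hypothesis fxy : foldable x y.
Notation nl := (nl ne).

Lemma foldable_cell1 : x.1 <> y.1.
Proof. by case: fxy => h1 _ h3 h4; apply: h1; apply: (mo_inj_cell1 h4 h3). Qed.

Section FoldQuotient.
Variables (V' E' : nat) (RV RE : nat -> nat).
Hypothesis cV : collapse #|V| V' (nv (otgt x)) (nv (otgt y)) RV.
Hypothesis cE : collapse #|E| E' (ne x.1) (ne y.1) RE.

Definition fold_pv (v : V) : 'I_V' := Ordinal (let: And3 h _ _ := cV in h _ (proj2 Nv v)).
(** The 1-cell [y.1] is identified with [x.1], with its direction reversed if [x]
and [y] run through their 1-cells in opposite directions. *)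
Definition fold_bit (o : oedge (dom Y)) : bool :=
  if (o.1 : E) == y.1 then o.2 (+) (x.2 (+) y.2) else o.2.
Definition fold_po (o : oedge (dom Y)) : 'I_E' * bool :=
  (Ordinal (let: And3 h _ _ := cE in h _ (proj2 Ne o.1)), fold_bit o).

Lemma fold_pv_eq u v : fold_pv u = fold_pv v <->
  [\/ u = v, u = otgt x /\ v = otgt y | u = otgt y /\ v = otgt x].
Proof.
have inj := proj1 Nv; have [_ _ h] := cV.
have {}h := h _ _ (proj2 Nv u) (proj2 Nv v); split.
  move/(congr1 val) => /= /h[/inj|[/inj ? /inj ?]|[/inj ? /inj ?]];
  by [constructor 1|constructor 2|constructor 3].
by move=> e; apply: val_inj; apply/h; case: e => [->|[-> ->]|[-> ->]];
  [constructor 1|constructor 2|constructor 3].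
Qed.

Lemma fold_po_eq o o' : fold_po o = fold_po o' <->
  [\/ o = o', [\/ o = x /\ o' = y | o = y /\ o' = x]
   | [\/ o = oinv x /\ o' = oinv y | o = oinv y /\ o' = oinv x]].
Proof.
have xy := foldable_cell1; have xy' : ((x.1 : E) == y.1) = false by apply/eqP.
have inj := proj1 Ne; have [_ _ h] := cE.
have {}h := h _ _ (proj2 Ne o.1) (proj2 Ne o'.1); split; last first.
  move=> e; rewrite /fold_po; congr (_, _).
    apply: val_inj; apply/h; case: e => [->|[[-> ->]|[-> ->]]|[[-> ->]|[-> ->]]];
    by [constructor 1|constructor 2|constructor 3].
  rewrite /fold_bit; case: e => [->|[[-> ->]|[-> ->]]|[[-> ->]|[-> ->]]] //=;
  by rewrite ?xy' eqxx; case: (x.2); case: (y.2).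
case=> /h hh; rewrite /fold_bit; case: o o' {h} hh => [e b] [e' b'] /=.
case=> [/inj <-|[/inj -> /inj ->]|[/inj -> /inj ->]].
- by case: eqP => _ hb; constructor 1; congr (_, _) => //; apply: (@addIb (x.2 (+) y.2)).
- rewrite xy' eqxx => hb; rewrite (surjective_pairing x) (surjective_pairing y) /oinv /=.
  by move: hb; case: b b' (x.2) (y.2) => [] [] [] [] //= _;
    solve [constructor 2; left; split; reflexivity|constructor 3; left; split; reflexivity].
rewrite xy' eqxx => hb; rewrite (surjective_pairing x) (surjective_pairing y) /oinv /=.
by move: hb; case: b b' (x.2) (y.2) => [] [] [] [] //= _;
  solve [constructor 2; right; split; reflexivity|constructor 3; right; split; reflexivity].
Qed.

Lemma fold_pv_onto v : exists u, fold_pv u == v.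
Proof.
have [_ h _] := cV; have [k hk e] := h v (ltn_ord v).
by have [u hu] := numbering_onto Nv hk; exists u; apply/eqP/val_inj; rewrite /= hu.
Qed.

Lemma fold_edge_of (e' : 'I_E') : exists e : E, [/\ e <> y.1, RE (ne e) = e'
  & fold_po (e, false) = (e', false)].
Proof.
have xy := foldable_cell1; have [_ h h'] := cE; have [k hk e] := h e' (ltn_ord e').
have [u hu] := numbering_onto Ne hk; rewrite -hu in e.
suff [w wy hw] : exists2 w : E, w <> y.1 & RE (ne w) = e'.
  exists w; split=> //; rewrite /fold_po /fold_bit /=; case: eqP => // _.
  by congr (_, _); apply: val_inj.
case: (u =P y.1) => [uy|uy]; last by exists u.
exists x.1 => //; rewrite -e uy; apply/h'; [exact: (proj2 Ne)|exact: (proj2 Ne)|].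
by constructor 2.
Qed.

Lemma fold_po_flip o : fold_po (oinv o) = flip (fold_po o).
Proof.
rewrite /fold_po /flip /=; congr (_, _).
by rewrite /fold_bit /=; case: eqP => _ //; rewrite addNb.
Qed.

Lemma fold_po_onto o' : exists e : E * bool, fold_po e == o'.
Proof.
case: o' => e' b; have [e [_ _ h]] := fold_edge_of e'.
case: b; last by exists (e, false); rewrite h.
by exists (e, true); rewrite -[(e, true)]/(oinv ((e, false) : oedge (dom Y))) fold_po_flip h.
Qed.

Let osxy : osrc x = osrc y. Proof. by case: fxy. Qed.
Let moxy : mo Y x = mo Y y. Proof. by case: fxy. Qed.

Lemma fold_pv_mv u v : fold_pv u = fold_pv v -> mv Y u = mv Y v.
Proof. by move/fold_pv_eq=> [->|[-> ->]|[-> ->]] //; rewrite -!otgt_mo moxy. Qed.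

Lemma fold_po_mo o o' : fold_po o = fold_po o' -> mo Y o = mo Y o'.
Proof. by move/fold_po_eq=> [->|[[-> ->]|[-> ->]]|[[-> ->]|[-> ->]]] //; rewrite ?mo_inv moxy. Qed.

Lemma fold_po_src o o' : fold_po o = fold_po o' -> fold_pv (osrc o) = fold_pv (osrc o').
Proof.
move/fold_po_eq=> [->|[[-> ->]|[-> ->]]|[[-> ->]|[-> ->]]] //; rewrite ?osxy //;
apply/fold_pv_eq; by [constructor 2|constructor 3].
Qed.

Definition folded : complex_over X :=
  quotient fold_pv_onto fold_po_onto fold_po_flip fold_pv_mv fold_po_mo fold_po_src.

Lemma folded_is_fold : is_fold Y folded.
Proof.
exists (oinv x), y, (q_proj fold_pv_onto fold_po_onto fold_po_flip fold_pv_mv fold_po_mo fold_po_src).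
split; first by split; rewrite ?otgt_inv //; [exact: foldable_cell1|rewrite mo_inv oinvK].
split; split=> //=.
- by move=> v; have [u /eqP] := fold_pv_onto v; exists u.
- move=> u v; split=> [/fold_pv_eq[->|[-> ->]|[-> ->]]|].
  + exact: rst_refl.
  + by apply: rst_step; have := FoldVert (oinv x) y.
  + by apply: rst_sym; apply: rst_step; have := FoldVert (oinv x) y.
  elim=> {u v} [u v []|//|//|u v w _ -> _ ->] //.
  by apply/fold_pv_eq; constructor 2.
- by move=> o; have [e /eqP] := fold_po_onto o; exists e.
- have st1 : clos_refl_sym_trans _ (fold_edge (oinv x) y) x y.
    by apply: rst_step; have := FoldEdge (oinv x) y; rewrite oinvK.
  have st2 : clos_refl_sym_trans _ (fold_edge (oinv x) y) (oinv x) (oinv y).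
    by apply: rst_step; apply: FoldEdgeInv.
  move=> o o'; split=> [/fold_po_eq[->|[[-> ->]|[-> ->]]|[[-> ->]|[-> ->]]]|] //.
  + exact: rst_refl.
  + exact: rst_sym.
  + exact: rst_sym.
  elim=> {o o'} [o o' []|//|//|o o' o'' _ -> _ ->] //; apply/fold_po_eq.
    by constructor 2; left; rewrite oinvK.
  by constructor 3; left.
- by move=> S; exists S.
by move=> S S'; split=> [->|]; [exact: rst_refl|elim=> // a b c _ -> _ ->].
Qed.

Lemma folded_coded s :
  [/\ var s 0 = V', var s 1 = E' & var s 2 = #|F|] ->
  (forall e : E, e <> y.1 -> [/\ arr s 0 (RE (ne e)) = RV (nv (fsrc e)),
     arr s 1 (RE (ne e)) = RV (nv (ftgt e)) & arr s 2 (RE (ne e)) = letter_of (me Y e)]) ->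
  (forall S : F, arr s 3 (nf S) = enum_rank (mf Y S : fcell2 X) /\
     forall i o, onth (lift_bd Y S) i = Some o ->
       arr s (BD i) (nf S) = letter (RE (ne o.1)) (fold_bit o)) ->
  coded (Y := folded) (fun v : 'I_V' => val v) (fun e : 'I_E' => val e) nf s.
Proof.
case=> h0 h1 h2 he hf; split; rewrite ?card_ord //; split.
- exact: numbering_ord.
- exact: numbering_ord.
- exact: Nf.
- move=> e'; have [e [ey re fe]] := fold_edge_of e'; have [g0 g1 g2] := he e ey.
  have [q1 q2 q3] := q_edge fold_po_onto fold_po_flip fold_po_mo fold_po_src fe.
  split.
  + by rewrite (q1 : fsrc e' = _); apply: etrans (congr1 (arr s 0) (esym re)) _.
  + by rewrite (q2 : ftgt e' = _); apply: etrans (congr1 (arr s 1) (esym re)) _.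
  + by rewrite (q3 : me folded e' = _); apply: etrans (congr1 (arr s 2) (esym re)) _.
move=> S; have [g3 g4] := hf S; split=> // i o'.
rewrite q_lift_bd onth_map; case E1 : (onth _ _) => [o|] //= -[<-].
by rewrite (g4 _ _ E1).
Qed.

End FoldQuotient.
Let v1 := EVar 20.

(** The letter of a 1-cell is renamed through the number of the 1-cell; this has the
wrong direction for [y] if [y.1] is reversed, and [y] is given the letter of [x]. *)
Definition rename_letters : prog :=
  PSeq (fill2 16 11 (EDbl (ERd 15 v1)) (EAdd (EDbl (ERd 15 v1)) (ECst 1)))
    (PSeq (PWr 16 (EVar 17) (ERd 16 (EVar 16)))
          (PWr 16 (ERd 7 (EVar 17)) (ERd 16 (ERd 7 (EVar 16))))).

Lemma rename_lettersP s : tables nv ne s -> limits Y s -> var s 16 = nl x -> var s 17 = nl y ->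
  arr s 15 (ne x.1) = arr s 15 (ne y.1) ->
  forall o, arr (sem rename_letters s) 16 (nl o) = letter (arr s 15 (ne o.1)) (fold_bit o).
Proof.
move=> tb [_ h11 _ _ _] e16 e17 e15 o; have inj := nl_inj Ne.
pose f := fill2 16 11 (EDbl (ERd 15 v1)) (EAdd (EDbl (ERd 15 v1)) (ECst 1)).
pose s1 := sem f s.
have hs1 o' : arr s1 16 (nl o') = letter (arr s 15 (ne o'.1)) o'.2.
  apply: (fill2P (g := fun k b => letter (arr s 15 k) b)); last by rewrite h11; apply: (proj2 Ne).
  by move=> k s' _ h20 _ fa; rewrite /= h20 fa // addnn /letter addn0.
have w16 : var s1 16 = nl x by rewrite -e16; apply: sem_var.
have w17 : var s1 17 = nl y by rewrite -e17; apply: sem_var.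
have a7 : arr s1 7 = arr s 7 by apply: sem_arr.
pose s2 := set_arr s1 16 (nl y) (arr s1 16 (nl x)).
have -> : sem rename_letters s = set_arr s2 16 (nl (oinv y)) (arr s2 16 (nl (oinv x))).
  have e1 : sem (PWr 16 (EVar 17) (ERd 16 (EVar 16))) s1 = s2 by rewrite /s2 -w16 -w17.
  rewrite -[sem rename_letters s]/(sem (PWr 16 (ERd 7 (EVar 17)) (ERd 16 (ERd 7 (EVar 16))))
    (sem (PWr 16 (EVar 17) (ERd 16 (EVar 16))) s1)) e1.
  rewrite -[sem _ s2]/(set_arr s2 16 (arr s1 7 (var s1 17)) (arr s2 16 (arr s1 7 (var s1 16)))).
  rewrite a7 w16 w17; have [_ _ _ -> _] := tb x; by have [_ _ _ -> _] := tb y.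
have xy : x.1 <> y.1 by exact: foldable_cell1.
have xy' : nl (oinv x) = nl y -> False by move/inj => h; apply: xy; rewrite -h.
rewrite !arr_set !eqxx /= /fold_bit; case: (eqVneq (nl o) (nl (oinv y))) => [/inj ->|n1].
  rewrite eqxx; case: eqP => [/xy' //|_]; rewrite hs1 e15 /=.
  by congr letter; case: x.2; case: y.2.
case: (eqVneq (nl o) (nl y)) => [/inj ->|n2].
  by rewrite eqxx hs1 e15; congr letter; case: x.2; case: y.2.
rewrite hs1; case: eqP => // e; have [h|h] := @same_cell1 (dom Y) y o (esym e); subst o.
  by rewrite eqxx in n2.
by rewrite eqxx in n1.
Qed.

Definition rename_arrays (l : seq nat) : prog :=
  pseq [seq fill (BD i) 13 (ERd 16 (ERd (BD i) v1)) | i <- l].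

Lemma rename_arrays_cons j l s : sem (rename_arrays (j :: l)) s =
  sem (rename_arrays l) (sem (fill (BD j) 13 (ERd 16 (ERd (BD j) v1))) s).
Proof. by []. Qed.

Lemma rename_arrays_var l z : z != 20 -> ~~ modv z (rename_arrays l).
Proof.
by move=> h; elim: l => //= i l IH; rewrite (negPf h) /=.
Qed.

Lemma rename_arrays_arr l a : (forall i, i \in l -> a != BD i) -> ~~ moda a (rename_arrays l).
Proof.
elim: l => // i l IH h.
rewrite -[moda _ _]/((a == BD i) || moda a (rename_arrays l)) (negPf (h i _)) ?mem_head //.
by apply: IH => j jl; apply: h; rewrite inE jl orbT.
Qed.

Lemma rename_arraysP l s i k : uniq l -> i \in l -> k < var s 13 ->
  arr (sem (rename_arrays l) s) (BD i) k = arr s 16 (arr s (BD i) k).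
Proof.
elim: l s => // j l IH s; rewrite cons_uniq => /andP[jl ul] il hk.
rewrite rename_arrays_cons; set s1 := sem (fill _ _ _) s.
have v13 : var s1 13 = var s 13 by apply: sem_var.
have a16 : arr s1 16 = arr s 16 by apply: sem_arr; apply: (negbT (neq_BD j _)).
move: il; rewrite inE; case: (eqVneq i j) => [-> _|ij il]; last first.
  rewrite IH ?v13 // a16; congr (arr s 16 _); congr (_ k).
  by apply: sem_arr; rewrite -[moda _ _]/(BD i == BD j) BD_eq.
rewrite sem_arr; last first.
  by apply: rename_arrays_arr => i' i'l; rewrite BD_eq; apply: contraNneq jl => ->.
have [|h _] := @fillP (BD j) 13 (ERd 16 (ERd (BD j) v1)) s (fun k => arr s 16 (arr s (BD j) k));
  last by rewrite h.
move=> m s' _ h20 _ fa fj; rewrite -[LHS]/(arr s' 16 (arr s' (BD j) (var s' 20))).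
by rewrite h20 fa ?neq_BD // fj.
Qed.

Definition merge_edges : prog :=
  PSeq (PSet 22 (ERd 8 (EVar 16))) (PSeq (PSet 23 (ERd 8 (EVar 17)))
    (PSeq (PSet 26 (ERd 8 (EVar 17))) (merge 15 11 11 18))).
Definition merge_ends : prog :=
  PSeq (PSet 22 (ERd 5 (EVar 16))) (PSeq (PSet 23 (ERd 5 (EVar 17))) (merge 14 10 10 19)).
(** The data of the 1-cell [y.1], which variable 26 remembers, are dropped: they
would overwrite those of [x.1], perhaps with the other direction. *)
Definition move_edges : prog :=
  let c := ENeq v1 (EVar 26) in let d := ERd 15 v1 in
  PSeq (scatter 0 11 c d (ERd 14 (ERd 4 (EDbl v1))))
    (PSeq (scatter 1 11 c d (ERd 14 (ERd 5 (EDbl v1))))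
          (scatter 2 11 c d (ERd 6 (EDbl v1)))).
Definition finish_fold : prog :=
  PSeq (PSet 0 (EVar 19)) (PSeq (PSet 1 (EVar 18)) (PSet 3 (ECst 1))).
Definition perform_fold : prog :=
  PSeq merge_edges (PSeq merge_ends (PSeq rename_letters (PSeq move_edges
    (PSeq (rename_arrays (iota 0 (max_bd X))) finish_fold)))).

Lemma perform_foldP s : coded nv ne nf s -> tables nv ne s -> limits Y s ->
  var s 16 = nl x -> var s 17 = nl y ->
  let s' := sem perform_fold s in
  var s' 3 = 1 /\ exists Y', is_fold Y Y' /\ exists nv' ne' nf', coded (Y := Y') nv' ne' nf' s'.
Proof.
move=> cd tb lm e16 e17; have [h10 h11 h12 h13 h14] := lm.
have [_ _ c2 [_ _ _ ce cf]] := cd.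
have [tx4 tx5 tx6 tx7 tx8] := tb x; have [ty4 ty5 ty6 ty7 ty8] := tb y.
pose s1 := sem merge_edges s; pose s2 := sem merge_ends s1.
pose s3 := sem rename_letters s2; pose s4 := sem move_edges s3.
pose s5 := sem (rename_arrays (iota 0 (max_bd X))) s4; pose s6 := sem finish_fold s5.
rewrite (erefl : sem perform_fold s = s6).
have vs1 z : ~~ modv z merge_edges -> var s1 z = var s z := @sem_var z _ s.
have vs2 z : ~~ modv z merge_ends -> var s2 z = var s1 z := @sem_var z _ s1.
have vs3 z : ~~ modv z rename_letters -> var s3 z = var s2 z := @sem_var z _ s2.
have vs4 z : ~~ modv z move_edges -> var s4 z = var s3 z := @sem_var z _ s3.
have vs5 z : z != 20 -> var s5 z = var s4 z.
  by move=> h; apply: sem_var; apply: rename_arrays_var.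
have as1 a : a != 15 -> arr s1 a = arr s a.
  by move=> h; apply: sem_arr; rewrite /= (negPf h).
have as2 a : a != 14 -> arr s2 a = arr s1 a.
  by move=> h; apply: sem_arr; rewrite /= (negPf h).
have as3 a : a != 16 -> arr s3 a = arr s2 a.
  by move=> h; apply: sem_arr; rewrite /= (negPf h).
have as4 a : a != 0 -> a != 1 -> a != 2 -> arr s4 a = arr s3 a.
  by move=> n0 n1 n2; apply: sem_arr; rewrite /= (negPf n0) (negPf n1) (negPf n2).
have cE : collapse #|E| (var s1 18) (ne x.1) (ne y.1) (arr s1 15).
  pose s0 := set_var (set_var (set_var s 22 (arr s 8 (var s 16))) 23 (arr s 8 (var s 17)))
    26 (arr s 8 (var s 17)).
  have e22 : var s0 22 = ne x.1 by rewrite -tx8 -e16.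
  have e23 : var s0 23 = ne y.1 by rewrite -ty8 -e17.
  have e11 : var s0 11 = #|E| by rewrite -h11.
  have := @mergeP 15 11 11 18 s0 isT (leqnn _); rewrite e22 e23 e11 => h.
  exact: h (proj2 Ne _) (proj2 Ne _).
have v26 : var s1 26 = ne y.1.
  rewrite /s1 /merge_edges; rewrite -ty8 -e17.
  pose s0 := set_var (set_var (set_var s 22 (arr s 8 (var s 16))) 23 (arr s 8 (var s 17)))
    26 (arr s 8 (var s 17)).
  exact: (@sem_var 26 (merge 15 11 11 18) s0).
have cV : collapse #|V| (var s2 19) (nv (otgt x)) (nv (otgt y)) (arr s2 14).
  pose s0 := set_var (set_var s1 22 (arr s1 5 (var s1 16))) 23 (arr s1 5 (var s1 17)).
  have e22 : var s0 22 = nv (otgt x) by rewrite -tx5 -e16 -(vs1 16) // -as1.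
  have e23 : var s0 23 = nv (otgt y) by rewrite -ty5 -e17 -(vs1 17) // -as1.
  have e10 : var s0 10 = #|V| by rewrite -h10 -(vs1 10).
  have := @mergeP 14 10 10 19 s0 isT (leqnn _); rewrite e22 e23 e10 => h.
  exact: h (proj2 Nv _) (proj2 Nv _).
have tb2 : tables nv ne s2 by move=> o; rewrite !as2 // !as1.
have lm2 : limits Y s2 by split; rewrite vs2 // vs1.
have re : arr s1 15 (ne x.1) = arr s1 15 (ne y.1).
  have [_ _ h] := cE; apply/h; [exact: (proj2 Ne)|exact: (proj2 Ne)|by constructor 2].
have rl o : arr s3 16 (nl o) = letter (arr s1 15 (ne o.1)) (fold_bit o).
  by rewrite (rename_lettersP tb2 lm2) ?as2 // vs2 // vs1.
have tb3 : tables nv ne s3 by move=> o; rewrite !as3.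
have a14 : arr s3 14 = arr s2 14 by rewrite as3.
have a15 : arr s3 15 = arr s1 15 by rewrite as3 // as2.
have L11 : var s3 11 = #|E| by rewrite vs3 // vs2 // vs1.
have L26 : var s3 26 = ne y.1 by rewrite vs3 // vs2.
pose c := ENeq v1 (EVar 26); pose d := ERd 15 v1.
have e4 : s4 = sem (scatter 2 11 c d (ERd 6 (EDbl v1)))
  (sem (scatter 1 11 c d (ERd 14 (ERd 5 (EDbl v1))))
    (sem (scatter 0 11 c d (ERd 14 (ERd 4 (EDbl v1)))) s3)) by exact: erefl.
have as6 : arr s6 = arr s5 by exact: erefl.
have [go6 e60 e61 e62] : [/\ var s6 3 = 1, var s6 0 = var s5 19, var s6 1 = var s5 18
  & var s6 2 = var s5 2] by split; exact: erefl.
have L13 : var s4 13 = #|F| by rewrite vs4 // vs3 // vs2 // vs1.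
have as5 a : a < 24 -> arr s5 a = arr s4 a.
  by move=> h; apply: sem_arr; apply: rename_arrays_arr => i _; rewrite neq_BD.
have bd5 i k : i < max_bd X -> k < #|F| -> arr s5 (BD i) k = arr s4 16 (arr s4 (BD i) k).
  by move=> hi hk; rewrite rename_arraysP ?iota_uniq ?mem_iota // L13.
clearbody s6 s5 s4 s3 s2 s1.
have h4 (e : E) : e <> y.1 -> [/\ arr s4 0 (arr s1 15 (ne e)) = arr s2 14 (nv (fsrc e)),
    arr s4 1 (arr s1 15 (ne e)) = arr s2 14 (nv (ftgt e))
  & arr s4 2 (arr s1 15 (ne e)) = letter_of (me Y e)].
  move=> ey.
  pose t1 := sem (scatter 0 11 c d (ERd 14 (ERd 4 (EDbl v1)))) s3.
  pose t2 := sem (scatter 1 11 c d (ERd 14 (ERd 5 (EDbl v1)))) t1.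
  rewrite -/t1 -/t2 in e4.
  have et1 : t1 = sem (scatter 0 11 c d (ERd 14 (ERd 4 (EDbl v1)))) s3 by exact: erefl.
  have et2 : t2 = sem (scatter 1 11 c d (ERd 14 (ERd 5 (EDbl v1)))) t1 by exact: erefl.
  have at1 a : a != 0 -> arr t1 a = arr s3 a.
    by move=> h; apply: sem_arr; rewrite /= (negPf h).
  have at2 a : a != 1 -> arr t2 a = arr t1 a.
    by move=> h; apply: sem_arr; rewrite /= (negPf h).
  have vt1 z : z != 20 -> var t1 z = var s3 z.
    by move=> h; apply: sem_var; rewrite /= (negPf h).
  have vt2 z : z != 20 -> var t2 z = var t1 z.
    by move=> h; apply: sem_var; rewrite /= (negPf h).
  clearbody t2 t1.
  have Py : ne e != ne y.1 by apply/eqP => /(proj1 Ne).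
  have hk := proj2 Ne e.
  have cond t k s' : (forall z, z != 20 -> var t z = var s3 z) ->
      (forall z, z != 20 -> var s' z = var t z) -> var s' 20 = k ->
      (eval c s' != 0) = (k != ne y.1).
    move=> ht hv h20; rewrite eval_neq -[eval v1 s']/(var s' 20) h20.
    by rewrite -[eval (EVar 26) s']/(var s' 26) hv // ht // L26.
  have inj j k : j < #|E| -> k < #|E| -> j != ne y.1 -> k != ne y.1 ->
      arr s1 15 j = arr s1 15 k -> j = k.
    move=> jE kE jy ky; have [_ _ h] := cE; move/(h _ _ jE kE) => [//|[_ ek]|[ej _]].
      by rewrite ek eqxx in ky.
    by rewrite ej eqxx in jy.
  have dbl k : k + k = letter k false by rewrite /letter addn0 addnn.
  have [q4 q5 q6 _ _] := tb3 (e, false); rewrite /nl /= -dbl in q4 q5 q6.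
  split.
  - rewrite e4 sem_arr // at2 // et1.
    rewrite (@scatterP 0 11 c d (ERd 14 (ERd 4 (EDbl v1))) s3 (fun k => k != ne y.1)
      (arr s1 15) (fun k => arr s2 14 (arr s3 4 (k + k)))) ?L11 // ?q4 //.
    move=> k s' kE h20 hv ha; rewrite (cond s3 k) //; split=> // _.
    by rewrite /= h20 !ha // a14 a15.
  - rewrite e4 sem_arr // et2.
    rewrite (@scatterP 1 11 c d (ERd 14 (ERd 5 (EDbl v1))) t1 (fun k => k != ne y.1)
      (arr s1 15) (fun k => arr s2 14 (arr s3 5 (k + k)))) ?vt1 ?L11 // ?q5 //.
    move=> k s' kE h20 hv ha; rewrite (cond t1 k) //; split=> // _.
    by rewrite /= h20 !ha // !at1 // a14 a15.
  rewrite e4 (@scatterP 2 11 c d (ERd 6 (EDbl v1)) t2 (fun k => k != ne y.1)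
      (arr s1 15) (fun k => arr s3 6 (k + k))) ?vt2 ?vt1 ?L11 // ?q6 //.
  have vt2' z : z != 20 -> var t2 z = var s3 z by move=> h; rewrite vt2 // vt1.
  move=> k s' kE h20 hv ha; rewrite (cond t2 k) //; split=> // _.
  by rewrite /= h20 !ha // !at2 // !at1 // a15.
split=> //; exists (folded cV cE); split; first exact: folded_is_fold.
exists (fun v => val v), (fun e => val e), nf; apply: folded_coded.
- rewrite e60 e61 e62 !vs5 //; split.
  + by rewrite vs4 // vs3.
  + by rewrite vs4 // vs3 // vs2.
  by rewrite vs4 // vs3 // vs2 // vs1.
- by move=> e ey; rewrite as6 !as5 //; exact: h4.
move=> S; have [g3 g4] := cf S; rewrite as6; split.
  by rewrite as5 // as4 // as3 // as2 // as1.
move=> i o ho; have [hi _] := onth_Some o ho.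
have iM : i < max_bd X by apply: leq_trans hi _; rewrite size_lift_bd; exact: leq_max_bd.
rewrite bd5 //; last exact: (proj2 Nf).
have -> : arr s4 (BD i) = arr s (BD i).
  by rewrite as4 ?BD_neq // as3 ?BD_neq // as2 ?BD_neq // as1 ?BD_neq.
by rewrite (g4 _ _ ho) as4 // rl.
Qed.

End Fold.

(** * The quotient made by an attachment *)

Lemma new_vertex_lt k l n : l < k -> k < n -> k - l.+1 < (n - l).-1.
Proof. lia. Qed.

Lemma new_vertex_pos x l n : x < (n - l).-1 -> x + l.+1 < n.
Proof. lia. Qed.

Section Attach.
Variables (X : wcomplex) (Y : complex_over X).
Notation V := (fvert (dom Y)).
Notation E := (fcell1 (dom Y)).
Notation F := (fcell2 (dom Y)).
Variables (nv : V -> nat) (ne : E -> nat) (nf : F -> nat).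
Hypothesis Nv : numbering nv.
Hypothesis Ne : numbering ne.
Hypothesis Nf : numbering nf.
Variables (R : cell2 X) (i : 'I_(size (bd R))) (v : vert (dom Y)) (q : seq (oedge (dom Y))).
Hypothesis site : attachment_site Y i v q.
Variable o0 : oedge (dom Y).
Notation L := (size (bd R)).
Notation l := (size q).

Definition walk_vert (k : nat) : V := if k is k'.+1 then otgt (nth o0 q k') else v.

(** Numbers of the vertices and codes of the 1-cells met along the boundary of the
packet from [i]: those of the attaching path, then new ones. *)
Definition va (k : nat) : nat :=
  if k <= l then nv (walk_vert k) else if k < L then #|V| + (k - l.+1) else nv v.
Definition qe (k : nat) : nat * bool :=
  if k < l then (ne (nth o0 q k).1, (nth o0 q k).2) else (#|E| + (k - l), false).

(** The position of the vertex [c] of the boundary circle counted from [i]. *)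
Definition pos (c : nat) : nat := (c + (L - i)) %% L.

Let L0 : 0 < L := bd_size_gt0 R.
Let lL : l <= L := site_size site.

Lemma pos_lt c : pos c < L. Proof. by rewrite ltn_mod. Qed.

Lemma cyc_pos (c : 'I_L) : cyc R (i + pos c) = c.
Proof.
rewrite -[RHS]cyc_ord; apply/cyc_modP.
by rewrite modnDmr addnCA subnKC ?modnDr // ltnW.
Qed.

Lemma pos_cyc k : pos (cyc R (i + k)) = k %% L.
Proof. by rewrite /pos /= modnDml addnAC subnKC ?modnDl // ltnW. Qed.

Lemma pos_inj (c c' : 'I_L) : pos c = pos c' -> c = c'.
Proof. by move=> h; rewrite -(cyc_pos c) h cyc_pos. Qed.

Let CV := (V + 'I_L)%type.
Definition num_v (z : CV) : nat := match z with inl u => nv u | inr c => va (pos c) end.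

Variables (V' : nat) (RV : nat -> nat).
Notation Vn := (#|V| + (L - l).-1).
Hypothesis cV : collapse Vn V' (va 0) (va L) RV.
Notation E' := (#|E| + (L - l)).

Lemma num_v_lt z : num_v z < Vn.
Proof.
have h u : nv u < Vn by apply: leq_trans (proj2 Nv u) (leq_addr _ _).
case: z => [//|c] /=; rewrite /va; case: (leqP (pos c) l) => // hl; rewrite pos_lt ltn_add2l.
have hc := pos_lt c.
exact: new_vertex_lt hl hc.
Qed.

Notation gv := (glue_vert (H := packet R) v q (i : vert (packet R)) (arc i l)).
Notation gvc := (clos_refl_sym_trans (vert (dom Y) + vert (packet R)) gv).

Lemma walk_vert_glue k : k <= l -> gvc (inl (walk_vert k)) (inr (cyc R (i + k) : vert (packet R))).
Proof.
case: k => [_|k hk]; first by rewrite addn0 cyc_ord; apply: rst_step; left.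
rewrite addnS -otgt_circ; apply: rst_step; apply: (@GlueVert (dom Y) (packet R) v q i (arc i l) k).
  exact: onth_nth.
exact: onth_arc.
Qed.

Lemma num_v_old z u : num_v z = nv u -> gvc z (inl u).
Proof.
case: z => [u' /(proj1 Nv) ->|c] /=; first exact: rst_refl.
rewrite /va; case: (leqP (pos c) l) => [h /= /(proj1 Nv) <-|_].
  by apply: rst_sym; have := walk_vert_glue h; rewrite cyc_pos.
rewrite pos_lt => h; have := proj2 Nv u; rewrite -h.
by rewrite ltnNge leq_addr.
Qed.

Lemma num_v_eq z z' : num_v z = num_v z' -> gvc z z'.
Proof.
case: z z' => [u|c] z' h.
  by apply: rst_sym; apply: num_v_old.
case: z' h => [u|c'] h; first exact: num_v_old.
move: h => /=; rewrite {1}/va; case: (leqP (pos c) l) => hc h.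
  apply: rst_trans (_ : gvc _ (inl (walk_vert (pos c)))) _; first by apply: num_v_old; rewrite /= /va hc.
  by apply: rst_sym; apply: num_v_old.
move: h; rewrite pos_lt /va; case: (leqP (pos c') l) => hc'.
  move=> h; have := proj2 Nv (walk_vert (pos c')); rewrite -h.
  by rewrite ltnNge leq_addr.
rewrite pos_lt => /eqP; rewrite eqn_add2l => /eqP h.
have e : pos c = pos c' by rewrite -(subnK hc) h subnK.
by rewrite (pos_inj e); apply: rst_refl.
Qed.

Definition at_pv (z : CV) : 'I_V' := Ordinal (let: And3 h _ _ := cV in h _ (num_v_lt z)).

(** The two ends of the boundary are one vertex of the packet. When the attaching
path goes all around, they may be different vertices of [Y], and this is the only
identification left to the renumbering [RV]. *)
Lemma at_pv_eq (z z' : vert (dom Y) + vert (packet R)) : at_pv z = at_pv z' <-> gvc z z'.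
Proof.
have ends : gvc (inl (walk_vert 0)) (inl (walk_vert l)) \/ va 0 = va L.
  move: lL; rewrite leq_eqVlt => /orP[/eqP e|h]; last first.
    by right; rewrite /va leq0n leqNgt h ltnn.
  left; apply: rst_trans (walk_vert_glue (leq0n _)) _; apply: rst_sym.
  rewrite addn0 (_ : cyc R i = cyc R (i + l)); first exact: walk_vert_glue.
  by apply/cyc_modP; rewrite e modnDr.
have [_ _ h] := cV; have {}h := h _ _ (num_v_lt z) (num_v_lt z').
have va0 : va 0 = nv (walk_vert 0) by rewrite /va leq0n.
have vaL : va L = nv (walk_vert l) \/ va L = va 0.
  move: lL; rewrite leq_eqVlt => /orP[/eqP e|hl]; first by left; rewrite /va e leqnn.
  by right; rewrite /va leq0n leqNgt hl ltnn.
split.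
  move/(congr1 val) => /= /h[|[h1 h2]|[h1 h2]]; first exact: num_v_eq.
    case: ends => [e|e]; last by apply: num_v_eq; rewrite h1 h2 e.
    case: vaL => e2; last by apply: num_v_eq; rewrite h1 h2 e2.
    rewrite va0 in h1; rewrite e2 in h2.
    exact: rst_trans (num_v_old h1) (rst_trans _ _ _ _ _ e (rst_sym _ _ _ _ (num_v_old h2))).
  case: ends => [e|e]; last by apply: num_v_eq; rewrite h1 h2 e.
  case: vaL => e2; last by apply: num_v_eq; rewrite h1 h2 e2.
  rewrite e2 in h1; rewrite va0 in h2.
  exact: rst_trans (num_v_old h1) (rst_trans _ _ _ _ _ (rst_sym _ _ _ _ e) (rst_sym _ _ _ _ (num_v_old h2))).
elim=> {z z' h} [z z' hz|//|//|z z' z'' _ -> _ ->] //.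
have [_ _ h] := cV; have {}h := h _ _ (num_v_lt z) (num_v_lt z').
apply: val_inj; apply/h; case: hz {h} => [|k a b ha hb].
  constructor 1; rewrite /= (_ : pos i = 0) ?va0 //.
  by rewrite /pos subnKC ?modnn // ltnW.
have [hk ea] := onth_Some o0 ha; move: hb; rewrite onth_arc ?(leq_trans hk) // => -[<-].
rewrite otgt_circ /= -addnS pos_cyc -{}ea.
have e : nv (otgt (nth o0 q k)) = va k.+1 by rewrite /va hk.
rewrite e; have : k.+1 <= L by exact: leq_trans hk lL.
rewrite leq_eqVlt => /orP[/eqP eL|hL]; last by constructor 1; rewrite modn_small.
by constructor 3; rewrite -eL modnn.
Qed.

Notation CE := (oedge (dom Y) + oedge (packet R))%type.
Notation ge := (glue_edge q (arc i l)).
Notation gec := (clos_refl_sym_trans CE ge).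

Definition num_e (z : CE) : nat * bool :=
  match z with
  | inl o => (ne o.1, o.2)
  | inr o => let c := qe (pos (o.1 : 'I_L)) in (c.1, c.2 (+) o.2)
  end.

Lemma num_e_lt z : (num_e z).1 < E'.
Proof.
have h e : ne e < E' by apply: leq_trans (proj2 Ne e) (leq_addr _ _).
case: z => [o|[c b]] /=; first exact: h.
rewrite /qe; case: (ltnP (pos (c : 'I_L)) l) => hl //=.
by rewrite ltn_add2l ltn_sub2r ?pos_lt //; apply: leq_ltn_trans (pos_lt c).
Qed.

Lemma walk_edge_glue k b : k < l ->
  gec (inl (if b then oinv (nth o0 q k) else nth o0 q k)) (inr (cyc R (i + k) : cell1 (packet R), b)).
Proof.
move=> hk; apply: rst_step; case: b; last first.
  by apply: (GlueEdge (k := k)); rewrite ?(onth_nth o0) ?onth_arc.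
have := @GlueEdgeInv (dom Y) (packet R) q (arc i l) k (nth o0 q k) (circ R (i + k)).
by apply; rewrite ?(onth_nth o0) ?onth_arc.
Qed.

Lemma num_e_old z o : num_e z = (ne o.1, o.2) -> gec z (inl o).
Proof.
case: z => [[e b] [/(proj1 Ne) he hb]|[c b]] /=.
  by rewrite (surjective_pairing o) -he -hb; apply: rst_refl.
rewrite /qe; case: ltnP => h /= [h1 h2]; last first.
  by have := proj2 Ne o.1; rewrite -h1 ltnNge leq_addr.
have := walk_edge_glue b h; rewrite cyc_pos => hg; apply: rst_sym.
suff -> : o = if b then oinv (nth o0 q (pos (c : 'I_L))) else nth o0 q (pos (c : 'I_L)) by [].
move/(proj1 Ne): h1 => h1; rewrite (surjective_pairing o) -h1 -h2.
by case: b {hg h2}; rewrite ?addbT ?addbF //; case: (nth _ _ _).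
Qed.

Lemma num_e_eq z z' : num_e z = num_e z' <-> gec z z'.
Proof.
split.
  case: z z' => [o|[c b]] z' h.
    by apply: rst_sym; apply: num_e_old; rewrite -h.
  case: z' h => [o|[c' b']] h; first exact: num_e_old.
  have old (d : cell1 (packet R)) bd : pos (d : 'I_L) < l ->
      exists o : oedge (dom Y), num_e (inr (d, bd)) = (ne o.1, o.2).
    move=> hd; exists ((nth o0 q (pos (d : 'I_L))).1, (nth o0 q (pos (d : 'I_L))).2 (+) bd).
    by rewrite /num_e /qe hd.
  have new (d : cell1 (packet R)) bd : l <= pos (d : 'I_L) ->
      num_e (inr (d, bd)) = (#|E| + (pos (d : 'I_L) - l), bd).
    by move=> hd; rewrite /num_e /qe ltnNge hd.
  case: (ltnP (pos (c : 'I_L)) l) => hc.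
    have [o h1] := old _ b hc; apply: rst_trans (num_e_old h1) _.
    by apply: rst_sym; apply: num_e_old; rewrite -h h1.
  case: (ltnP (pos (c' : 'I_L)) l) => hc'.
    have [o h1] := old _ b' hc'; rewrite -h in h1; apply: rst_trans (num_e_old h1) _.
    by apply: rst_sym; apply: num_e_old; rewrite -h h1.
  move: h; rewrite !new // => -[/eqP h1 ->]; move: h1; rewrite eqn_add2l => /eqP h1.
  have e : pos (c : 'I_L) = pos (c' : 'I_L) by rewrite -(subnK hc) h1 subnK.
  by rewrite (pos_inj e); apply: rst_refl.
elim=> {z z'} [z z' hz|//|//|z z' z'' _ -> _ ->] //.
case: hz => k a b ha hb; have [hk ea] := onth_Some o0 ha;
  have hkL := leq_trans hk lL; move: hb; rewrite onth_arc // => -[<-];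
  rewrite /num_e [X in qe X]pos_cyc modn_small // /qe hk ea /= ?addbF ?addbT //.
Qed.

Definition at_poz (z : CE) : 'I_E' * bool := (Ordinal (num_e_lt z), (num_e z).2).

Lemma at_poz_eq z z' : at_poz z = at_poz z' <-> gec z z'.
Proof.
rewrite -num_e_eq; split=> [[h1 h2]|h]; first by rewrite (surjective_pairing (num_e z)) h1 h2 -surjective_pairing.
by rewrite /at_poz; congr (_, _); [apply: val_inj; rewrite /= h|rewrite h].
Qed.

Definition to_sum (o : oedge (u_cx Y (packet_map R))) : CE :=
  match o.1 with inl e => inl (e, o.2) | inr e => inr (e, o.2) end.

Notation Z := (u_cx Y (packet_map R)).
Notation zeta := (u_map Y (packet_map R)).
Definition at_po (o : oedge Z) : 'I_E' * bool := at_poz (to_sum o).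

Lemma at_pv_onto w : exists z, at_pv z == w.
Proof.
have [_ h _] := cV; have [x hx ex] := h w (ltn_ord w).
suff [z hz] : exists z, num_v z = x.
  by exists z; apply/eqP/val_inj; rewrite /= hz.
case: (ltnP x #|V|) => h1.
  by have [u hu] := numbering_onto Nv h1; exists (inl u).
have hxl : x - #|V| < (L - l).-1 by rewrite ltn_subLR.
have hL : x - #|V| + l.+1 < L by exact: new_vertex_pos.
exists (inr (cyc R (i + (x - #|V| + l.+1)))).
rewrite /num_v pos_cyc modn_small // /va leqNgt ltn_addl // hL addnK.
by rewrite subnKC.
Qed.

Lemma at_po_flip (o : oedge Z) : at_po (oinv o) = flip (at_po o).
Proof.
case: o => [[e|c] b]; rewrite /at_po /at_poz /flip /to_sum /=; congr (_, _).
- exact: val_inj.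
- exact: val_inj.
- by rewrite addbN.
Qed.

Lemma at_po_new (k : nat) : l <= k -> k < L -> (num_e (inr (circ R (i + k)))) = (#|E| + (k - l), false).
Proof.
move=> h1 h2; rewrite /num_e [X in qe X]pos_cyc modn_small // /qe ltnNge h1 //.
Qed.

Lemma at_po_ontoz (e' : 'I_E') : exists z : CE, num_e z = (val e', false) /\
  (if z is inr o then exists k, [/\ l <= k, k < L, o = circ R (i + k) & e' = #|E| + (k - l) :> nat]
   else True).
Proof.
case: (ltnP e' #|E|) => h1.
  have [e he] := numbering_onto Ne h1.
  by exists (inl ((e, false) : oedge (dom Y))); rewrite /= he.
have hk : e' - #|E| + l < L.
  by rewrite -[X in _ < X](subnK lL) ltn_add2r ltn_subLR // ltn_ord.
exists (inr (circ R (i + (e' - #|E| + l)))); rewrite at_po_new ?leq_addl // addnK subnKC //.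
split=> //; exists (e' - #|E| + l); split=> //; first exact: leq_addl.
by rewrite addnK subnKC.
Qed.

Lemma at_poz_of z (e' : 'I_E') b : num_e z = (val e', b) -> at_poz z = (e', b).
Proof. by move=> h; rewrite /at_poz; congr (_, _); [apply: val_inj; rewrite /= h|rewrite h]. Qed.

Definition of_sum (z : CE) : oedge Z := match z with inl o => ul _ o | inr o => ur _ o end.

Lemma of_sumK z : to_sum (of_sum z) = z.
Proof. by case: z => -[e b]. Qed.

Lemma at_po_onto o' : exists e : fcell1 Z * bool, at_po e == o'.
Proof.
case: o' => e' b; have [z [hz _]] := at_po_ontoz e'.
have h : at_po (of_sum z) = (e', false).
  by rewrite /at_po of_sumK; apply: at_poz_of.
case: b; last by exists (of_sum z); rewrite h.
by exists (oinv (of_sum z)); rewrite at_po_flip h.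
Qed.

Lemma at_pv_mv (z z' : vert Z) : at_pv z = at_pv z' -> mv zeta z = mv zeta z'.
Proof.
move/at_pv_eq; elim=> {z z'} [z z' []|//|//|z z' z'' _ -> _ ->] //.
  by case: site.
move=> k a b ha hb; have [hk ea] := onth_Some o0 ha.
move: hb; rewrite onth_arc ?(leq_trans hk) // => -[<-].
have := site_label site o0 hk; rewrite ea -mo_circ => h.
have e : mv Y (otgt a) = mv (packet_map R) (otgt (circ R (i + k))).
  by rewrite -!otgt_mo h.
exact: e.
Qed.

Lemma mo_of_sum z : mo zeta (of_sum z) =
  match z with inl o => mo Y o | inr o => mo (packet_map R) o end.
Proof. by case: z => -[e []]. Qed.

Lemma to_sumK o : of_sum (to_sum o) = o.
Proof. by case: o => -[e|e] b. Qed.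

Lemma at_po_mo (o o' : oedge Z) : at_po o = at_po o' -> mo zeta o = mo zeta o'.
Proof.
rewrite -{2}(to_sumK o) -{2}(to_sumK o') !mo_of_sum => /at_poz_eq.
elim=> [z z' []|//|z z' _ -> //|z z' z'' _ -> _ ->] // k a b ha hb;
  have [hk ea] := onth_Some o0 ha; move: hb; rewrite onth_arc ?(leq_trans hk) // => -[<-];
  by have := site_label site o0 hk; rewrite ?mo_inv ea -mo_circ => ->.
Qed.

Lemma at_po_src (o o' : oedge Z) : at_po o = at_po o' -> at_pv (osrc o) = at_pv (osrc o').
Proof.
pose sv (z : CE) : vert (dom Y) + vert (packet R) :=
  match z with inl o => inl (osrc o) | inr o => inr (osrc o) end.
have hs z : osrc (of_sum z) = sv z by case: z => -[e []].
rewrite -{2}(to_sumK o) -{2}(to_sumK o') !hs => /at_poz_eq h; apply/at_pv_eq.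
elim: h => {o o'} [z z' hz|z|z z' _ hz|z z' z'' _ h1 _ h2].
- case: hz => k a b ha hb; have [hk ea] := onth_Some o0 ha;
  move: hb; rewrite onth_arc ?(leq_trans hk) // => -[<-].
    have := walk_vert_glue (ltnW hk); rewrite /sv osrc_circ.
    suff -> : walk_vert k = osrc a by [].
    case: site => -[w hw] _ _ _; case: k {ha} hk ea => [|k] hk <- /=.
      by rewrite (path_nth0 o0 hw).
    by rewrite (path_nth o0 hw) ?(ltnW hk) // ltn_eqF.
  by have := walk_vert_glue hk; rewrite /= /sv addnS -otgt_circ ea.
- exact: rst_refl.
- exact: rst_sym.
- exact: rst_trans h1 h2.
Qed.

Definition attached : complex_over X :=
  @quotient X Z zeta _ _ at_pv at_po at_pv_onto at_po_onto at_po_flip at_pv_mv at_po_mo at_po_src.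

Let proj : over_map zeta attached :=
  @q_proj X Z zeta _ _ at_pv at_po at_pv_onto at_po_onto at_po_flip at_pv_mv at_po_mo at_po_src.

Lemma attached_is_attachment : immersion1 Y -> maximal_reduction Y i v q ->
  is_attachment Y attached.
Proof.
move=> im mx; split=> //; exists R, i, v, q; split=> //.
exists (over_comp proj (u_inl Y (packet_map R))), (over_comp proj (u_inr Y (packet_map R))).
have sv x : sum_fun (pv (over_comp proj (u_inl Y (packet_map R))))
    (pv (over_comp proj (u_inr Y (packet_map R)))) x = at_pv x by case: x.
have se x : sum_fun (po (over_comp proj (u_inl Y (packet_map R))))
    (po (over_comp proj (u_inr Y (packet_map R)))) x = at_poz x.
  by rewrite -(of_sumK x) -/(at_po (of_sum x)); case: x => -[e b].
split; split.
- by move=> w; have [z /eqP hz] := at_pv_onto w; exists z; rewrite sv.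
- by move=> z z'; rewrite !sv; apply: at_pv_eq.
- move=> o; have [e /eqP he] := at_po_onto o; exists (to_sum e); rewrite se; exact: he.
- by move=> z z'; rewrite !se; apply: at_poz_eq.
- by move=> S; exists S; case: S.
move=> S S'; split=> [|]; last by elim=> // a b c _ -> _ ->.
by case: S S' => S [] S' //= [->]; apply: rst_refl.
Qed.

Notation n := (cell2_exponent R).
Definition cell_num (S : F + 'I_n) : nat := match S with inl S' => nf S' | inr j => #|F| + j end.

Lemma cell_num_numbering : numbering (T := (F + 'I_n)%type) cell_num.
Proof.
split.
  move=> [S|j] [S'|j'] /=.
  - by move/(proj1 Nf) ->.
  - by move=> h; have := proj2 Nf S; rewrite h ltnNge leq_addr.
  - by move=> h; have := proj2 Nf S'; rewrite -h ltnNge leq_addr.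
  - by move/eqP; rewrite eqn_add2l => /eqP /val_inj ->.
case=> [S|j] /=; rewrite card_sum card_ord; last by rewrite ltn_add2l.
by apply: leq_trans (proj2 Nf S) (leq_addr _ _).
Qed.

Lemma attached_coded s :
  [/\ var s 0 = V', var s 1 = E' & var s 2 = #|F| + n] ->
  (forall e : E, [/\ arr s 0 (ne e) = RV (nv (fsrc e)), arr s 1 (ne e) = RV (nv (ftgt e))
     & arr s 2 (ne e) = letter_of (me Y e)]) ->
  (forall k, l <= k -> k < L -> [/\ arr s 0 (#|E| + (k - l)) = RV (va k),
     arr s 1 (#|E| + (k - l)) = RV (va k.+1) & arr s 2 (#|E| + (k - l)) = letter_of (bd_at R (i + k))]) ->
  (forall S : F, arr s 3 (nf S) = enum_rank (mf Y S : fcell2 X) /\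
     forall m o, onth (lift_bd Y S) m = Some o -> arr s (BD m) (nf S) = nl ne o) ->
  (forall j, j < n -> arr s 3 (#|F| + j) = enum_rank (R : fcell2 X) /\
     forall m, m < L -> arr s (BD m) (#|F| + j) =
       let c := qe (pos (j * root_length R + m)) in letter c.1 c.2) ->
  coded (Y := attached) (fun v : 'I_V' => val v) (fun e : 'I_E' => val e) cell_num s.
Proof.
case=> h0 h1 h2 he hn hf hj; split; rewrite ?card_ord //.
  by rewrite h2 card_sum card_ord.
split.
- exact: numbering_ord.
- exact: numbering_ord.
- exact: cell_num_numbering.
- move=> e'; have [z [hz hk]] := at_po_ontoz e'.
  have fe : at_po (of_sum z) = (e', false).
    by rewrite /at_po of_sumK; apply: at_poz_of.
  have [q1 q2 q3] := @q_edge X Z zeta _ _ at_pv at_po at_po_onto at_po_flip at_po_mo at_po_src _ _ fe.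
  have re : (num_e z).1 = val e' by rewrite hz.
  split.
  + rewrite (q1 : fsrc e' = _); case: z hz hk {fe q1 q2 q3} re => [[e b]|o] hz hk /= re.
      by case: hz => _ /= ->; rewrite -re; have [-> _ _] := he e.
    have [k [h3 h4 -> ee]] := hk; rewrite [X in arr s 0 X]ee; have [-> _ _] := hn k h3 h4.
    by rewrite -[num_v _]/(va (pos (cyc R (i + k)))) pos_cyc modn_small.
  + rewrite (q2 : ftgt e' = _); case: z hz hk {fe q1 q2 q3} re => [[e b]|o] hz hk /= re.
      by case: hz => _ /= ->; rewrite -re; have [_ -> _] := he e.
    have [k [h3 h4 -> ee]] := hk; rewrite [X in arr s 1 X]ee; have [_ -> _] := hn k h3 h4.
    rewrite -[num_v _]/(va (pos (otgt (circ R (i + k)) : 'I_L))) otgt_circ -addnS pos_cyc.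
    have hkL : k.+1 <= L by [].
    move: hkL; rewrite leq_eqVlt => /orP[/eqP eL|hL]; last by rewrite modn_small.
    have [_ _ hc] := cV; have h0n : va 0 < Vn := num_v_lt (inl v).
    have hLn : va L < Vn.
      have -> : va L = nv v by rewrite /va leqNgt (leq_ltn_trans h3 h4) ltnn.
      exact: num_v_lt (inl v).
    rewrite -eL modnn eL; apply/hc => //; by constructor 3.
  rewrite (q3 : me attached e' = _) mo_of_sum; case: z hz hk {fe q1 q2 q3} re => [[e b]|o] hz hk /= re.
    by case: hz => _ /= ->; rewrite -re; have [_ _ ->] := he e.
  by have [k [h3 h4 -> ee]] := hk; rewrite [X in arr s 2 X]ee; have [_ _ ->] := hn k h3 h4.
move=> S; change (F + 'I_n)%type in S; case: S => [S'|j].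
  have [g3 g4] := hf S'; split=> // m o'.
  rewrite q_lift_bd onth_map u_lift_bd /= onth_map; case E1 : (onth _ _) => [o|] //= -[<-].
  by rewrite (g4 _ _ E1); case: o {E1} => e b.
have [g3 g4] := hj _ (ltn_ord j); split=> // m o'.
rewrite q_lift_bd onth_map u_lift_bd [u_bd _ _ _]/= onth_map packet_lift_bd onth_map.
case E1 : (onth _ _) => [m'|] //= -[<-]; have [hm] := onth_Some 0 E1.
rewrite size_iota in hm; rewrite nth_iota // add0n => em; subst m'.
rewrite g4 // /nl /at_po /at_poz /to_sum /= addbF.
have -> : pos (j * root_length R + m) = pos (cyc R (j * root_length R + m)).
  by rewrite /pos /= modnDml.
by [].
Qed.

End Attach.

Lemma sem_if e p q s : sem (PIf e p q) s = if eval e s != 0 then sem p s else sem q s.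
Proof. by []. Qed.

Lemma sem_seq p q s : sem (PSeq p q) s = sem q (sem p s).
Proof. by []. Qed.

Lemma sem_pseq_cat ps qs s : sem (pseq (ps ++ qs)) s = sem (pseq qs) (sem (pseq ps) s).
Proof. by elim: ps s => //= p ps IH s. Qed.

Lemma modv_pseq (T : Type) z (f : T -> prog) l :
  (forall k, ~~ modv z (f k)) -> ~~ modv z (pseq (map f l)).
Proof. by move=> h; elim: l => //= k l IH; rewrite (negPf (h k)). Qed.

Lemma moda_pseq (T : Type) a (f : T -> prog) l :
  (forall k, ~~ moda a (f k)) -> ~~ moda a (pseq (map f l)).
Proof. by move=> h; elim: l => //= k l IH; rewrite (negPf (h k)). Qed.

(** * Following a path of given labels *)

Section Walk.
Variables (X : wcomplex) (Y : complex_over X).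
Notation V := (fvert (dom Y)).
Notation E := (fcell1 (dom Y)).
Notation F := (fcell2 (dom Y)).
Variables (nv : V -> nat) (ne : E -> nat) (nf : F -> nat).
Hypothesis Nv : numbering nv.
Hypothesis Ne : numbering ne.
Hypothesis Nf : numbering nf.
Notation nl := (nl ne).

(** What the search for foldable pairs leaves in memory when there is none. *)
Definition indexed (s : state) : Prop :=
  [/\ tables nv ne s, limits Y s & forall o, arr s 10 (oslot nv o) = nl o].

Lemma indexed_ext s s' : (forall x, x \in [:: 10; 11; 12; 13; 14] -> var s' x = var s x) ->
  (forall a, a \in [:: 4; 5; 6; 7; 8; 10] -> arr s' a = arr s a) -> indexed s -> indexed s'.
Proof.
move=> hv ha [tb [l1 l2 l3 l4 l5] sl]; split.
- by move=> o; rewrite !ha.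
- by split; rewrite hv.
by move=> o; rewrite ha.
Qed.

Definition fail : prog := PSet 27 (ECst 0).
(** An entry found in a slot is trusted only if it is a 1-cell with the right origin
and label. *)
Definition walk_step (lab k : nat) : prog :=
  PSeq (PSet 28 (ERd 10 (slot X (ERd 13 (ECst k)) (ECst lab))))
    (PIf (ELt (EVar 28) (EVar 12))
      (PIf (ENeq (ERd 4 (EVar 28)) (ERd 13 (ECst k))) fail
        (PIf (ENeq (ERd 6 (EVar 28)) (ECst lab)) fail
          (PSeq (PWr 12 (ECst k) (EVar 28)) (PWr 13 (ECst k.+1) (ERd 5 (EVar 28))))))
      fail).

Lemma walk_stepP s (u : V) (oX : oedge X) k : indexed s -> arr s 13 k = nv u ->
  let s' := sem (walk_step (letter_of oX) k) s in
  (exists o : oedge (dom Y), [/\ osrc o = u, mo Y o = oX, var s' 27 = var s 27,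
     arr s' 12 =1 upd (arr s 12) k (nl o) & arr s' 13 =1 upd (arr s 13) k.+1 (nv (otgt o))])
  \/ ((forall o : oedge (dom Y), osrc o = u -> mo Y o <> oX) /\ var s' 27 = 0).
Proof.
move=> [tb [_ _ h12 _ _] sl] hk.
pose g := arr s 10 (slotn X (nv u) (letter_of oX)); pose s1 := set_var s 28 g.
pose ok := PSeq (PWr 12 (ECst k) (EVar 28)) (PWr 13 (ECst k.+1) (ERd 5 (EVar 28))).
have -> : sem (walk_step (letter_of oX) k) s =
  if g < #|E| + #|E| then
    if arr s 4 g != nv u then set_var s1 27 0
    else if arr s 6 g != letter_of oX then set_var s1 27 0 else sem ok s1
  else set_var s1 27 0.
  rewrite /walk_step sem_seq.
  have -> : sem (PSet 28 (ERd 10 (slot X (ERd 13 (ECst k)) (ECst (letter_of oX))))) s = s1.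
    rewrite -[LHS]/(set_var s 28 (arr s 10 (eval (slot X (ERd 13 (ECst k)) (ECst (letter_of oX))) s))).
    rewrite eval_slot -[eval (ERd 13 (ECst k)) s]/(arr s 13 k) hk //.
  rewrite sem_if eval_lt -[eval (EVar 28) s1]/g -[eval (EVar 12) s1]/(var s 12) h12.
  case: ifP => // _; rewrite sem_if eval_neq -[eval (ERd 4 _) s1]/(arr s 4 g).
  rewrite -[eval (ERd 13 _) s1]/(arr s 13 k) hk; case: ifP => // _.
  by rewrite sem_if eval_neq.
have have_o (o : oedge (dom Y)) : osrc o = u -> mo Y o = oX -> g = nl o.
  by move=> h1 h2; rewrite /g -sl /oslot h1 h2.
case: (ltnP g (#|E| + #|E|)) => hg; last first.
  right; split=> // o h1 h2; move: hg; rewrite (have_o o h1 h2) leqNgt.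
  by rewrite nl_lt.
have [o ho] := nl_onto Ne hg; have [t4 t5 t6 _ _] := tb o.
rewrite -ho t4 t6; case: ifPn => [ne1|/negPn/eqP/(proj1 Nv) e1].
  right; split=> // o' h1 h2; move/eqP: ne1; apply.
  by have := have_o o' h1 h2; rewrite -ho => /(nl_inj Ne) ->; rewrite h1.
case: ifPn => [ne2|/negPn/eqP/letter_of_inj e2].
  right; split=> // o' h1 h2; move/eqP: ne2; apply.
  by have := have_o o' h1 h2; rewrite -ho => /(nl_inj Ne) ->; rewrite h2.
left; exists o; split=> //; rewrite /ok sem_seq => j.
  by rewrite ho.
by rewrite -t5 ho.
Qed.

Variables (R : cell2 X) (i : 'I_(size (bd R))).

Definition walk_steps (l : nat) : prog :=
  pseq [seq walk_step (letter_of (bd_at R (i + k))) k | k <- iota 0 l].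
Definition walk (l : nat) : prog := PSeq (PSet 27 (ECst 1)) (walk_steps l).

Lemma walk_var l z : z != 27 -> z != 28 -> ~~ modv z (walk l).
Proof.
move=> h1 h2; rewrite /= (negPf h1) /=; apply: modv_pseq => k.
by rewrite /= (negPf h1) (negPf h2).
Qed.

Lemma walk_arr l a : a != 12 -> a != 13 -> ~~ moda a (walk l).
Proof.
move=> h1 h2; rewrite /=; apply: moda_pseq => k.
by rewrite /= (negPf h1) (negPf h2).
Qed.

Lemma indexed_walk l s : indexed s -> indexed (sem (walk l) s).
Proof.
apply: indexed_ext => [x hx|a ha].
  apply: sem_var; apply: walk_var; by apply: contraTneq hx => ->.
apply: sem_arr; apply: walk_arr; by apply: contraTneq ha => ->.
Qed.

Definition follows (v : V) (l : nat) (q : seq (oedge (dom Y))) : Prop :=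
  [/\ size q = l, exists w, is_path (v : vert (dom Y)) q w
    & map (mo Y) q = [seq bd_at R (i + m) | m <- iota 0 l]].

Lemma walkP s v l : indexed s -> arr s 13 0 = nv v ->
  let s' := sem (walk l) s in
  if var s' 27 != 0 then exists q, [/\ follows v l q,
       forall k o, onth q k = Some o -> arr s' 12 k = nl o
     & forall k x, k <= l -> is_path (v : vert (dom Y)) (take k q) x -> arr s' 13 k = nv x]
  else forall q, ~ follows v l q.
Proof.
move=> ix h0; elim: l => [|l IH].
  exists [::]; split=> //; first by split=> //; exists v.
    by case.
  by move=> k x; rewrite leqn0 => /eqP -> <-.
have ixl : indexed (sem (walk l) s) := indexed_walk l ix.
have -> : sem (walk l.+1) s = sem (walk_step (letter_of (bd_at R (i + l))) l) (sem (walk l) s).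
  have ew m : sem (walk m) s = sem (walk_steps m) (set_var s 27 1) by [].
  by rewrite !ew /walk_steps -addn1 iotaD map_cat sem_pseq_cat.
move: ixl IH; set s1 := sem (walk l) s; clearbody s1 => ixl; cbv zeta.
have sub q : follows v l.+1 q -> follows v l (take l q).
  case=> hs [w hw] hl; split; first by rewrite size_take hs ltnSn.
    have := hw; rewrite -{1}(cat_take_drop l q) => /is_path_catP[x hx _]; by exists x.
  rewrite map_take hl -map_take take_iota; congr (map _ (iota _ _)); apply/minn_idPl/leqnSn.
have stay0 : var s1 27 = 0 -> var (sem (walk_step (letter_of (bd_at R (i + l))) l) s1) 27 = 0.
  move=> z0; rewrite /walk_step sem_seq; set s2 := sem _ s1.
  have z2 : var s2 27 = 0 by exact: z0.
  clearbody s2; rewrite sem_if; case: ifP => _ //; rewrite sem_if; case: ifP => _ //.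
  by rewrite sem_if; case: ifP.
case: eqP => [z0 no|nz [q [fq hQ hV]]].
  by rewrite stay0 // => q /sub/no.
have [hs [w hw] hl] := fq.
have tq : take l q = q by rewrite take_oversize // hs.
have hu : arr s1 13 l = nv w by apply: hV; rewrite ?tq.
case: (walk_stepP (bd_at R (i + l)) ixl hu) => [[o [ho hm h27 h12 h13]]|[no h27]].
  rewrite h27; case: eqP => // _; exists (rcons q o); split.
  - split; first by rewrite size_rcons hs.
      by exists (otgt o); apply/is_path_rcons; rewrite ho.
    by rewrite map_rcons hl hm -addn1 iotaD map_cat cats1.
  - move=> k o1; rewrite h12 /upd; case: (eqVneq k l) => [->|nk] ho1.
      have [_] := onth_Some o ho1; rewrite nth_rcons hs ltnn eqxx => ->; by [].
    have [hk e] := onth_Some o ho1; apply: hQ.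
    rewrite size_rcons hs ltnS leq_eqVlt (negPf nk) /= in hk.
    by rewrite (onth_nth o) ?hs // -e nth_rcons hs hk.
  move=> k x; rewrite leq_eqVlt => /orP[/eqP->|hk].
    rewrite take_oversize ?size_rcons ?hs // => /is_path_rcons[_ <-].
    by rewrite h13 /upd eqxx.
  rewrite h13 /upd ltn_eqF // -cats1 takel_cat ?hs //; exact: hV.
rewrite h27 eqxx => q' fq'; have [hs' [w' hw'] hl'] := fq'.
have [im] : immersion1 Y /\ True.
  split=> // o1 o2 e1 e2; have [_ _ sl] := ixl; apply: (nl_inj Ne).
  by rewrite -!sl /oslot e1 e2.
have [o0 [q0 eq0]] : exists o0 q0, q' = rcons q0 o0.
  by case/lastP: (q') hs' => // q0 o0; exists o0, q0.
rewrite eq0 in hw' hl' hs'; move/is_path_rcons: hw' => [hw0 _] _.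
move: hs'; rewrite size_rcons => -[hs0].
move: hl'; rewrite map_rcons -addn1 iotaD map_cat cats1 => /rcons_inj[hl0 hm0].
have e : q0 = q by apply: (immersion_path_inj im hw0 hw); rewrite hl0 hl.
subst q0; apply: (no o0) => //.
exact: is_path_det2 hw0 hw.
Qed.

(** * Searching for a perimeter reduction *)

(** In a packed immersed complex, the packet lifts along a walk exactly when the
first 1-cell of the walk is marked. *)
Definition marked (x : oedge (dom Y)) : Prop :=
  exists2 S, mf Y S = R & onth (lift_bd Y S) i = Some x.

Definition v1 := EVar 20.
Definition rank : expr := ECst (enum_rank (R : fcell2 X)).
Definition marks : prog :=
  PFor 20 13 (PIf (ENeq (ERd 3 v1) rank) PSkip (PWr 11 (ERd (BD i) v1) v1)).

Definition cells (s : state) : Prop := forall S : F, arr s 3 (nf S) = enum_rank (mf Y S : fcell2 X) /\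
  forall m o, onth (lift_bd Y S) m = Some o -> arr s (BD m) (nf S) = nl o.

Lemma cells_ext s s' : arr s' 3 = arr s 3 -> (forall m, arr s' (BD m) = arr s (BD m)) ->
  cells s -> cells s'.
Proof.
move=> h3 hb hc S; have [g3 g4] := hc S; rewrite h3; split=> // m o.
by rewrite hb; apply: g4.
Qed.

Lemma lift_at S : mf Y S = R -> exists x, onth (lift_bd Y S) i = Some x.
Proof.
move=> h; have hi : i < size (lift_bd Y S) by rewrite size_lift_bd h.
by case: (lift_bd Y S) hi => // o p hi; exists (nth o (o :: p) i); rewrite (onth_nth o).
Qed.

Lemma rank_eq S : ((enum_rank (mf Y S : fcell2 X) : nat) == enum_rank (R : fcell2 X)) = (mf Y S == R :> fcell2 X).
Proof. by rewrite (inj_eq val_inj) (inj_eq enum_rank_inj). Qed.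

Lemma marksP s : cells s -> limits Y s -> forall x, marked x ->
  exists S, [/\ mf Y S = R, onth (lift_bd Y S) i = Some x & arr (sem marks s) 11 (nl x) = nf S].
Proof.
move=> hc [_ _ _ h13 _] x [S hS hx].
pose I k s' := forall S x, nf S < k -> mf Y S = R -> onth (lift_bd Y S) i = Some x ->
  exists S', [/\ mf Y S' = R, onth (lift_bd Y S') i = Some x & arr s' 11 (nl x) = nf S'].
suff h : I #|F| (sem marks s) by exact: h (proj2 Nf S) hS hx.
rewrite -h13; apply: for_frame => // k s' hk IH fv fa {hS hx}S {}x hSk hS hx.
have f3 : arr s' 3 = arr s 3 by apply: fa.
have fB : arr s' (BD i) = arr s (BD i) by apply: fa; apply: (negbT (BD_neq i _)).
pose s1 := set_var s' 20 k.
have -> : sem (PIf (ENeq (ERd 3 v1) rank) PSkip (PWr 11 (ERd (BD i) v1) v1)) s1 =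
  if arr s' 3 k != enum_rank (R : fcell2 X) then s1 else set_arr s1 11 (arr s' (BD i) k) k.
  by rewrite sem_if eval_neq.
have [S0 hS0] : exists S, nf S = k by apply: (numbering_onto Nf); rewrite -h13.
have [g3 g4] := hc S0; rewrite f3 -hS0 g3 rank_eq fB.
have lt : S <> S0 -> nf S < k.
  move=> ne1; rewrite ltn_neqAle -ltnS hSk andbT -hS0; apply/eqP => e.
  by apply: ne1; apply: (proj1 Nf).
case: ifPn => [ne2|/negPn/eqP eR].
  apply: (IH S) => //; apply: lt => e; move/eqP: ne2; apply; rewrite -e; exact: hS.
have [x0 hx0] := lift_at eR; rewrite (g4 _ _ hx0).
case: (eqVneq (nl x) (nl x0)) => [/(nl_inj Ne) e|nx].
  by exists S0; rewrite e arr_set !eqxx.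
have [|S' [h1 h2 h3]] := IH S x _ hS hx.
  by apply: lt => e; move/eqP: nx; apply; move: hx; rewrite e hx0 => -[->].
by exists S'; rewrite arr_set (negPf nx).
Qed.

Definition found : prog := PSeq (PSet 29 (ECst 1)) (PSet 30 (EVar 21)).
(** The array of marks is never cleared, so that its entry may be old: it is valid
if the 2-cell that it names confirms it. *)
Definition check : prog :=
  PSeq (PSet 28 (ERd 11 (ERd 12 (ECst 0))))
    (PIf (ELt (EVar 28) (EVar 13))
      (PIf (ENeq (ERd 3 (EVar 28)) rank) found
        (PIf (ENeq (ERd (BD i) (EVar 28)) (ERd 12 (ECst 0))) found PSkip)) found).

Definition marks_ok (s : state) : Prop := forall x, marked x ->
  exists S, [/\ mf Y S = R, onth (lift_bd Y S) i = Some x & arr s 11 (nl x) = nf S].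

Lemma checkP s x : cells s -> limits Y s -> marks_ok s -> arr s 12 0 = nl x ->
  let s' := sem check s in
  (marked x /\ var s' 29 = var s 29) \/ [/\ ~ marked x, var s' 29 = 1 & var s' 30 = var s 21].
Proof.
move=> hc [_ _ _ h13 _] mk hx.
pose g := arr s 11 (nl x); pose s1 := set_var s 28 g.
have -> : sem check s = if g < #|F| then
    if arr s 3 g != enum_rank (R : fcell2 X) then sem found s1
    else if arr s (BD i) g != nl x then sem found s1 else s1
  else sem found s1.
  rewrite /check sem_seq.
  have -> : sem (PSet 28 (ERd 11 (ERd 12 (ECst 0)))) s = s1 by rewrite /s1 /g -hx.
  rewrite sem_if eval_lt -[eval (EVar 28) s1]/g -[eval (EVar 13) s1]/(var s 13) h13.
  case: ifP => // _; rewrite sem_if eval_neq -[eval (ERd 3 _) s1]/(arr s 3 g).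
  rewrite -[eval rank s1]/(enum_rank (R : fcell2 X) : nat); case: ifP => // _.
  rewrite sem_if eval_neq -[eval (ERd (BD i) _) s1]/(arr s (BD i) g).
  by rewrite -[eval (ERd 12 _) s1]/(arr s 12 0) hx.
have fnd : ~ marked x -> forall t, t = sem found s1 ->
    (marked x /\ var t 29 = var s 29) \/ [/\ ~ marked x, var t 29 = 1 & var t 30 = var s 21].
  by move=> h t ->; right.
have mkg : marked x -> exists S, [/\ mf Y S = R, onth (lift_bd Y S) i = Some x & g = nf S].
  by move/mk.
case: ltnP => hg; last first.
  apply: fnd => // /mkg[S [_ _ e]]; by rewrite e leqNgt (proj2 Nf) in hg.
case: ifPn => [n1|/negPn/eqP e1].
  by apply: fnd => // /mkg[S [hS _ e]]; move: n1; rewrite e (proj1 (hc S)) hS eqxx.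
case: ifPn => [n2|/negPn/eqP e2].
  apply: fnd => // /mkg[S [hS ho e]]; move: n2; rewrite e (proj2 (hc S) _ _ ho).
  by rewrite eqxx.
left; split=> //; have [S hS] := numbering_onto Nf hg.
have eR : mf Y S = R by apply/eqP; rewrite -rank_eq -(proj1 (hc S)) hS e1.
exists S => //; have [x0 hx0] := lift_at eR; rewrite hx0.
by move: e2; rewrite -hS (proj2 (hc S) _ _ hx0) => /(nl_inj Ne) ->.
Qed.

Definition probe (l : nat) : prog :=
  PIf (EVar 29) PSkip
    (PSeq (PWr 13 (ECst 0) (EVar 21)) (PSeq (walk l) (PIf (EVar 27) check PSkip))).
Definition search_loop (l : nat) : prog := PFor 21 10 (probe l).
Definition search (l : nat) : prog :=
  PSeq marks (PSeq (PSet 29 (ECst 0)) (search_loop l)).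

Definition good (v : V) (l : nat) (q : seq (oedge (dom Y))) : Prop :=
  follows v l q /\ forall x, onth q 0 = Some x -> ~ marked x.

Lemma check_var z : z \notin [:: 28; 29; 30] -> ~~ modv z check.
Proof.
rewrite !inE !negb_or => /and3P[/negPf h1 /negPf h2 /negPf h3].
by rewrite /= h1 h2 h3.
Qed.

Lemma probe_arr l a : a != 12 -> a != 13 -> ~~ moda a (probe l).
Proof.
move=> h1 h2; rewrite -[moda _ _]/((a == 13) || (moda a (walk l) || moda a (PIf (EVar 27) check PSkip))).
by rewrite (negPf h2) (negPf (walk_arr l h1 h2)).
Qed.

Lemma probe_var l z : z \notin [:: 27; 28; 29; 30] -> ~~ modv z (probe l).
Proof.
move=> hz; have /and4P[h1 h2 h3 h4] : [&& z != 27, z != 28, z != 29 & z != 30].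
  by move: hz; rewrite !inE !negb_or.
rewrite -[modv _ _]/(modv z (walk l) || (modv z check || false)).
rewrite (negPf (walk_var l h1 h2)) orbF; apply: check_var.
by rewrite !inE (negPf h2) (negPf h3) (negPf h4).
Qed.

Lemma probeP l s v : 0 < l -> indexed s -> cells s -> marks_ok s -> var s 21 = nv v ->
  let s' := sem (probe l) s in
  if var s 29 != 0 then s' = s
  else (var s' 29 != 0 /\ exists q, var s' 30 = nv v /\ good v l q)
    \/ (var s' 29 = 0 /\ forall q, ~ good v l q).
Proof.
move=> l0 ix hc mk h21; cbv zeta; pose s1 := sem (PWr 13 (ECst 0) (EVar 21)) s.
have -> : sem (probe l) s = if var s 29 != 0 then s
  else sem (PIf (EVar 27) check PSkip) (sem (walk l) s1) by [].
case: (var s 29 =P 0) => z29; last by [].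
rewrite [~~ true]/=.
have a1 a : a != 13 -> arr s1 a = arr s a by move=> h; apply: sem_arr; rewrite /= h.
have ix1 : indexed s1.
  apply: indexed_ext ix => // a ha; apply: a1; by apply: contraTneq ha => ->.
have h0 : arr s1 13 0 = nv v by rewrite /s1 /= /upd /=.
have := walkP l ix1 h0; have := indexed_walk l ix1.
have vw z : z != 27 -> z != 28 -> var (sem (walk l) s1) z = var s z.
  by move=> n1 n2; rewrite sem_var ?walk_var.
have aw a : a != 12 -> a != 13 -> arr (sem (walk l) s1) a = arr s a.
  by move=> n1 n2; rewrite sem_arr ?walk_arr // a1.
set s2 := sem (walk l) s1 in vw aw *; clearbody s2 => ix2; cbv zeta.
rewrite sem_if -[eval (EVar 27) s2]/(var s2 27).
case: eqP => [_ no|_ [q [fq hQ _]]].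
  right; rewrite vw //; split=> // q [fq _]; exact: no q fq.
have [sq _ _] := fq.
have [x hx] : exists x, onth q 0 = Some x by case: (q) sq l0 => [<-|x q'] //; exists x.
have hc2 : cells s2.
  apply: cells_ext hc; first by rewrite aw.
  by move=> m; rewrite aw // BD_neq.
have mk2 : marks_ok s2 by move=> y hy; have [S hS] := mk y hy; exists S; rewrite aw.
have lm2 : limits Y s2 by case: ix2.
case: (checkP hc2 lm2 mk2 (hQ _ _ hx)) => [[hm ->]|[hm -> ->]]; last first.
  left; split=> //; exists q; rewrite vw // h21; split=> //; split=> // y.
  by rewrite hx => -[<-].
right; rewrite vw //; split=> // q' [fq' nm]; apply: (nm x) => //.
have [sq' _ lq'] := fq'; have [_ _ lq] := fq.
have im : immersion1 Y.
  move=> o1 o2 e1 e2; have [_ _ sl] := ix; apply: (nl_inj Ne).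
  by rewrite -!sl /oslot e1 e2.
have [_ [w hw] _] := fq; have [_ [w' hw'] _] := fq'.
by rewrite (immersion_path_inj im hw' hw) // lq' lq.
Qed.

Lemma searchP l s : 0 < l -> indexed s -> cells s ->
  let s' := sem (search l) s in
  [/\ indexed s', cells s' & if var s' 29 != 0 then exists v q, var s' 30 = nv v /\ good v l q
      else forall v q, ~ good v l q].
Proof.
move=> l0 ix hc; have [tb lm sl] := ix.
have -> : sem (search l) s = sem (search_loop l) (set_var (sem marks s) 29 0) by [].
have mk := marksP hc lm.
have am a : a != 11 -> arr (sem marks s) a = arr s a.
  by move=> h; apply: sem_arr; rewrite /= (negPf h).
have vm z : z != 20 -> var (sem marks s) z = var s z.
  by move=> h; apply: sem_var; rewrite /= (negPf h).
have {}ix : indexed (set_var (sem marks s) 29 0).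
  apply: indexed_ext ix => [x hx|a ha].
    rewrite var_set ifN ?vm //; by apply: contraTneq hx => ->.
  by rewrite -[arr _ a]/(arr (sem marks s) a) am //; apply: contraTneq ha => ->.
have {}hc : cells (set_var (sem marks s) 29 0).
  apply: cells_ext hc; first exact: am.
  by move=> m; apply: am; rewrite BD_neq.
have {}mk : marks_ok (set_var (sem marks s) 29 0) by [].
have z29 : var (set_var (sem marks s) 29 0) 29 = 0 by [].
move: ix hc mk z29; set t := set_var (sem marks s) 29 0; clearbody t => ix hc mk z29 {tb lm sl am vm}.
pose I k s' := if var s' 29 != 0 then exists v q, var s' 30 = nv v /\ good v l q
  else forall v q, nv v < k -> ~ good v l q.
have [_ [h10 _ _ _ _] _] := ix.
have ixs s' : (forall x, x \notin [:: 21; 27; 28; 29; 30] -> var s' x = var t x) ->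
    (forall a, a != 12 -> a != 13 -> arr s' a = arr t a) -> indexed s' /\ cells s'.
  move=> hv ha; split.
    apply: indexed_ext ix => [x hx|a hx].
      by apply: hv; move: hx; rewrite !inE => /or4P[/eqP->|/eqP->|/eqP->|/orP[/eqP->|/eqP->]].
    by apply: ha; apply: contraTneq hx => ->.
  apply: cells_ext hc; first by rewrite ha.
  by move=> m; rewrite ha // BD_neq.
have hI : I #|V| (sem (search_loop l) t).
  rewrite -h10; apply: for_frame => [|k s' hk IH fv fa]; first by rewrite /I z29.
  set s1 := set_var s' 21 k.
  have [ix1 hc1] : indexed s1 /\ cells s1.
    apply: ixs => [x hx|a n1 n2].
      rewrite var_set ifN; last by apply: contraNneq hx => ->.
      apply: fv; move: hx; rewrite inE negb_or => /andP[n1 n2].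
      by rewrite -[modv _ _]/((x == 21) || modv x (probe l)) (negPf n1) (negPf (probe_var l n2)).
    by rewrite -[arr s1 a]/(arr s' a) fa // probe_arr.
  have mk1 : marks_ok s1.
    move=> y hy; have [S hS] := mk y hy; exists S.
    by rewrite -[arr s1 11]/(arr s' 11) fa // probe_arr.
  have [v hv] : exists v, nv v = k by apply: (numbering_onto Nv); rewrite -h10.
  have := probeP l0 ix1 hc1 mk1 (esym hv : var s1 21 = nv v); cbv zeta.
  rewrite -[var s1 29]/(var s' 29); move: IH; rewrite /I; case: ifP => h29 IH.
    by move=> ->; rewrite -[var s1 29]/(var s' 29) h29.
  case=> [[-> [q hq]]|[-> no]]; first by exists v, q.
  rewrite eqxx => w q hw; move: hw; rewrite ltnS leq_eqVlt => /orP[/eqP ew|]; last exact: IH.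
  by rewrite -hv in ew; rewrite ((proj1 Nv) _ _ ew).
have [ix' hc'] : indexed (sem (search_loop l) t) /\ cells (sem (search_loop l) t).
  apply: ixs => [x hx|a n1 n2].
    apply: sem_var; move: hx; rewrite inE negb_or => /andP[n1 n2].
    by rewrite -[modv _ _]/((x == 21) || modv x (probe l)) (negPf n1) (negPf (probe_var l n2)).
  by apply: sem_arr; apply: probe_arr.
split=> //; move: hI; rewrite /I; case: ifP => // _ h v q; apply: h; exact: (proj2 Nv).
Qed.

(** Only the labels of the arc decide whether attaching it pays off. *)
Definition heavy (l : nat) : bool :=
  (l <= size (bd R)) && (perimeter (packet_map R) < path_perimeter (X := X) [seq bd_at R (i + m) | m <- iota 0 l]).

Lemma heavy_gt0 l : heavy l -> 0 < l.
Proof. by case: l => //; rewrite /heavy /path_perimeter big_nil ltn0 andbF. Qed.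

(** Since [Y] is packed, a lift of [R] at the first 1-cell of the walk extends to the
packet, and since [Y] is immersed this lift follows the whole walk. *)
Lemma reduction_good v q : packed Y -> immersion1 Y ->
  perimeter_reduction Y i v q <-> heavy (size q) /\ good v (size q) q.
Proof.
move=> pk im; split.
  case=> site w; have hl := site_labels site; have lL := site_size site.
  split; first by rewrite /heavy lL -hl w.
  have [hp _ _ no] := site; split=> [|x hx [S hS hSx]]; first by split.
  have [psi hpsi] := packed_at pk hS.
  have e : po psi (circ R i) = x.
    move: hSx; rewrite hpsi onth_map (onth_nth 0) ?size_iota // nth_iota // add0n => -[].
    by [].
  have hq : 0 < size q by case: (q) hx.
  apply: (site_no_lift_edge im site (psi := psi) (o := x) (m := 0) hq).
  by rewrite addn0 e; case: (q) hx => //= y q' [->].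
case=> hv [[_ hp hl] nm]; have q0 := heavy_gt0 hv; have /andP[lL w] := hv.
split; last by rewrite hl.
have [x hx] : exists x, onth q 0 = Some x by case: (q) q0 => // x q'; exists x.
have hlab : map (mo Y) q = map (mo (packet_map R)) (arc i (size q)).
  by rewrite map_mo_arc // hl.
have hx' : mo Y x = bd_at R i.
  have := congr1 (fun s => onth s 0) hl; rewrite onth_map hx /=.
  by case: (size q) q0 => // n _ /= [->]; rewrite addn0.
split=> //.
- have [y hw] := hp; have ev : osrc x = v by case: (q) hx hw => //= x' q' [->] [].
  by rewrite -ev -osrc_mo hx' -[X in _ = mv _ X]cyc_ord.
case=> psi [h1 h2]; apply: (nm x hx).
have e : po psi (circ R i) = x.
  have := congr1 (fun s => onth s 0) h2; rewrite hx onth_map onth_arc // addn0 /=.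
  by case.
exists (pf psi (Ordinal (cell2_exponent_gt0 R))); first by rewrite pf_over.
rewrite pf_bd packet_lift_bd /= onth_map onth_map (onth_nth 0) ?size_iota // nth_iota //=.
by rewrite mul0n add0n add0n e.
Qed.

End Walk.

(** * Attaching a packet *)

Lemma moda_pseq_in (T : eqType) a (f : T -> prog) (l : seq T) :
  (forall k, k \in l -> ~~ moda a (f k)) -> ~~ moda a (pseq (map f l)).
Proof.
elim: l => // k l IH h; rewrite -[moda _ _]/(moda a (f k) || moda a (pseq (map f l))).
rewrite (negPf (h k _)) ?mem_head //; apply: IH => j jl; apply: h.
by rewrite inE jl orbT.
Qed.

(** The writes may overlap as long as they agree where they do. *)
Lemma writesP (T : eqType) (ts : seq T) (a : T -> nat) (ex ee : T -> expr) (x y : T -> nat) s :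
  (forall s' t, t \in ts -> var s' = var s ->
     (forall c, (forall t', t' \in ts -> c != a t') -> arr s' c = arr s c) ->
     eval (ex t) s' = x t /\ eval (ee t) s' = y t) ->
  (forall t t', t \in ts -> t' \in ts -> a t = a t' -> x t = x t' -> y t = y t') ->
  let s' := sem (pseq [seq PWr (a t) (ex t) (ee t) | t <- ts]) s in
  [/\ forall t, t \in ts -> arr s' (a t) (x t) = y t,
      forall c z, (forall t, t \in ts -> c = a t -> z <> x t) -> arr s' c z = arr s c z
    & var s' = var s].
Proof.
elim/last_ind: ts => [|ts t IH] ev co /=; first by split.
have -> : [seq PWr (a t) (ex t) (ee t) | t <- rcons ts t] =
  [seq PWr (a t) (ex t) (ee t) | t <- ts] ++ [:: PWr (a t) (ex t) (ee t)].
  by rewrite map_rcons cats1.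
rewrite sem_pseq_cat.
have sub t' : t' \in ts -> t' \in rcons ts t by rewrite mem_rcons inE => ->; rewrite orbT.
have [|t1 t2 h1 h2|h1 h2 h3] := IH.
- by move=> s' t' ht hv ha; apply: ev; [exact: sub|by []|move=> c hc; apply: ha => t'' /sub/hc].
- by apply: co; apply: sub.
set s1 := sem _ s in h1 h2 h3 *.
have [e1 e2] : eval (ex t) s1 = x t /\ eval (ee t) s1 = y t.
  apply: ev => //; first by rewrite mem_rcons mem_head.
  move=> c hc; apply: sem_arr; apply: moda_pseq_in => t' ht.
  exact: hc (sub _ ht).
have es : sem (pseq [:: PWr (a t) (ex t) (ee t)]) s1 = set_arr s1 (a t) (x t) (y t).
  by rewrite /= e1 e2.
rewrite es; split=> //.
  move=> t'; rewrite mem_rcons inE => /orP[/eqP->|ht]; rewrite arr_set ?eqxx //.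
  case: eqP => [ea|_] /=; last exact: h1.
  case: eqP => [ex'|_]; last exact: h1.
  by apply: co => //; [rewrite mem_rcons mem_head|exact: sub].
move=> c z hc; rewrite arr_set; case: eqP => [ea|_] /=; last by apply: h2 => t' /sub/hc.
case: eqP => [ez|_]; last by apply: h2 => t' /sub/hc.
by case: (hc t) => //; rewrite mem_rcons mem_head.
Qed.

Section Attach.
Variables (X : wcomplex) (R : cell2 X) (i : 'I_(size (bd R))) (l : nat).
Notation L := (size (bd R)).
Notation n := (cell2_exponent R).
Notation rl := (root_length R).
Notation M := (max_bd X).

(** The last vertex of the boundary is the first one. *)
Definition next_vertex (k : nat) : prog :=
  if k.+1 < L then PSeq (PWr 13 (ECst k.+1) (EVar 31)) (PSet 31 (EAdd (EVar 31) (ECst 1)))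
  else PWr 13 (ECst k.+1) (ERd 13 (ECst 0)).
Definition next_edge (k : nat) : prog :=
  PSeq (PWr 12 (ECst k) (EDbl (EVar 32)))
    (PSeq (PWr 0 (EVar 32) (ERd 13 (ECst k)))
      (PSeq (PWr 1 (EVar 32) (ERd 13 (ECst k.+1)))
        (PSeq (PWr 2 (EVar 32) (ECst (letter_of (bd_at R (i + k)))))
          (PSet 32 (EAdd (EVar 32) (ECst 1)))))).
Definition extend_step (k : nat) : prog := PSeq (next_vertex k) (next_edge k).
Definition extend : prog := pseq [seq extend_step k | k <- iota l (L - l)].

Lemma extend_stepP k s :
  let s' := sem (extend_step k) s in let e := var s 32 in
  let w := if k.+1 < L then var s 31 else arr s 13 0 in
  [/\ arr s' 13 =1 upd (arr s 13) k.+1 w, arr s' 12 =1 upd (arr s 12) k (e + e),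
      arr s' 0 =1 upd (arr s 0) e (arr s 13 k), arr s' 1 =1 upd (arr s 1) e w
    & arr s' 2 =1 upd (arr s 2) e (letter_of (bd_at R (i + k)))] /\
  (var s' 32 = e.+1 /\ var s' 31 = if k.+1 < L then (var s 31).+1 else var s 31).
Proof.
cbv zeta; rewrite /extend_step sem_seq; set w := if _ then _ else _.
set s1 := sem (next_vertex k) s.
have [h13 h12 h0 h1 h2] : [/\ arr s1 13 =1 upd (arr s 13) k.+1 w, arr s1 12 = arr s 12,
    arr s1 0 = arr s 0, arr s1 1 = arr s 1 & arr s1 2 = arr s 2].
  by rewrite /s1 /next_vertex /w; case: ifP.
have [h32 h31] : var s1 32 = var s 32 /\ var s1 31 = if k.+1 < L then (var s 31).+1 else var s 31.
  by rewrite /s1 /next_vertex; case: ifP => _; split=> //=; rewrite /upd /= addn1.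
clearbody s1; rewrite -h32 -h31 -h12 -h0 -h1 -h2.
have e13 : arr s1 13 k = arr s 13 k by rewrite h13 /upd ltn_eqF.
have e13' : arr s1 13 k.+1 = w by rewrite h13 /upd eqxx.
rewrite -e13 -e13'; split; last by split=> //=; rewrite /upd /= addn1.
split; try by []; by move=> x; rewrite -[LHS]/(arr s1 13 x) h13 e13'.
Qed.

Lemma extend_frame s : (forall z, z != 31 -> z != 32 -> var (sem extend s) z = var s z) /\
  (forall a, a \notin [:: 0; 1; 2; 12; 13] -> arr (sem extend s) a = arr s a).
Proof.
split=> [z h1 h2|a ha].
  apply: sem_var; apply: modv_pseq => k; rewrite /extend_step /next_vertex.
  by case: ifP => _; rewrite /= ?(negPf h1) ?(negPf h2).
apply: sem_arr; apply: moda_pseq => k; move: ha; rewrite !inE !negb_or => /and5P[h0 h1 h2 h3 h4].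
rewrite /extend_step /next_vertex.
by case: ifP => _; rewrite /= (negPf h0) (negPf h1) (negPf h2) (negPf h3) (negPf h4).
Qed.

(** In these pairs, [(j, 0)] stands for the entry of the [j]-th 2-cell of the packet
in array 3, and [(j, p.+1)] for its entry in array [BD p]. *)
Definition cell_writes : seq (nat * nat) := [seq (j, p) | j <- iota 0 n, p <- iota 0 L.+1].
Definition attach_cells : prog :=
  pseq [seq PWr (if t.2 is p.+1 then BD p else 3) (EAdd (EVar 2) (ECst t.1))
          (if t.2 is p.+1 then ERd 12 (ECst (pos i (t.1 * rl + p))) else rank R)
       | t <- cell_writes].

Lemma attach_cellsP s : let s' := sem attach_cells s in
  [/\ forall j, j < n -> arr s' 3 (var s 2 + j) = enum_rank (R : fcell2 X) /\
        forall p, p < L -> arr s' (BD p) (var s 2 + j) = arr s 12 (pos i (j * rl + p)),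
      forall a x, a = 3 \/ (exists p, a = BD p) -> x < var s 2 -> arr s' a x = arr s a x,
      forall a, a < 24 -> a != 3 -> arr s' a = arr s a & var s' = var s].
Proof.
have mem j p : j < n -> p < L.+1 -> (j, p) \in cell_writes.
  by move=> hj hp; apply/allpairsP; exists (j, p); rewrite !mem_iota.
have := @writesP _ cell_writes (fun t => if t.2 is p.+1 then BD p else 3)
  (fun t => EAdd (EVar 2) (ECst t.1))
  (fun t => if t.2 is p.+1 then ERd 12 (ECst (pos i (t.1 * rl + p))) else rank R)
  (fun t => var s 2 + t.1)
  (fun t => if t.2 is p.+1 then arr s 12 (pos i (t.1 * rl + p)) else enum_rank (R : fcell2 X)) s.
case=> [s' t _ hv ha|t t' _ _ ea|h1 h2 h3].
- split; first by rewrite /= hv.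
  case: t.2 => [//|p] /=; rewrite ha // => t' _; case: t'.2 => // p'; by rewrite neq_BD.
- move/eqP; rewrite eqn_add2l => /eqP ej; move: ea; rewrite ej.
  by case: (t.2) (t'.2) => [|p] [|p'] // /eqP; rewrite BD_eq => /eqP ->.
split=> //.
- move=> j hj; split; first exact: (h1 (j, 0) (mem j 0 hj isT)).
  by move=> p hp; exact: (h1 (j, p.+1) (mem j p.+1 hj hp)).
- by move=> a x _ hx; apply: h2 => t _ _ ex; move: hx; rewrite ex ltnNge leq_addr.
move=> a ha n3; apply: sem_arr; apply: moda_pseq => -[j [|p]] /=; first exact: n3.
exact: negbT (neq_BD p ha).
Qed.

Definition join_ends : prog :=
  PSeq (PSet 22 (ERd 13 (ECst 0))) (PSeq (PSet 23 (ERd 13 (ECst L))) (merge 14 34 31 19)).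
Definition rename_ends : prog :=
  PSeq (fill 0 35 (ERd 14 (ERd 0 v1))) (fill 1 35 (ERd 14 (ERd 1 v1))).
Definition finish_attach : prog :=
  PSeq (PSet 0 (EVar 19)) (PSeq (PSet 1 (EVar 32))
    (PSeq (PSet 2 (EAdd (EVar 2) (ECst n))) (PSet 3 (ECst 1)))).
Definition start_walk : prog :=
  PSeq (PWr 13 (ECst 0) (EVar 30)) (PSeq (walk i l) (PSeq (PSet 31 (EVar 0)) (PSet 32 (EVar 1)))).
Definition perform_attach : prog :=
  PSeq start_walk (PSeq extend (PSeq attach_cells (PSeq join_ends (PSeq rename_ends finish_attach)))).

Variables (Y : complex_over X).
Notation V := (fvert (dom Y)).
Notation E := (fcell1 (dom Y)).
Notation F := (fcell2 (dom Y)).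
Variables (nv : V -> nat) (ne : E -> nat) (nf : F -> nat).
Hypothesis Nv : numbering nv.
Hypothesis Ne : numbering ne.
Hypothesis Nf : numbering nf.
Variables (v : V) (q : seq (oedge (dom Y))).
Hypothesis sq : size q = l.
Hypothesis site : attachment_site Y i v q.
Variable o0 : oedge (dom Y).
Notation vak := (va nv R v q o0).
Notation qek := (qe ne q o0).

Let lL : l <= L. Proof. by rewrite -sq; exact: site_size site. Qed.

Lemma va_old k : k <= l -> vak k = nv (walk_vert v q o0 k).
Proof. by move=> h; rewrite /va sq h. Qed.

Lemma va_new m : l + m.+1 < L -> vak (l + m).+1 = #|V| + m.
Proof. by rewrite addnS => h; rewrite /va sq ltnNge leq_addr /= h subSS addKn. Qed.

Lemma va_end : l < L -> vak L = vak 0.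
Proof. by move=> h; rewrite /va sq leqNgt h ltnn. Qed.

Lemma qe_new m : qek (l + m) = (#|E| + m, false).
Proof. by rewrite /qe sq ltnNge leq_addr addKn. Qed.

Lemma extendP s : var s 31 = #|V| -> var s 32 = #|E| ->
  (forall k, k <= l -> arr s 13 k = vak k) ->
  (forall k, k < l -> arr s 12 k = letter (qek k).1 (qek k).2) ->
  let s' := sem extend s in
  [/\ var s' 31 = #|V| + (L - l).-1, var s' 32 = #|E| + (L - l),
      forall k, k <= L -> arr s' 13 k = vak k,
      forall k, k < L -> arr s' 12 k = letter (qek k).1 (qek k).2
    & (forall x, x < #|E| -> [/\ arr s' 0 x = arr s 0 x, arr s' 1 x = arr s 1 x & arr s' 2 x = arr s 2 x]) /\
      forall k, l <= k -> k < L -> [/\ arr s' 0 (#|E| + (k - l)) = vak k,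
        arr s' 1 (#|E| + (k - l)) = vak k.+1
        & arr s' 2 (#|E| + (k - l)) = letter_of (bd_at R (i + k))]].
Proof.
move=> h31 h32 hV hQ.
suff H m : m <= L - l -> let s' := sem (pseq [seq extend_step k | k <- iota l m]) s in
  [/\ var s' 31 = #|V| + (if m < L - l then m else (L - l).-1), var s' 32 = #|E| + m,
      forall k, k <= l + m -> arr s' 13 k = vak k,
      forall k, k < l + m -> arr s' 12 k = letter (qek k).1 (qek k).2
    & (forall x, x < #|E| -> [/\ arr s' 0 x = arr s 0 x, arr s' 1 x = arr s 1 x & arr s' 2 x = arr s 2 x]) /\
      forall k, l <= k -> k < l + m -> [/\ arr s' 0 (#|E| + (k - l)) = vak k,
        arr s' 1 (#|E| + (k - l)) = vak k.+1
        & arr s' 2 (#|E| + (k - l)) = letter_of (bd_at R (i + k))]].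
  by have := H _ (leqnn _); rewrite ltnn subnKC.
elim: m => [_|m IH hm].
  rewrite !addn0; split=> //; last first.
    by split=> // k h1 h2; have := leq_ltn_trans h1 h2; rewrite ltnn.
  by rewrite -[sem _ _]/s h31; case: (L - l) => [|d]; rewrite /= addn0.
have {IH} [h1 h2 h3 h4 [h5 h6]] := IH (ltnW hm).
cbv zeta; rewrite -addn1 iotaD map_cat sem_pseq_cat addn1.
set s1 := sem _ s in h1 h2 h3 h4 h5 h6 *.
have -> : sem (pseq [seq extend_step k | k <- iota (l + m) 1]) s1 = sem (extend_step (l + m)) s1 by [].
have [[g13 g12 g0 g1 g2] [g32 g31]] := extend_stepP (l + m) s1.
move: g13 g12 g0 g1 g2 g32 g31; set s2 := sem _ s1; clearbody s2 s1.
rewrite h1 h2 hm => g13 g12 g0 g1 g2 g32 g31.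
have hk : l + m < L by rewrite -ltn_subRL.
set w := if _ then _ else _ in g13 g1.
have ew : w = vak (l + m).+1.
  rewrite /w; case: ifP => h; first by rewrite va_new // addnS.
  have e : (l + m).+1 = L by apply/eqP; rewrite eqn_leq hk leqNgt h.
  by rewrite h3 // e va_end // (leq_ltn_trans _ hk) ?leq_addr.
clearbody w; rewrite {w}ew in g13 g1.
have eb : ((l + m).+1 < L) = (m.+1 < L - l) by rewrite ltn_subRL addnS.
split.
- rewrite g31 eb; case: ifP => h; first by rewrite addnS.
  suff -> : (L - l).-1 = m by [].
  by have /eqP <- : m.+1 == L - l by rewrite eqn_leq hm leqNgt h.
- by rewrite g32 addnS.
- move=> k; rewrite addnS leq_eqVlt g13 /upd => /orP[/eqP ->|hk']; first by rewrite eqxx.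
  by rewrite (ltn_eqF hk') h3.
- move=> k; rewrite addnS ltnS leq_eqVlt g12 /upd => /orP[/eqP ->|hk'].
    by rewrite eqxx qe_new addnn /letter addn0.
  by rewrite (ltn_eqF hk') h4.
split=> [x hx|k h7]; rewrite g0 g1 g2 /upd.
  by rewrite (ltn_eqF (leq_trans hx (leq_addr _ _))); apply: h5.
rewrite addnS ltnS eqn_add2l leq_eqVlt => /orP[/eqP ->|hk'].
  by rewrite addKn eqxx h3.
have -> : (k - l == m) = false.
  by apply/negbTE; rewrite neq_ltn ltn_subLR ?hk'.
exact: h6.
Qed.


Lemma walk_vert_path k : k <= l -> is_path (v : vert (dom Y)) (take k q) (walk_vert v q o0 k).
Proof.
have [[w hw] _ _ _] := site; elim: k => [|k IH] hk; first by rewrite take0.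
have hkq : k < size q by rewrite sq.
have e := take_nth o0 hkq.
have [x hx _] : exists2 x, is_path (v : vert (dom Y)) (take k.+1 q) x & is_path x (drop k.+1 q) w.
  by move: hw; rewrite -{1}(cat_take_drop k.+1 q) => /is_path_catP.
by move: hx; rewrite e => /is_path_rcons[h1 h2]; apply/is_path_rcons; split.
Qed.

Lemma start_walkP s : immersion1 Y -> indexed nv ne s -> var s 30 = nv v ->
  follows i v l q ->
  let s' := sem start_walk s in
  [/\ forall k, k <= l -> arr s' 13 k = vak k,
      forall k, k < l -> arr s' 12 k = letter (qek k).1 (qek k).2,
      var s' 31 = var s 0 /\ var s' 32 = var s 1,
      forall z, z \notin [:: 27; 28; 31; 32] -> var s' z = var s z
    & forall a, a != 12 -> a != 13 -> arr s' a = arr s a].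
Proof.
move=> im ix h30 fq; cbv zeta; pose s1 := sem (PWr 13 (ECst 0) (EVar 30)) s.
have -> : sem start_walk s = set_var (set_var (sem (walk i l) s1) 31 (var (sem (walk i l) s1) 0)) 32
   (var (sem (walk i l) s1) 1) by exact: erefl.
have a1 a : a != 13 -> arr s1 a = arr s a by move=> h; apply: sem_arr; rewrite /= h.
have ix1 : indexed nv ne s1.
  apply: indexed_ext ix => // a ha; apply: a1; by apply: contraTneq ha => ->.
have h0 : arr s1 13 0 = nv v by rewrite /s1 /= /upd /=.
have := walkP Nv Ne i l ix1 h0.
have vw z : z != 27 -> z != 28 -> var (sem (walk i l) s1) z = var s z.
  by move=> n1 n2; rewrite sem_var ?walk_var.
have aw a : a != 12 -> a != 13 -> arr (sem (walk i l) s1) a = arr s a.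
  by move=> n1 n2; rewrite sem_arr ?walk_arr // a1.
set s2 := sem (walk i l) s1 in vw aw *; clearbody s2 => {s1 a1 ix1 h0}; cbv zeta.
case: ifP => _; last by move/(_ q).
move=> [q' [fq' hQ hV]].
have eq : q' = q.
  have [_ [w hw] lq] := fq; have [_ [w' hw'] lq'] := fq'.
  by rewrite (immersion_path_inj im hw' hw) // lq' lq.
subst q'; split.
- move=> k hk; rewrite va_old // -[LHS]/(arr s2 13 k); apply: hV => //; exact: walk_vert_path.
- move=> k hk; rewrite -[LHS]/(arr s2 12 k) (hQ k (nth o0 q k)); last by apply: onth_nth; rewrite sq.
  by rewrite /qe sq hk.
- by rewrite -[var _ 31]/(var s2 0) -[var _ 32]/(var s2 1) !vw.
- move=> z; rewrite !inE !negb_or => /and4P[n1 n2 n3 n4].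
  by rewrite !var_set (negPf n3) (negPf n4) vw.
by move=> a n1 n2; rewrite -[LHS]/(arr s2 a) aw.
Qed.

(** The walk is repeated to record its 1-cells and vertices, then prolonged by new
ones around the boundary. *)
Lemma perform_attachP s : coded nv ne nf s -> indexed nv ne s -> room Y M s ->
  var s 30 = nv v -> follows i v l q -> maximal_reduction Y i v q -> immersion1 Y ->
  let s' := sem perform_attach s in
  var s' 3 = 1 /\ exists Y', is_attachment Y Y' /\ exists nv' ne' nf', coded (Y := Y') nv' ne' nf' s'.
Proof.
move=> cd ix [r34 r35] h30 fq mx im; have [c0 c1 c2 [_ _ _ ce cf]] := cd.
pose s1 := sem start_walk s; pose s2 := sem extend s1; pose s3 := sem attach_cells s2.
pose s4 := sem join_ends s3; pose s5 := sem rename_ends s4; pose s6 := sem finish_attach s5.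
rewrite (erefl : sem perform_attach s = s6).
have [hV hQ [v31 v32] vs1 as1] := start_walkP im ix h30 fq.
rewrite -/s1 in hV hQ v31 v32 vs1 as1.
rewrite c0 in v31; rewrite c1 in v32.
have [w31 w32 wV wQ [wo wn]] := extendP v31 v32 hV hQ.
have [vs2 as2] := extend_frame s1; rewrite -/s2 in w31 w32 wV wQ wo wn vs2 as2.
have [x3 xo as3 vs3] := attach_cellsP s2; rewrite -/s3 in x3 xo as3 vs3.
have LM : L <= M by exact: leq_max_bd.
have e2 : var s2 2 = #|F| by rewrite vs2 // vs1.
have e34 : var s2 34 = #|V| + M by rewrite vs2 // vs1.
have e35 : var s2 35 = #|E| + M by rewrite vs2 // vs1.
have cV : collapse (#|V| + (L - size q).-1) (var s4 19) (vak 0) (vak L) (arr s4 14).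
  pose s0 := set_var (set_var s3 22 (arr s3 13 0)) 23 (arr s3 13 L).
  have es0 : s4 = sem (merge 14 34 31 19) s0 by exact: erefl.
  have e22 : var s0 22 = vak 0 by rewrite -[LHS]/(arr s3 13 0) as3 // wV.
  have e23 : var s0 23 = vak L by rewrite -[LHS]/(arr s3 13 L) as3 // wV.
  have e31 : var s0 31 = #|V| + (L - size q).-1 by rewrite -[LHS]/(var s3 31) vs3 w31 sq.
  have e34' : var s0 34 = #|V| + M by rewrite -[LHS]/(var s3 34) vs3.
  have := @mergeP 14 34 31 19 s0 isT; rewrite -es0 e22 e23 e31 e34'; apply.
  - by rewrite leq_add2l; apply: leq_trans (leq_pred _) (leq_trans (leq_subr _ _) LM).
  - by rewrite va_old //; apply: leq_trans (proj2 Nv _) (leq_addr _ _).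
  have [eL|hl] := leqP L l; last first.
    by rewrite va_end // va_old //; apply: leq_trans (proj2 Nv _) (leq_addr _ _).
  by rewrite va_old //; apply: leq_trans (proj2 Nv _) (leq_addr _ _).
have vs4 z : z \notin [:: 19; 20; 22; 23; 24; 25] -> var s4 z = var s3 z.
  move=> hz; apply: sem_var; move: hz; rewrite !inE !negb_or.
  case/and5P=> h1 h2 h3 h4 /andP[h5 h6].
  by rewrite /= (negPf h1) (negPf h2) (negPf h3) (negPf h4) (negPf h5) (negPf h6).
have as4 a : a != 14 -> arr s4 a = arr s3 a.
  by move=> h; apply: sem_arr; rewrite /= (negPf h).
have vs5 z : z != 20 -> var s5 z = var s4 z.
  by move=> h; apply: sem_var; rewrite /= (negPf h).
have as5 a : a != 0 -> a != 1 -> arr s5 a = arr s4 a.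
  by move=> n0 n1; apply: sem_arr; rewrite /= (negPf n0) (negPf n1).
have f4 : var s4 35 = #|E| + M by rewrite vs4 // vs3.
have ren a k : (a == 0) || (a == 1) -> k < #|E| + M -> arr s5 a k = arr s4 14 (arr s4 a k).
  pose t := sem (fill 0 35 (ERd 14 (ERd 0 v1))) s4.
  have et : s5 = sem (fill 1 35 (ERd 14 (ERd 1 v1))) t by exact: erefl.
  have et' : t = sem (fill 0 35 (ERd 14 (ERd 0 v1))) s4 by exact: erefl.
  have at1 b : b != 0 -> arr t b = arr s4 b.
    by move=> h; apply: sem_arr; rewrite /= (negPf h).
  have vt : var t 35 = var s4 35 by apply: sem_var.
  clearbody t; case/orP=> /eqP -> hk; last first.
    have [|h _] := @fillP 1 35 (ERd 14 (ERd 1 v1)) t (fun k => arr s4 14 (arr s4 1 k)).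
      by move=> m s' _ h20 _ fa fj; rewrite /= h20 fa // fj // !at1.
    by rewrite et h // vt f4.
  have [|h _] := @fillP 0 35 (ERd 14 (ERd 0 v1)) s4 (fun k => arr s4 14 (arr s4 0 k)).
    by move=> m s' _ h20 _ fa fj; rewrite /= h20 fa // fj.
  by rewrite et sem_arr // et' h // f4.
have as6 : arr s6 = arr s5 by exact: erefl.
have [go6 e60 e61 e62] : [/\ var s6 3 = 1, var s6 0 = var s5 19, var s6 1 = var s5 32
  & var s6 2 = var s5 2 + n] by split; exact: erefl.
clearbody s6 s5 s4 s3 s2 s1.
split=> //; exists (attached Nv Ne site cV); split; first exact: attached_is_attachment.
exists (fun v => val v), (fun e => val e), (cell_num nf (R := R)); apply: attached_coded => //.
- rewrite e60 e61 e62 !vs5 //; split=> //.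
    by rewrite vs4 // vs3 w32 sq.
  by rewrite vs4 // vs3 e2.
- move=> e; have he := proj2 Ne e; have [g0 g1 g2] := ce e.
  have heM : ne e < #|E| + M by apply: leq_trans he (leq_addr _ _).
  have [k0 k1 k2] := wo _ he.
  rewrite as6 (ren 0) // (ren 1) // as5 // (as4 0) // (as4 1) // (as4 2) // !as3 //.
  by rewrite k0 k1 k2 !as1 // g0 g1 g2.
- move=> k; rewrite sq => lk kL; have [k0 k1 k2] := wn k lk kL.
  have hkM : #|E| + (k - l) < #|E| + M.
    by rewrite ltn_add2l; apply: leq_ltn_trans (leq_subr _ _) (leq_trans kL LM).
  rewrite as6 (ren 0) // (ren 1) // as5 // (as4 0) // (as4 1) // (as4 2) // !as3 //.
  by rewrite k0 k1 k2.
- move=> S; have [g3 g4] := cf S; have hS := proj2 Nf S.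
  rewrite as6 as5 // as4 // xo ?e2 //; last by left.
  rewrite as2 // as1 //; split=> // m o ho.
  rewrite as5 ?BD_neq // as4 ?BD_neq // xo ?e2 //; last by right; exists m.
  by rewrite as2 ?as1 ?BD_neq // ?(g4 _ _ ho) // !inE !BD_neq.
move=> j hj; have [y3 yB] := x3 _ hj; rewrite e2 in y3 yB.
rewrite as6 as5 // as4 // y3; split=> // m hm.
by rewrite as5 ?BD_neq // as4 ?BD_neq // yB // wQ // pos_lt.
Qed.

End Attach.

(** * One step of the algorithm *)

Section Step.
Variable X : wcomplex.
Notation M := (max_bd X).

Definition site_start : finType := {R : fcell2 X & 'I_(size (bd (R : cell2 X)))}.

Fixpoint try_sites (cs : seq (site_start * nat)) : prog :=
  if cs is c :: cs' then
    PSeq (search (tagged c.1) c.2)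
      (PIf (EVar 29) (perform_attach (tagged c.1) c.2) (try_sites cs'))
  else PSet 3 (ECst 0).

Definition longer (c c' : site_start * nat) : bool := c'.2 <= c.2.
(** Only heavy arcs can give a reduction; the longest ones come first. *)
Definition candidates : seq (site_start * nat) :=
  [seq c <- sort longer [seq (t, l) | t <- enum site_start, l <- iota 0 M.+1]
  | heavy (tagged c.1) c.2].

Lemma longer_trans : ssrbool.transitive longer.
Proof. by move=> b a c; rewrite /longer => h1 h2; exact: leq_trans h2 h1. Qed.

Lemma candidates_sorted : sorted longer candidates.
Proof.
apply: (sorted_filter longer_trans); apply: sort_sorted => a b; exact: leq_total.
Qed.

Lemma candidates_all (R : cell2 X) (i : 'I_(size (bd R))) l :
  heavy i l -> (Tagged (fun R : fcell2 X => 'I_(size (bd (R : cell2 X)))) i, l) \in candidates.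
Proof.
move=> h; rewrite mem_filter h mem_sort; apply: allpairs_f; first exact: mem_enum.
rewrite mem_iota add0n ltnS; have /andP[hl _] := h.
exact: leq_trans hl (leq_max_bd R).
Qed.

Definition step_prog : prog :=
  PSeq (set_limits X M) (PSeq inverse_letters (PSeq oriented_tables (PSeq (fill_slots X)
    (PSeq (find_fold X) (PIf (EVar 15) (perform_fold X) (try_sites candidates)))))).

Variable Y : complex_over X.
Notation V := (fvert (dom Y)).
Notation E := (fcell1 (dom Y)).
Notation F := (fcell2 (dom Y)).
Variables (nv : V -> nat) (ne : E -> nat) (nf : F -> nat).

Definition stepped (s : state) : Prop :=
  if var s 3 == 0 then stops_at Y /\ coded nv ne nf s
  else exists Y', alg_step Y Y' /\ exists nv' ne' nf', coded (Y := Y') nv' ne' nf' s.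

(** Once the arcs before it have failed, an arc for which the search succeeds is the
longest one that gives a reduction, so the reduction is maximal. *)
Lemma try_sitesP cs s : packed Y -> immersion1 Y ->
  coded nv ne nf s -> indexed nv ne s -> room Y M s ->
  sorted longer cs -> (forall c, c \in cs -> heavy (tagged c.1) c.2) ->
  (forall (R : cell2 X) (i : 'I_(size (bd R))) l v (q : seq (oedge (dom Y))), heavy i l -> good i v l q ->
     (Tagged (fun R : fcell2 X => 'I_(size (bd (R : cell2 X)))) i, l) \in cs) ->
  stepped (sem (try_sites cs) s).
Proof.
move=> pk im; elim: cs s => [|c cs IH] s cd ix rm srt hv all_in.
  rewrite /stepped -[sem _ _]/(set_var s 3 0) var_set eqxx eqxx; split.
    split=> // -[R [i [v [q hr]]]]; have [h1 h2] := (reduction_good i v q pk im).1 hr.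
    by have := all_in _ _ _ _ _ h1 h2.
  by apply: coded_ext cd => // x hx; rewrite var_set ifN // ltn_eqF.
have [_ _ _ [Nv Ne Nf _ cf]] := cd.
have hc := hv c (mem_head _ _).
have [ix1 hc1 hs] := searchP Nv Ne Nf (tagged c.1) (heavy_gt0 hc) ix cf.
rewrite -[sem (try_sites _) s]/(sem (PIf (EVar 29) (perform_attach (tagged c.1) c.2) (try_sites cs))
  (sem (search (tagged c.1) c.2) s)).
have va z : z \notin [:: 20; 21; 27; 28; 29; 30] -> var (sem (search (tagged c.1) c.2) s) z = var s z.
  rewrite 2!inE !negb_or => /and3P[n1 n2 n3]; apply: sem_var.
  rewrite -[modv _ _]/(((z == 20) || (false || false)) || ((z == 29) || ((z == 21) || modv z (probe (tagged c.1) c.2)))).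
  have n4 : z \notin [:: 27; 28; 29; 30] by rewrite !inE !negb_or; move: n3; rewrite andbT.
  rewrite (negPf (probe_var _ _ n4)) (negPf n1) (negPf n2).
  by move: n4; rewrite !inE !negb_or => /and4P[_ _ /negPf ->].
have aa a : a \notin [:: 11; 12; 13] -> arr (sem (search (tagged c.1) c.2) s) a = arr s a.
  rewrite !inE !negb_or => /and3P[n1 n2 n3]; apply: sem_arr.
  rewrite -[moda _ _]/((false || (a == 11)) || (moda a (probe (tagged c.1) c.2))).
  by rewrite (negPf n1) (negPf (probe_arr _ _ n2 n3)).
move: hs ix1 hc1 va aa; set s1 := sem (search _ _) s; clearbody s1; cbv zeta => hs ix1 hc1 va aa.
have cd1 : coded nv ne nf s1.
  apply: coded_ext cd => [x hx|a ha|m].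
  - by apply: va; rewrite !inE !negb_or !ltn_eqF // (leq_trans hx).
  - by apply: aa; rewrite !inE !negb_or !ltn_eqF // (leq_trans ha).
  by apply: aa; rewrite !inE !BD_neq.
have rm1 : room Y M s1 by case: rm => r1 r2; split; rewrite va.
rewrite sem_if -[eval (EVar 29) s1]/(var s1 29); move: hs; case: ifP => _ hs; last first.
  apply: IH => //; first by move: srt; exact: path_sorted.
    by move=> c' h; apply: hv; rewrite inE h orbT.
  move=> R i l v q h1 h2; have := all_in R i l v q h1 h2; rewrite inE => /orP[/eqP e|//].
  by case: (hs v q); rewrite -e.
have [v [q [h30 gd]]] := hs; have [fq _] := gd; have [sq _ _] := fq.
have pr : perimeter_reduction Y (tagged c.1) v q.
  by apply/reduction_good => //; rewrite sq.
have mx : maximal_reduction Y (tagged c.1) v q.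
  split=> // i' v' p1 p2 pr' _ _.
  have [h1 h2] := (reduction_good i' v' _ pk im).1 pr'.
  have := all_in _ _ _ _ _ h1 h2.
  have mn := order_path_min longer_trans (srt : path longer c cs).
  have le c' : c' \in c :: cs -> c'.2 <= c.2.
    by rewrite inE => /orP[/eqP-> //|]; move/allP: mn; apply.
  move/le; rewrite /= !size_cat sq addnCA -[X in _ <= X]addn0 leq_add2l leqn0 addn_eq0.
  by rewrite !size_eq0 => /andP[/eqP -> /eqP ->].
have [o0 _] : exists o0 : oedge (dom Y), True.
  by case: (q) sq (heavy_gt0 hc) => [<-|o q'] //; exists o.
have [site _] := pr.
have [go3 [Y' [hat cd']]] := perform_attachP Nv Ne Nf sq site o0 cd1 ix1 rm1 h30 fq mx im.
rewrite /stepped go3; exists Y'; split=> //; by right.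
Qed.

Lemma step_progP s : packed Y -> coded nv ne nf s -> stepped (sem step_prog s).
Proof.
move=> pk cd; have [_ _ _ [Nv Ne Nf _ _]] := cd.
pose s1 := sem (set_limits X M) s; pose s2 := sem inverse_letters s1.
pose s3 := sem oriented_tables s2; pose s4 := sem (fill_slots X) s3.
pose s5 := sem (find_fold X) s4.
have -> : sem step_prog s = if var s5 15 != 0 then sem (perform_fold X) s5
  else sem (try_sites candidates) s5 by exact: erefl.
have [lm1 rm1] := set_limitsP M cd; rewrite -/s1 in lm1 rm1.
have v1 z : z < 10 -> var s1 z = var s z.
  by move=> h; apply: sem_var; rewrite /= !ltn_eqF // (leq_trans h).
have a1 a : arr s1 a = arr s a by exact: sem_arr.
have v2 z : z != 20 -> var s2 z = var s1 z by move=> h; apply: sem_var; rewrite /= (negPf h).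
have a2 a : a != 9 -> arr s2 a = arr s1 a.
  by move=> h; apply: sem_arr; rewrite /= (negPf h).
have iv := inverse_lettersP lm1; rewrite -/s2 in iv.
have v3 z : z != 20 -> var s3 z = var s2 z by move=> h; apply: sem_var; rewrite /= (negPf h).
have a3 a : a \notin [:: 4; 5; 6; 7; 8] -> arr s3 a = arr s2 a.
  rewrite !inE !negb_or => /and5P[/negPf n1 /negPf n2 /negPf n3 /negPf n4 /negPf n5]; apply: sem_arr.
  by rewrite /= n1 n2 n3 n4 n5.
have cd2 : coded nv ne nf s2.
  apply: coded_ext cd => [x hx|a ha|m].
  - by rewrite v2 ?v1 // ?(ltn_eqF) // (leq_trans hx).
  - by rewrite a2 ?a1 // ltn_eqF // (leq_trans ha).
  by rewrite a2 ?a1 // BD_neq.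
have lm2 : limits Y s2 by case: lm1 => l1 l2 l3 l4 l5; split; rewrite v2.
have tb3 := oriented_tablesP Ne cd2 lm2 iv; rewrite -/s3 in tb3.
have lm3 : limits Y s3 by case: lm2 => l1 l2 l3 l4 l5; split; rewrite v3.
have sl4 := fill_slotsP Nv Ne tb3 lm3; rewrite -/s4 in sl4.
have v4 z : z != 20 -> var s4 z = var s3 z by move=> h; apply: sem_var; rewrite /= (negPf h).
have a4 a : a != 10 -> arr s4 a = arr s3 a by move=> h; apply: sem_arr; rewrite /= (negPf h).
have tb4 : tables nv ne s4 by move=> o; rewrite !a4.
have lm4 : limits Y s4 by case: lm3 => l1 l2 l3 l4 l5; split; rewrite v4.
have := find_foldP Ne tb4 sl4 lm4; rewrite -/s5.
have v5 z : z \notin [:: 15; 16; 17; 20] -> var s5 z = var s4 z.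
  rewrite !inE !negb_or => /and4P[/negPf n1 /negPf n2 /negPf n3 /negPf n4]; apply: sem_var.
  by rewrite /= n1 n2 n3 n4.
have a5 a : arr s5 a = arr s4 a by exact: sem_arr.
have tb5 : tables nv ne s5 by move=> o; rewrite !a5.
have lm5 : limits Y s5 by case: lm4 => l1 l2 l3 l4 l5; split; rewrite v5.
have rm5 : room Y M s5 by case: rm1 => r1 r2; split; rewrite v5 // v4 // v3 // v2.
have cd5 : coded nv ne nf s5.
  apply: coded_ext cd2 => [x hx|a ha|m].
  - have h20 : x != 20 by rewrite ltn_eqF // (leq_trans hx).
    by rewrite v5 ?v4 ?v3 // !inE !negb_or !ltn_eqF // (leq_trans hx).
  - by rewrite a5 a4 ?a3 // ?inE ?negb_or !ltn_eqF // (leq_trans ha).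
  by rewrite a5 a4 ?a3 // ?inE BD_neq.
move: v5 a5 tb5 lm5 rm5 cd5; set t := s5; clearbody t => v5 a5 tb5 lm5 rm5 cd5; cbv zeta.
case: eqP => h15 h; last first.
  have [x [y [fxy e16 e17]]] := h.
  have [go3 [Y' [hf cd']]] := perform_foldP Nv Ne Nf fxy cd5 tb5 lm5 e16 e17.
  by rewrite /stepped go3; exists Y'; split=> //; left.
have [im sl] := h.
apply: try_sitesP => //.
- by split=> // o; rewrite a5.
- exact: candidates_sorted.
- by move=> c; rewrite mem_filter => /andP[].
by move=> R i l v q hh _; exact: candidates_all.
Qed.

End Step.

(** * The cost of a step *)

Definition step_limits : seq nat := [:: 10; 11; 12; 13; 14; 34; 35].

Section Tame.
Variable L : seq nat.

(** What [compile_ok] and [cost_bound] ask of a program, in a form that can be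
checked piece by piece. *)
Definition tame (d : nat) (p : prog) : bool :=
  [&& pvars 40 p, limits_in L p, all (fun x => ~~ modv x p) L & pdepth p <= d].

Lemma tame_seq d p q : tame d p -> tame d q -> tame d (PSeq p q).
Proof.
case/and4P=> a1 a2 a3 a4 /and4P[b1 b2 b3 b4]; apply/and4P; split.
- by rewrite /= a1.
- by rewrite /= a2.
- apply/allP => x hx; rewrite -[modv _ _]/(modv x p || modv x q) negb_or.
  by rewrite (allP a3 x hx) (allP b3 x hx).
by rewrite /= geq_max a4.
Qed.

Lemma tame_if d e p q : evars 40 e -> tame d p -> tame d q -> tame d (PIf e p q).
Proof.
move=> he hp hq; have /and4P[h1 h2 h3 h4] := tame_seq hp hq; apply/and4P; split=> //.
by rewrite -[pvars _ _]/([&& evars 40 e, pvars 40 p & pvars 40 q]) he.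
Qed.

Lemma tame_for d i n p : i < 40 -> n < 40 -> i \notin L -> n \in L -> tame d p ->
  tame d.+1 (PFor i n p).
Proof.
move=> hi n40 hiL hn /and4P[h1 h2 h3 h4].
apply/and4P; split=> //; first by rewrite -[pvars _ _]/([&& i < 40, n < 40 & pvars 40 p]) hi n40.
  by rewrite -[limits_in _ _]/((n \in L) && limits_in L p) hn.
apply/allP => x hx; rewrite -[modv _ _]/((x == i) || modv x p) negb_or (allP h3) ?andbT //.
by apply: contraNneq hiL => <-.
Qed.

Lemma tame_set d x e : x < 40 -> x \notin L -> evars 40 e -> tame d (PSet x e).
Proof.
move=> hx hl he; apply/and4P; split=> //; first by rewrite /= hx.
by apply/allP => y hy; rewrite /=; apply: contraNneq hl => <-.
Qed.

Lemma tame_wr d a e1 e2 : evars 40 e1 -> evars 40 e2 -> tame d (PWr a e1 e2).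
Proof. by move=> h1 h2; apply/and4P; split=> //; [rewrite /= h1|apply/allP]. Qed.

Lemma tame_pseq (T : eqType) d (f : T -> prog) l :
  (forall k, k \in l -> tame d (f k)) -> tame d (pseq (map f l)).
Proof.
elim: l => [_|k l IH h]; first by apply/and4P; split=> //; apply/allP.
apply: tame_seq; first exact: h (mem_head _ _).
by apply: IH => j jl; apply: h; rewrite inE jl orbT.
Qed.

Lemma tame_mono d d' p : d <= d' -> tame d p -> tame d' p.
Proof. by move=> h /and4P[h1 h2 h3 h4]; apply/and4P; split=> //; apply: leq_trans h. Qed.

Lemma tame_cost N d p s : tame d p -> (forall x, x \in L -> var s x <= N) ->
  cost p s <= psize p * N.+1 ^ d.
Proof.
case/and4P=> _ l1 l2 l3 hN; apply: leq_trans (cost_bound (L := L) (N := N) _ hN) _.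
  by rewrite /fixed_limits l1.
by rewrite leq_mul2l leq_pexp2l ?orbT.
Qed.

End Tame.

Lemma evars_mulc d k e : evars d e -> evars d (EMulc k e).
Proof. by move=> h; elim: k => //= k ->; rewrite h. Qed.

Lemma evars_slot X d u w : evars d u -> evars d w -> evars d (slot X u w).
Proof. by move=> h1 h2; rewrite -[evars d _]/(evars d w && evars d (EMulc _ u)) h2 evars_mulc. Qed.

Lemma evars_rd d a e : evars d e -> evars d (ERd a e).
Proof. by []. Qed.

Lemma evars_neq d u w : evars d u -> evars d w -> evars d (ENeq u w).
Proof. by move=> h1 h2; rewrite /= h1 h2. Qed.

Section Cost.
Variable X : wcomplex.

Lemma tame_walk (R : cell2 X) (i : 'I_(size (bd R))) l : tame step_limits 0 (walk i l).
Proof.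
apply: tame_seq => //; apply: tame_pseq => k _; apply: tame_seq; last by [].
apply: tame_set => //; apply: evars_rd; exact: evars_slot.
Qed.

Lemma tame_search (R : cell2 X) (i : 'I_(size (bd R))) l : tame step_limits 1 (search i l).
Proof.
apply: tame_seq; first by apply: tame_for.
apply: tame_seq => //; apply: tame_for => //; apply: tame_if => //.
by apply: tame_seq => //; apply: tame_seq => //; apply: tame_walk.
Qed.

Lemma tame_perform_attach (R : cell2 X) (i : 'I_(size (bd R))) l : tame step_limits 1 (perform_attach i l).
Proof.
apply: tame_seq.
  apply: (tame_mono (leq0n 1)); apply: tame_seq => //; apply: tame_seq => //; exact: tame_walk.
apply: tame_seq.
  apply: tame_pseq => k _; apply: tame_seq; last by [].
  by rewrite /next_vertex; case: ifP.
apply: tame_seq; first by apply: tame_pseq => -[j [|p]] _.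
by do ?apply: tame_seq.
Qed.

Lemma tame_perform_fold : tame step_limits 1 (perform_fold X).
Proof.
do 4![apply: tame_seq; first by []]; apply: tame_seq; last by [].
by apply: tame_pseq => i _.
Qed.

Lemma tame_try_sites cs : tame step_limits 1 (@try_sites X cs).
Proof.
elim: cs => // c cs IH; apply: tame_seq; first exact: tame_search.
by apply: tame_if => //; apply: tame_perform_attach.
Qed.

Definition step_body : prog :=
  PSeq inverse_letters (PSeq oriented_tables (PSeq (fill_slots X)
    (PSeq (find_fold X) (PIf (EVar 15) (perform_fold X) (try_sites (candidates X)))))).

Lemma tame_step_body : tame step_limits 1 step_body.
Proof.
do 2![apply: tame_seq; first by []]; apply: tame_seq.
  by apply: tame_for => //; apply: tame_wr => //; apply: evars_slot.
apply: tame_seq.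
  apply: tame_seq => //; apply: tame_for => //; apply: tame_if => //.
    by apply: evars_neq => //; apply: evars_rd; apply: evars_slot.
  do 2![apply: tame_seq; first by []]; apply: tame_set => //.
  apply: evars_rd; exact: evars_slot.
by apply: tame_if => //; [exact: tame_perform_fold|exact: tame_try_sites].
Qed.

Lemma step_pvars : pvars 40 (step_prog X).
Proof.
rewrite -[pvars _ _]/(pvars 40 (set_limits X (max_bd X)) && pvars 40 step_body).
by have /and4P[-> _ _ _] := tame_step_body.
Qed.

Lemma step_cost N s : #|fcell1 X| <= N -> var s 0 + max_bd X <= N -> var s 1 + var s 1 <= N ->
  var s 1 + max_bd X <= N -> var s 2 <= N ->
  cost (step_prog X) s <= psize (set_limits X (max_bd X)) + psize step_body * N.+1.
Proof.
move=> h1 h2 h3 h4 h5.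
rewrite -[cost _ s]/(cost (set_limits X (max_bd X)) s + cost step_body (sem (set_limits X (max_bd X)) s)).
apply: leq_add; first exact: leqnn.
rewrite -[N.+1]expn1; apply: tame_cost tame_step_body _.
move=> x hx; have {}hx : x \in step_limits := hx.
have h0 : var s 0 <= N := leq_trans (leq_addr _ _) h2.
have h0' : var s 1 <= N := leq_trans (leq_addr _ _) h4.
move: hx; rewrite !inE; do 6?[case/orP; first by move/eqP->]; by move/eqP->.
Qed.

End Cost.

(** * Writing down the bouquet *)

Lemma nth_enum_map (r : nat) (T : Type) (d : T) (f : 'I_r -> T) (i : 'I_r) :
  nth d [seq f i | i <- enum 'I_r] i = f i.
Proof. by rewrite (nth_map i) ?size_enum_ord // nth_ord_enum. Qed.

Lemma flatten_numbering (r : nat) (f : 'I_r -> nat) :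
  numbering (T := {i : 'I_r & 'I_(f i)})
    (fun e => flatten_index [seq f i | i <- enum 'I_r] (tag e) (tagged e)).
Proof.
have bound (e : {i : 'I_r & 'I_(f i)}) : tagged e < nth 0 [seq f i | i <- enum 'I_r] (tag e).
  by rewrite nth_enum_map.
split=> [e e' h|e].
  have h1 := congr1 (reshape_index [seq f i | i <- enum 'I_r]) h.
  have h2 := congr1 (reshape_offset [seq f i | i <- enum 'I_r]) h.
  move: h1 h2; rewrite /= !flatten_indexKl ?flatten_indexKr // => /val_inj.
  by case: e e' {h} => [i k] [i' k'] /= ei; subst i' => /val_inj ->.
rewrite card_tagged; apply: leq_trans (flatten_indexP (bound e)) _.
by apply/eq_leq; congr sumn; apply: eq_map => i; rewrite card_ord.
Qed.

Section Init.
Let v1 := EVar 20.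

Definition copy_lengths : prog :=
  PFor 20 10 (PSeq (PWr 4 v1 (ERd 0 v1)) (PSet 11 (EAdd (EVar 11) (ERd 0 v1)))).

(** Variables 21 and 22 locate the current letter, 23 counts the vertices and 24
is the current vertex. *)
Definition close_loop : prog :=
  PSeq (PWr 1 v1 (ECst 0)) (PSeq (PSet 24 (ECst 0)) (PSeq (PSet 22 (ECst 0))
    (PSet 21 (EAdd (EVar 21) (ECst 1))))).
Definition open_vertex : prog :=
  PSeq (PWr 1 v1 (EVar 23)) (PSeq (PSet 24 (EVar 23)) (PSet 23 (EAdd (EVar 23) (ECst 1)))).
Definition draw_letter : prog :=
  PSeq (PWr 0 v1 (EVar 24)) (PSeq (PSet 22 (EAdd (EVar 22) (ECst 1)))
    (PIf (ENeq (EVar 22) (ERd 4 (EVar 21))) open_vertex close_loop)).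
Definition draw : prog :=
  PSeq (PSet 21 (ECst 0)) (PSeq (PSet 22 (ECst 0)) (PSeq (PSet 23 (ECst 1))
    (PSeq (PSet 24 (ECst 0)) (PFor 20 11 draw_letter)))).
Definition init_tail : prog :=
  PSeq (fill 2 11 (ERd 1 v1)) (PSeq draw
    (PSeq (PSet 0 (EVar 23)) (PSeq (PSet 1 (EVar 11)) (PSet 2 (ECst 0))))).
Definition init_head : prog := PSeq (PSet 10 (EVar 0)) (PSet 11 (ECst 0)).
Definition init_prog : prog := PSeq init_head (PSeq copy_lengths init_tail).

Lemma draw_letterP s : let s' := sem draw_letter s in
  let w := if (var s 22).+1 != arr s 4 (var s 21) then var s 23 else 0 in
  [/\ arr s' 0 =1 upd (arr s 0) (var s 20) (var s 24),
      arr s' 1 =1 upd (arr s 1) (var s 20) w, var s' 24 = w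
    & if (var s 22).+1 != arr s 4 (var s 21) then
        [/\ var s' 21 = var s 21, var s' 22 = (var s 22).+1 & var s' 23 = (var s 23).+1]
      else [/\ var s' 21 = (var s 21).+1, var s' 22 = 0 & var s' 23 = var s 23] ].
Proof.
pose s1 := set_var (set_arr s 0 (var s 20) (var s 24)) 22 (var s 22 + 1).
have -> : sem draw_letter s = if eval (ENeq (EVar 22) (ERd 4 (EVar 21))) s1 != 0
  then sem open_vertex s1 else sem close_loop s1 by [].
rewrite eval_neq -[eval (EVar 22) s1]/(var s 22 + 1) -[eval (ERd 4 _) s1]/(arr s 4 (var s 21)) addn1.
by cbv zeta; case: ifP => _; split=> //=; split=> //; rewrite /upd /= addn1.
Qed.

Variables (X : wcomplex) (x0 : vert X) (r : nat) (gen : 'I_r -> loop x0).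
Notation B := (bouquet gen).

Definition lengths : seq nat := [seq size (gen i) | i <- enum 'I_r].
Definition inner_lengths : seq nat := [seq (size (gen i)).-1 | i <- enum 'I_r].
Notation n := (sumn lengths).

Definition bnv (v : fvert (dom B)) : nat :=
  if (v : bq_vert gen) is Some w then (flatten_index inner_lengths (tag w) (tagged w)).+1 else 0.
Definition bne (e : fcell1 (dom B)) : nat :=
  flatten_index lengths (tag (e : bq_cell1 gen)) (tagged (e : bq_cell1 gen)).

Lemma bnv_numbering : numbering bnv.
Proof.
have [inj lt] := flatten_numbering (fun i : 'I_r => (size (gen i)).-1).
split=> [[w|] [w'|] //= [] /inj -> //|[w|]]; rewrite card_option //=.
by rewrite ltnS; apply: lt.
Qed.

Lemma bne_numbering : numbering bne.
Proof. exact: (flatten_numbering (fun i : 'I_r => size (gen i))). Qed.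

Lemma card_bq_cell1 : #|fcell1 (dom B)| = n.
Proof.
by rewrite card_tagged; congr sumn; apply: eq_map => i; rewrite card_ord.
Qed.

Lemma card_bq_vert : #|fvert (dom B)| = (sumn inner_lengths).+1.
Proof.
rewrite card_option card_tagged; congr (sumn _).+1; apply: eq_map => i.
by rewrite card_ord.
Qed.

Lemma size_gen_gt0 i : 0 < size (gen i).
Proof. by case: (gen i) => -[]. Qed.

Lemma size_lengths : size lengths = r.
Proof. by rewrite size_map size_enum_ord. Qed.

Lemma size_inner_lengths : size inner_lengths = r.
Proof. by rewrite size_map size_enum_ord. Qed.

Lemma r_le : r <= n.
Proof.
rewrite -{1}size_lengths /lengths; elim: (enum _) => //= i l IH.
by rewrite -add1n leq_add ?size_gen_gt0.
Qed.

Lemma bnv_at (i : 'I_r) k : k < size (gen i) ->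
  bnv (bq_at gen i k) = if k.+1 != size (gen i) then (sumn (take i inner_lengths) + k).+1 else 0.
Proof.
move=> hk; have e : (k.+1 != size (gen i)) = (k < (size (gen i)).-1).
  by rewrite -ltnS prednK ?size_gen_gt0 // ltn_neqAle hk andbT.
by rewrite /bq_at e; case: insubP => [k' -> /= ek|/negPf ->] //=; rewrite ek.
Qed.

(** Letter [j] is the [k]-th one of circle [i], or else there are no letters left and
[i = r]. *)
Definition drawn (j : nat) (s : state) : Prop := exists i k,
  [/\ j = sumn (take i lengths) + k, k < nth 0 lengths i \/ (i = r /\ k = 0),
      var s 21 = i, var s 22 = k
    & [/\ var s 23 = (sumn (take i inner_lengths) + k).+1,
          var s 24 = (if k is k'.+1 then (sumn (take i inner_lengths) + k').+1 else 0)
        & forall e, bne e < j -> arr s 0 (bne e) = bnv (fsrc e) /\ arr s 1 (bne e) = bnv (ftgt e)]].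

Lemma draw_step j s : drawn j s -> j < n -> var s 20 = j ->
  (forall i, i < r -> arr s 4 i = nth 0 lengths i) -> drawn j.+1 (sem draw_letter s).
Proof.
move=> [i [k [ej hk h21 h22 [h23 h24 he]]]] jn h20 h4.
have {}hk : k < nth 0 lengths i.
  case: hk => // -[ei ek]; move: jn; rewrite ej ei ek addn0 take_oversize ?size_lengths //.
  by rewrite ltnn.
have ir : i < r.
  by rewrite -size_lengths ltnNge; apply/negP => h; rewrite nth_default in hk.
pose o : 'I_r := Ordinal ir; have nl : nth 0 lengths i = size (gen o) by exact: (nth_enum_map 0 (fun i => size (gen i)) o).
have nl' : nth 0 inner_lengths i = (size (gen o)).-1.
  exact: (nth_enum_map 0 (fun i => (size (gen i)).-1) o).
rewrite nl in hk.
pose e0 : fcell1 (dom B) := Tagged (fun i => 'I_(size (gen i))) (Ordinal hk).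
have be0 : bne e0 = j by rewrite ej.
have [g0 g1 g24 gv] := draw_letterP s; move: g0 g1 g24 gv.
set s' := sem draw_letter s; clearbody s'.
rewrite h20 h21 h22 h4 // nl h23 h24 => g0 g1 g24 gv.
set w := if _ then _ else _ in g1 g24.
have ew : w = bnv (ftgt e0) by rewrite -[ftgt e0]/(bq_at gen o k) bnv_at.
have es : (if k is k'.+1 then (sumn (take i inner_lengths) + k').+1 else 0) = bnv (fsrc e0).
  rewrite -[fsrc e0]/(if k is k'.+1 then bq_at gen o k' else None).
  by move: (hk); case: (k) => [|k'] hk' //; rewrite bnv_at ?(ltnW hk') // ltn_eqF.
have he' e : bne e < j.+1 -> arr s' 0 (bne e) = bnv (fsrc e) /\ arr s' 1 (bne e) = bnv (ftgt e).
  rewrite ltnS leq_eqVlt g0 g1 /upd -be0; case: (eqVneq (bne e) (bne e0)) => [e1 _|_].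
    by rewrite (proj1 bne_numbering _ _ e1) -es.
  by rewrite be0 => /=; exact: he.
case: (eqVneq k.+1 (size (gen o))) gv => e1 /= [g21 g22 g23]; last first.
  exists i, k.+1; split=> //.
  - by rewrite ej addnS.
  - by left; rewrite nl ltn_neqAle e1.
  by split=> //; [rewrite g23 addnS|rewrite g24 /w e1].
exists i.+1, 0; split=> //.
- by rewrite ej (take_nth 0) ?size_lengths // sumn_rcons nl addn0 -e1 addnS.
- have: i.+1 <= r by []. rewrite leq_eqVlt => /orP[/eqP->|h]; first by right.
  by left; rewrite (nth_enum_map 0 (fun i => size (gen i)) (Ordinal h)) size_gen_gt0.
split=> //; last by rewrite g24 /w e1 eqxx.
by rewrite g23 (@take_nth _ 0 i) ?size_inner_lengths // sumn_rcons nl' -e1 addn0.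
Qed.

Lemma copy_lengthsP s : holds_generators gen s ->
  let s' := sem copy_lengths (sem init_head s) in
  (forall i, i < r -> arr s' 4 i = nth 0 lengths i) /\ var s' 11 = n.
Proof.
case; set ws := map _ _ => s0 a0 _.
have sws : size ws = r by rewrite size_map size_enum_ord.
rewrite sws in s0 a0.
have hlen i : i < r -> arr s 0 i = nth 0 lengths i.
  move=> h; rewrite a0 // (nth_enum_map [::] (fun i => [seq letter_of o | o <- lpath (gen i)]) (Ordinal h)).
  by rewrite (nth_enum_map 0 (fun i => size (gen i)) (Ordinal h)) size_map.
pose s1 := sem init_head s; cbv zeta; rewrite -/s1; set s2 := sem copy_lengths s1.
have hs1 : var s1 10 = r by rewrite -s0.
pose I k s' := (forall i, i < k -> arr s' 4 i = nth 0 lengths i) /\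
  var s' 11 = sumn (take k lengths).
have : I r s2.
  rewrite -hs1; apply: for_frame; first by split=> //; rewrite take0.
  move=> k s' hk [IH1 IH2] fv fa; rewrite hs1 in hk.
  have fa0 : arr s' 0 = arr s 0 by apply: fa.
  split=> [i|].
    rewrite -[LHS]/(if i == k then arr s' 0 k else arr s' 4 i) ltnS leq_eqVlt.
    by case: eqP => [->|_] /=; [rewrite fa0 hlen|exact: IH1].
  rewrite -[LHS]/(var s' 11 + arr s' 0 k) IH2 fa0 hlen // (take_nth 0) ?size_lengths //.
  by rewrite sumn_rcons.
by case=> g1 g2; split=> //; rewrite g2 take_oversize // size_lengths.
Qed.

Lemma init_progP s : holds_generators gen s ->
  coded (Y := B) bnv bne (@of_void nat) (sem init_prog s).
Proof.
move=> hg; have [h2 n2] := copy_lengthsP hg; have [_ _ a1] := hg.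
move: a1; set ws := map _ _ => a1.
have shw : shape ws = lengths.
  by rewrite /shape -map_comp; apply: eq_map => i /=; rewrite size_map.
pose s1 := sem init_head s; pose s2 := sem copy_lengths s1; rewrite -/s1 -/s2 in h2 n2.
have b2 : arr s2 1 = arr s 1 by rewrite /s2 sem_arr.
pose s3 := sem (fill 2 11 (ERd 1 v1)) s2.
have [|L3 _] := @fillP 2 11 (ERd 1 v1) s2 (fun k => arr s 1 k).
  by move=> k s' _ h20 _ fa _; rewrite -b2 -(fa 1 isT) -h20.
rewrite -/s3 n2 in L3.
pose s4 := set_var (set_var (set_var (set_var s3 21 0) 22 0) 23 1) 24 0.
pose s5 := sem (PFor 20 11 draw_letter) s4.
have -> : sem init_prog s = set_var (set_var (set_var s5 0 (var s5 23)) 1 (var s5 11)) 2 0 by exact: erefl.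
have n4 : var s4 11 = n by rewrite -n2; exact: (@sem_var 11 (fill 2 11 (ERd 1 v1))).
have l4 i : i < r -> arr s4 4 i = nth 0 lengths i.
  by move=> hi; rewrite -h2 // -[arr s4 4]/(arr s3 4) /s3 sem_arr.
have n5 : var s5 11 = n by rewrite -n4; apply: sem_var.
have l5 : arr s5 2 = arr s3 2 by rewrite /s5 sem_arr.
have : drawn n s5.
  rewrite -n4; apply: for_frame.
    exists 0, 0; split=> //; first by rewrite take0.
      case: (posnP r) => [->|h]; [by right|left].
      by rewrite (nth_enum_map 0 (fun i => size (gen i)) (Ordinal h)) size_gen_gt0.
    by split=> //; rewrite take0.
  move=> k s' hk IH fv fa; rewrite n4 in hk; apply: draw_step => // i hi.
  by rewrite -[arr _ 4]/(arr s' 4) fa // l4.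
case=> i [k [ej hk h21 h22 [h23 _ he]]].
have [ei ek] : i = r /\ k = 0.
  case: hk => // hk; have := flatten_indexP hk; rewrite -[flatten_index _ _ _]ej.
  by rewrite ltnn.
clearbody s5; split.
- rewrite card_bq_vert -[LHS]/(var s5 23) h23 ei ek addn0 take_oversize //.
  by rewrite size_inner_lengths.
- by rewrite card_bq_cell1 -n5.
- by rewrite eq_card0 //; case.
split=> //.
- exact: bnv_numbering.
- exact: bne_numbering.
- by split=> [[]|[]].
move=> e; have he0 : bne e < n by rewrite -card_bq_cell1; exact: (proj2 bne_numbering).
have [g0 g1] := he e he0; split=> //.
rewrite -[LHS]/(arr s5 2 (bne e)) l5 L3 // a1; last first.
  by rewrite size_flatten shw.
case: e he0 {g0 g1} => i' k' he0.
have hb : k' < nth 0 lengths i' by rewrite (nth_enum_map 0 (fun i => size (gen i))).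
rewrite nth_flatten shw /bne flatten_indexKl // flatten_indexKr //.
rewrite (nth_enum_map [::] (fun i => [seq letter_of o | o <- lpath (gen i)])).
have o := tnth (in_tuple (gen i')) k'.
by rewrite (nth_map o) // [me _ _](tnth_nth o).
Qed.

Lemma init_pvars : pvars 40 init_prog. Proof. by []. Qed.

Lemma init_cost s : holds_generators gen s ->
  cost init_prog s <= psize init_head + (psize copy_lengths + psize init_tail) * n.+1.
Proof.
move=> hg; have [_ n2] := copy_lengthsP hg; have [h0 _ _] := hg.
rewrite size_map size_enum_ord in h0.
pose s1 := sem init_head s; pose s2 := sem copy_lengths s1; rewrite -/s1 -/s2 in n2.
rewrite -[cost init_prog s]/(cost init_head s + (cost copy_lengths s1 + cost init_tail s2)).
rewrite leq_add2l mulnDl -[n.+1]expn1; apply: leq_add.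
  apply: (cost_bound (L := [:: 10])) => // x; rewrite inE => /eqP ->.
  by rewrite -[var s1 10]/(var s 0) h0 r_le.
by apply: (cost_bound (L := [:: 11])) => // x; rewrite inE => /eqP ->; rewrite n2.
Qed.

End Init.

(** * Reading off a presentation *)

Section Spanning.
Let v1 := EVar 20.

(** Array 4 marks the 1-cells of a growing forest, and array 5 holds the component
of each vertex. A component is relabelled as a whole whenever it is absorbed by
another one, which takes quadratic time altogether. *)
Definition relabel : prog :=
  PFor 20 10 (PIf (ENeq (ERd 5 v1) (EVar 23)) PSkip (PWr 5 v1 (EVar 22))).
Definition visit_edge : prog :=
  PSeq (PSet 22 (ERd 5 (ERd 0 (EVar 21)))) (PSeq (PSet 23 (ERd 5 (ERd 1 (EVar 21))))
    (PIf (ENeq (EVar 22) (EVar 23)) (PSeq (PWr 4 (EVar 21) (ECst 1)) relabel)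
      (PWr 4 (EVar 21) (ECst 0)))).
Definition spanning : prog := PSeq (fill 5 10 v1) (PFor 21 11 visit_edge).

Lemma relabelP s k : k < var s 10 ->
  arr (sem relabel s) 5 k = if arr s 5 k == var s 23 then var s 22 else arr s 5 k.
Proof.
pose f k := if arr s 5 k == var s 23 then var s 22 else arr s 5 k.
suff [h _] : (forall k, k < var s 10 -> arr (sem relabel s) 5 k = f k) /\
  (forall k, var s 10 <= k -> arr (sem relabel s) 5 k = arr s 5 k) by exact: h.
pose I m s' := (forall k, k < m -> arr s' 5 k = f k) /\ (forall k, m <= k -> arr s' 5 k = arr s 5 k).
apply: (@for_frame I) => // m s' hm [IH1 IH2] fv fa.
pose s1 := set_var s' 20 m.
have -> : sem (PIf (ENeq (ERd 5 v1) (EVar 23)) PSkip (PWr 5 v1 (EVar 22))) s1 =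
  if arr s' 5 m != var s' 23 then s1 else set_arr s1 5 m (var s' 22).
  by rewrite sem_if eval_neq.
rewrite IH2 // !fv //; split=> j hj; last first.
  by case: ifP => _; rewrite -?[arr s1 5]/(arr s' 5) ?arr_set ?eqxx /= ?gtn_eqF // IH2 // ltnW.
case: (eqVneq j m) => [->|ne].
  by rewrite /f; case: eqP => _ /=; rewrite ?IH2 // /upd !eqxx.
have jm : j < m by rewrite ltn_neqAle ne -ltnS.
by case: ifP => _; rewrite ?arr_set ?(negPf ne) ?andbF; exact: IH1.
Qed.

Lemma visit_edgeP s : let s' := sem visit_edge s in
  let a := arr s 5 (arr s 0 (var s 21)) in let b := arr s 5 (arr s 1 (var s 21)) in
  arr s' 4 =1 upd (arr s 4) (var s 21) (a != b) /\
  forall k, k < var s 10 -> arr s' 5 k = if arr s 5 k == b then a else arr s 5 k.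
Proof.
cbv zeta; set a := arr s 5 (arr s 0 _); set b := arr s 5 (arr s 1 _).
pose s1 := set_var (set_var s 22 a) 23 b.
have -> : sem visit_edge s = if eval (ENeq (EVar 22) (EVar 23)) s1 != 0
  then sem relabel (set_arr s1 4 (var s 21) 1) else set_arr s1 4 (var s 21) 0 by [].
rewrite eval_neq -[eval (EVar 22) s1]/a -[eval (EVar 23) s1]/b.
case: eqP => e; split=> [x|k hk] //.
- by rewrite -[LHS]/(arr s 5 k); case: eqP => // ->.
- by rewrite [~~ false]/= sem_arr.
by rewrite [~~ false]/= relabelP.
Qed.

Variables (X : fcomplex) (Y : complex_over X).
Notation V := (fvert (dom Y)).
Notation E := (fcell1 (dom Y)).
Notation F := (fcell2 (dom Y)).
Variables (nv : V -> nat) (ne : E -> nat) (nf : F -> nat).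
Hypothesis Nv : numbering nv.
Hypothesis Ne : numbering ne.

Definition comp_of (s : state) (x : vert (dom Y)) : nat := arr s 5 (nv x).

Lemma spanningP s : coded nv ne nf s -> var s 10 = #|V| -> var s 11 = #|E| ->
  let s' := sem spanning s in
  forest (comp_of s') (fun e : cell1 (dom Y) => arr s' 4 (ne e) != 0) /\
  forall e : cell1 (dom Y), comp_of s' (src e) = comp_of s' (tgt e).
Proof.
move=> [_ _ _ [_ _ _ he _]] h10 h11; pose s1 := sem (fill 5 10 v1) s.
have -> : sem spanning s = sem (PFor 21 11 visit_edge) s1 by [].
have v10 : var s1 10 = #|V| by rewrite -h10; apply: sem_var.
have v11 : var s1 11 = #|E| by rewrite -h11; apply: sem_var.
have [|f1 _] := @fillP 5 10 v1 s id; first by move=> k s' _.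
pose I j s' := forest (comp_of s') (fun e : cell1 (dom Y) => ne e < j /\ arr s' 4 (ne e) != 0) /\
  forall e : cell1 (dom Y), ne e < j -> comp_of s' (src e) = comp_of s' (tgt e).
suff [[root [tau [h1 h2 h3 h4]]] h5] : I #|E| (sem (PFor 21 11 visit_edge) s1).
  split=> [|e]; last by apply: h5; exact: (proj2 Ne).
  exists root, tau; split=> // [x|e h]; last by apply: h4; split=> //; exact: (proj2 Ne).
  by apply: runs_in_sub (h3 x) => e [].
rewrite -v11; apply: for_frame => [|j s' hj [IH1 IH2] fv fa].
  split=> //; apply: (forest_ext (comp := fun x : vert (dom Y) => nv x) (T := fun _ => False)).
  - by move=> x; rewrite /comp_of f1 // h10; exact: (proj2 Nv).
  - by move=> e; split=> // -[].
  by apply: (@forest0 (dom Y) nat (fun x => nv x)); exact: (proj1 Nv).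
pose s2 := set_var s' 21 j.
have [e0 he0] : exists e, ne e = j by apply: (numbering_onto Ne); rewrite -v11.
have [g0 g1 _] := he e0.
have a0 : arr s2 0 = arr s 0 by rewrite -[LHS]/(arr s' 0) fa // /s1 sem_arr.
have a1 : arr s2 1 = arr s 1 by rewrite -[LHS]/(arr s' 1) fa // /s1 sem_arr.
have w10 : var s2 10 = #|V| by rewrite -v10 -fv.
rewrite -/s2; have [k4 k5] := visit_edgeP s2; move: k4 k5.
rewrite -[var s2 21]/j a0 a1 -he0 g0 g1 -[arr s2 5 _]/(comp_of s' (src (e0 : cell1 (dom Y)))).
rewrite -[arr s2 5 (nv (ftgt e0))]/(comp_of s' (tgt (e0 : cell1 (dom Y)))) w10.
set a := comp_of s' (src _); set b := comp_of s' (tgt _).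
have h9 : arr s2 4 = arr s' 4 by []; have h9' : arr s2 5 = arr s' 5 by [].
rewrite h9 h9'; set s3 := sem visit_edge _; clearbody s3 => k4 k5.
have hc x : comp_of s3 x = if comp_of s' x == b then a else comp_of s' x.
  by rewrite /comp_of k5 //; exact: (proj2 Nv).
have lt e : ne e < (ne e0).+1 <-> e = e0 \/ ne e < ne e0.
  rewrite ltnS leq_eqVlt; split=> [/orP[/eqP/(proj1 Ne)|]|[->|->]]; rewrite ?eqxx ?orbT //.
    by left.
  by right.
have ne_lt e : ne e < ne e0 -> (ne e == ne e0) = false by move=> h; rewrite ltn_eqF.
split; last first.
  move=> e /lt[->|h]; rewrite !hc; last by rewrite IH2 // -he0.
  by rewrite -/a -/b eqxx if_same.
case: (eqVneq a b) k4 => [eab|nab] k4.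
  apply: forest_ext (_ : _ =1 _) _ IH1; first by move=> x; rewrite hc; case: eqP => // ->.
  move=> e; rewrite k4 /upd -he0; split=> [[h1 h2]|[/lt[->|h1]]].
  - by split; [apply/lt; right|rewrite ne_lt].
  - by rewrite eqxx.
  - by rewrite ne_lt.
apply: forest_ext (_ : _ =1 _) _ (forest_add IH1 nab); first by move=> x; rewrite hc.
move=> e; rewrite k4 /upd -he0; split=> [[->|[h1 h2]]|[/lt[->|h1] h2]].
- by split; [apply/lt; left|rewrite eqxx].
- by split; [apply/lt; right|rewrite ne_lt].
- by left.
by right; move: h2; rewrite ne_lt.
Qed.

End Spanning.

(** * Writing the words of a presentation *)

Section Emit.

Definition emit (e : expr) : prog :=
  PSeq (PWr 1 (EVar 24) e) (PSet 24 (EAdd (EVar 24) (ECst 1))).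

Definition lettered (s : state) (ls : seq nat) : Prop :=
  var s 24 = size ls /\ forall j, j < size ls -> arr s 1 j = nth 0 ls j.

Lemma emitP e s ls : lettered s ls -> lettered (sem (emit e) s) (rcons ls (eval e s)).
Proof.
case=> h1 h2; split; first by rewrite size_rcons -h1 -[LHS]/(var s 24 + 1) addn1.
move=> j; rewrite size_rcons ltnS nth_rcons.
rewrite -[arr _ 1 j]/(if j == var s 24 then eval e s else arr s 1 j) h1.
by case: ltngtP => // h _; exact: h2.
Qed.

Lemma emitsP (T : Type) (ps : seq T) (e : T -> expr) (y : T -> nat) s ls : lettered s ls ->
  (forall p s', (forall z, z != 24 -> var s' z = var s z) ->
     (forall a, a != 1 -> arr s' a = arr s a) -> eval (e p) s' = y p) ->
  lettered (sem (pseq [seq emit (e p) | p <- ps]) s) (ls ++ map y ps).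
Proof.
elim: ps s ls => [|p ps IH] s ls hl he /=; first by rewrite cats0.
rewrite -cat_rcons -(he p s) //; apply: IH; first exact: emitP.
move=> p' s' hv ha; apply: he => [z hz|a ha'].
  by rewrite hv // -[LHS]/(if z == 24 then _ else var s z) (negPf hz).
by rewrite ha // -[LHS]/(if a == 1 then _ else arr s a) (negPf ha').
Qed.

Definition written (s : state) (ws : seq (seq nat)) : Prop :=
  lettered s (flatten ws) /\ forall i, i < size ws -> arr s 0 i = size (nth [::] ws i).

Lemma written_rcons s s' ws w : written s ws -> lettered s' (flatten ws ++ w) ->
  arr s' 0 =1 upd (arr s 0) (size ws) (size w) -> written s' (rcons ws w).
Proof.
move=> [_ h] hl h0; split; first by rewrite flatten_rcons.
move=> i; rewrite size_rcons ltnS h0 /upd nth_rcons.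
by case: ltngtP => // hi _; exact: h.
Qed.

Lemma dispatchP (T : eqType) (c : T -> expr) (b : T -> prog) (P : state -> Prop) (t0 : T) (ts : seq T) s :
  uniq ts -> t0 \in ts ->
  (forall t s', P s' -> (eval (c t) s' != 0) = (t0 != t)) ->
  P s -> (P s -> P (sem (b t0) s)) ->
  sem (pseq [seq PIf (c t) PSkip (b t) | t <- ts]) s = sem (b t0) s.
Proof.
move=> un ht hc Ps Pb.
have skip l s' : t0 \notin l -> P s' -> sem (pseq [seq PIf (c t) PSkip (b t) | t <- l]) s' = s'.
  elim: l s' => // t l IH s'; rewrite inE negb_or => /andP[n1 n2] Ps'.
  rewrite -[LHS]/(sem (pseq [seq PIf (c t) PSkip (b t) | t <- l]) (sem (PIf (c t) PSkip (b t)) s')).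
  by rewrite sem_if hc // n1 IH.
elim: ts un ht => // t l IH; rewrite cons_uniq => /andP[nt un]; rewrite inE.
rewrite -[sem (pseq _) s]/(sem (pseq [seq PIf (c t) PSkip (b t) | t <- l]) (sem (PIf (c t) PSkip (b t)) s)).
rewrite sem_if hc //; case: (eqVneq t0 t) => [e _|_ ht]; last exact: IH.
by rewrite -e in nt *; rewrite skip //; exact: Pb.
Qed.

End Emit.

Section Read.
Variable X : wcomplex.
Let k1 := EVar 21.

Definition write_edge : prog :=
  PIf (ERd 4 k1) (PSeq (PWr 0 k1 (ECst 1)) (emit (EDbl k1))) (PWr 0 k1 (ECst 0)).
(** A loop over positions would have to address the array [BD p] by a variable, which
the machine cannot do; it is unrolled for each 2-cell [R] of [X]. *)
Definition write_boundary (R : cell2 X) : prog :=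
  PSeq (PWr 0 (EAdd (EVar 11) k1) (ECst (size (bd R))))
    (pseq [seq emit (ERd (BD p) k1) | p <- iota 0 (size (bd R))]).
Definition write_cell : prog :=
  pseq [seq PIf (ENeq (ERd 3 k1) (rank R)) PSkip (write_boundary R) | R <- enum (fcell2 X)].
Definition write_words : prog :=
  PSeq (PSet 24 (ECst 0)) (PSeq (PFor 21 11 write_edge) (PFor 21 13 write_cell)).
Definition read_head : prog :=
  PSeq (PSet 10 (EVar 0)) (PSeq (PSet 11 (EVar 1)) (PSet 13 (EVar 2))).
Definition read_tail : prog :=
  PSeq spanning (PSeq write_words (PSet 0 (EAdd (EVar 11) (EVar 13)))).
Definition read_prog : prog := PSeq read_head read_tail.

Variable Y : complex_over X.
Notation V := (fvert (dom Y)).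
Notation E := (fcell1 (dom Y)).
Notation F := (fcell2 (dom Y)).
Variables (nv : V -> nat) (ne : E -> nat) (nf : F -> nat).
Hypothesis Nv : numbering nv.
Hypothesis Ne : numbering ne.
Hypothesis Nf : numbering nf.

Definition edge_word (s : state) (k : nat) : seq nat := if arr s 4 k != 0 then [:: k + k] else [::].
Definition cell_word (S : F) : seq nat := [seq nl ne o | o <- lift_bd Y S].

Lemma write_edgesP s : var s 11 = #|E| -> written s [::] ->
  let s' := sem (PFor 21 11 write_edge) s in
  written s' [seq edge_word s k | k <- iota 0 #|E|].
Proof.
move=> h11 h0; rewrite -h11; apply: (@for_frame (fun m s' => written s' [seq edge_word s k | k <- iota 0 m])) => //.
move=> k s' hk IH fv fa; rewrite -[k.+1]addn1 iotaD map_cat add0n cats1.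
pose s1 := set_var s' 21 k; have IH1 : written s1 [seq edge_word s k | k <- iota 0 k] by exact: IH.
have f4 : arr s' 4 = arr s 4 by exact: fa.
have -> : sem write_edge s1 = if arr s' 4 k != 0 then sem (emit (EDbl k1)) (set_arr s1 0 k 1)
  else set_arr s1 0 k 0 by [].
have -> : edge_word s k = if arr s' 4 k != 0 then [:: k + k] else [::] by rewrite f4.
have sz : size [seq edge_word s k | k <- iota 0 k] = k by rewrite size_map size_iota.
apply: (written_rcons IH1); rewrite ?sz; case: ifP => _ //; last by rewrite cats0; case: IH1.
rewrite cats1; apply: (@emitP (EDbl k1) (set_arr s1 0 k 1)); by case: IH1.
Qed.

Lemma write_boundaryP s S ws : cells ne nf s -> var s 11 = size ws - nf S -> nf S <= size ws ->
  var s 21 = nf S -> written s ws ->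
  written (sem (write_boundary (mf Y S)) s) (rcons ws (cell_word S)).
Proof.
move=> hc h11 le h21 hw; have [_ g4] := hc S; have [hl _] := hw.
pose s1 := set_arr s 0 (size ws) (size (bd (mf Y S))).
have e1 : sem (PWr 0 (EAdd (EVar 11) k1) (ECst (size (bd (mf Y S))))) s = s1.
  by rewrite -[LHS]/(set_arr s 0 (var s 11 + var s 21) _) h11 h21 subnK.
rewrite -[sem (write_boundary _) s]/(sem (pseq [seq emit (ERd (BD p) k1) | p <- iota 0 (size (bd (mf Y S)))])
  (sem (PWr 0 (EAdd (EVar 11) k1) (ECst (size (bd (mf Y S))))) s)) e1.
have sz : size (cell_word S) = size (bd (mf Y S)) by rewrite size_map size_lift_bd.
have ew : cell_word S = [seq arr s (BD p) (nf S) | p <- iota 0 (size (bd (mf Y S)))].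
  apply: (@eq_from_nth _ 0); first by rewrite size_map size_iota sz.
  move=> p; rewrite sz => hp; rewrite (nth_map 0) ?size_iota // nth_iota // add0n.
  have hp' : p < size (lift_bd Y S) by rewrite size_lift_bd.
  case El : (lift_bd Y S) hp' => [|o l] // hp'.
  by rewrite /cell_word (nth_map o) El // (g4 p (nth o (o :: l) p)) // El; apply: onth_nth.
apply: (written_rcons hw).
  rewrite ew; apply: (@emitsP _ _ _ _ s1 (flatten ws)) => // p s' hv ha.
  by rewrite -[LHS]/(arr s' (BD p) (var s' 21)) hv // ha // h21.
move=> j; rewrite sem_arr; last by apply: moda_pseq.
by rewrite /s1 sz.
Qed.

Lemma write_cellsP s : cells ne nf s -> var s 13 = #|F| -> var s 11 = #|E| ->
  forall ws, written s ws -> size ws = #|E| ->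
  forall g : 'I_#|F| -> F, (forall k, nf (g k) = k) ->
  written (sem (PFor 21 13 write_cell) s) (ws ++ [seq cell_word (g k) | k <- enum 'I_#|F|]).
Proof.
move=> hc h13 h11 ws hw sw g hg; set wc := [seq _ | _ <- _].
have swc : size wc = #|F| by rewrite size_map size_enum_ord.
have am a : a != 0 -> a != 1 -> ~~ moda a write_cell.
  move=> n0 n1; apply: moda_pseq => R; rewrite -[moda _ _]/((a == 0) || moda a (pseq _)) (negPf n0).
  by apply: moda_pseq => p; rewrite /= (negPf n1).
have vm z : z != 24 -> ~~ modv z write_cell.
  move=> n; apply: modv_pseq => R; rewrite -[modv _ _]/(modv z (pseq _)).
  by apply: modv_pseq => p; rewrite /= (negPf n).
have -> : wc = take #|F| wc by rewrite take_oversize ?swc.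
rewrite -h13; apply: (@for_frame (fun m s' => written s' (ws ++ take m wc))).
  by rewrite take0 cats0.
move=> k s' hk IH fv fa; rewrite h13 in hk; pose o := Ordinal hk.
have ek : nf (g o) = k by rewrite hg.
rewrite (take_nth [::]) ?swc // -rcons_cat.
have -> : nth [::] wc k = cell_word (g o) by exact: (nth_enum_map [::] (fun k => cell_word (g k)) o).
pose s1 := set_var s' 21 k; rewrite -/s1.
have hc1 : cells ne nf s1.
  apply: cells_ext hc; first by rewrite -[LHS]/(arr s' 3) fa // am.
  by move=> m; rewrite -[LHS]/(arr s' (BD m)) fa // am // BD_neq.
have w11 : var s1 11 = #|E| by rewrite -[LHS]/(var s' 11) fv //; exact: vm 11 isT.
have es : size (ws ++ take k wc) = #|E| + k by rewrite size_cat sw size_takel // swc ltnW.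
have hb : written (sem (write_boundary (mf Y (g o))) s1) (rcons (ws ++ take k wc) (cell_word (g o))).
  apply: write_boundaryP => //; rewrite es ek ?addnK // leq_addl //.
rewrite /write_cell (@dispatchP _ (fun R : fcell2 X => ENeq (ERd 3 k1) (rank R))
  (fun R : fcell2 X => write_boundary R) (fun t => arr t 3 = arr s1 3 /\ var t 21 = k) (mf Y (g o))) //.
- exact: enum_uniq.
- by rewrite mem_enum.
- move=> R t [h3 h21]; rewrite eval_neq -[eval (ERd 3 _) t]/(arr t 3 (var t 21)) h3 h21 -ek.
  by rewrite (proj1 (hc1 (g o))) -[eval (rank R) t]/(enum_rank R : nat) rank_eq.
move=> _; split.
  by apply: sem_arr; rewrite -[moda _ _]/(moda 3 (pseq _)); apply: moda_pseq.
by rewrite sem_var //; rewrite -[modv _ _]/(modv 21 (pseq _)); apply: modv_pseq.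
Qed.

Lemma numbering_inverse (T : finType) (f : T -> nat) (Nf' : numbering f) :
  exists2 g : 'I_#|T| -> T, forall k, f (g k) = k & forall x, g (Ordinal (proj2 Nf' x)) = x.
Proof.
pose h x := Ordinal (proj2 Nf' x).
have h_inj : injective h by move=> x y [] /(proj1 Nf').
have [g gK hK] : bijective h by apply: inj_card_bij => //; rewrite card_ord.
by exists g => // k; rewrite -[in RHS](hK k).
Qed.

(** As the complex is connected, the forest that is found has a single root. *)
Lemma read_progP (x0 : vert X) (r : nat) (gen : 'I_r -> loop x0) s :
  reachable (bouquet gen) Y -> pi1_injective Y -> coded nv ne nf s ->
  exists rels : seq (word #|E|),
    holds_presentation rels (sem read_prog s) /\ presents_subgroup gen rels.
Proof.
move=> rY inj cd; have [c0 c1 c2 [_ _ _ ce cf]] := cd.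
pose s1 := sem read_head s; pose s2 := sem spanning s1; pose s3 := set_var s2 24 0.
pose s4 := sem (PFor 21 11 write_edge) s3; pose s5 := sem (PFor 21 13 write_cell) s4.
have -> : sem read_prog s = set_var s5 0 (var s5 11 + var s5 13) by exact: erefl.
have w10 : var s1 10 = #|V| by rewrite -c0.
have w11 : var s1 11 = #|E| by rewrite -c1.
have w13 : var s1 13 = #|F| by rewrite -c2.
have cd1 : coded nv ne nf s1 by apply: coded_ext cd => // -[|[|[]]].
have [[root [tau [tp tr tT th]]] cl] := spanningP Nv Ne cd1 w10 w11.
rewrite -/s2 in tr tT th cl.
have vm z : z != 24 -> ~~ modv z write_cell.
  move=> n; apply: modv_pseq => R; rewrite -[modv _ _]/(modv z (pseq _)).
  by apply: modv_pseq => p; rewrite /= (negPf n).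
have a2 a : a != 4 -> a != 5 -> arr s2 a = arr s a.
  by move=> n4 n5; rewrite /s2 sem_arr //= (negPf n4) (negPf n5).
have v2 z : z \notin [:: 20; 21; 22; 23] -> var s2 z = var s1 z.
  rewrite !inE !negb_or => /and4P[n0 n1 n2 n3]; rewrite /s2 sem_var //=.
  by rewrite (negPf n0) (negPf n1) (negPf n2) (negPf n3).
have a4 a : a != 0 -> a != 1 -> arr s4 a = arr s2 a.
  by move=> n0 n1; rewrite /s4 sem_arr //= (negPf n0) (negPf n1).
have v4 z : z != 21 -> z != 24 -> var s4 z = var s2 z.
  move=> n0 n1; rewrite /s4 sem_var /= ?(negPf n0) ?(negPf n1) //.
  by rewrite /upd (negPf n1).
have v5 z : z != 21 -> z != 24 -> var s5 z = var s4 z.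
  move=> n0 n1; apply: sem_var; rewrite -[modv _ _]/((z == 21) || modv z write_cell) (negPf n0).
  exact: vm.
have x11 : var s5 11 = #|E| by rewrite v5 // v4 // v2.
have x13 : var s5 13 = #|F| by rewrite v5 // v4 // v2.
have x1 : var s5 1 = #|E| by rewrite v5 // v4 // v2 // -c1.
have [gE gEk gEK] := numbering_inverse Ne; have [gF gFk gFK] := numbering_inverse Nf.
pose num (e : cell1 (dom Y)) : 'I_#|E| := Ordinal (proj2 Ne e).
pose T (e : cell1 (dom Y)) := arr s2 4 (ne e) != 0.
pose rels : seq (word #|E|) := [seq if arr s2 4 k != 0 then [:: (k, false)] else [::] | k : 'I_#|E| <- enum 'I_#|E|]
  ++ [seq read_path num (lift_bd Y (gF k)) | k : 'I_#|F| <- enum 'I_#|F|].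
exists rels; split.
  have w3 : written s3 [::] by split.
  have h3 : var s3 11 = #|E| by rewrite -[LHS]/(var s2 11) v2.
  have := write_edgesP h3 w3; rewrite -/s4 => w4.
  have hc4 : cells ne nf s4.
    apply: cells_ext cf; first by rewrite a4 // a2.
    by move=> m; rewrite a4 ?BD_neq // a2 ?BD_neq.
  have h4 : var s4 11 = #|E| by rewrite v4 // v2.
  have h4' : var s4 13 = #|F| by rewrite v4 // v2.
  have sw : size [seq edge_word s3 k | k <- iota 0 #|E|] = #|E| by rewrite size_map size_iota.
  have := write_cellsP hc4 h4' h4 w4 sw gFk; rewrite -/s5.
  have -> : [seq edge_word s3 k | k <- iota 0 #|E|] ++ [seq cell_word (gF k) | k <- enum 'I_#|F|] =
      [seq [seq letter a.1 a.2 | a : 'I_#|E| * bool <- w] | w : word #|E| <- rels].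
    rewrite /rels map_cat -[X in _ = X ++ _]map_comp -[X in _ = _ ++ X]map_comp; congr (_ ++ _).
      rewrite -val_enum_ord -map_comp; apply: eq_map => k /=.
      by rewrite /edge_word -[arr s3 4]/(arr s2 4); case: ifP => //= _; rewrite /letter addn0 addnn.
    by apply: eq_map => k /=; rewrite /read_path -map_comp; apply: eq_map.
  set ws := map _ rels => -[[_ hl] hs]; split; first exact: x1.
  split=> //; rewrite -[LHS]/(var s5 11 + var s5 13) x11 x13 size_map size_cat 2!size_map.
  by rewrite (size_enum_ord #|E|) (size_enum_ord #|F|).
have [b [hb img genb]] := reachable_subgroup rY.
have ct x y : comp_of nv s2 x = comp_of nv s2 y.
  have [p hp] := reachable_connected rY x y.
  elim: p x hp => [x ->|o p IH x [<- /IH <-]] //; case: o {p IH} => e [].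
    exact: esym (cl e).
  exact: cl.
have rt x : root x = root b by exact: tr.
have tp' x : is_path (root b) (tau x) x by rewrite -(rt x).
have th' e : T e -> homotopic (root b) (tgt e) (tau (tgt e)) (tau (src e) ++ [:: (e, false)]).
  by rewrite -(rt (tgt e)) => /th[].
apply: (presentation inj hb img genb tp' tT th' (num := num) (cell_of := gE)) => //.
- by move=> k; apply: val_inj; rewrite /= gEk.
- move=> e Te; rewrite mem_cat; apply/orP; left; apply/mapP; exists (num e); first exact: mem_enum.
  by rewrite (Te : arr s2 4 (num e) != 0).
- move=> S; rewrite mem_cat; apply/orP; right; apply/mapP.
  by exists (Ordinal (proj2 Nf S)); rewrite ?mem_enum // gFK.
move=> u; rewrite mem_cat => /orP[] /mapP[k _ ->]; last by constructor 3; exists (gF k).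
case: ifP => hk; last by constructor 1.
constructor 2; exists (gE k); first by rewrite /T gEk.
by congr [:: (_, _)]; apply: val_inj; rewrite /= gEk.
Qed.

End Read.

Lemma tame_read X : tame [:: 10; 11; 13] 2 (read_tail X).
Proof.
apply: tame_seq; first by [].
apply: tame_seq; last by [].
apply: tame_seq; first by [].
apply: tame_seq; first by [].
apply: tame_for => //; apply: tame_pseq => R0 _; apply: tame_if => //.
by apply: tame_seq => //; apply: tame_pseq => p _.
Qed.

Lemma read_pvars X : pvars 40 (read_prog X).
Proof.
rewrite -[pvars _ _]/(true && pvars 40 (read_tail X)).
by have /and4P[-> _ _ _] := tame_read X.
Qed.

Lemma read_cost X N s : var s 0 <= N -> var s 1 <= N -> var s 2 <= N ->
  cost (read_prog X) s <= psize read_head + psize (read_tail X) * N.+1 ^ 2.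
Proof.
move=> h0 h1 h2.
rewrite -[cost _ s]/(cost read_head s + cost (read_tail X) (sem read_head s)) leq_add2l.
apply: tame_cost (tame_read X) _ => x; rewrite !inE => /or3P[] /eqP ->; [exact: h0|exact: h1|exact: h2].
Qed.

(** * The algorithm on the machine *)

Section Machine.
Variable X : wcomplex.
Notation M := (max_bd X).

(** The state that the machine state [s] implements. *)
Definition scratched (s : state) : state := State (var s) (fun a => arr s (ren M a)).

Lemma agree_scratched s : agree M 40 s (scratched s).
Proof. by []. Qed.

Lemma ren_small a : a < 4 -> ren M a = a.
Proof. by rewrite /ren => ->. Qed.

Lemma ren_BD i : i < M -> ren M (BD i) = 4 + i.
Proof.
move=> h; have h1 a : a <= 24 -> (BD i < a) = false.
  by move=> ha; rewrite ltnNge (leq_trans ha (leq_addr _ _)).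
rewrite /ren (h1 4) // (h1 24) // [BD i < _]ltn_add2l h; exact: (addKn 20 (4 + i)).
Qed.

Lemma lift_bd_lt (Y : complex_over X) S i o : onth (lift_bd Y S) i = Some o -> i < M.
Proof.
by move=> h; have [hi _] := onth_Some o h; apply: leq_trans hi _; rewrite size_lift_bd; exact: leq_max_bd.
Qed.

Lemma coded_scratched (Y : complex_over X) s : holds_complex Y s ->
  exists nv ne nf, coded (Y := Y) nv ne nf (scratched s).
Proof.
case=> h0 h1 h2 [nv [ne [nf [Nv Ne Nf he hf]]]]; exists nv, ne, nf; split=> //; split=> //.
move=> S; have [g3 g4] := hf S; split; first by rewrite /= ren_small.
by move=> i o ho; rewrite -[LHS]/(arr s (ren M (BD i)) _) (ren_BD (lift_bd_lt ho)); exact: g4.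
Qed.

Lemma coded_holds (Y : complex_over X) nv ne nf s s0 : agree M 40 s s0 ->
  coded (Y := Y) nv ne nf s0 -> holds_complex Y s.
Proof.
case=> hv ha [h0 h1 h2 [Nv Ne Nf he hf]]; split; rewrite ?hv //.
have ha' a k : a < 4 -> arr s a k = arr s0 a k by move=> h; rewrite -ha ren_small.
exists nv, ne, nf; split=> // [e|S]; first by rewrite !ha'.
have [g3 g4] := hf S; rewrite ha' //; split=> // i o ho.
by rewrite -(ren_BD (lift_bd_lt ho)) ha; exact: g4.
Qed.

Definition init_cmd : cmd := compile M init_prog 40.
Definition step_cmd : cmd := compile M (step_prog X) 40.
Definition read_cmd : cmd := compile M (read_prog X) 40.

Definition step_limit : nat := size_const X + size_const X + M + #|fcell1 X|.
Lemma limit_bounds : [/\ size_const X + size_const X <= step_limit,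
  size_const X + M <= step_limit & #|fcell1 X| <= step_limit].
Proof.
split; last exact: leq_addl; apply: leq_trans (leq_addr _ _); first exact: leq_addr.
by rewrite leq_add2r leq_addr.
Qed.

Lemma limit_le : size_const X <= step_limit.
Proof. by case: limit_bounds => h _ _; apply: leq_trans h; apply: leq_addr. Qed.

Definition steps_const : nat := (pot_const X).+1.
Definition step_const : nat :=
  psize init_head + 2 * (psize copy_lengths + psize init_tail) +
  (psize (set_limits X M) + psize (step_body X) * step_limit.+1).
Definition read_const : nat := psize read_head + psize (read_tail X) * step_limit.+1 ^ 2.
Definition total_const : nat := step_const + (steps_const * step_const.+1 + read_const).

Variables (x0 : vert X) (r : nat) (gen : 'I_r -> loop x0).
Hypothesis r0 : 0 < r.
Notation Y1 := (bouquet gen).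
Notation n1 := #|fcell1 (dom Y1)|.

Lemma n1_gt0 : 0 < n1.
Proof. by rewrite card_bq_cell1 (leq_trans r0) // r_le. Qed.

Lemma run_lt n Y : run n Y1 Y -> n < steps_const * n1.
Proof.
case/(run_potential (@bouquet_packed X x0 r gen)) => _ h.
apply: leq_ltn_trans (leq_trans (leq_trans (leq_addr _ _) h) (bouquet_potential gen)) _.
by rewrite ltn_pmul2r ?n1_gt0.
Qed.

Lemma starts_init : starts gen (step_const * n1) init_cmd.
Proof.
move=> s hg; have n0 := n1_gt0.
have hg' : holds_generators gen (scratched s).
  by case: hg.
have [t [s' [x c a _]]] := compile_ok init_pvars (leqnn 40) (agree_scratched s).
exists t, s'; split=> //; last exact: coded_holds a (init_progP hg').
apply: leq_trans c (leq_trans (init_cost hg') _); rewrite -card_bq_cell1.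
set A := psize init_head; set B := psize copy_lengths + psize init_tail.
apply: (@leq_trans ((A + 2 * B) * n1)); last by rewrite leq_mul2r leq_addr orbT.
rewrite mulnDl leq_add ?leq_pmulr // (mulnC 2) -mulnA leq_mul2l.
by apply/orP; right; rewrite mul2n -addnn -addn1 leq_add2l.
Qed.

Lemma step_limitS : (step_limit * n1).+1 <= step_limit.+1 * n1.
Proof. by rewrite mulSn addnC -[X in X < _]addn0 ltn_add2l n1_gt0. Qed.

Lemma performs_step : performs_steps gen (step_const * n1) step_cmd.
Proof.
move=> Y s rY hY; have n0 := n1_gt0; have [nv [ne [nf cd]]] := coded_scratched hY.
have [t [s' [x c a _]]] := compile_ok (step_pvars X) (leqnn 40) (agree_scratched s).
exists t, s'; split=> //; last first.
  move: (step_progP (reachable_packed rY) cd) a {c}; set s2 := sem _ _; clearbody s2 => sp a.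
  move: sp; rewrite /stepped (_ : var s' go = var s2 3); last exact: (proj1 a).
  case: ifP => _; first by case=> st cd'; split=> //; exact: coded_holds a cd'.
  by case=> Y' [st [nv' [ne' [nf' cd']]]]; exists Y'; split=> //; exact: coded_holds a cd'.
apply: leq_trans c _; have [bV bE bF] := reachable_bounds n0 rY; have [h0 h1 h2 _] := hY.
have [lA lB lC] := limit_bounds.
have le1 : size_const X * n1 <= step_limit * n1 by rewrite leq_mul2r limit_le orbT.
have leM : size_const X * n1 + M <= step_limit * n1.
  apply: (@leq_trans ((size_const X + M) * n1)); last by rewrite leq_mul2r lB orbT.
  by rewrite mulnDl leq_add2l leq_pmulr.
have le2 : size_const X * n1 + size_const X * n1 <= step_limit * n1.
  by rewrite -mulnDl leq_mul2r lA orbT.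
have leC : #|fcell1 X| <= step_limit * n1 by apply: leq_trans lC _; rewrite leq_pmulr.
apply: leq_trans (step_cost (N := step_limit * n1) leC _ _ _ _) _.
- by rewrite [var _ 0]h0; apply: leq_trans leM; rewrite leq_add2r.
- by rewrite [var _ 1]h1; apply: leq_trans (leq_add bE bE) le2.
- by rewrite [var _ 1]h1; apply: leq_trans leM; rewrite leq_add2r.
- by rewrite [var _ 2]h2; apply: leq_trans bF le1.
rewrite /step_const [X in _ <= X]mulnDl; apply: leq_trans (leq_addl _ _).
rewrite mulnDl leq_add ?leq_pmulr // -mulnA leq_mul2l step_limitS orbT.
by [].
Qed.

Lemma loop_stops n Y s : run n Y1 Y -> holds_complex Y s ->
  exists t1 s1 t2 s' Y', [/\ exec step_cmd s t1 s1, exec (While go step_cmd) s1 t2 s',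
    t1 + t2 <= (steps_const * n1 - n) * (step_const * n1).+1
    & [/\ reachable Y1 Y', stops_at Y' & holds_complex Y' s']].
Proof.
move: {-1}(steps_const * n1 - n) (erefl (steps_const * n1 - n)) => k.
elim: k n Y s => [|k IH] n Y s ek rn hY.
  by have := run_lt rn; rewrite -subn_gt0 ek.
have rY : reachable Y1 Y by exists n.
have [t1 [s1 [x1 c1]]] := performs_step rY hY.
case: eqP => [z [st hY1]|/eqP nz [Y' [st hY']]].
  exists t1, s1, 1, s1, Y; split=> //; first exact: ExWhileStop.
  by rewrite addn1 mulSn; apply: leq_trans (leq_addr _ _).
have rn' : run n.+1 Y1 Y' by exists Y.
have ek' : steps_const * n1 - n.+1 = k by rewrite subnS ek.
have [t2 [s2 [t3 [s3 [Y2 [x2 x3 c2 h]]]]]] := IH _ _ _ ek' rn' hY'.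
exists t1, s1, (t2 + t3).+1, s3, Y2; split=> //; first exact: ExWhile x2 x3.
by rewrite addnS -addSn mulSn leq_add.
Qed.

(** The last complex is pi_1-injective: otherwise it would admit a reduction. *)
Lemma computes : reduction_hypothesis X ->
  computes_presentation gen (total_const * n1 ^ 2) (reduction_algorithm init_cmd step_cmd read_cmd).
Proof.
move=> rh s hg; have n0 := n1_gt0.
have [t1 [s1 [x1 c1 h1]]] := starts_init hg.
have rn : run 0 Y1 Y1 by [].
have [t2 [s2 [t3 [s3 [Y [x2 x3 c2 [rY st hY]]]]]]] := loop_stops rn h1.
have inj : pi1_injective Y.
  apply: NNPP => ni; have [im no] := st; apply: no.
  exact: rh (reachable_connected rY) (reachable_packed rY) im ni.
have [nv [ne [nf cd]]] := coded_scratched hY; have [_ _ _ [Nv Ne Nf _ _]] := cd.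
have [t4 [s4 [x4 c4 [av aa] _]]] := compile_ok (read_pvars X) (leqnn 40) (agree_scratched s3).
exists (t1 + ((t2 + t3) + t4)), s4; split.
- exact: ExSeq x1 (ExSeq (ExSeq x2 x3) x4).
- rewrite /total_const mulnDl; apply: leq_add.
    by apply: leq_trans c1 _; rewrite leq_mul2l -{1}[n1]expn1 leq_pexp2l ?orbT.
  rewrite mulnDl; apply: leq_add.
    apply: leq_trans c2 _; rewrite subn0 -mulnA -mulnA leq_mul2l; apply/orP; right.
    by rewrite mulnCA leq_mul2l mulSn -add1n leq_add2r n0 orbT.
  have [bV bE bF] := reachable_bounds n0 rY; have [h0 h1' h2 _] := hY.
  have le1 : size_const X * n1 <= step_limit * n1 by rewrite leq_mul2r limit_le orbT.
  have rc : cost (read_prog X) (scratched s3) <= psize read_head + psize (read_tail X) * (step_limit * n1).+1 ^ 2.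
    apply: read_cost.
    - by rewrite [var _ 0]h0; apply: leq_trans bV le1.
    - by rewrite [var _ 1]h1'; apply: leq_trans bE le1.
    by rewrite [var _ 2]h2; apply: leq_trans bF le1.
  apply: leq_trans c4 (leq_trans rc _).
  rewrite /read_const mulnDl leq_add ?leq_pmulr ?expn_gt0 ?n0 // -mulnA leq_mul2l.
  by rewrite -expnMn leq_exp2r // step_limitS orbT.
have [rels [[k1 [h0 h1' h2]] ps]] := read_progP Nv Ne Nf rY inj cd.
exists #|fcell1 (dom Y)|, rels; split=> //; split; first by rewrite av.
have ha a k : a < 4 -> arr s4 a k = arr (sem (read_prog X) (scratched s3)) a k.
  by move=> h; rewrite -aa ren_small.
by split; [rewrite av|move=> i hi; rewrite ha // h1'|move=> j hj; rewrite ha // h2].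
Qed.

End Machine.

Theorem corollary6p2 (X : wcomplex) :
  connected X -> reduction_hypothesis X ->
  exists (C1 C2 C3 : nat) (init step read : cmd),
  forall (x0 : vert X) (r : nat) (gen : 'I_r -> loop x0), 0 < r ->
  let Y1 := bouquet gen in
  let n1 := #|fcell1 (dom Y1)| in
  [/\ forall n Y, run n Y1 Y -> n < C1 * n1,
      starts gen (C2 * n1) init,
      performs_steps gen (C2 * n1) step
    & computes_presentation gen (C3 * n1 ^ 2)
        (reduction_algorithm init step read)].
Proof.
move=> _ rh; exists (steps_const X), (step_const X), (total_const X).
exists (init_cmd X), (step_cmd X), (read_cmd X) => x0 r gen r0; split.
- by move=> n Y; apply: run_lt.
- exact: starts_init.
- exact: performs_step.
- exact: computes.
Qed.
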